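(* Let $k\geqslant2$ and let $\mathfrak{n}\in A$ be monic of degree $d\geqslant1$. Let $\{f_j^{\bar v}\}_{\bar v,\,1\leqslant j\leqslant N}$ be the vertex Poincaré series, $\{f^{\bar e}\}_{\bar e}$ the non-cuspidal edge Poincaré series, and $\{f^{\overline{e_{\mathfrak{c}}}}\}_{\mathfrak{c}}$ the cuspidal edge Poincaré series of weight $2k$ for $\Gamma(\mathfrak{n})$ (as defined in the context). Assume that: (1) for every stable vertex $\bar v$ of $\Gamma(\mathfrak{n})\backslash\mathcal{T}$, $f_1^{\bar v},\ldots,f_N^{\bar v}$ vanish to order $\geqslant k+1$ at every cusp; (2) for every non-cuspidal stable edge $\bar e$, $f^{\bar e}$ vanishes to order $\geqslant k+1$ at every cusp; (3) for every cusp $\mathfrak{c}$, $f^{\overline{e_{\mathfrak{c}}}}$ vanishes to order exactly $k$ at $\mathfrak{c}$ and to order $\geqslant k+1$ at every other cusp. Then the $V\cdot N+E$ vertex and non-cuspidal edge Poincaré series form a basis of $M_{2k}^{k+1}(\Gamma(\mathfrak{n}))$, and together with the $c$ cuspidal edge Poincaré series they form a basis of $M_{2k}^k(\Gamma(\mathfrak{n}))$.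
   Context: $q$ is an odd prime power, $A=\mathbb{F}_q[T]$, $F=\mathbb{F}_q(T)$, $\pi=1/T$, $F_\infty=\mathbb{F}_q((\pi))$, $\mathcal{O}_\infty=\mathbb{F}_q[[\pi]]$, $\mathbb{C}_\infty$ is the completion of an algebraic closure of $F_\infty$, $\Omega=\mathbb{C}_\infty\setminus F_\infty$, $|z|_i=\inf_{x\in F_\infty}|z-x|$. $G=\mathrm{GL}_2(A)$, $\Gamma(\mathfrak{n})=\ker(G\to\mathrm{GL}_2(A/\mathfrak{n}A))$; cusps are $\Gamma(\mathfrak{n})$-orbits in $\mathbb{P}^1(F)$, and $c$ is their number. $u(z;a,b)=\frac1{z-b}-\frac1{z-a}$, $s(z;a,b)=u(z;a,b)\,\mathrm{d}z$ with $\frac1{z-\infty}=0$. Tree. $\mathcal{T}$ is the Bruhat–Tits tree of $\mathrm{PGL}_2(F_\infty)$: vertices are homothety classes $[L]$ of rank-two $\mathcal{O}_\infty$-lattices in the row space $F_\infty^2$, adjacent if they have representatives with $\pi L\subset L'\subset L$ (strict); $\gamma[L]=[L\gamma^{-1}]$; $v_n=[\pi^n\mathcal{O}_\infty f_1+\mathcal{O}_\infty f_2]$. Ends are identified equivariantly with $\mathbb{P}^1(F_\infty)$, $(v_n)_{n\geqslant0}$ representing $\infty$ and $(v_{-n})_{n\geqslant0}$ representing $0$. $[a\to b]$ is the geodesic from $a$ to $b$ (in the geometric realization). The type of a vertex $v$ is the unique $n\geqslant0$ such that $v\in Gv_n$; types of adjacent vertices differ by 1. A vertex or edge of $\Gamma(\mathfrak{n})\backslash\mathcal{T}$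 is stable if its lifts have trivial stabilizer in $\Gamma(\mathfrak{n})$. The stable vertices are those of type $<d$; together with the edges between them they form the finite graph $(\Gamma(\mathfrak{n})\backslash\mathcal{T})^0$, with $V$ vertices and $E$ non-oriented edges. The stable edges are these $E$ edges (''non-cuspidal'') and the edges joining a vertex of type $d-1$ to one of type $d$ (''cuspidal''). Each cuspidal edge is the first edge of a half-line of $\Gamma(\mathfrak{n})\backslash\mathcal{T}$ with vertices of types $d-1,d,d+1,\ldots$, lifting to a half-line of $\mathcal{T}$ whose end lies in a unique cusp $\mathfrak{c}\subset\mathbb{P}^1(F)$; this gives a bijection between cuspidal edges and cusps, written $\overline{e_{\mathfrak{c}}}\leftrightarrow\mathfrak{c}$. Kurihara differentials. A Kurihara differential is a $k$-form $\prod_{i=1}^rs(z;\alpha_i,\beta_i)^{k_i}$ on $\mathbb{P}^1_{\mathbb{F}_q}$ with $r\geqslant2$, $k_i\geqslant1$, $\sum k_i=k$, $\alpha_i\ne\beta_i$ in $\mathbb{P}^1(\mathbb{F}_q)$ and $\bigcap_i\{\alpha_i,\beta_i\}=\emptyset$ (equal pairs may be grouped so that the pairs are distinct). They span the $\overline{\mathbb{F}_q}$-vector space, of dimension $N=k(q-1)-q$, of $k$-forms with poles of order $\leqslant k-1$ at the points of $\mathbb{P}^1(\mathbb{F}_q)$ and no other poles. The reduction map $\mathbb{P}^1(F)\to\mathbb{P}^1(\mathbb{F}_q)$ is reduction modulo the maximal ideal of $\mathcal{O}_\infty$ in coprime homogeneous coordinates. Poincaré series. For each stable vertex $\bar v$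 fix a lift $v=\delta v_0$ with $\delta\in\mathrm{GL}_2(F)$, and a basis $\overline{s_j}=\prod_is(z;\alpha_i^{(j)},\beta_i^{(j)})^{k_i^{(j)}}$ ($1\leqslant j\leqslant N$, distinct pairs for fixed $j$), consisting of Kurihara differentials, of the $N$-dimensional $\overline{\mathbb{F}_q}$-vector space of $k$-forms on $\mathbb{P}^1_{\mathbb{F}_q}$ with poles of order $\leqslant k-1$ at the points of $\mathbb{P}^1(\mathbb{F}_q)$ and no other poles; for each $j$ choose $a_i^{(j)},b_i^{(j)}\in\mathbb{P}^1(F)$ reducing to $\alpha_i^{(j)},\beta_i^{(j)}$ with $\bigcap_i[a_i^{(j)}\to b_i^{(j)}]=\{v_0\}$. Set $f_j^{\bar v}(z)=\sum_{\gamma\in\Gamma(\mathfrak{n})}\prod_iu(z;\gamma\delta a_i^{(j)},\gamma\delta b_i^{(j)})^{k_i^{(j)}}$. For each stable edge $\bar e$ choose a lift $e$ in $\mathcal{T}$, $r\geqslant2$, $k_i\geqslant1$ with $\sum k_i=k$, and $a_i,b_i\in\mathbb{P}^1(F)$, $a_i\neq b_i$, with distinct pairs $\{a_i,b_i\}$, such that $\bigcap_{i=1}^r[a_i\to b_i]$ consists of $e$ and its endpoints; set $f^{\bar e}(z)=\sum_{\gamma\in\Gamma(\mathfrak{n})}\prod_{i=1}^ru(z;\gamma a_i,\gamma b_i)^{k_i}$. All choices are fixed. These series converge to cusp forms of weight $2k$ for $\Gamma(\mathfrak{n})$. Modular forms. $M_w^n(\Gamma(\mathfrak{n}))$ is the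 $\mathbb{C}_\infty$-space of rigid holomorphic $f\colon\Omega\to\mathbb{C}_\infty$ with $f(\gamma z)=j_\gamma(z)^wf(z)$ for $\gamma\in\Gamma(\mathfrak{n})$ (where $j_\gamma(z)=c_\gamma z+d_\gamma$, with $(c_\gamma,d_\gamma)$ the bottom row of $\gamma$) that vanish to order $\geqslant n$ at every cusp. For a cusp $\nu\infty$, $\nu\in\mathrm{GL}_2(F)$, let $\mathfrak{b}\subset F$ be the group of upper-right entries of upper unipotent matrices in $\nu^{-1}\Gamma(\mathfrak{n})\nu$ and $t=1/e_{\mathfrak{b}}$, $e_{\mathfrak{b}}(z)=z\prod_{b\in\mathfrak{b}\setminus\{0\}}(1-z/b)$; $f$ vanishes to order $\geqslant n$ (resp. exactly $n$) there if $j_\nu(z)^{-w}f(\nu z)=\sum_{m\geqslant n}c_mt(z)^m$ for $|z|_i$ large (resp. with moreover $c_n\ne0$). *)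

(* Defs.v *)
From HB Require Import structures.
From mathcomp Require Import all_boot all_order all_algebra all_field.
From mathcomp Require Import all_classical all_reals.

Set Implicit Arguments.
Unset Strict Implicit.
Unset Printing Implicit Defensive.

Import Order.TTheory GRing.Theory Num.Theory.
Local Open Scope classical_set_scope.
Local Open Scope ring_scope.

(* P^1(K) is [option K], with [None] the point at infinity. *)
Definition P1 (K : Type) : Type := option K.

(* The point [x : y]; meaningful when (x, y) != (0, 0). *)
Definition hpoint (K : fieldType) (x y : K) : P1 K :=
  if y == 0 then None else Some (x / y).

Definition mob (K : fieldType) (g : 'M[K]_2) (s : P1 K) : P1 K :=
  match s with
  | Some x => hpoint (g 0 0 * x + g 0 1) (g 1 0 * x + g 1 1)
  | None => hpoint (g 0 0) (g 1 0)
  end.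

Definition mobz (K : fieldType) (g : 'M[K]_2) (z : K) : K :=
  (g 0 0 * z + g 0 1) / (g 1 0 * z + g 1 1).

Definition jfac (K : fieldType) (g : 'M[K]_2) (z : K) : K :=
  g 1 0 * z + g 1 1.

(* u(z; a, b), for z in a field L into which the field of a and b is mapped
   by [emb]. *)
Definition udiff (K : Type) (L : fieldType) (emb : K -> L) (z : L)
    (a b : P1 K) : L :=
  let pole s := if s is Some x then (z - emb x)^-1 else 0 in
  pole b - pole a.

(* The data (r, (a_i), (b_i), (k_i)) of a product of r powers of u or s. *)
Record kdata (X : Type) := Kdata {
  kr : nat;
  ka : 'I_kr -> P1 X;
  kb : 'I_kr -> P1 X;
  kexp : 'I_kr -> nat }.

Definition kpair (X : Type) (D : kdata X) (i : 'I_(kr D)) : set (P1 X) :=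
  [set ka i; kb i].

Definition kdata_wf (X : Type) (k : nat) (D : kdata X) : Prop :=
  [/\ (2 <= kr D)%N,
      forall i, (1 <= @kexp X D i)%N,
      (\sum_i @kexp X D i)%N = k,
      forall i, @ka X D i <> kb i
    & injective (@kpair X D)].

Definition kprod (X : Type) (L : fieldType) (emb : X -> L) (z : L)
    (D : kdata X) : L :=
  \prod_i udiff emb z (@ka X D i) (kb i) ^+ kexp i.

Definition kmap (X Y : Type) (f : P1 X -> P1 Y) (D : kdata X) : kdata Y :=
  Kdata (fun i => f (@ka X D i)) (fun i => f (kb i)) (@kexp X D).

(* The same exponents with other points. *)
Definition krelift (X Y : Type) (D : kdata X) (a b : 'I_(kr D) -> P1 Y) :
    kdata Y := Kdata a b (@kexp X D).

Section KuriharaForms.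

Variable Fq : finFieldType.

Definition Fqbar : closedFieldType :=
  projT1 (countable_algebraic_closure Fq).

Definition to_Fqbar : {rmorphism Fq -> Fqbar} :=
  sval (projT2 (countable_algebraic_closure Fq)).

(* A k-form g(z) (dz)^k on the projective line over Fqbar is given by its
   coefficient g. *)
Definition kform : fieldType := {fraction {poly Fqbar}}.

Definition form_const (c : Fqbar) : kform := FracField.tofrac c%:P.

Definition form_z : kform := FracField.tofrac 'X.

(* Order at x of (P / Q) (dz)^k for P, Q nonzero.  At infinity, dz has a
   double pole; sizes are degrees plus one. *)
Definition form_order (k : nat) (P Q : {poly Fqbar}) (x : P1 Fqbar) : int :=
  match x with
  | Some y => (mup y P)%:Z - (mup y Q)%:Z
  | None => (size Q)%:Z - (size P)%:Z - (2 * k)%:Z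
  end.

Definition Fq_rational (x : P1 Fqbar) : Prop :=
  exists y : P1 Fq, x = omap to_Fqbar y.

Definition form_space (k : nat) : set kform :=
  [set g | g = 0 \/ exists P Q : {poly Fqbar},
    [/\ P != 0, Q != 0, g = FracField.tofrac P / FracField.tofrac Q,
        forall x, Fq_rational x -> - (k.-1)%:Z <= form_order k P Q x
      & forall x, ~ Fq_rational x -> 0 <= form_order k P Q x]].

(* The dimension of [form_space k], for k >= 2. *)
Definition kdim (k : nat) : nat := k * (#|Fq| - 1) - #|Fq|.

Definition form_basis (k N : nat) (g : 'I_N -> kform) : Prop :=
  (forall j, form_space k (g j)) /\
  forall h, form_space k h ->
    exists! c : {ffun 'I_N -> Fqbar}, h = \sum_j form_const (c j) * g j.

Definition kurihara (k : nat) (D : kdata Fq) : Prop :=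
  kdata_wf k D /\ \bigcap_(i in [set: 'I_(kr D)]) kpair i = set0.

Definition kform_of (D : kdata Fq) : kform :=
  kprod (fun c => form_const (to_Fqbar c)) form_z D.

End KuriharaForms.

(* The rational function field F of A = Fq[T]. *)
Definition ratfun (Fq : finFieldType) : fieldType := {fraction {poly Fq}}.

(* An algebraically closed field with a nonarchimedean absolute value
   extending the absolute value of F at infinity, normalised by |T| = q. *)
Record valued_ext (Fq : finFieldType) (R : realType) := ValuedExt {
  vcar :> closedFieldType;
  iota : {rmorphism ratfun Fq -> vcar};
  vabs : vcar -> R;
  vabs_ge0 : forall x, 0 <= vabs x;
  vabs_eq0 : forall x, vabs x = 0 <-> x = 0;
  vabsM : forall x y, vabs (x * y) = vabs x * vabs y;
  vabsD : forall x y, vabs (x + y) <= Num.max (vabs x) (vabs y);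
  vabsT : vabs (iota (FracField.tofrac 'X)) = #|Fq|%:R }.

Arguments iota {Fq R} v.
Arguments vabs {Fq R} v.

Section Drinfeld.

Variables (Fq : finFieldType) (R : realType) (K : valued_ext Fq R).

Local Notation A := {poly Fq}.
Local Notation F := (ratfun Fq).
Local Notation q := (#|Fq|%:R : R).
Local Notation abs := (vabs K).

Definition AtoF (a : A) : F := FracField.tofrac a.

Definition FqtoF (c : Fq) : F := AtoF c%:P.

Definition converges (u : nat -> K) (l : K) : Prop :=
  forall e : R, 0 < e -> exists N, forall n, (N <= n)%N -> abs (u n - l) < e.

Definition cauchy_sequence (u : nat -> K) : Prop :=
  forall e : R, 0 < e ->
    exists N, forall m n, (N <= m)%N -> (N <= n)%N -> abs (u m - u n) < e.

Definition pi_inf : K := iota K (AtoF 'X)^-1.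

(* O_infty = Fq[[pi]] and F_infty = Fq((pi)), as subsets of K. *)
Definition Oinf : set K := [set x | exists a : nat -> Fq,
  converges (fun n => \sum_(i < n) iota K (FqtoF (a i)) * pi_inf ^+ i) x].

Definition Finf : set K := [set x | exists m : nat, Oinf (pi_inf ^+ m * x)].

Definition algebraic_over_Finf (y : K) : Prop :=
  exists p : {poly K}, [/\ p != 0, forall i, Finf p`_i & root p y].

(* K is the completion of an algebraic closure of F_infty; this determines it
   up to isometric isomorphism over F_infty. *)
Record is_Cinf : Prop := IsCinf {
  Cinf_complete : forall u, cauchy_sequence u -> exists l, converges u l;
  Cinf_dense : forall (x : K) (e : R), 0 < e ->
    exists2 y, algebraic_over_Finf y & abs (x - y) < e }.

(* [l] is the limit of [phi], a function of finite subsets of S, along the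
   directed set of these subsets. *)
Definition unordered_limit (I : eqType) (S : set I) (phi : seq I -> K)
    (l : K) : Prop :=
  forall e : R, 0 < e -> exists B0 : seq I, [set` B0] `<=` S /\
    forall B : seq I, uniq B -> [set` B] `<=` S -> {subset B0 <= B} ->
      abs (phi B - l) < e.

(* Unconditional sum and product over S; the value is irrelevant (0) if there
   is no limit. *)
Definition usum (I : eqType) (S : set I) (g : I -> K) : K :=
  xget 0 [set l | unordered_limit S (fun B => \sum_(i <- B) g i) l].

Definition uprod (I : eqType) (S : set I) (g : I -> K) : K :=
  xget 0 [set l | unordered_limit S (fun B => \prod_(i <- B) g i) l].

Definition Omega : set K := ~` Finf.

Definition vabs_i (z : K) : R := inf [set abs (z - x) | x in Finf].

(* The affinoids of the standard admissible covering of Omega. *)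
Definition Omega_aff (m : nat) : set K :=
  [set z | abs z <= q ^+ m /\ q ^- m <= vabs_i z].

Definition holomorphic (f : K -> K) : Prop :=
  forall (m : nat) (e : R), 0 < e -> exists p r : {poly K},
    forall z, Omega_aff m z -> r.[z] != 0 /\ abs (f z - p.[z] / r.[z]) < e.

Definition GL2A : set 'M[A]_2 := [set g | g \in unitmx].

Definition Gamma (n : A) : set 'M[A]_2 :=
  [set g | g \in unitmx /\ forall i j, n %| g i j - (1%:M : 'M[A]_2) i j].

Definition mxAF (g : 'M[A]_2) : 'M[F]_2 := map_mx AtoF g.

Definition mxFK (g : 'M[F]_2) : 'M[K]_2 := map_mx (iota K) g.

Definition mxAK (g : 'M[A]_2) : 'M[K]_2 := mxFK (mxAF g).

Definition GL2Finf : set 'M[K]_2 :=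
  [set g | g \in unitmx /\ forall i j, Finf (g i j)].

(* [x] enumerates the orbits of Gamma(n) on S: one representative for each
   orbit.  [act] is the action of 'M[A]_2. *)
Definition orbit_representatives (X : Type) (n : A)
    (act : 'M[A]_2 -> X -> X) (S : set X) (I : Type) (x : I -> X) : Prop :=
  (forall i, S (x i)) /\
  forall y, S y -> exists! i, exists2 g, Gamma n g & act g (x i) = y.

(* The tree.  Lattices are sets of row vectors, vertices are homothety
   classes of lattices, and edges are two-element sets of vertices. *)

Definition lattice_of (g : 'M[K]_2) : set 'rV[K]_2 :=
  [set x *m g | x in [set x : 'rV[K]_2 | forall j, Oinf (x 0 j)]].

Definition is_lattice (L : set 'rV[K]_2) : Prop :=
  exists2 g, GL2Finf g & L = lattice_of g.

Definition scale_lattice (c : K) (L : set 'rV[K]_2) : set 'rV[K]_2 :=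
  [set c *: x | x in L].

Definition vertex : Type := set (set 'rV[K]_2).

Definition homothety_class (L : set 'rV[K]_2) : vertex :=
  [set scale_lattice c L | c in [set c | Finf c /\ c != 0]].

Definition is_vertex (v : vertex) : Prop :=
  exists2 L, is_lattice L & v = homothety_class L.

Definition act_lattice (g : 'M[K]_2) (L : set 'rV[K]_2) : set 'rV[K]_2 :=
  [set x *m invmx g | x in L].

Definition act_vertex (g : 'M[K]_2) (v : vertex) : vertex :=
  act_lattice g @` v.

Definition act_edge (g : 'M[K]_2) (e : set vertex) : set vertex :=
  act_vertex g @` e.

Definition adjacent (v w : vertex) : Prop :=
  exists L L', [/\ is_lattice L, is_lattice L', v = homothety_class L,
    w = homothety_class L'
    & scale_lattice pi_inf L `<` L' /\ L' `<` L].

Definition vtx (n : nat) : vertex :=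
  homothety_class
    (lattice_of (diag_mx (\row_(j < 2) if j == 0 then pi_inf ^+ n else 1))).

Definition has_type (v : vertex) (n : nat) : Prop :=
  exists2 g, GL2A g & v = act_vertex (mxAK g) (vtx n).

(* The end of the half-line x is s: the identification is equivariant under
   GL_2(F_infty) and maps the end of (v_n) to infinity, and half-lines which
   eventually coincide up to a shift have the same end. *)
Definition has_end (x : nat -> vertex) (s : P1 K) : Prop :=
  exists g, [/\ GL2Finf g, mob g None = s
    & exists m p, forall i, x (m + i)%N = act_vertex g (vtx (p + i))].

Definition is_geodesic (a b : P1 K) (x : int -> vertex) : Prop :=
  [/\ injective x, forall n, adjacent (x n) (x (n + 1)),
      has_end (fun n => x (- n%:Z)) a & has_end (fun n => x n%:Z) b].

(* Subcomplexes of the geometric realization are given by their sets of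
   cells: [set v] for a vertex v, and [set v; w] for an edge. *)
Definition geodesic (a b : P1 K) : set (set vertex) :=
  [set c | exists2 x, is_geodesic a b x
    & exists n, c = [set x n] \/ c = [set x n; x (n + 1)]].

Definition geodesics_meet (D : kdata F) : set (set vertex) :=
  \bigcap_(i in [set: 'I_(kr D)])
    geodesic (omap (iota K) (ka i)) (omap (iota K) (kb i)).

Definition closed_edge (e : set vertex) : set (set vertex) :=
  [set c | c = e \/ exists2 v, e v & c = [set v]].

Definition stable_vertex (n : A) (v : vertex) : Prop :=
  is_vertex v /\
  forall g, Gamma n g -> act_vertex (mxAK g) v = v -> g = 1%:M.

Definition noncuspidal_edge (n : A) (e : set vertex) : Prop :=
  exists v w, [/\ e = [set v; w], adjacent v w, stable_vertex n v
    & stable_vertex n w].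

Definition cuspidal_edge (d : nat) (e : set vertex) : Prop :=
  exists v w, [/\ e = [set v; w], adjacent v w, has_type v d.-1
    & has_type w d].

Definition cusp (n : A) (s : P1 F) : set (P1 F) :=
  [set mob (mxAF g) s | g in Gamma n].

(* The half-line of vertices of types d - 1, d, d + 1 and so on with first
   edge e has its end in c. *)
Definition edge_leads_to (d : nat) (e : set vertex) (c : set (P1 F)) : Prop :=
  exists x : nat -> vertex,
    [/\ e = [set x 0%N; x 1%N], forall i, adjacent (x i) (x i.+1),
        forall i, has_type (x i) (d.-1 + i)
      & exists2 s, c s & has_end x (omap (iota K) s)].

(* Reduction P^1(F) -> P^1(Fq), as a relation: a = [x : y] with x, y in
   O_infty coprime, and xi, eta are their residues. *)
Definition reduces_to (a : P1 F) (alpha : P1 Fq) : Prop :=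
  exists (x y : F) (xi eta : Fq),
    [/\ abs (iota K (x - FqtoF xi)) < 1, abs (iota K (y - FqtoF eta)) < 1,
        (xi != 0) || (eta != 0), a = hpoint x y & alpha = hpoint xi eta].

Definition poincare (n : A) (delta : 'M[F]_2) (D : kdata F) (z : K) : K :=
  usum (Gamma n)
    (fun g => kprod (iota K) z (kmap (mob (mxAF g *m delta)) D)).

(* Upper right entries of the upper unipotent matrices in
   nu^-1 Gamma(n) nu. *)
Definition translations (n : A) (nu : 'M[F]_2) : set F :=
  [set b | exists2 g, Gamma n g & invmx nu *m mxAF g *m nu =
    \matrix_(i < 2, j < 2) if i == j then 1 else if i == 0 then b else 0].

Definition exp_translations (n : A) (nu : 'M[F]_2) (z : K) : K :=
  z * uprod (translations n nu `\ 0) (fun b => 1 - z / iota K b).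

Definition t_param (n : A) (nu : 'M[F]_2) (z : K) : K :=
  (exp_translations n nu z)^-1.

(* j_nu(z)^-w f(nu z) = sum over i >= m of c_i t(z)^i, for |z|_i large. *)
Definition has_t_expansion (n : A) (w m : nat) (f : K -> K) (nu : 'M[F]_2)
    (c : nat -> K) : Prop :=
  exists r : R, forall z, Omega z -> r < vabs_i z ->
    converges (fun N => \sum_(m <= i < N) c i * t_param n nu z ^+ i)
      (jfac (mxFK nu) z ^- w * f (mobz (mxFK nu) z)).

Definition vanishes_ge (n : A) (w m : nat) (f : K -> K) (c : set (P1 F)) :=
  forall nu, nu \in unitmx -> c (mob nu None) ->
    exists a, has_t_expansion n w m f nu a.

Definition vanishes_exactly (n : A) (w m : nat) (f : K -> K)
    (c : set (P1 F)) :=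
  forall nu, nu \in unitmx -> c (mob nu None) ->
    exists2 a, has_t_expansion n w m f nu a & a m != 0.

(* M_w^m(Gamma(n)).  A function on Omega is given by any of its extensions to
   K; two of them are identified when they agree on Omega. *)
Definition modular_forms (w m : nat) (n : A) : set (K -> K) :=
  [set f | [/\ holomorphic f,
    forall g z, Gamma n g -> Omega z ->
      f (mobz (mxAK g) z) = jfac (mxAK g) z ^+ w * f z
    & forall s, vanishes_ge n w m f (cusp n s)]].

(* The finite family b is a basis of the space M of functions on Omega. *)
Definition basis_on_Omega (M : set (K -> K)) (I : finType)
    (b : I -> K -> K) : Prop :=
  (forall i, M (b i)) /\
  forall f, M f ->
    exists! c : {ffun I -> K}, forall z, Omega z -> f z = \sum_i c i * b i z.

End Drinfeld.

Arguments vtx {Fq R} K n.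
Arguments geodesics_meet {Fq R} K D _.
Arguments poincare {Fq R} K n delta D z.
Arguments modular_forms {Fq R} K w m n.

(* Main.v *)
(* On a term of weight k = sum k_i, the quantity abs(term)(z) * |z|_i^k is at
   most 1, with equality only if z lies over all the geodesics [a_i -> b_i].
   Hence the Poincare series, evaluated at suitable points (N points in distinct
   residue discs over each stable vertex, one point with z^2 = T over each
   stable edge), form a matrix that is invertible after reduction: the series
   are linearly independent.

   Conversely, a form f in M_{2k}^{k+1} which vanishes at those points is zero.
   Otherwise B = sup |f| |z|_i^k is attained over some vertex.  In a fixed
   affinoid f is close to a rational function, and zeros and poles can be
   counted disc by disc.  At a vertex of type >= d, periodicity under nA makes
   the slopes of the Gauss norms in all the directions below the vertex agree,
   which contradicts the decay |t|^(k+1) at the cusp.  At a stable vertex the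
   zeros at the chosen points are too many compared with the slopes in the
   directions of the edges.  Interpolation at the points then expresses every
   element of M_{2k}^{k+1}, and the cuspidal edge series absorb the leading
   coefficients of the elements of M_{2k}^k at the cusps. *)
Require Import Defs.
From HB Require Import structures.
From mathcomp Require Import all_boot all_order all_algebra all_field.
From mathcomp Require Import all_classical all_reals.
From mathcomp Require Import ring lra zify.

Set Implicit Arguments.
Unset Strict Implicit.
Unset Printing Implicit Defensive.

Import Order.TTheory GRing.Theory Num.Theory.
Local Open Scope classical_set_scope.
Local Open Scope ring_scope.

(** No dimension is ever computed. There are as many evaluation points as series, so an invertible
    matrix gives independence, and spanning only asks that evaluation be injective on M_{2k}^{k+1}.
    The constant N = k(q - 1) - q is what injectivity requires. At a stable vertex where B is
    attained, the poles of an approximant exceed its zeros by at most k - 1 in each of the q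
    rational residue discs, and by at least k + 1 in the closed disc; strictness comes from a point
    with a smaller value on each adjacent edge. Zeros in N further residue discs would give N + k +
    1 <= q(k - 1) = N + k. The obstacle is that f has a rational approximant only on one affinoid at
    a time and up to an absolute error. The error is therefore fixed below the smallest value that
    the argument will meet, so that f and the approximant have equal absolute values there. Near a
    cusp the height of the final contradiction has to be chosen before the approximant. On the way
    up, the pole excess is compared with k times the number of periods of absolute value at most
    q^L, since both bounds are multiplied by q at each step. *)

(** * Ultrametric calculus and the absolute value of polynomials *)

Section AbsoluteValue.

Variables (Fq : finFieldType) (R : realType) (K : valued_ext Fq R).
Implicit Types (x y z : K).

Local Notation abs := (vabs K).
Local Notation q := (#|Fq|%:R : R).
Local Notation T := (Defs.iota K (AtoF 'X)).

Lemma abs_ge0 x : 0 <= abs x. Proof. exact: vabs_ge0. Qed.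
Hint Resolve abs_ge0 : core.

Lemma absM : {morph abs : x y / x * y}. Proof. exact: vabsM. Qed.

Lemma abs_eq0 x : (abs x == 0) = (x == 0).
Proof. by apply/eqP/eqP => /vabs_eq0. Qed.

Lemma abs0 : abs 0 = 0. Proof. by apply/eqP; rewrite abs_eq0. Qed.

Lemma abs_gt0 x : (0 < abs x) = (x != 0).
Proof. by rewrite lt_def abs_eq0 abs_ge0 andbT. Qed.

Lemma abs1 : abs 1 = 1.
Proof.
have n0 : abs 1 != 0 by rewrite abs_eq0 oner_eq0.
by apply: (mulfI n0); rewrite -absM !mulr1.
Qed.

Lemma absX x m : abs (x ^+ m) = abs x ^+ m.
Proof. by elim: m => [|m IH]; rewrite ?expr0 ?abs1 // !exprS absM IH. Qed.

Lemma abs_unity x m : (0 < m)%N -> x ^+ m = 1 -> abs x = 1.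
Proof.
move=> m0 xm; have := absX x m; rewrite xm abs1 => /esym/eqP.
by rewrite pexpr_eq1 // => /eqP.
Qed.

Lemma absN x : abs (- x) = abs x.
Proof. by rewrite -mulN1r absM (@abs_unity (-1) 2) ?mul1r // sqrrN expr1n. Qed.

Lemma absB x y : abs (x - y) = abs (y - x).
Proof. by rewrite -absN opprB. Qed.

Lemma absV x : abs x^-1 = (abs x)^-1.
Proof.
have [->|x0] := eqVneq x 0; first by rewrite invr0 abs0 invr0.
have n0 : abs x != 0 by rewrite abs_eq0.
by apply: (mulfI n0); rewrite -absM !divff // abs1.
Qed.

Lemma abs_div x y : abs (x / y) = abs x / abs y.
Proof. by rewrite absM absV. Qed.

Lemma abs_exprz x (m : int) : abs (x ^ m) = abs x ^ m.
Proof. by case: m => m; rewrite ?NegzE -?exprnN ?absV -?exprnP absX. Qed.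

Lemma abs_prod I (r : seq I) (P : pred I) (f : I -> K) :
  abs (\prod_(i <- r | P i) f i) = \prod_(i <- r | P i) abs (f i).
Proof. by elim/big_rec2: _ => [|i x y _ <-]; rewrite ?abs1 ?absM. Qed.

Lemma absD_le x y r : abs x <= r -> abs y <= r -> abs (x + y) <= r.
Proof. by move=> xr yr; apply: le_trans (vabsD _ _) _; rewrite ge_max xr. Qed.

Lemma absB_le x y r : abs x <= r -> abs y <= r -> abs (x - y) <= r.
Proof. by move=> xr yr; apply: absD_le; rewrite ?absN. Qed.

Lemma absD_lt x y r : abs x < r -> abs y < r -> abs (x + y) < r.
Proof. by move=> xr yr; apply: le_lt_trans (vabsD _ _) _; rewrite gt_max xr. Qed.

Lemma absB_lt x y r : abs x < r -> abs y < r -> abs (x - y) < r.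
Proof. by move=> xr yr; apply: absD_lt; rewrite ?absN. Qed.

Lemma absB_le_max x y : abs (x - y) <= Num.max (abs x) (abs y).
Proof. by apply: absB_le; rewrite le_max lexx ?orbT. Qed.

Lemma absDl x y : abs y < abs x -> abs (x + y) = abs x.
Proof.
move=> yx; apply: le_anti; rewrite absD_le ?(ltW yx) //= leNgt.
by apply/negP => H; have := absB_lt H yx; rewrite addrK ltxx.
Qed.

Lemma absDr x y : abs x < abs y -> abs (x + y) = abs y.
Proof. by rewrite addrC; exact: absDl. Qed.

Lemma absBl x y : abs y < abs x -> abs (x - y) = abs x.
Proof. by move=> yx; apply: absDl; rewrite absN. Qed.

Lemma absBr x y : abs x < abs y -> abs (x - y) = abs y.
Proof. by move=> xy; rewrite absB absBl. Qed.

Lemma abs_near x y : abs (x - y) < abs y -> abs x = abs y.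
Proof. by move=> H; rewrite -(absDr H) subrK. Qed.

(** The form in which approximations are used: an error below a known lower bound e does not change
    the absolute value. *)
Lemma abs_near_le x y e : abs (x - y) < e -> e <= abs y -> abs x = abs y.
Proof. by move=> H1 H2; apply: abs_near; apply: lt_le_trans H2. Qed.

Lemma abs_sum_le I (r : seq I) (P : pred I) (f : I -> K) e : 0 <= e ->
  (forall i, P i -> abs (f i) <= e) -> abs (\sum_(i <- r | P i) f i) <= e.
Proof.
move=> e0 fe; elim/big_rec: _ => [|i x Pi xe]; first by rewrite abs0.
by apply: absD_le; rewrite ?fe.
Qed.

Lemma abs_sum_lt I (r : seq I) (P : pred I) (f : I -> K) e : 0 < e ->
  (forall i, P i -> abs (f i) < e) -> abs (\sum_(i <- r | P i) f i) < e.
Proof.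
move=> e0 fe; elim/big_rec: _ => [|i x Pi xe]; first by rewrite abs0.
by apply: absD_lt; rewrite ?fe.
Qed.

Lemma abs_sum_lt_seq (I : eqType) (r : seq I) (f : I -> K) e : 0 < e ->
  (forall i, i \in r -> abs (f i) < e) -> abs (\sum_(i <- r) f i) < e.
Proof. by move=> e0 fe; rewrite big_seq; apply: abs_sum_lt. Qed.

Lemma q_gt1 : 1 < q.
Proof. by rewrite ltr1n finNzRing_gt1. Qed.

Lemma q_gt0 : 0 < q. Proof. exact: lt_trans ltr01 q_gt1. Qed.
Hint Resolve q_gt0 : core.

Lemma abs_T : abs T = q. Proof. exact: vabsT. Qed.

Lemma T_neq0 : T != 0. Proof. by rewrite -abs_gt0 abs_T. Qed.

Lemma abs_Texp (m : int) : abs (T ^ m) = q ^ m.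
Proof. by rewrite abs_exprz abs_T. Qed.

Lemma pi_inf_def : pi_inf K = T^-1.
Proof. by rewrite /pi_inf fmorphV. Qed.

(** The composite embedding gets a name so that it can be declared a ring morphism; likewise [c2k]
    below. *)
Definition a2k (p : {poly Fq}) : K := Defs.iota K (AtoF p).

Lemma a2k_is_zmod_morphism : zmod_morphism a2k.
Proof. by move=> p r; rewrite /a2k /AtoF !rmorphB. Qed.
Lemma a2k_is_monoid_morphism : monoid_morphism a2k.
Proof. by split => [|p r]; rewrite /a2k /AtoF ?rmorphM ?rmorph1. Qed.
HB.instance Definition _ :=
  GRing.isZmodMorphism.Build {poly Fq} K a2k a2k_is_zmod_morphism.
HB.instance Definition _ :=
  GRing.isMonoidMorphism.Build {poly Fq} K a2k a2k_is_monoid_morphism.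

Definition c2k (c : Fq) : K := Defs.iota K (FqtoF c).

Lemma c2kE c : c2k c = a2k c%:P. Proof. by []. Qed.
Lemma c2k_is_zmod_morphism : zmod_morphism c2k.
Proof. by move=> p r; rewrite !c2kE !rmorphB. Qed.
Lemma c2k_is_monoid_morphism : monoid_morphism c2k.
Proof. by split => [|p r]; rewrite !c2kE ?rmorphM ?rmorph1. Qed.
HB.instance Definition _ :=
  GRing.isZmodMorphism.Build Fq K c2k c2k_is_zmod_morphism.
HB.instance Definition _ :=
  GRing.isMonoidMorphism.Build Fq K c2k c2k_is_monoid_morphism.

(** Nonzero constants are roots of unity, of order dividing q - 1. *)
Lemma abs_c2k c : c != 0 -> abs (c2k c) = 1.
Proof.
move=> c0; apply: (@abs_unity _ #|Fq|.-1).
  by rewrite -ltnS (ltn_predK (finNzRing_gt1 Fq)) finNzRing_gt1.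
rewrite -rmorphXn /=.
suff -> : c ^+ #|Fq|.-1 = 1 by rewrite rmorph1.
apply: (mulfI c0); rewrite mulr1 -exprS (ltn_predK (finNzRing_gt1 Fq)).
exact: expf_card.
Qed.

Lemma abs_c2k_le1 c : abs (c2k c) <= 1.
Proof. by have [->|/abs_c2k->//] := eqVneq c 0; rewrite rmorph0 abs0. Qed.

(** Induction along Horner's scheme: if p is nonzero then |p T| >= q, which dominates the constant
    term. *)
Lemma abs_a2k (p : {poly Fq}) : p != 0 -> abs (a2k p) = q ^+ (size p).-1.
Proof.
elim/poly_ind: p => [|p c IH]; first by rewrite eqxx.
have -> : a2k (p * 'X + c%:P) = a2k p * T + c2k c by rewrite rmorphD rmorphM.
have [->|p0 _] := eqVneq p 0.
  rewrite mul0r add0r polyC_eq0 => c0.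
  by rewrite rmorph0 mul0r add0r abs_c2k // size_polyC c0.
have H : abs (a2k p * T) = q ^+ (size p).
  rewrite absM IH // abs_T -exprSr prednK // lt0n size_poly_eq0 //.
rewrite size_MXaddC (negbTE p0) /= -H absDl // H.
apply: le_lt_trans (abs_c2k_le1 c) _.
by rewrite exprn_egt1 ?q_gt1 // size_poly_eq0.
Qed.

Lemma a2k_ge1 (p : {poly Fq}) : p != 0 -> 1 <= abs (a2k p).
Proof. by move=> /abs_a2k ->; rewrite exprn_ege1 // ltW // q_gt1. Qed.

Lemma AtoF_eq0 (p : {poly Fq}) : (AtoF p == 0) = (p == 0).
Proof. exact: tofrac_eq0. Qed.

Lemma fracE (y : ratfun Fq) :
  exists p r : {poly Fq}, r != 0 /\ y = AtoF p / AtoF r.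
Proof.
elim/quotW: y => x; exists (frac x).1, (frac x).2.
have d0 : (frac x).2 != 0 by exact: denom_ratioP.
split=> //; apply: (canRL (mulfK _)); first by rewrite AtoF_eq0.
rewrite /AtoF; unlock FracField.tofrac; rewrite -[LHS]FracField.pi_mul.
apply/eqmodP; rewrite /= FracField.equivfE /FracField.mulf.
by rewrite !numden_Ratio ?mulr1 ?oner_eq0 // mulrC.
Qed.

End AbsoluteValue.

#[global] Hint Extern 0 (is_true (0 < _)) => exact: q_gt0 : core.
#[global] Hint Extern 0 (is_true (1 < _)) => exact: q_gt1 : core.
#[global] Hint Extern 0 (is_true (0 <= _)) => exact: abs_ge0 : core.

(** * The completion F_infinity and the distance to it *)

Section LocalField.

Variables (Fq : finFieldType) (R : realType) (K : valued_ext Fq R).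
Implicit Types (x y z : K).

Local Notation abs := (vabs K).
Local Notation q := (#|Fq|%:R : R).
Local Notation T := (Defs.iota K (AtoF 'X)).
Local Notation Finf := (@Finf Fq R K).
Local Notation Oinf := (@Oinf Fq R K).
Local Notation a2k := (a2k K).
Local Notation c2k := (c2k K).
Local Notation im := (@vabs_i Fq R K).

Lemma q_unbounded (r : R) : exists m : nat, r < q ^+ m.
Proof.
pose m := Num.Def.archi_bound r; exists m.
have [r0|r0] := leP 0 r; last by apply: lt_le_trans r0 _; rewrite exprn_ge0 // ltW.
apply: lt_trans (archi_boundP r0) _.
by rewrite -natrX ltr_nat ltn_expl // finNzRing_gt1.
Qed.

Lemma q_exprz_unbounded (r : R) : exists m : int, r < q ^ m.
Proof. by have [m rm] := q_unbounded r; exists m%:Z; rewrite -exprnP. Qed.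

Lemma q_small (r : R) : 0 < r -> exists m : nat, q ^- m < r.
Proof.
move=> r0; have [m rm] := q_unbounded r^-1; exists m.
by rewrite -[ltRHS]invrK ltf_pV2 ?posrE ?exprn_gt0 ?invr_gt0.
Qed.

Lemma iota_val (y : ratfun Fq) : y != 0 -> exists m : int, abs (Defs.iota K y) = q ^ m.
Proof.
have [p [r [r0 ->]]] := fracE y; rewrite mulf_eq0 invr_eq0 !AtoF_eq0 (negbTE r0) orbF => p0.
exists ((size p).-1%:Z - (size r).-1%:Z); rewrite rmorphM fmorphV /= abs_div.
by rewrite -!/(a2k _) !abs_a2k // expfzDr ?gt_eqF // exprnN.
Qed.

Lemma q_exprz_lt (m p : int) : (q ^ m < q ^ p) = (m < p).
Proof. by rewrite ltr_eXz2l. Qed.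

Lemma q_exprz_le (m p : int) : (q ^ m <= q ^ p) = (m <= p).
Proof. by rewrite ler_eXz2l. Qed.

Lemma q_exprz_gt0 (m : int) : 0 < q ^ m.
Proof. exact: exprz_gt0. Qed.

Lemma q_exprz_inj (m p : int) : q ^ m = q ^ p -> m = p.
Proof. by move=> e; apply/eqP; rewrite eq_le -!q_exprz_le e lexx. Qed.

(** The closure of F in K. Field operations and the discreteness of absolute values are easier to
    prove for limits of rational functions than for digit expansions; [FinfP] identifies the two
    descriptions. *)
Definition Fclosure : set K :=
  [set x | forall e : R, 0 < e -> exists y : ratfun Fq, abs (x - Defs.iota K y) < e].

Lemma Fclosure_val x : Fclosure x -> x != 0 -> exists m : int, abs x = q ^ m.
Proof.
move=> cx x0; have [y xy] : exists y : ratfun Fq, abs (x - Defs.iota K y) < abs x by apply: cx; rewrite abs_gt0.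
have e : abs (Defs.iota K y) = abs x by apply: abs_near; rewrite absB.
have y0 : y != 0 by apply: contraNneq x0 => y0; rewrite -abs_eq0 -e y0 rmorph0 abs0.
by have [m] := iota_val y0; rewrite e; exists m.
Qed.

Lemma Fclosure_iota (y : ratfun Fq) : Fclosure (Defs.iota K y).
Proof. by move=> e e0; exists y; rewrite subrr abs0. Qed.

Lemma FclosureB x y : Fclosure x -> Fclosure y -> Fclosure (x - y).
Proof.
move=> cx cy e e0; have [a xa] := cx e e0; have [b yb] := cy e e0.
exists (a - b); rewrite rmorphB /=.
have -> : x - y - (Defs.iota K a - Defs.iota K b) =
  (x - Defs.iota K a) - (y - Defs.iota K b) by ring.
exact: absB_lt.
Qed.

Lemma FclosureM x y : Fclosure x -> Fclosure y -> Fclosure (x * y).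
Proof.
move=> cx cy e e0.
have h0 z : 0 < e / (1 + abs z) by rewrite divr_gt0 // ltr_pwDl.
have hz u z : abs u < e / (1 + abs z) -> abs (u * z) < e.
  move=> H; rewrite absM; apply: le_lt_trans (_ : abs u * (1 + abs z) < e).
    by rewrite ler_wpM2l // lerDr.
  by rewrite -ltr_pdivlMr // ltr_pwDl.
have [b yb] := cy _ (h0 x); have [a xa] := cx _ (h0 (Defs.iota K b)).
exists (a * b); rewrite rmorphM /=.
have -> : x * y - Defs.iota K a * Defs.iota K b =
  (y - Defs.iota K b) * x + (x - Defs.iota K a) * Defs.iota K b by ring.
by apply: absD_lt; exact: hz.
Qed.

Lemma FclosureV x : Fclosure x -> Fclosure x^-1.
Proof.
have [->|x0] := eqVneq x 0; first by rewrite invr0.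
move=> cx e e0; have ax0 : 0 < abs x by rewrite abs_gt0.
(* The first bound forces |a| = |x|; the second one then controls the difference of the inverses,
   which is |x - a| / |x|^2. *)
have [a xa] : exists y : ratfun Fq, abs (x - Defs.iota K y) < Num.min (abs x) (e * abs x ^+ 2).
  by apply: cx; rewrite lt_min ax0 mulr_gt0 ?exprn_gt0.
move: xa; rewrite lt_min => /andP[xa1 xa2].
have ea : abs (Defs.iota K a) = abs x by apply: abs_near; rewrite absB.
have a0 : Defs.iota K a != 0 by rewrite -abs_gt0 ea.
exists a^-1; rewrite fmorphV.
have -> : x^-1 - (Defs.iota K a)^-1 = - (x - Defs.iota K a) / (x * Defs.iota K a).
  by field; rewrite x0 a0.
by rewrite abs_div absN absM ea ltr_pdivrMr -?expr2 // exprn_gt0.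
Qed.

(** Division with remainder splits a rational function into a polynomial and a part of absolute
    value less than 1. *)
Lemma Fclosure_poly x : Fclosure x -> exists a, abs (x - a2k a) < 1.
Proof.
move=> cx; have [y xy] := cx _ ltr01.
have [p [r [r0 ey]]] := fracE y; exists (p %/ r).
have -> : x - a2k (p %/ r) = (x - Defs.iota K y) + a2k (p %% r) / a2k r.
  have /(congr1 a2k) := divp_eq p r; rewrite rmorphD rmorphM /= => e.
  have r0' : a2k r != 0 by rewrite fmorph_eq0 AtoF_eq0.
  have -> : Defs.iota K y = a2k p / a2k r by rewrite ey rmorphM fmorphV.
  by rewrite e; field.
apply: absD_lt => //; rewrite abs_div.
have [->|m0] := eqVneq (p %% r) 0; first by rewrite rmorph0 abs0 mul0r.
rewrite !abs_a2k // ltr_pdivrMr ?exprn_gt0 // mul1r ltr_eXn2l //.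
have lt_pr : (size (p %% r)%R < size r)%N by rewrite ltn_modp.
by move: m0 lt_pr; rewrite -size_poly_gt0; case: (size r) => [//|s] /prednK {1}<-.
Qed.

Lemma a2k_le1 a : abs (a2k a) <= 1 -> exists c, a = c%:P.
Proof.
have [->|a0] := eqVneq a 0; first by exists 0; rewrite polyC0.
rewrite abs_a2k // -(expr0 q) ler_eXn2l // leqn0 => /eqP s.
by exists a`_0; apply: size1_polyC; rewrite -(prednK (_ : 0 < size a)%N) ?s ?lt0n ?size_poly_eq0.
Qed.

Lemma Fclosure_digit x : Fclosure x -> abs x <= 1 -> exists c, abs (x - c2k c) < 1.
Proof.
move=> /Fclosure_poly[a xa] x1; have [|c ac] := @a2k_le1 a; last by exists c; rewrite c2kE -ac.
have -> : a2k a = x - (x - a2k a) by ring.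
by apply: absB_le => //; exact: ltW.
Qed.

Lemma Fclosure_T : Fclosure T. Proof. exact: Fclosure_iota. Qed.

(** Absolute values on the closure of F are powers of q, so a value below 1 is at most 1/q. *)
Lemma Fclosure_shift x : Fclosure x -> abs x < 1 -> abs (T * x) <= 1.
Proof.
have [->|x0] := eqVneq x 0; first by rewrite mulr0 abs0.
move=> cx; have [m em] := Fclosure_val cx x0.
rewrite absM abs_T em; have -> : q * q ^ m = q ^ (m + 1).
  by rewrite expfzDr ?gt_eqF // expr1z mulrC.
by rewrite -(expr0z q) q_exprz_lt q_exprz_le; lia.
Qed.

Lemma Oinf_Fclosure x : Fclosure x -> abs x <= 1 -> Oinf x.
Proof.
move=> cx x1.
(* Digit expansion: [dg] picks the residue of y, [nx] removes it and rescales by T. After n digits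
   the error is exactly pi^n times the remainder [xs n]. *)
pose dg y := xget 0 [set c | abs (y - c2k c) < 1].
pose nx y := T * (y - c2k (dg y)).
pose xs n := iter n nx x; have xsS n : xs n.+1 = nx (xs n) by [].
have dgP y : Fclosure y -> abs y <= 1 -> abs (y - c2k (dg y)) < 1.
  by move=> cy y1; have [c yc] := Fclosure_digit cy y1; exact: (@xgetPex _ 0 [set c | abs (y - c2k c) < 1] (ex_intro _ c yc)).
have xsP n : Fclosure (xs n) /\ abs (xs n) <= 1.
  elim: n => [//|n [IH1 IH2]]; rewrite xsS /nx.
  have c1 : Fclosure (xs n - c2k (dg (xs n))) by apply: FclosureB => //; exact: Fclosure_iota.
  split; first by apply: FclosureM => //; exact: Fclosure_T.
  by apply: Fclosure_shift => //; exact: dgP.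
exists (fun n => dg (xs n)) => e e0; have [N Ne] := q_small e0.
exists N => n Nn.
have -> : \sum_(i < n) Defs.iota K (FqtoF (dg (xs i))) * pi_inf K ^+ i - x = - (pi_inf K ^+ n * xs n).
  elim: (n) => [|p IH]; first by rewrite big_ord0 /xs /= expr0; ring.
  rewrite xsS big_ord_recr /= addrAC IH /nx exprSr pi_inf_def.
  by rewrite -!/(c2k _); field; rewrite T_neq0.
rewrite absN absM absX pi_inf_def absV abs_T.
apply: le_lt_trans (_ : q^-1 ^+ N < e); last by rewrite exprVn.
apply: le_trans (_ : q^-1 ^+ n <= _); first by rewrite ler_piMr ?exprn_ge0 ?(xsP n).2 // invr_ge0 ltW.
by rewrite ler_wiXn2l // ?invr_ge0 ?ltW // invf_lt1.
Qed.

Lemma FinfP x : Finf x <-> Fclosure x.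
Proof.
split=> [[m [a ax]] e e0|cx].
  have [|N /(_ N (leqnn N)) H] := ax (e / q ^+ m); first by rewrite divr_gt0 ?exprn_gt0.
  exists ((AtoF 'X) ^+ m * \sum_(i < N) FqtoF (a i) * (AtoF 'X)^-1 ^+ i).
  rewrite rmorphM rmorph_sum rmorphXn /= (eq_bigr (fun i : 'I_N => Defs.iota K (FqtoF (a i)) * pi_inf K ^+ i)); last first.
    by move=> i _; rewrite rmorphM rmorphXn /= /pi_inf.
  set s := \sum_(_ < _) _ in H *.
  have -> : x - T ^+ m * s = - (T ^+ m * (s - pi_inf K ^+ m * x)).
    by rewrite pi_inf_def exprVn; field; rewrite expf_neq0 // T_neq0.
  by rewrite absN absM absX abs_T mulrC -ltr_pdivlMr ?exprn_gt0.
have [m xm] := q_unbounded (abs x); exists m; apply: Oinf_Fclosure.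
  rewrite /pi_inf -rmorphXn; apply: FclosureM => //; exact: Fclosure_iota.
by rewrite absM absX pi_inf_def absV abs_T exprVn mulrC ler_pdivrMr ?exprn_gt0 // mul1r ltW.
Qed.

Lemma Finf_iota (y : ratfun Fq) : Finf (Defs.iota K y). Proof. exact/FinfP/Fclosure_iota. Qed.
Lemma FinfB x y : Finf x -> Finf y -> Finf (x - y).
Proof. by rewrite !FinfP; exact: FclosureB. Qed.
Lemma FinfM x y : Finf x -> Finf y -> Finf (x * y).
Proof. by rewrite !FinfP; exact: FclosureM. Qed.
Lemma FinfV x : Finf x -> Finf x^-1.
Proof. by rewrite !FinfP; exact: FclosureV. Qed.
Lemma Finf0 : Finf 0. Proof. by rewrite -(rmorph0 (Defs.iota K)); exact: Finf_iota. Qed.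
Lemma Finf1 : Finf 1. Proof. by rewrite -(rmorph1 (Defs.iota K)); exact: Finf_iota. Qed.
Lemma FinfN x : Finf x -> Finf (- x).
Proof. by rewrite -sub0r; apply: FinfB; exact: Finf0. Qed.
Lemma FinfD x y : Finf x -> Finf y -> Finf (x + y).
Proof. by move=> fx fy; rewrite -[y]opprK; apply: FinfB => //; exact: FinfN. Qed.
Lemma Finf_c2k c : Finf (c2k c). Proof. exact: Finf_iota. Qed.
Lemma Finf_a2k c : Finf (a2k c). Proof. exact: Finf_iota. Qed.
Lemma Finf_T : Finf T. Proof. exact: Finf_iota. Qed.
Lemma FinfX x n : Finf x -> Finf (x ^+ n).
Proof. by move=> fx; elim: n => [|n IH]; rewrite ?expr0 ?exprS; [exact: Finf1|exact: FinfM]. Qed.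
Lemma Finf_Texp (m : int) : Finf (T ^ m).
Proof. by case: m => m; rewrite ?NegzE -?exprnN -?exprnP; [|apply: FinfV]; apply/FinfX/Finf_T. Qed.

Lemma Finf_val x : Finf x -> x != 0 -> exists m : int, abs x = q ^ m.
Proof. by rewrite FinfP; exact: Fclosure_val. Qed.

Lemma Finf_digit x (m : int) : Finf x -> abs x <= q ^ m ->
  exists c, abs (x - c2k c * T ^ m) < q ^ m.
Proof.
move=> fx xm; have Tm0 : T ^ m != 0 by rewrite expfz_neq0 // T_neq0.
have [||c xc] := @Fclosure_digit (x / T ^ m).
- by apply/FinfP/FinfM => //; apply/FinfV/Finf_Texp.
- by rewrite abs_div abs_Texp ler_pdivrMr ?mul1r ?q_exprz_gt0.
exists c; have -> : x - c2k c * T ^ m = (x / T ^ m - c2k c) * T ^ m by field.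
by rewrite absM abs_Texp gtr_pMl ?q_exprz_gt0.
Qed.

Lemma Finf_closed x : (forall e : R, 0 < e -> exists2 y, Finf y & abs (x - y) < e) -> Finf x.
Proof.
move=> H; apply/FinfP => e e0; have [y /FinfP /(_ e e0)[a ya] xy] := H e e0.
exists a; have -> : x - Defs.iota K a = (x - y) + (y - Defs.iota K a) by ring.
exact: absD_lt.
Qed.

Lemma OinfP x : Oinf x <-> Finf x /\ abs x <= 1.
Proof.
split=> [ox|[fx x1]]; last exact/Oinf_Fclosure/x1/FinfP.
split; first by exists 0%N; rewrite expr0 mul1r.
case: ox => a /(_ 1 ltr01)[N /(_ N (leqnn N)) H].
set s := \sum_(_ < _) _ in H; have -> : x = s - (s - x) by ring.
apply: absB_le; last exact: ltW.
apply: abs_sum_le => // i _; rewrite absM -/(c2k _) mulr_ile1 ?abs_c2k_le1 //.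
by rewrite absX exprn_ile1 // pi_inf_def absV abs_T invf_le1 // ltW.
Qed.

Lemma im_le z x : Finf x -> im z <= abs (z - x).
Proof.
move=> fx; apply: ge_inf; last by exists x.
by exists 0 => _ [y _ <-].
Qed.

Lemma im_ge z r : (forall x, Finf x -> r <= abs (z - x)) -> r <= im z.
Proof.
move=> H; apply: lb_le_inf; first by exists (abs (z - 0)), 0 => //; exact: Finf0.
by move=> _ [x fx <-]; exact: H.
Qed.

Lemma im_ge0 z : 0 <= im z. Proof. exact: im_ge. Qed.

Lemma im_le_abs z : im z <= abs z.
Proof. by rewrite -{2}(subr0 z); apply/im_le/Finf0. Qed.

Lemma im_gt0 z : (0 < im z) <-> Omega z.
Proof.
split=> [i0 fz|oz].
  by have := im_le z fz; rewrite subrr abs0 leNgt i0.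
rewrite lt_def im_ge0 andbT; apply/eqP => e; apply: oz; apply: Finf_closed => r r0.
have : ~ (r <= im z) by rewrite e leNgt r0.
move=> H; apply: contrapT => H'; apply: H; apply: im_ge => x fx.
by rewrite leNgt; apply/negP => H; apply: H'; exists x.
Qed.

Lemma Omega_neq z x : Omega z -> Finf x -> z - x != 0.
Proof. by move=> oz fx; apply/eqP => /subr0_eq e; apply: oz; rewrite e. Qed.

(** Only the case |z| = |x| is not settled by the ultrametric inequality alone; there |z - x| >=
    |z|_i = |z|. *)
Lemma abs_sub_im z x : abs z = im z -> Finf x -> abs (z - x) = Num.max (abs z) (abs x).
Proof.
move=> e fx; case: (ltgtP (abs z) (abs x)) => H.
- exact: absBr.
- exact: absBl.
- by apply: le_anti; rewrite absB_le ?H //= -H e im_le.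
Qed.

(** It suffices to test the q centres c T^m, since every x in F_infinity with |x| <= q^m is closer
    than q^m to one of them. *)
Lemma im_exprz z (m : int) : (forall c, q ^ m <= abs (z - c2k c * T ^ m)) -> abs z = q ^ m ->
  im z = q ^ m.
Proof.
move=> H e; apply: le_anti; rewrite -{1}e im_le_abs /= ; apply: im_ge => x fx.
have [xm|xm] := leP (abs x) (q ^ m); last by rewrite absBr ?e // ltW.
have [c xc] := Finf_digit fx xm; have := H c.
rewrite !leNgt; apply: contra => H'.
have -> : z - c2k c * T ^ m = (z - x) + (x - c2k c * T ^ m) by ring.
exact: absD_lt.
Qed.

(** The distance to x0 lies strictly between two consecutive values of F_infinity, so |x - x0|
    always differs from it and no x can be closer to z. *)
Lemma im_noninteger z x0 (m : int) : Finf x0 -> q ^ m < abs (z - x0) < q ^ (m + 1) ->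
  im z = abs (z - x0).
Proof.
move=> f0 /andP[l1 l2]; apply: le_anti; rewrite im_le //=; apply: im_ge => x fx.
have -> : z - x = (z - x0) - (x - x0) by ring.
have [e0|xx0] := eqVneq (x - x0) 0; first by rewrite e0 subr0.
have [p ep] := Finf_val (FinfB fx f0) xx0.
have [pm|pm] := leP p m.
  by rewrite [leRHS]absBl // ep; apply: le_lt_trans l1; rewrite q_exprz_le.
have H : abs (z - x0) < abs (x - x0).
  by rewrite ep; apply: lt_le_trans l2 _; rewrite q_exprz_le; lia.
by rewrite [leRHS]absBr // ltW.
Qed.

End LocalField.

(** * Points of prescribed absolute value in general position *)

Section GenericPoints.

Variables (Fq : finFieldType) (R : realType) (K : valued_ext Fq R).
Implicit Types (x y z : K).

Local Notation abs := (vabs K).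
Local Notation q := (#|Fq|%:R : R).
Local Notation T := (Defs.iota K (AtoF 'X)).

Lemma exists_root x m : (0 < m)%N -> exists w, w ^+ m = x.
Proof.
move=> m0; have /closed_rootP[w] : size ('X^m - x%:P) != 1%N.
  by rewrite size_XnsubC // eqSS -lt0n.
by rewrite rootE !hornerE subr_eq0 => /eqP; exists w.
Qed.

Lemma abs_root x w m r : w ^+ m = x -> (0 < m)%N -> 1 < abs x < r ^+ m -> 0 <= r ->
  1 < abs w < r.
Proof.
move=> <- m0; rewrite absX => /andP[w1 wr] r0; apply/andP; split.
  by rewrite ltNge; apply: contraTN w1 => w1; rewrite -leNgt exprn_ile1.
by move: wr; rewrite ltr_pXn2r ?nnegrE // -lt0n.
Qed.

Lemma bernoulli (r : R) m : 0 <= r -> 1 + r *+ m <= (1 + r) ^+ m.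
Proof.
move=> r0; elim: m => [|m IH]; first by rewrite mulr0n addr0 expr0.
rewrite exprS; apply: le_trans (_ : (1 + r) * (1 + r *+ m) <= _); last first.
  by rewrite ler_wpM2l // addr_ge0.
have : 0 <= r * (r *+ m) by rewrite mulr_ge0 // mulrn_wge0.
by rewrite mulrS; nra.
Qed.

(** An m-th root of T with m large: Bernoulli's inequality puts the m-th root of q below r. *)
Lemma near_one (r : R) : 1 < r -> exists w : K, 1 < abs w < r.
Proof.
move=> r1; pose m := (Num.Def.archi_bound (q / (r - 1))).+1.
have m0 : (0 < m)%N by [].
have [w wT] := exists_root T m0; exists w; apply: (abs_root wT) => //; last by lra.
rewrite abs_T q_gt1 /=; apply: lt_le_trans (_ : 1 + (r - 1) *+ m <= _); last first.
  by apply: le_trans (bernoulli _ _) _; [lra | rewrite addrC subrK].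
have : q / (r - 1) < m%:R.
  apply: lt_trans (archi_boundP _) _; first by rewrite divr_ge0 ?subr_ge0 // ltW.
  by rewrite ltr_nat.
by rewrite ltr_pdivrMr ?subr_gt0 // mulr_natl; lra.
Qed.

(* The m-th roots of unity, for m prime to the characteristic: the product of
   the differences of one of them with the others is m times a unit. *)
Lemma unity_family N : exists s : seq K, [/\ (N <= size s)%N, uniq s,
  forall x, x \in s -> abs x = 1 &
  forall x y, x \in s -> y \in s -> x != y -> abs (x - y) = 1].
Proof.
(* If the characteristic divides N + 1, then N + 2 equals 1 in Fq. *)
have [m [m0 mN mF]] : exists m, [/\ (0 < m)%N, (N <= m)%N & (m%:R : Fq) != 0].
  have [e|n0] := eqVneq (N.+1%:R : Fq) 0; last by exists N.+1; rewrite leqnSn.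
  exists N.+2; rewrite -natr1 e add0r oner_neq0; split=> //; lia.
have am : abs m%:R = 1 by rewrite -(rmorph_nat (c2k K)) abs_c2k.
have mK : (m%:R : K) != 0 by rewrite -abs_gt0 am.
have [s es] := closed_field_poly_normal ('X^m - 1 : {poly K}).
move: es; rewrite (lead_coefDl (q := - 1)) ?lead_coefXn ?scale1r => [es|]; last first.
  by rewrite size_polyN size_poly1 size_polyXn.
exists s.
have rs x : x \in s -> x ^+ m = 1.
  rewrite -root_prod_XsubC -es rootE !hornerE subr_eq0.
  by move/eqP.
have as1 x : x \in s -> abs x = 1 by move=> /rs; exact: abs_unity.
split=> //.
- have : size ('X^m - 1 : {poly K}) = (size s).+1 by rewrite es size_prod_XsubC.
  by rewrite size_XnsubC // => -[<-].
- by rewrite -separable_prod_XsubC -es separable_Xn_sub_1.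
move=> x y xs ys xy.
have {es} es : 'X^m - 1 = ('X - x%:P) * \prod_(z <- rem x s) ('X - z%:P).
  by rewrite es (perm_big _ (perm_to_rem xs)) big_cons.
(* The derivative at x is m x^(m-1), of absolute value 1, and also a product of factors x - z of
   absolute value at most 1; hence no factor can be smaller than 1. *)
have : ('X^m - 1 : {poly K})^`().[x] = \prod_(z <- rem x s) (x - z).
  rewrite es derivM derivXsubC mul1r hornerD hornerM !hornerE subrr mul0r addr0.
  by rewrite horner_prod; apply: eq_bigr => z _; rewrite !hornerE.
have ys' : y \in rem x s.
  by have := perm_mem (perm_to_rem xs) y; rewrite ys inE eq_sym (negbTE xy) /= => <-.
rewrite derivB derivXn derivC subr0 (perm_big _ (perm_to_rem ys')) big_cons.
move=> /(congr1 abs); rewrite hornerMn hornerXn -mulr_natl !absM am absX as1 // expr1n mulr1.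
have le1 z : z \in s -> abs (x - z) <= 1 by move=> zs; apply: absB_le; rewrite as1.
move=> e; apply: le_anti; rewrite le1 //=.
rewrite leNgt; apply/negP => d1; move: e => /eqP; rewrite eq_sym lt_eqF // mulrC.
apply: le_lt_trans d1; rewrite ler_piMl //.
rewrite abs_prod big_seq prodr_ile1 // => i /mem_rem/mem_rem si.
by rewrite abs_ge0 le1.
Qed.

(** Pigeonhole principle: the candidates a + sg x, for more than [size l] roots of unity x, have
    mutual distance |sg|, so an open disc of radius |sg| around a point of l contains at most one of
    them. A candidate outside all these discs is generic. *)
Lemma generic_pt (sg a : K) (l : seq K) : sg != 0 ->
  exists z, abs (z - a) = abs sg /\
    forall b, b \in l -> abs (z - b) = Num.max (abs sg) (abs (b - a)).
Proof.
move=> sg0; have [s [sl us s1 s2]] := unity_family (size l).+1.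
pose bad x b := (b \in l) && (abs (a + sg * x - b) < abs sg).
have [[x xs xb]|H] := pselect (exists2 x, x \in s & forall b, ~~ bad x b).
  have xE : a + sg * x - a = sg * x by ring.
  exists (a + sg * x); split=> [|b bl]; first by rewrite xE absM (s1 x) // mulr1.
  have -> : a + sg * x - b = sg * x - (b - a) by ring.
  have sx : abs (sg * x) = abs sg by rewrite absM (s1 x) // mulr1.
  case: (ltgtP (abs sg) (abs (b - a))) => c.
  - by rewrite [LHS]absBr ?sx.
  - by rewrite [LHS]absBl ?sx.
  - apply: le_anti; rewrite absB_le ?sx ?c //=.
    have := xb b; rewrite /bad bl /= -leNgt c.
    by have -> : a + sg * x - b = sg * x - (b - a) by ring.
have bx x : exists b, x \in s -> bad x b.
  have [xs|] := boolP (x \in s); last by exists 0.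
  apply: contrapT => H'; apply: H; exists x => // b; apply/negP => bb.
  by apply: H'; exists b.
have [f fP] := choice bx.
have : (size (map f s) <= size l)%N.
  apply: uniq_leq_size => [|_ /mapP[x xs ->]]; last by case/andP: (fP x xs).
  rewrite map_inj_in_uniq // => x y xs ys fxy; apply: contrapT => /eqP xy.
  have /andP[_ h1] := fP x xs; have /andP[_ h2] := fP y ys.
  have : abs (sg * (x - y)) < abs sg.
    have -> : sg * (x - y) = (a + sg * x - f x) - (a + sg * y - f y) by rewrite fxy; ring.
    exact: absB_lt.
  by rewrite absM (s2 x y) // mulr1 ltxx.
by rewrite size_map leqNgt; move: sl => ->.
Qed.

End GenericPoints.

(** * Two-by-two matrices and fractional linear maps *)

Section Matrices.

Variable (F : fieldType).
Implicit Types (A B : 'M[F]_2).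

Lemma sum2 (V : nmodType) (f : 'I_2 -> V) : \sum_i f i = f 0 + f 1.
Proof. by rewrite big_ord_recl big_ord1; congr (_ + f _); apply: val_inj. Qed.

Lemma mulmx2 m n (A : 'M[F]_(m, 2)) (B : 'M[F]_(2, n)) i j :
  (A *m B) i j = A i 0 * B 0 j + A i 1 * B 1 j.
Proof. by rewrite mxE sum2. Qed.

Lemma ord2P (P : 'I_2 -> Prop) : P 0 -> P 1 -> forall i, P i.
Proof.
move=> p0 p1 [[|[|//]] h]; first by rewrite (_ : Ordinal h = 0) //; exact: val_inj.
by rewrite (_ : Ordinal h = 1) //; exact: val_inj.
Qed.

Lemma mx2P A B : A 0 0 = B 0 0 -> A 0 1 = B 0 1 -> A 1 0 = B 1 0 -> A 1 1 = B 1 1 -> A = B.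
Proof.
move=> e0 e1 e2 e3; apply/matrixP; apply: ord2P; apply: ord2P => //.
Qed.

Lemma det2 A : \det A = A 0 0 * A 1 1 - A 0 1 * A 1 0.
Proof.
rewrite (expand_det_row _ 0) sum2 /cofactor !det_mx11 !mxE /= expr0 expr1.
rewrite mul1r mulN1r mulrN; congr (_ * A _ _ - _ * A _ _); exact: val_inj.
Qed.

Definition mk2 (a b c d : F) : 'M[F]_2 :=
  \matrix_(i, j) if i == 0 then if j == 0 then a else b else if j == 0 then c else d.

Lemma mk2E a b c d : ((mk2 a b c d 0 0 = a) * (mk2 a b c d 0 1 = b)
  * (mk2 a b c d 1 0 = c) * (mk2 a b c d 1 1 = d))%type.
Proof. by rewrite !mxE. Qed.

Lemma det_mk2 a b c d : \det (mk2 a b c d) = a * d - b * c.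
Proof. by rewrite det2 !mk2E. Qed.

Lemma unitmx2 A : (A \in unitmx) = (A 0 0 * A 1 1 - A 0 1 * A 1 0 != 0).
Proof. by rewrite unitmxE unitfE det2. Qed.

Lemma invmx_mul A B : A *m B = 1%:M -> invmx A = B.
Proof.
move=> AB; have [uA _] := mulmx1_unit AB.
by rewrite -[invmx A]mulmx1 -AB mulKmx.
Qed.

Lemma invmx_prod A B : A \in unitmx -> B \in unitmx -> invmx (A *m B) = invmx B *m invmx A.
Proof.
by move=> uA uB; apply: invmx_mul; rewrite mulmxA mulmxK // mulmxV.
Qed.

Lemma invmx2 A : A \in unitmx ->
  invmx A = (\det A)^-1 *: mk2 (A 1 1) (- A 0 1) (- A 1 0) (A 0 0).
Proof.
move=> uA; have d0 : \det A != 0 by rewrite -unitfE -unitmxE.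
move: d0; rewrite det2 => d0; apply: invmx_mul; apply: mx2P; rewrite mulmx2 ?det2 !mxE /=; field; done.
Qed.

Lemma mobzM A B z : jfac B z != 0 -> mobz (A *m B) z = mobz A (mobz B z).
Proof.
rewrite /mobz /jfac !mulmx2 => j0; set u := B 0 0 * z + B 0 1; set v := B 1 0 * z + B 1 1.
have v0 : v != 0 by [].
have E a b : a * (u / v) + b = (a * u + b * v) / v.
  by move: u v v0 => u v v0; rewrite mulrDl mulfK // mulrA.
rewrite !E invf_div mulrA divfK //.
by congr (_ / _); rewrite /u /v; ring.
Qed.

Lemma jfacM A B z : jfac B z != 0 -> jfac (A *m B) z = jfac A (mobz B z) * jfac B z.
Proof.
rewrite /mobz /jfac !mulmx2 => j0.
by rewrite [RHS]mulrDl -mulrA divfK //; ring.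
Qed.

Lemma mobz1 z : mobz (1%:M : 'M[F]_2) z = z.
Proof. by rewrite /mobz !mxE /= mul0r add0r divr1 mul1r addr0. Qed.

Lemma jfac1 z : jfac (1%:M : 'M[F]_2) z = 1.
Proof. by rewrite /jfac !mxE /= mul0r add0r. Qed.

End Matrices.

(** * The projective line in homogeneous coordinates *)

Section ProjectiveLine.

Variable F : fieldType.
Implicit Types (s a b : P1 F) (g h : 'M[F]_2).

(** The pair of [hx s] and [hy s] consists of homogeneous coordinates of s, which avoid a case
    distinction at infinity. *)
Definition hx s : F := if s is Some x then x else 1.
Definition hy s : F := if s is Some _ then 1 else 0.

Lemma hpointE s : hpoint (hx s) (hy s) = s.
Proof. by case: s => [x|]; rewrite /hpoint /= ?oner_eq0 ?eqxx // divr1. Qed.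

Lemma hpoint_scale (e x y : F) : e != 0 -> hpoint (e * x) (e * y) = hpoint x y.
Proof.
by move=> e0; rewrite /hpoint mulf_eq0 (negbTE e0) /= -mulf_div divff // mul1r.
Qed.

(** The linear action on coordinates agrees with [mob] up to a factor e. Identities on the
    projective line are reduced to ring identities by cancelling such factors. *)
Lemma mob_hom g s : g \in unitmx -> exists2 e, e != 0 &
  g 0 0 * hx s + g 0 1 * hy s = e * hx (mob g s) /\
  g 1 0 * hx s + g 1 1 * hy s = e * hy (mob g s).
Proof.
rewrite unitmx2 => dg.
have -> : mob g s = hpoint (g 0 0 * hx s + g 0 1 * hy s) (g 1 0 * hx s + g 1 1 * hy s).
  by case: s => [x|] /=; rewrite ?mulr1 ?mulr0 ?addr0.
set X := _ + _; set Y := _ + _; rewrite /hpoint.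
have [Y0|Y0] := eqVneq Y 0; last first.
  by exists Y; rewrite //= mulr1 mulrC divfK.
exists X; rewrite /= ?mulr1 ?mulr0 //; apply/eqP => X0.
have h1 : (g 0 0 * g 1 1 - g 0 1 * g 1 0) * hx s = 0.
  have -> : (g 0 0 * g 1 1 - g 0 1 * g 1 0) * hx s = g 1 1 * X - g 0 1 * Y by rewrite /X /Y; ring.
  by rewrite X0 Y0 !mulr0 subr0.
have h2 : (g 0 0 * g 1 1 - g 0 1 * g 1 0) * hy s = 0.
  have -> : (g 0 0 * g 1 1 - g 0 1 * g 1 0) * hy s = g 0 0 * Y - g 1 0 * X by rewrite /X /Y; ring.
  by rewrite X0 Y0 !mulr0 subr0.
move: h1 h2 => /eqP; rewrite mulf_eq0 (negbTE dg) /= => /eqP h1 /eqP.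
rewrite mulf_eq0 (negbTE dg) /= => /eqP h2.
move: h1 h2; rewrite {X Y X0 Y0}; case: s => [x|] /= h1 h2.
  by move: (oner_neq0 F); rewrite h2 eqxx.
by move: (oner_neq0 F); rewrite h1 eqxx.
Qed.

Lemma mobM g h s : g \in unitmx -> h \in unitmx -> mob (g *m h) s = mob g (mob h s).
Proof.
move=> ug uh; have [e e0 [e1 e2]] := mob_hom s uh; set t := mob h s in e1 e2 *.
have mobE k r : mob k r = hpoint (k 0 0 * hx r + k 0 1 * hy r) (k 1 0 * hx r + k 1 1 * hy r).
  by case: r => [x|] /=; rewrite ?mulr1 ?mulr0 ?addr0.
rewrite !mobE !mulmx2 -[RHS](hpoint_scale _ _ e0); congr hpoint.
  transitivity (g 0 0 * (e * hx t) + g 0 1 * (e * hy t)); last first.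
    by move: e {e0 e1 e2} => e; ring.
  by rewrite -e1 -e2; ring.
transitivity (g 1 0 * (e * hx t) + g 1 1 * (e * hy t)); last first.
  by move: e {e0 e1 e2} => e; ring.
by rewrite -e1 -e2; ring.
Qed.

Lemma mob1 s : mob (1%:M : 'M[F]_2) s = s.
Proof.
case: s => [x|]; rewrite /= !mxE /= /hpoint ?oner_eq0 ?eqxx //.
by rewrite mul0r add0r oner_eq0 divr1 mul1r addr0.
Qed.

Lemma mobK g s : g \in unitmx -> mob (invmx g) (mob g s) = s.
Proof. by move=> ug; rewrite -mobM ?unitmx_inv // mulVmx // mob1. Qed.

Lemma mobVK g s : g \in unitmx -> mob g (mob (invmx g) s) = s.
Proof. by move=> ug; rewrite -mobM ?unitmx_inv // mulmxV // mob1. Qed.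

(** The linear form with zero s. Together with the determinant [cross], it writes u(z; a, b) as one
    quotient that covers the points at infinity ([udiffE]). *)
Definition pole_form s (z : F) : F := hy s * z - hx s.
Definition cross a b : F := hx b * hy a - hx a * hy b.

Lemma cross_neq0 a b : a <> b -> cross a b != 0.
Proof.
rewrite /cross; case: a => [x|]; case: b => [y|] //= ab.
- by rewrite !mulr1 subr_eq0; apply: contra_notN ab => /eqP ->.
- by rewrite mulr1 mulr0 subr0 oner_neq0.
- by rewrite mulr0 mul1r sub0r oppr_eq0 oner_neq0.
Qed.

(* The columns are representatives of b and a, so 0 is mapped to a and
   infinity to b. *)
Definition frame a b : 'M[F]_2 := mk2 (hx b) (hx a) (hy b) (hy a).

Lemma frame_unit a b : a <> b -> frame a b \in unitmx.
Proof. by move=> /cross_neq0; rewrite unitmx2 !mk2E. Qed.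

Lemma frame0 a b : mob (frame a b) (Some 0) = a.
Proof. by rewrite /= !mk2E !mulr0 !add0r hpointE. Qed.

Lemma frame_inf a b : mob (frame a b) None = b.
Proof. by rewrite /= !mk2E hpointE. Qed.

End ProjectiveLine.

(** * The action on Omega and the invariant weight of a pair of ends *)

Section OmegaAction.

Variables (Fq : finFieldType) (R : realType) (K : valued_ext Fq R).
Implicit Types (x y z : K) (g h : 'M[K]_2).

Local Notation abs := (vabs K).
Local Notation q := (#|Fq|%:R : R).
Local Notation T := (Defs.iota K (AtoF 'X)).
Local Notation Finf := (@Finf Fq R K).
Local Notation im := (@vabs_i Fq R K).
Local Notation Omega := (@Omega Fq R K).
Local Notation G2 := (@GL2Finf Fq R K).
Local Notation emb := (Defs.iota K).

Lemma G2_unit g : G2 g -> g \in unitmx. Proof. by case. Qed.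
Lemma G2_Finf g i j : G2 g -> Finf (g i j). Proof. by case. Qed.

Lemma det_neq0 g : G2 g -> \det g != 0.
Proof. by case; rewrite unitmxE unitfE. Qed.

Lemma Finf_det g : G2 g -> Finf (\det g).
Proof. by move=> [_ fg]; rewrite det2; apply: FinfB; apply: FinfM. Qed.

Lemma G2M g h : G2 g -> G2 h -> G2 (g *m h).
Proof.
move=> [ug fg] [uh fh]; split; first by rewrite unitmx_mul ug.
by move=> i j; rewrite mulmx2; apply: FinfD; apply: FinfM.
Qed.

Lemma G2Z c g : Finf c -> c != 0 -> G2 g -> G2 (c *: g).
Proof.
move=> fc c0 [ug fg]; split; last by move=> i j; rewrite mxE; exact: FinfM.
by rewrite -mul_scalar_mx unitmx_mul ug andbT unitmxE det_scalar unitfE expf_neq0.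
Qed.

Lemma G2_mk2 a b c d : Finf a -> Finf b -> Finf c -> Finf d -> a * d - b * c != 0 ->
  G2 (mk2 a b c d).
Proof.
move=> fa fb fc fd n0; split; first by rewrite unitmx2 !mk2E.
by apply: ord2P; apply: ord2P; rewrite !mk2E.
Qed.

Lemma G2V g : G2 g -> G2 (invmx g).
Proof.
move=> gg; have [ug fg] := gg; rewrite invmx2 //; apply: G2Z.
- exact/FinfV/Finf_det.
- by rewrite invr_eq0 det_neq0.
- apply: G2_mk2; rewrite ?fg //; try exact: FinfN.
  by move: ug; rewrite unitmx2 mulrNN (mulrC (g 1 1)).
Qed.

Lemma G2_1 : G2 1%:M.
Proof.
split; first exact: unitmx1.
by move=> i j; rewrite mxE; case: (i == j); [exact: Finf1|exact: Finf0].
Qed.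

Lemma G2_mxFK (g : 'M[ratfun Fq]_2) : g \in unitmx -> G2 (mxFK K g).
Proof.
by move=> ug; split; [rewrite map_unitmx | move=> i j; rewrite mxE; exact: Finf_iota].
Qed.

Lemma mxFKM (g h : 'M[ratfun Fq]_2) : mxFK K (g *m h) = mxFK K g *m mxFK K h.
Proof. exact: map_mxM. Qed.

Lemma mxFKV (g : 'M[ratfun Fq]_2) : mxFK K (invmx g) = invmx (mxFK K g).
Proof. exact: map_invmx. Qed.

Lemma mxAF_is_map (g : 'M[{poly Fq}]_2) :
  mxAF g = map_mx (@FracField.tofrac {poly Fq}) g.
Proof. by apply/matrixP => i j; rewrite !mxE. Qed.

Lemma mxAFM (g h : 'M[{poly Fq}]_2) : mxAF (g *m h) = mxAF g *m mxAF h.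
Proof. by rewrite !mxAF_is_map map_mxM. Qed.

Lemma mxAF_mulV (g : 'M[{poly Fq}]_2) : g \in unitmx -> mxAF g *m mxAF (invmx g) = 1%:M.
Proof. by move=> ug; rewrite -mxAFM mulmxV // mxAF_is_map map_mx1. Qed.

Lemma mxAF_unit (g : 'M[{poly Fq}]_2) : g \in unitmx -> mxAF g \in unitmx.
Proof.
rewrite !unitmxE unitfE mxAF_is_map det_map_mx => ug.
by rewrite tofrac_eq0; apply: contraTneq ug => ->; rewrite unitr0.
Qed.

Lemma mxAFV (g : 'M[{poly Fq}]_2) : g \in unitmx -> mxAF (invmx g) = invmx (mxAF g).
Proof. by move=> ug; rewrite (invmx_mul (mxAF_mulV ug)). Qed.

Lemma mxAKM (g h : 'M[{poly Fq}]_2) : mxAK K (g *m h) = mxAK K g *m mxAK K h.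
Proof. by rewrite /mxAK mxAFM mxFKM. Qed.

Lemma mxAF1 : mxAF (1%:M : 'M[{poly Fq}]_2) = 1%:M.
Proof. by rewrite mxAF_is_map map_mx1. Qed.

Lemma mxFK1 : mxFK K 1%:M = 1%:M.
Proof. exact: map_mx1. Qed.

Lemma mxAK1 : mxAK K (1%:M : 'M[{poly Fq}]_2) = 1%:M.
Proof. by rewrite /mxAK mxAF1 mxFK1. Qed.

Lemma mxAKV (g : 'M[{poly Fq}]_2) : g \in unitmx -> mxAK K (invmx g) = invmx (mxAK K g).
Proof. by move=> ug; rewrite /mxAK mxAFV // mxFKV. Qed.

Lemma mxAKE (g : 'M[{poly Fq}]_2) i j : mxAK K g i j = a2k K (g i j).
Proof. by rewrite !mxE. Qed.

Lemma G2_mxAK (g : 'M[{poly Fq}]_2) : g \in unitmx -> G2 (mxAK K g).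
Proof. by move=> ug; apply/G2_mxFK/mxAF_unit. Qed.

Lemma det_mxAK (g : 'M[{poly Fq}]_2) : \det (mxAK K g) = a2k K (\det g).
Proof. by rewrite /mxAK /mxFK det_map_mx mxAF_is_map det_map_mx. Qed.

Lemma abs_det_mxAK (g : 'M[{poly Fq}]_2) : g \in unitmx -> abs (\det (mxAK K g)) = 1.
Proof.
rewrite det_mxAK unitmxE poly_unitE => /andP[/eqP s _].
by rewrite abs_a2k ?s ?expr0 // -size_poly_eq0 s.
Qed.

Lemma lin_neq0 c d z : Omega z -> Finf c -> Finf d -> (c != 0) || (d != 0) ->
  c * z + d != 0.
Proof.
move=> oz fc fd; have [->|c0 _] := eqVneq c 0; first by rewrite mul0r add0r.
have -> : c * z + d = c * (z - (- d / c)) by field.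
rewrite mulf_neq0 // Omega_neq //; apply: FinfM; [exact: FinfN|exact: FinfV].
Qed.

Lemma jfac_neq0 g z : G2 g -> Omega z -> jfac g z != 0.
Proof.
move=> [ug fg] oz; apply: lin_neq0 => //; move: ug; rewrite unitmx2.
apply: contraR; rewrite negb_or !negbK => /andP[/eqP -> /eqP ->].
by rewrite !mulr0 subrr.
Qed.

Lemma abs_lin_ge a b z : Finf a -> Finf b -> abs a * im z <= abs (a * z + b).
Proof.
move=> fa fb; have [->|a0] := eqVneq a 0; first by rewrite abs0 mul0r.
have -> : a * z + b = a * (z - (- b / a)) by field.
rewrite absM ler_wpM2l // im_le //; apply: FinfM; [exact: FinfN|exact: FinfV].
Qed.

(** The determinant is a (c z + d) - c (a z + b), and |a| |z|_i <= |a z + b|, |c| |z|_i <= |c z +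
    d|. *)
Lemma im_lin a b c d z : Finf a -> Finf b -> Finf c -> Finf d ->
  abs (a * d - b * c) * im z <= abs (a * z + b) * abs (c * z + d).
Proof.
move=> fa fb fc fd.
have -> : a * d - b * c = a * (c * z + d) - c * (a * z + b) by ring.
apply: le_trans (_ : Num.max (abs (a * (c * z + d))) (abs (c * (a * z + b))) * im z <= _).
  by rewrite ler_wpM2r ?im_ge0 // absB_le_max.
rewrite !absM; set u := abs (a * z + b); set v := abs (c * z + d).
have h1 : abs a * im z <= u by exact: abs_lin_ge.
have h2 : abs c * im z <= v by exact: abs_lin_ge.
have u0 : 0 <= u by []. have v0 : 0 <= v by [].
case: (leP (abs a * v) (abs c * u)) => _.
  by rewrite mulrAC mulrC ler_wpM2l.
by rewrite mulrAC ler_wpM2r.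
Qed.

Lemma im_mobz_ge g z : G2 g -> Omega z ->
  abs (\det g) * im z / abs (jfac g z) ^+ 2 <= im (mobz g z).
Proof.
move=> gg oz; have [ug fg] := gg; have j0 := jfac_neq0 gg oz.
apply: im_ge => x fx.
have -> : mobz g z - x = ((g 0 0 - x * g 1 0) * z + (g 0 1 - x * g 1 1)) / jfac g z.
  by rewrite /mobz; rewrite /jfac in j0 *; field.
rewrite abs_div expr2 invfM mulrA ler_wpM2r ?invr_ge0 //.
rewrite ler_pdivrMr ?abs_gt0 //.
have -> : \det g = (g 0 0 - x * g 1 0) * g 1 1 - (g 0 1 - x * g 1 1) * g 1 0 by rewrite det2; ring.
by apply: im_lin => //; apply: FinfB => //; apply: FinfM.
Qed.

Lemma Omega_mobz g z : G2 g -> Omega z -> Omega (mobz g z).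
Proof.
move=> gg oz; apply/im_gt0; apply: lt_le_trans (im_mobz_ge gg oz).
rewrite divr_gt0 ?exprn_gt0 ?abs_gt0 ?jfac_neq0 // mulr_gt0 ?abs_gt0 ?det_neq0 //.
exact/im_gt0.
Qed.

Lemma mobzK g z : G2 g -> Omega z -> mobz (invmx g) (mobz g z) = z.
Proof. by move=> gg oz; rewrite -mobzM ?jfac_neq0 // mulVmx ?mobz1 // G2_unit. Qed.

Lemma mobzVK g z : G2 g -> Omega z -> mobz g (mobz (invmx g) z) = z.
Proof.
by move=> gg oz; rewrite -mobzM ?jfac_neq0 //; [rewrite mulmxV ?mobz1 // G2_unit|exact: G2V].
Qed.

(** The inequality [im_mobz_ge], applied to g at z and to the inverse of g at the image of z. *)
Lemma im_mobz g z : G2 g -> Omega z ->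
  im (mobz g z) = abs (\det g) * im z / abs (jfac g z) ^+ 2.
Proof.
move=> gg oz; apply: le_anti; rewrite im_mobz_ge // andbT.
have og := Omega_mobz gg oz; have := im_mobz_ge (G2V gg) og.
rewrite mobzK // det_inv absV.
have : jfac (invmx g) (mobz g z) * jfac g z = 1.
  by rewrite -jfacM ?jfac_neq0 // mulVmx ?jfac1 // G2_unit.
move=> /(congr1 abs); rewrite absM abs1 => e.
have j0 : 0 < abs (jfac g z) by rewrite abs_gt0 jfac_neq0.
have -> : abs (jfac (invmx g) (mobz g z)) = (abs (jfac g z))^-1.
  by rewrite -[RHS]mul1r -e mulfK // gt_eqF.
have d0 : 0 < abs (\det g) by rewrite abs_gt0 det_neq0.
rewrite exprVn invrK => H; rewrite ler_pdivlMr ?exprn_gt0 //.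
rewrite -[_ * _ ^+ 2](mulKf (lt0r_neq0 d0)) mulrCA ler_wpM2l //.
by rewrite mulrA.
Qed.

Definition P1Finf (s : P1 K) : Prop := if s is Some x then Finf x else True.

Lemma P1Finf_omap (s : P1 (ratfun Fq)) : P1Finf (omap emb s).
Proof. by case: s => //= x; exact: Finf_iota. Qed.

Lemma P1FinfP s : P1Finf s -> Finf (hx s) /\ Finf (hy s).
Proof. by case: s => [x|] /= fx; split => //; try exact: Finf1; exact: Finf0. Qed.

Lemma P1Finf_mob g s : G2 g -> P1Finf s -> P1Finf (mob g s).
Proof.
move=> [_ fg]; have H x y : Finf x -> Finf y -> P1Finf (hpoint x y).
  by move=> fx fy; rewrite /hpoint; case: eqP => //= _; apply/FinfM/FinfV.
by case: s => [x|] /= fx; apply: H => //; apply: FinfD => //; apply: FinfM.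
Qed.

Lemma pole_form_neq0 s z : Omega z -> P1Finf s -> pole_form s z != 0.
Proof.
move=> oz /P1FinfP[f1 f2]; rewrite /pole_form -mulrN1 mulrN1.
apply: lin_neq0 => //; first exact: FinfN.
by case: (s) => [x|] /=; rewrite ?oppr_eq0 oner_neq0 ?orbT.
Qed.

Lemma udiffE z a b : Omega z -> P1Finf a -> P1Finf b ->
  udiff id z a b = cross a b / (pole_form a z * pole_form b z).
Proof.
move=> oz /(pole_form_neq0 oz) + /(pole_form_neq0 oz); rewrite /udiff /cross /pole_form.
case: a => [a|]; case: b => [b|] /=; rewrite ?mul1r ?mul0r ?mulr1 ?mulr0 ?sub0r ?subr0 ?mulrN1 ?mulN1r => pa pb.
- by field; rewrite pa pb.
- by rewrite mul1r invrN.
- by rewrite invrN opprK.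
- by rewrite oppr0 mul0r.
Qed.

Lemma udiff_omap z (a b : P1 (ratfun Fq)) :
  udiff emb z a b = udiff id z (omap emb a) (omap emb b).
Proof. by case: a; case: b. Qed.

Lemma mob_omap (g : 'M[ratfun Fq]_2) s :
  omap emb (mob g s) = mob (mxFK K g) (omap emb s).
Proof.
have H (x y : ratfun Fq) : omap emb (hpoint x y) = hpoint (emb x) (emb y).
  by rewrite /hpoint fmorph_eq0; case: eqP => //= _; rewrite fmorph_div.
by case: s => [x|] /=; rewrite H !mxE ?rmorphD ?rmorphM.
Qed.

Lemma udiff_mob g z a b : G2 g -> Omega z -> P1Finf a -> P1Finf b ->
  udiff id (mobz g z) (mob g a) (mob g b) = udiff id z a b * (jfac g z ^+ 2 / \det g).
Proof.
move=> gg oz fa fb; have j0 := jfac_neq0 gg oz; have d0 := det_neq0 gg.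
have H s : P1Finf s -> exists2 e, e != 0 &
    pole_form (mob g s) (mobz g z) = \det g * pole_form s z / (e * jfac g z) /\
    (g 0 0 * hx s + g 0 1 * hy s = e * hx (mob g s) /\
     g 1 0 * hx s + g 1 1 * hy s = e * hy (mob g s)).
  move=> fs; have [e e0 [e1 e2]] := mob_hom s (G2_unit gg); exists e => //; split => //.
  apply: (mulIf (mulf_neq0 e0 j0)); rewrite divfK ?mulf_neq0 //.
  rewrite /pole_form.
  transitivity ((e * hy (mob g s)) * (mobz g z * jfac g z) - (e * hx (mob g s)) * jfac g z); first by ring.
  by rewrite -e1 -e2 /mobz -/(jfac g z) divfK // /jfac det2; ring.
rewrite !udiffE //; try by [exact: Omega_mobz | exact: P1Finf_mob].
have pa := pole_form_neq0 oz fa; have pb := pole_form_neq0 oz fb.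
have [e e0 [-> [e1 e2]]] := H a fa; have [e' e0' [-> [e1' e2']]] := H b fb.
have -> : cross (mob g a) (mob g b) = \det g * cross a b / (e * e').
  apply: (mulIf (mulf_neq0 e0 e0')); rewrite divfK ?mulf_neq0 // /cross.
  transitivity ((e' * hx (mob g b)) * (e * hy (mob g a)) - (e * hx (mob g a)) * (e' * hy (mob g b))); first by ring.
  by rewrite -e1 -e2 -e1' -e2' det2; ring.
by field; rewrite pa pb j0 d0 e0 e0'.
Qed.

(** The invariant size of u(z; a, b): by [weight_mob] it may be computed after moving a to 0 and b
    to infinity, where it is |z|_i / |z|. *)
Definition weight z a b : R := abs (udiff id z a b) * im z.

Lemma weight_ge0 z a b : 0 <= weight z a b.
Proof. by rewrite mulr_ge0 ?im_ge0. Qed.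

Lemma weightE z a b : Omega z -> P1Finf a -> P1Finf b ->
  weight z a b = abs (cross a b) * im z / (abs (pole_form a z) * abs (pole_form b z)).
Proof. by move=> oz fa fb; rewrite /weight udiffE // abs_div absM mulrAC. Qed.

Lemma cross_im z a b : P1Finf a -> P1Finf b ->
  abs (cross a b) * im z <= abs (pole_form a z) * abs (pole_form b z).
Proof.
move=> /P1FinfP[f1 f2] /P1FinfP[f3 f4]; rewrite /pole_form /cross absB.
have -> : hx a * hy b - hx b * hy a = hy a * - hx b - (- hx a) * hy b by ring.
by apply: im_lin => //; exact: FinfN.
Qed.

Lemma weight_le1 z a b : Omega z -> P1Finf a -> P1Finf b -> weight z a b <= 1.
Proof.
move=> oz fa fb; rewrite weightE // ler_pdivrMr ?mul1r ?cross_im //.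
by rewrite mulr_gt0 // abs_gt0 pole_form_neq0.
Qed.

Lemma weight_mob g z a b : G2 g -> Omega z -> P1Finf a -> P1Finf b ->
  weight (mobz g z) (mob g a) (mob g b) = weight z a b.
Proof.
move=> gg oz fa fb; rewrite /weight udiff_mob // im_mobz // absM abs_div absX.
have j0 : abs (jfac g z) != 0 by rewrite abs_eq0 jfac_neq0.
have d0 : abs (\det g) != 0 by rewrite abs_eq0 det_neq0.
by field; rewrite j0 d0.
Qed.

Lemma kprod_mob (g : 'M[ratfun Fq]_2) z (D : kdata (ratfun Fq)) :
  g \in unitmx -> Omega z ->
  kprod emb (mobz (mxFK K g) z) (kmap (mob g) D) =
  kprod emb z D * (jfac (mxFK K g) z ^+ 2 / \det (mxFK K g)) ^+ (\sum_i @kexp _ D i).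
Proof.
move=> ug oz; rewrite /kprod -prodrXr -big_split /=; apply: eq_bigr => i _.
rewrite !udiff_omap !mob_omap udiff_mob ?exprMn //; [exact: G2_mxFK|exact: P1Finf_omap..].
Qed.

Lemma abs_kprod z (D : kdata (ratfun Fq)) :
  abs (kprod emb z D) * im z ^+ (\sum_i @kexp _ D i) =
  \prod_i weight z (omap emb (ka i)) (omap emb (@kb _ D i)) ^+ @kexp _ D i.
Proof.
rewrite /kprod abs_prod -prodrXr -big_split /=; apply: eq_bigr => i _.
by rewrite absX udiff_omap exprMn.
Qed.

End OmegaAction.

(** * Unconditional sums and products *)

Section UnorderedLimits.

Variables (Fq : finFieldType) (R : realType) (K : valued_ext Fq R).
Hypothesis K_Cinf : is_Cinf K.
Variables (I : eqType) (S : set I).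
Implicit Types (B : seq I) (phi : seq I -> K) (g : I -> K).

Local Notation abs := (vabs K).
Local Notation q := (#|Fq|%:R : R).

Lemma unordered_limit_unique phi l l' :
  unordered_limit S phi l -> unordered_limit S phi l' -> l = l'.
Proof.
move=> h h'; apply/eqP; rewrite -subr_eq0 -abs_eq0; apply/negPn/negP => n0.
have e0 : 0 < abs (l - l') by rewrite lt_def n0 abs_ge0.
have [B0 [sB0 H]] := h _ e0; have [B1 [sB1 H']] := h' _ e0.
pose B := undup (B0 ++ B1).
have sB : [set` B] `<=` S.
  by move=> i /=; rewrite mem_undup mem_cat => /orP[/sB0|/sB1].
have sub0 : {subset B0 <= B} by move=> i iB; rewrite mem_undup mem_cat iB.
have sub1 : {subset B1 <= B} by move=> i iB; rewrite mem_undup mem_cat iB orbT.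
have : abs (l - l') < abs (l - l').
  have {1}-> : l - l' = (phi B - l') - (phi B - l) by ring.
  by apply: absB_lt; [apply: H' | apply: H]; rewrite ?undup_uniq.
by rewrite ltxx.
Qed.

(** Completeness is available for sequences, so the net is sampled along an increasing sequence
    [C n] of finite sets, the unions of the sets chosen for the errors q^-m with m <= n. *)
Lemma unordered_cauchy phi :
  (forall e : R, 0 < e -> exists B0, [/\ uniq B0, [set` B0] `<=` S &
    forall B, uniq B -> [set` B] `<=` S -> {subset B0 <= B} ->
      abs (phi B - phi B0) < e]) ->
  exists l, unordered_limit S phi l.
Proof.
move=> H.
have /choice[B_ HB] n : exists B0, [/\ uniq B0, [set` B0] `<=` S &
    forall B, uniq B -> [set` B] `<=` S -> {subset B0 <= B} ->
      abs (phi B - phi B0) < q ^- n] by apply: H; rewrite invr_gt0 exprn_gt0.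
pose C n := undup (flatten [seq B_ i | i <- iota 0 n.+1]).
have CP n i : (i \in C n) = has (fun m => i \in B_ m) (iota 0 n.+1).
  rewrite mem_undup; apply/flatten_mapP/hasP => -[m m1 m2]; by exists m.
have sC n : [set` C n] `<=` S.
  by move=> i /=; rewrite CP => /hasP[m _]; have [_ sB _] := HB m; exact: sB.
have subC m n : (m <= n)%N -> {subset B_ m <= C n}.
  by move=> mn i im; rewrite CP; apply/hasP; exists m => //; rewrite mem_iota /=; lia.
have near m n : (m <= n)%N -> abs (phi (C n) - phi (B_ m)) < q ^- m.
  by move=> mn; have [_ _] := HB m; apply; rewrite ?undup_uniq //; exact: subC.
have cau : cauchy_sequence (fun n => phi (C n)).
  move=> e e0; have [N Ne] := @q_small Fq R e e0; exists N => m n Nm Nn.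
  have -> : phi (C m) - phi (C n) = (phi (C m) - phi (B_ N)) - (phi (C n) - phi (B_ N)) by ring.
  by apply: lt_trans Ne; apply: absB_lt; exact: near.
have [l lP] := Cinf_complete K_Cinf cau; exists l => e e0.
have [N Ne] := @q_small Fq R e e0; have [M HM] := lP e e0.
have [_ sN nearN] := HB N; exists (B_ N); split => // B uB sB subB.
have -> : phi B - l = (phi B - phi (B_ N)) - (phi (C (maxn M N)) - phi (B_ N))
   + (phi (C (maxn M N)) - l) by ring.
apply: absD_lt; last by apply: HM; rewrite leq_maxl.
by apply: lt_trans Ne; apply: absB_lt; [exact: nearN | apply: near; rewrite leq_maxr].
Qed.

(** Terms tending to 0 along the finite subsets; over a complete nonarchimedean field this gives
    unconditional convergence ([usumP]). *)
Definition summable g := forall e : R, 0 < e -> exists B0 : seq I,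
  [/\ uniq B0, [set` B0] `<=` S & forall i, S i -> i \notin B0 -> abs (g i) < e].

Lemma perm_split B B0 : uniq B -> uniq B0 -> {subset B0 <= B} ->
  perm_eq B (B0 ++ [seq i <- B | i \notin B0]).
Proof.
move=> uB uB0 sB; apply: uniq_perm => //.
  rewrite cat_uniq uB0 filter_uniq // andbT; apply/hasPn => i.
  by rewrite mem_filter => /andP[].
move=> i; rewrite mem_cat mem_filter.
by have [/sB ->|//] := boolP (i \in B0).
Qed.

Lemma abs_sum_diff g B B0 e : 0 < e -> uniq B -> uniq B0 -> [set` B] `<=` S ->
  {subset B0 <= B} -> (forall i, S i -> i \notin B0 -> abs (g i) < e) ->
  abs (\sum_(i <- B) g i - \sum_(i <- B0) g i) < e.
Proof.
move=> e0 uB uB0 sB subB ge; rewrite (perm_big _ (perm_split uB uB0 subB)) big_cat /=.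
rewrite addrAC subrr add0r; apply: abs_sum_lt_seq => // i.
by rewrite mem_filter => /andP[i0 iB]; apply: ge => //; exact: sB.
Qed.

Lemma usumP g : summable g ->
  unordered_limit S (fun B => \sum_(i <- B) g i) (usum S g).
Proof.
move=> sg; have [|l lP] := @unordered_cauchy (fun B => \sum_(i <- B) g i).
  move=> e e0; have [B0 [uB0 sB0 H]] := sg e e0; exists B0; split => // B uB sB subB.
  exact: abs_sum_diff.
exact: (@xgetPex _ 0 [set l | unordered_limit S (fun B => \sum_(i <- B) g i) l] (ex_intro _ l lP)).
Qed.

Lemma usum_unique g l : unordered_limit S (fun B => \sum_(i <- B) g i) l -> usum S g = l.
Proof.
move=> h; apply: (@unordered_limit_unique (fun B => \sum_(i <- B) g i) _ _ _ h).
exact: (@xgetPex _ 0 [set l | unordered_limit S (fun B => \sum_(i <- B) g i) l] (ex_intro _ l h)).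
Qed.

Lemma usum_near g B0 e : summable g -> 0 < e -> uniq B0 -> [set` B0] `<=` S ->
  (forall i, S i -> i \notin B0 -> abs (g i) < e) ->
  abs (usum S g - \sum_(i <- B0) g i) < e.
Proof.
move=> sg e0 uB0 sB0 ge; have [B1 [sB1 H]] := usumP sg e0.
pose B := undup (B0 ++ B1).
have sB : [set` B] `<=` S.
  by move=> i /=; rewrite mem_undup mem_cat => /orP[/sB0|/sB1].
have sub0 : {subset B0 <= B} by move=> i iB; rewrite mem_undup mem_cat iB.
have sub1 : {subset B1 <= B} by move=> i iB; rewrite mem_undup mem_cat iB orbT.
set s := \sum_(i <- B0) g i; pose s' := \sum_(i <- B) g i.
have -> : usum S g - s = (s' - s) - (s' - usum S g) by ring.
apply: absB_lt; last by apply: H; rewrite ?undup_uniq.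
by apply: abs_sum_diff; rewrite ?undup_uniq.
Qed.

Lemma usum_scale g c : summable g -> usum S (fun i => c * g i) = c * usum S g.
Proof.
move=> sg; apply: usum_unique => e e0.
have [c0|c0] := eqVneq c 0.
  exists [::]; split => // B _ _ _; rewrite c0 mul0r subr0 big1 ?abs0 // => i _.
  by rewrite mul0r.
have c0' : 0 < abs c by rewrite abs_gt0.
have [|B0 [sB0 H]] := usumP sg (_ : 0 < e / abs c); first by rewrite divr_gt0.
exists B0; split => // B uB sB subB.
by rewrite -big_distrr /= -mulrBr absM mulrC -ltr_pdivlMr // H.
Qed.

Lemma usum_reindex g f f' : cancel f f' -> cancel f' f -> (forall i, S i <-> S (f i)) ->
  summable g -> usum S (fun i => g (f i)) = usum S g.
Proof.
move=> fK f'K Sf sg; apply: usum_unique => e e0; have [B0 [sB0 H]] := usumP sg e0.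
exists [seq f' i | i <- B0]; split.
  by move=> _ /= /mapP[i /sB0 si ->]; apply/Sf; rewrite f'K.
move=> B uB sB subB; have := H [seq f i | i <- B]; rewrite big_map; apply.
- by rewrite map_inj_uniq //; exact: can_inj fK.
- by move=> _ /= /mapP[i /sB si ->]; exact: (Sf i).1.
- move=> i iB; rewrite -(f'K i); apply: map_f; apply: subB; exact: map_f.
Qed.

Lemma usum_eq g g' : summable g -> (forall i, S i -> g i = g' i) -> usum S g = usum S g'.
Proof.
move=> sg e; apply/esym/usum_unique => d d0; have [B0 [sB0 H]] := usumP sg d0.
exists B0; split=> // B uB sB subB.
rewrite (_ : \sum_(i <- B) g' i = \sum_(i <- B) g i); first exact: H.
by rewrite big_seq [RHS]big_seq; apply: eq_bigr => i /sB /e.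
Qed.

End UnorderedLimits.

(** * Products over a discrete set of periods *)

Section InfiniteProduct.

Variables (Fq : finFieldType) (R : realType) (K : valued_ext Fq R).
Hypothesis K_Cinf : is_Cinf K.
Local Notation abs := (vabs K).
Local Notation q := (#|Fq|%:R : R).
Local Notation emb := (Defs.iota K).
Local Notation im := (@vabs_i Fq R K).
Implicit Types (z : K) (b : ratfun Fq).

Lemma abs_prod_near1 (I : eqType) (r : seq I) (x : I -> K) e : 0 <= e <= 1 ->
  (forall i, i \in r -> abs (x i) <= e) -> abs (\prod_(i <- r) (1 - x i) - 1) <= e.
Proof.
move=> /andP[e0 e1]; elim: r => [|i r IH] xe; first by rewrite big_nil subrr abs0.
rewrite big_cons; set p := \prod_(_ <- _) _ in IH *.
have IH' : abs (p - 1) <= e by apply: IH => j jr; apply: xe; rewrite inE jr orbT.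
have xi : abs (x i) <= e by apply: xe; rewrite mem_head.
have -> : (1 - x i) * p - 1 = (p - 1) - x i * ((p - 1) + 1) by ring.
apply: absB_le => //; rewrite absM -[e]mulr1 ler_pM //.
by apply: absD_le; rewrite ?abs1 // (le_trans IH').
Qed.

Variable S : set (ratfun Fq).
Hypothesis S0 : ~ S 0.
Hypothesis S_discrete : forall r : R, exists B0 : seq (ratfun Fq),
  [/\ uniq B0, [set` B0] `<=` S & forall b, S b -> abs (emb b) <= r -> b \in B0].

Let fac z b : K := 1 - z / emb b.

Lemma S_neq0 b : S b -> emb b != 0.
Proof. by move=> sb; rewrite fmorph_eq0; apply: contra_notN S0 => /eqP <-. Qed.

(** Factors with |b| > |z| have absolute value 1, so all partial products containing [B1] have the
    same absolute value C. Beyond radius r, further factors change such a product by at most C |z| /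
    r. *)
Lemma prod_limit z :
  unordered_limit S (fun B => \prod_(b <- B) fac z b) (uprod S (fac z)).
Proof.
have [|l lP] := @unordered_cauchy _ _ _ K_Cinf _ S (fun B => \prod_(b <- B) fac z b); last first.
  exact: (@xgetPex _ 0 [set l | unordered_limit S (fun B => \prod_(b <- B) fac z b) l] (ex_intro _ l lP)).
move=> e e0; have [B1 [uB1 sB1 H1]] := S_discrete (abs z).
pose C := abs (\prod_(b <- B1) fac z b).
have far r b : S b -> ~ (abs (emb b) <= r) -> 0 < r -> abs (z / emb b) <= abs z / r.
  move=> sb /negP; rewrite -ltNge abs_div => rb r0.
  by rewrite ler_wpM2l // lef_pV2 ?posrE ?(ltW rb) // (lt_trans r0).
have eqC B : uniq B -> [set` B] `<=` S -> {subset B1 <= B} ->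
    abs (\prod_(b <- B) fac z b) = C.
  move=> uB sB subB; rewrite (perm_big _ (perm_split uB uB1 subB)) big_cat absM /=.
  rewrite -[RHS]mulr1; congr (_ * _); rewrite abs_prod big_seq big1 // => b.
  rewrite mem_filter => /andP[b1 /sB sb]; rewrite /fac absBl ?abs1 //.
  rewrite abs_div ltr_pdivrMr ?abs_gt0 ?S_neq0 // mul1r ltNge.
  by apply: contraNN b1; exact: H1.
(* The first bound keeps |z| / r at most 1, the second makes C |z| / r smaller than e. *)
pose r := Num.max (abs z + 1) ((abs z + 1) * (C + 1) / e).
have r1 : abs z + 1 <= r by rewrite /r le_max lexx.
have z1 : 0 < abs z + 1 by rewrite ltr_wpDl.
have r0 : 0 < r by apply: lt_le_trans r1.
have C0 : 0 <= C by [].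
have rC : abs z / r * C < e.
  rewrite mulrAC ltr_pdivrMr //; apply: lt_le_trans (_ : e * ((abs z + 1) * (C + 1) / e) <= _).
    rewrite mulrCA mulfV ?gt_eqF // mulr1; have := abs_ge0 z; nra.
  by rewrite ler_pM2l // /r le_max lexx orbT.
have [B0 [uB0 sB0 H0]] := S_discrete r.
have sub1 : {subset B1 <= undup (B1 ++ B0)}.
  by move=> b bB; rewrite mem_undup mem_cat bB.
exists (undup (B1 ++ B0)); split; rewrite ?undup_uniq //.
  by move=> b /=; rewrite mem_undup mem_cat => /orP[/sB1|/sB0].
set B' := undup _ in sub1 * => B uB sB subB.
have uB' : uniq B' by rewrite undup_uniq.
rewrite (perm_big _ (perm_split uB uB' subB)) big_cat /=.
set p := \prod_(_ <- B') _; set p' := \prod_(_ <- _) _.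
have -> : p * p' - p = p * (p' - 1) by ring.
have -> : abs (p * (p' - 1)) = C * abs (p' - 1).
  by rewrite absM eqC // => b /subB /sB.
rewrite mulrC; apply: le_lt_trans rC; rewrite ler_wpM2r //.
apply: abs_prod_near1 => [|b].
  by rewrite divr_ge0 ?(ltW r0) //= ler_pdivrMr // mul1r (le_trans _ r1) // lerDl.
rewrite mem_filter => /andP[bB /sB sb]; apply: far => // br.
by move/negP: bB; apply; rewrite mem_undup mem_cat (H0 b) ?orbT.
Qed.

Lemma abs_fac z b : abs z = im z -> S b -> abs (fac z b) = Num.max 1 (abs z / abs (emb b)).
Proof.
move=> ez sb; have b0 : 0 < abs (emb b) by rewrite abs_gt0 S_neq0.
have -> : fac z b = - ((z - emb b) / emb b) by rewrite /fac; field; rewrite S_neq0.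
rewrite absN abs_div abs_sub_im //; last exact: Finf_iota.
by rewrite maxr_pMl ?invr_ge0 // divff ?gt_eqF // maxC.
Qed.

(** When |z| = |z|_i, every factor has absolute value max(1, |z| / |b|), which is at least 1;
    leaving out factors can only decrease the product. *)
Lemma prod_lower z (D : seq (ratfun Fq)) : abs z = im z -> uniq D -> [set` D] `<=` S ->
  \prod_(b <- D) Num.max 1 (abs z / abs (emb b)) <= abs (uprod S (fac z)).
Proof.
move=> ez uD sD; have [B0 [sB0 H]] := prod_limit z ltr01.
pose B := undup (D ++ B0).
have sB : [set` B] `<=` S.
  by move=> i /=; rewrite mem_undup mem_cat => /orP[/sD|/sB0].
have sub0 : {subset D <= B} by move=> i iB; rewrite mem_undup mem_cat iB.
have sub1 : {subset B0 <= B} by move=> i iB; rewrite mem_undup mem_cat iB orbT.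
have ge1 (r : seq (ratfun Fq)) : 1 <= \prod_(b <- r) Num.max 1 (abs z / abs (emb b)).
  elim: r => [|b r IH]; rewrite ?big_nil // big_cons; apply: (le_trans IH).
  by rewrite ler_peMl ?le_max ?lexx // (le_trans ler01 IH).
have eB : abs (\prod_(b <- B) fac z b) = \prod_(b <- B) Num.max 1 (abs z / abs (emb b)).
  by rewrite abs_prod big_seq [RHS]big_seq; apply: eq_bigr => b /sB; exact: abs_fac.
have := H B (undup_uniq _) sB sub1; rewrite absB => /(abs_near_le) /(_ _).
rewrite eB => /(_ (ge1 _)) ->.
rewrite (perm_big _ (perm_split (undup_uniq _) uD sub0)) big_cat /=.
by rewrite ler_pMr ?ge1 // (lt_le_trans ltr01) ?ge1.
Qed.

End InfiniteProduct.

(** * The principal congruence subgroup *)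

Section CongruenceSubgroup.

Variables (Fq : finFieldType) (n : {poly Fq}).
Implicit Types (g h k : 'M[{poly Fq}]_2).
Local Notation Gamma := (@Gamma Fq n).

Lemma GammaP g : Gamma g <-> g \in unitmx /\ exists h, g = 1%:M + n *: h.
Proof.
split=> -[ug H]; split => //.
  have /choice[f fP] (ij : 'I_2 * 'I_2) : exists a, g ij.1 ij.2 - (1%:M : 'M[{poly Fq}]_2) ij.1 ij.2 = n * a.
    by have /dvdpP[a ->] := H ij.1 ij.2; exists a; rewrite mulrC.
  exists (\matrix_(i, j) f (i, j)); apply/matrixP => i j.
  by have := fP (i, j); rewrite !mxE /= => <-; rewrite addrC subrK.
by case: H => h -> i j; rewrite !mxE addrAC subrr add0r dvdp_mulr.
Qed.

Lemma Gamma_unit g : Gamma g -> g \in unitmx. Proof. by case. Qed.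

Lemma Gamma1 : Gamma 1%:M.
Proof. by apply/GammaP; split; [exact: unitmx1 | exists 0; rewrite scaler0 addr0]. Qed.

Lemma GammaM g h : Gamma g -> Gamma h -> Gamma (g *m h).
Proof.
move=> /GammaP[ug [g' eg]] /GammaP[uh [h' eh]]; apply/GammaP.
rewrite unitmx_mul ug uh; split=> //; exists (g' + h' + n *: (g' *m h')).
rewrite eg eh mulmxDl mul1mx mulmxDr mulmx1 -scalemxAl -scalemxAr.
by rewrite !scalerDr -!addrA; congr (_ + _); rewrite addrCA addrA addrC addrA.
Qed.

Lemma Gamma_conj k g : k \in unitmx -> Gamma g -> Gamma (invmx k *m g *m k).
Proof.
move=> uk /GammaP[ug [g' eg]]; apply/GammaP; rewrite !unitmx_mul unitmx_inv uk ug.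
split=> //; exists (invmx k *m g' *m k).
by rewrite eg mulmxDr mulmx1 mulmxDl mulVmx // -scalemxAr -scalemxAl.
Qed.

Lemma Gamma_conjV k g : k \in unitmx -> Gamma g -> Gamma (k *m g *m invmx k).
Proof. by move=> uk; rewrite -{1}(invmxK k); apply: Gamma_conj; rewrite unitmx_inv. Qed.

Lemma GammaV g : Gamma g -> Gamma (invmx g).
Proof.
move=> /GammaP[ug [g' eg]]; apply/GammaP; rewrite unitmx_inv; split=> //.
exists (- (invmx g *m g')); apply: (can_inj (mulKmx ug)).
by rewrite mulmxV // mulmxDr mulmx1 -scalemxAr mulmxN mulKVmx // scalerN eg addrK.
Qed.

Lemma Gamma_cong g h : g \in unitmx -> h \in unitmx ->
  (forall i j, g i j %% n = h i j %% n) -> Gamma (g *m invmx h).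
Proof.
move=> ug uh H; apply/GammaP; rewrite unitmx_mul unitmx_inv ug uh; split=> //.
pose k := \matrix_(i, j) (g i j %/ n - h i j %/ n) : 'M[{poly Fq}]_2.
have -> : g = h + n *: k.
  apply/matrixP => i j; rewrite !mxE mulrBr ![n * _]mulrC.
  rewrite {1}(divp_eq (g i j) n) {1}(divp_eq (h i j) n) H; ring.
by exists (k *m invmx h); rewrite mulmxDl mulmxV // scalemxAl.
Qed.

Hypothesis n_size : (1 < size n)%N.

(** The determinant is a constant congruent to 1 modulo n, and n is not constant. *)
Lemma Gamma_det g : Gamma g -> \det g = 1.
Proof.
move=> /GammaP[+ [h eg]]; rewrite unitmxE poly_unitE => /andP[/eqP s1 _].
have [c ec] : exists c, \det g = c%:P by exists (\det g)`_0; apply: size1_polyC; rewrite s1.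
have : n %| \det g - 1.
  have -> : \det g - 1 = n * (h 0 0 + h 1 1 + n * \det h).
    rewrite !(expand_det_row _ 0) !sum2 /cofactor !det_mx11 !mxE /= !expr0 !expr1.
    rewrite eg !mxE /= (_ : lift 0 0 = 1 :> 'I_2); last exact: val_inj.
    rewrite (_ : lift 1 0 = 0 :> 'I_2); last exact: val_inj.
    by rewrite !mulr1n !mulr0n; ring.
  exact: dvdp_mulr.
rewrite ec -polyC1 -polyCB => /dvdpP[a ea].
have [c0|c0] := eqVneq (c - 1) 0; first by rewrite (subr0_eq c0).
have : size ((c - 1)%:P) = 1%N by rewrite size_polyC c0.
rewrite ea; have [->|a0] := eqVneq a 0; first by rewrite mul0r size_poly0.
rewrite size_mul // -?size_poly_gt0 1?ltnW // => /eqP.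
by move: a0 n_size; rewrite -size_poly_gt0; move: (size a) (size n) => x y; lia.
Qed.

Lemma Gamma_translation a : Gamma (\matrix_(i < 2, j < 2) if i == j then 1 else if i == 0 then n * a else 0).
Proof.
apply/GammaP; split.
  rewrite unitmxE (expand_det_row _ 0) !sum2 /cofactor !det_mx11 !mxE /= !expr0 !expr1.
  by rewrite !mulr1 !mulr0 addr0 unitr1.
exists (\matrix_(i, j) if i == j then 0 else if i == 0 then a else 0).
apply/matrixP => i j; rewrite !mxE; case: (i == j); rewrite ?mulr0 ?addr0 ?add0r //.
by case: (i == 0); rewrite ?mulr0.
Qed.

End CongruenceSubgroup.

(** * Finiteness of bounded sets of polynomial matrices and translations *)

Section Discreteness.

Variables (Fq : finFieldType) (R : realType) (K : valued_ext Fq R).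
Local Notation abs := (vabs K).
Local Notation q := (#|Fq|%:R : R).
Local Notation emb := (Defs.iota K).
Local Notation a2k := (a2k K).

Definition small_polys (m : nat) : seq {poly Fq} := [seq rVpoly r | r <- enum 'rV[Fq]_m].

Lemma mem_small_polys m p : (p \in small_polys m) = (size p <= m)%N.
Proof.
apply/mapP/idP => [[r _ ->]|s]; first exact: size_poly.
by exists (poly_rV p); rewrite ?mem_enum // poly_rV_K.
Qed.

Lemma small_polys_uniq m : uniq (small_polys m).
Proof. by rewrite map_inj_uniq ?enum_uniq //; exact: can_inj (@rVpolyK _ _). Qed.

Lemma size_small_polys m : size (small_polys m) = (#|Fq| ^ m)%N.
Proof. by rewrite size_map -cardE card_mx mul1n. Qed.

Lemma abs_a2k_size p m : abs (a2k p) <= q ^+ m -> (size p <= m.+1)%N.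
Proof.
have [->|p0] := eqVneq p 0; first by rewrite size_poly0.
by rewrite abs_a2k // ler_eXn2l //; lia.
Qed.

Lemma bounded_matrices (r : R) : exists B : seq 'M[{poly Fq}]_2,
  forall g : 'M[{poly Fq}]_2, (forall i j, abs (a2k (g i j)) <= r) -> g \in B.
Proof.
have [m rm] := @q_unbounded Fq R r; pose s := small_polys m.+1.
pose mx (f : {ffun 'I_2 * 'I_2 -> 'I_(size s)}) : 'M[{poly Fq}]_2 :=
  \matrix_(i, j) nth 0 s (f (i, j)).
exists [seq mx f | f <- enum {ffun 'I_2 * 'I_2 -> 'I_(size s)}].
move=> g gr; have gs i j : g i j \in s.
  by rewrite mem_small_polys abs_a2k_size // (le_trans (gr i j)) // ltW.
have gi i j : (index (g i j) s < size s)%N by rewrite index_mem.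
apply/mapP; exists [ffun ij => Ordinal (gi ij.1 ij.2)]; first by rewrite mem_enum.
by apply/matrixP => i j; rewrite !mxE ffunE /= nth_index.
Qed.

Lemma common_denominator (I : finType) (f : I -> ratfun Fq) : exists D : {poly Fq},
  D != 0 /\ forall i, exists a, f i * AtoF D = AtoF a.
Proof.
have /choice[d dP] i : exists d : {poly Fq}, d != 0 /\ exists a, f i * AtoF d = AtoF a.
  have [p [r [r0 ->]]] := fracE (f i); exists r; split=> //; exists p.
  by rewrite divfK // AtoF_eq0.
exists (\prod_i d i); split; first by apply/prodf_neq0 => i _; have [] := dP i.
move=> i; have [_ [a ea]] := dP i; exists (a * \prod_(j | j != i) d j).
by rewrite (bigD1 i) //= /AtoF !rmorphM /= -!/(AtoF _) mulrA ea.
Qed.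

(** The denominators of [nu] and of its inverse give a common denominator of all translations, so
    that bounded translations come from polynomials of bounded degree. *)
Lemma translations_discrete (n : {poly Fq}) (nu : 'M[ratfun Fq]_2) (r : R) :
  exists B0 : seq (ratfun Fq), [/\ uniq B0, [set` B0] `<=` translations n nu `\ 0 &
    forall b, (translations n nu `\ 0) b -> abs (emb b) <= r -> b \in B0].
Proof.
have [D [D0 HD]] := common_denominator (fun ij : 'I_2 * 'I_2 => nu ij.1 ij.2).
have [D' [D0' HD']] := common_denominator (fun ij : 'I_2 * 'I_2 => invmx nu ij.1 ij.2).
have DD0 : AtoF (D' * D) != 0 by rewrite AtoF_eq0 mulf_neq0.
have [m rm] := @q_unbounded Fq R (r * abs (a2k (D' * D))).
pose S := translations n nu `\ 0.
exists (undup [seq b <- [seq AtoF p / AtoF (D' * D) | p <- small_polys m.+1] | `[< S b >]]).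
split; first exact: undup_uniq.
  by move=> b /=; rewrite mem_undup mem_filter => /andP[/asboolP].
move=> b Sb br; rewrite mem_undup mem_filter; apply/andP; split; first exact/asboolP.
suff [p ep] : exists p, b * AtoF (D' * D) = AtoF p.
  apply/mapP; exists p; last by rewrite -ep mulfK.
  rewrite mem_small_polys abs_a2k_size //.
  have -> : a2k p = emb b * a2k (D' * D) by rewrite /a2k -ep rmorphM.
  rewrite absM (le_trans _ (ltW rm)) // ler_wpM2r //.
case: Sb => [[g _ /matrixP/(_ 0 1)]]; rewrite !mulmx2 mxE /= => <- _.
have [a ea] := HD (0, 1); have [b' eb] := HD (1, 1).
have [c ec] := HD' (0, 0); have [e ee] := HD' (0, 1).
rewrite /= in ea eb ec ee.
exists ((c * g 0 0 + e * g 1 0) * a + (c * g 0 1 + e * g 1 1) * b').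
have AD x y : AtoF (x + y) = AtoF x + AtoF y by rewrite /AtoF rmorphD.
have AM x y : AtoF (x * y) = AtoF x * AtoF y by rewrite /AtoF rmorphM.
by rewrite !AD !AM !AD !AM -ea -eb -ec -ee !mxE; ring.
Qed.

End Discreteness.

(** * The parameter t and expansions at the cusps *)

Section TExpansion.

Variables (Fq : finFieldType) (R : realType) (K : valued_ext Fq R).
Hypothesis K_Cinf : is_Cinf K.
Local Notation abs := (vabs K).
Local Notation q := (#|Fq|%:R : R).
Local Notation T := (Defs.iota K (AtoF 'X)).
Local Notation emb := (Defs.iota K).
Local Notation im := (@vabs_i Fq R K).
Local Notation Omega := (@Omega Fq R K).
Implicit Types (z : K) (f : K -> K) (n : {poly Fq}) (nu : 'M[ratfun Fq]_2).

(** A point over the vertex v_m, in general position with respect to l. The centres c T^m are added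
    to the points to be avoided, so that [im_exprz] applies. *)
Lemma exists_vertex_pt (m : int) (l : seq K) : exists z, [/\ abs z = q ^ m, im z = q ^ m &
  forall b, b \in l -> abs (z - b) = Num.max (q ^ m) (abs b)].
Proof.
have [|z []] := @generic_pt _ _ K (T ^ m) 0 ([seq c2k K c * T ^ m | c <- enum Fq] ++ l).
  by rewrite expfz_neq0 // T_neq0.
rewrite subr0 abs_Texp => az H; exists z; split=> // [|b bl].
  apply: im_exprz => // c; rewrite H; first by rewrite le_max lexx.
  by rewrite mem_cat; apply/orP; left; apply/mapP; exists c; rewrite ?mem_enum.
by rewrite H ?subr0 // mem_cat bl orbT.
Qed.

Lemma exists_high_pt (r : R) : exists z, [/\ abs z = im z, r < abs z & 0 < abs z].
Proof.
have [m rm] := @q_exprz_unbounded Fq R r; have [z [z1 z2 _]] := exists_vertex_pt m [::].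
by exists z; rewrite z1 z2 exprz_gt0.
Qed.

(** An upper bound for |t| is a lower bound for the exponential function, so any finite set of
    periods may be kept in the product. *)
Lemma t_param_bound n nu z (D : seq (ratfun Fq)) : abs z = im z -> 0 < abs z ->
  uniq D -> [set` D] `<=` translations n nu `\ 0 ->
  0 < abs (t_param n nu z) /\
  abs (t_param n nu z) * (abs z * \prod_(b <- D) Num.max 1 (abs z / abs (emb b))) <= 1.
Proof.
move=> ez z0 uD sD; rewrite /t_param absV /exp_translations absM.
have S0 : ~ (translations n nu `\ 0) 0 by move=> [_]; apply.
have disc := @translations_discrete Fq R K n nu.
have := prod_lower K_Cinf S0 disc ez uD sD; set u := abs (uprod _ _); set p := \prod_(_ <- _) _.
have p0 : 0 < p.
  by apply: prodr_gt0 => b _; rewrite lt_max ltr01.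
move=> pu; have u0 : 0 < u by apply: lt_le_trans pu.
rewrite invr_gt0 mulr_gt0 //; split=> //.
by rewrite ler_pdivrMl ?mulr_gt0 // mulr1 ler_wpM2l.
Qed.

Lemma t_param_le n nu z : abs z = im z -> 0 < abs z ->
  0 < abs (t_param n nu z) /\ abs (t_param n nu z) * abs z <= 1.
Proof.
move=> ez z0; have [|H1 H2] := @t_param_bound n nu z [::] ez z0 isT; first by move=> b.
by rewrite big_nil mulr1 in H2.
Qed.

Lemma converges_le (u : nat -> K) l c r : converges u l ->
  (exists N, forall i, (N <= i)%N -> abs (u i - c) <= r) -> abs (l - c) <= r.
Proof.
move=> ul [N H]; rewrite leNgt; apply/negP => lt_r.
have [M HM] := ul (abs (l - c)) (le_lt_trans (le_trans (abs_ge0 _) (H _ (leqnn _))) lt_r).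
have h1 := HM _ (leq_maxl M N); have h2 := H _ (leq_maxr M N).
have : abs (l - c) < abs (l - c).
  have {1}-> : l - c = (u (maxn M N) - c) - (u (maxn M N) - l) by ring.
  by apply: absB_lt => //; apply: le_lt_trans h2 lt_r.
by rewrite ltxx.
Qed.

Lemma converges_bounded (u : nat -> K) l : converges u l ->
  exists2 C, 0 <= C & forall i, abs (u i) <= C.
Proof.
move=> /(_ 1 ltr01)[N H]; pose C := Num.max (1 + abs l) (\big[Num.max/0]_(i < N) abs (u i)).
have C1 : 1 + abs l <= C by rewrite /C le_max lexx.
have al := abs_ge0 l.
exists C => [|i]; first lra.
have [Ni|iN] := leqP N i; last first.
  rewrite /C le_max; apply/orP; right.
  by have := le_bigmax_cond 0 (fun i : 'I_N => abs (u i)) (isT : xpredT (Ordinal iN)).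
apply: le_trans C1; have -> : u i = (u i - l) + l by ring.
by apply: absD_le; [have := H _ Ni; lra | lra].
Qed.

(* Only points with |z|_i = |z| are used near the cusps. *)
Lemma t_expansion_bound n w m f nu c : has_t_expansion n w m f nu c ->
  exists C r, [/\ 0 <= C, 0 < r & forall z, abs z = im z -> r < abs z ->
    abs (jfac (mxFK K nu) z ^- w * f (mobz (mxFK K nu) z) - c m * t_param n nu z ^+ m)
      <= C * abs (t_param n nu z) ^+ m.+1].
Proof.
move=> [r H]; have [z0 [e0 rz0 z0gt]] := exists_high_pt r.
have [t0 t0z0] := t_param_le n nu e0 z0gt; set t0' := abs (t_param _ _ z0) in t0 t0z0.
(* The terms of a convergent series are bounded: at the single point z0 this bounds |c_i| by C /
   |t(z0)|^i. *)
have : exists2 C, 0 <= C & forall i, (m <= i)%N -> abs (c i) * t0' ^+ i <= C.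
  have oz0 : Omega z0 by apply/im_gt0; rewrite -e0.
  have [|C C0 HC] := converges_bounded (H z0 oz0 _); first by rewrite -e0.
  exists C => // i mi.
  have : abs (c i * t_param n nu z0 ^+ i) <= C.
    have -> : c i * t_param n nu z0 ^+ i = \sum_(m <= j < i.+1) c j * t_param n nu z0 ^+ j
        - \sum_(m <= j < i) c j * t_param n nu z0 ^+ j.
      by rewrite big_nat_recr //= addrAC subrr add0r.
    by apply: absB_le; exact: HC.
  by rewrite absM absX.
(* Beyond radius 1 / |t(z0)|, the bound |t(z)| <= 1 / |z| gives |t(z)| <= |t(z0)|, and every later
   term is dominated by C |t(z) / t(z0)|^(m+1). *)
move=> [C C0 HC]; exists (C / t0' ^+ m.+1), (Num.max (abs z0) t0'^-1); split.
- by rewrite divr_ge0 // exprn_ge0 // ltW.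
- by rewrite lt_max z0gt.
move=> z ez; rewrite gt_max => /andP[z0z tz].
have zgt : 0 < abs z by apply: lt_trans z0z.
have [t1 t1z] := t_param_le n nu ez zgt; set t := t_param n nu z in t1 t1z *.
have tt0 : abs t <= t0'.
  apply: le_trans (_ : (abs z)^-1 <= _); first by rewrite -[leRHS]mul1r ler_pdivlMr.
  by rewrite -[leRHS]invrK lef_pV2 ?posrE ?invr_gt0 // ltW.
apply: (converges_le (H z _ _)); [by apply/im_gt0; rewrite -ez | by rewrite -ez (lt_trans rz0) |].
exists m.+1 => N mN; rewrite big_ltn // addrAC subrr add0r.
rewrite big_nat_cond; apply: abs_sum_le => [|i].
  by rewrite mulr_ge0 ?exprn_ge0 // divr_ge0 // exprn_ge0 // ltW.
rewrite andbT => /andP[mi _].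
rewrite absM absX -mulrA [_^-1 * _]mulrC mulrA ler_pdivlMr ?exprn_gt0 //.
apply: le_trans (_ : (abs (c i) * t0' ^+ i) * abs t ^+ m.+1 <= _); last first.
  by rewrite ler_wpM2r ?exprn_ge0 // HC // ltnW.
rewrite -!mulrA ler_wpM2l // -(subnK mi) !exprD -mulrA mulrCA [leRHS]mulrC.
rewrite -!mulrA ler_wpM2r ?mulr_ge0 ?exprn_ge0 ?(ltW t0) //.
by rewrite lerXn2r ?nnegrE // ltW.
Qed.

End TExpansion.

(** * Functions that are rational on a set *)

Section RationalFunctions.

Variable L : fieldType.
Implicit Types (S : set L) (f g : L -> L).

Definition rational_on S f := exists p r : {poly L},
  forall z, S z -> r.[z] != 0 /\ f z = p.[z] / r.[z].

Lemma rational_poly S (p : {poly L}) : rational_on S (fun z => p.[z]).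
Proof. by exists p, 1 => z _; rewrite hornerC oner_neq0 divr1. Qed.

Lemma rational_eq S f g : (forall z, S z -> f z = g z) -> rational_on S f -> rational_on S g.
Proof. by move=> e [p [r H]]; exists p, r => z sz; rewrite -e //; exact: H. Qed.

Lemma rationalD S f g : rational_on S f -> rational_on S g -> rational_on S (fun z => f z + g z).
Proof.
move=> [p [r H]] [p' [r' H']]; exists (p * r' + p' * r), (r * r') => z sz.
have [r0 ->] := H z sz; have [r0' ->] := H' z sz.
by rewrite !hornerE mulf_neq0 //; split => //; field; rewrite r0 r0'.
Qed.

Lemma rationalM S f g : rational_on S f -> rational_on S g -> rational_on S (fun z => f z * g z).
Proof.
move=> [p [r H]] [p' [r' H']]; exists (p * p'), (r * r') => z sz.
have [r0 ->] := H z sz; have [r0' ->] := H' z sz.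
by rewrite !hornerM; split; [exact: mulf_neq0 | exact: mulf_div].
Qed.

Lemma rationalV S f : (forall z, S z -> f z != 0) -> rational_on S f -> rational_on S (fun z => (f z)^-1).
Proof.
move=> f0 [p [r H]]; exists r, p => z sz; have [r0 ef] := H z sz.
have := f0 z sz; rewrite ef mulf_eq0 invr_eq0 negb_or => /andP[p0 _].
by split => //; rewrite invf_div.
Qed.

Lemma rationalX S f m : rational_on S f -> rational_on S (fun z => f z ^+ m).
Proof.
move=> rf; elim: m => [|m IH].
  by apply: rational_eq (rational_poly S 1) => z _; rewrite hornerC expr0.
by apply: rational_eq (rationalM rf IH) => z _; rewrite exprS.
Qed.

Lemma rational_sum S (I : Type) (r : seq I) (f : I -> L -> L) :
  (forall i, rational_on S (f i)) -> rational_on S (fun z => \sum_(i <- r) f i z).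
Proof.
move=> H; elim: r => [|i r IH].
  by apply: rational_eq (rational_poly S 0) => z _; rewrite big_nil horner0.
by apply: rational_eq (rationalD (H i) IH) => z _; rewrite big_cons.
Qed.

Lemma rational_prod S (I : Type) (r : seq I) (f : I -> L -> L) :
  (forall i, rational_on S (f i)) -> rational_on S (fun z => \prod_(i <- r) f i z).
Proof.
move=> H; elim: r => [|i r IH].
  by apply: rational_eq (rational_poly S 1) => z _; rewrite big_nil hornerC.
by apply: rational_eq (rationalM (H i) IH) => z _; rewrite big_cons.
Qed.

End RationalFunctions.

(** * Convergence, holomorphy and modularity of the Poincare series *)

Section PoincareSeries.

Variables (Fq : finFieldType) (R : realType) (K : valued_ext Fq R).
Hypothesis K_Cinf : is_Cinf K.
Variables (n : {poly Fq}) (delta : 'M[ratfun Fq]_2) (k : nat) (D : kdata (ratfun Fq)).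
Hypothesis n_size : (1 < size n)%N.
Hypothesis delta_unit : delta \in unitmx.
Hypothesis D_wf : kdata_wf k D.
Hypothesis no_common_end : forall s, exists i, s <> @ka _ D i /\ s <> @kb _ D i.

Local Notation abs := (vabs K).
Local Notation q := (#|Fq|%:R : R).
Local Notation T := (Defs.iota K (AtoF 'X)).
Local Notation emb := (Defs.iota K).
Local Notation im := (@vabs_i Fq R K).
Local Notation Omega := (@Omega Fq R K).
Local Notation Finf := (@Finf Fq R K).
Local Notation G2 := (@GL2Finf Fq R K).
Implicit Types (z : K) (g : 'M[{poly Fq}]_2).

Lemma Omega_affP z : Omega z <-> exists m, Omega_aff (K := K) m z.
Proof.
split=> [/im_gt0 i0|[m [_ H]]]; last first.
  by apply/im_gt0; apply: lt_le_trans H; rewrite invr_gt0 exprn_gt0.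
have [m1 h1] := @q_unbounded Fq R (abs z); have [m2 h2] := q_small Fq i0.
exists (maxn m1 m2); split.
  by apply: le_trans (ltW h1) _; rewrite ler_eXn2l // leq_maxl.
apply: le_trans (ltW h2); rewrite lef_pV2 ?posrE ?exprn_gt0 //.
by rewrite ler_eXn2l // leq_maxr.
Qed.

Lemma Omega_aff_Omega m z : Omega_aff (K := K) m z -> Omega z.
Proof. by move=> H; apply/Omega_affP; exists m. Qed.

(** The form [pole_form s] at the image of z under Y, multiplied by [jfac Y z]. For Y inverse to X
    it is proportional to the pole form of X s, and its coefficients are linear in the entries of
    Y. *)
Definition ell (Y : 'M[K]_2) (s : P1 K) z : K :=
  (hy s * Y 0 0 - hx s * Y 1 0) * z + (hy s * Y 0 1 - hx s * Y 1 1).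

Lemma ell_cross (Y : 'M[K]_2) (a b : P1 K) z : (forall i j, Finf (Y i j)) -> P1Finf a -> P1Finf b ->
  abs (cross a b) * abs (\det Y) * im z <= abs (ell Y a z) * abs (ell Y b z).
Proof.
move=> fY /P1FinfP[f1 f2] /P1FinfP[f3 f4]; rewrite /ell -absM.
set A := hy a * Y 0 0 - _; set B := hy a * Y 0 1 - _; set A' := hy b * _ - _; set B' := hy b * Y 0 1 - _.
have -> : cross a b * \det Y = - (A * B' - B * A') by rewrite det2 /cross /A /B /A' /B'; ring.
by rewrite absN; apply: im_lin; apply: FinfB; apply: FinfM.
Qed.

Lemma abs_udiff_ell X (a b : P1 K) z : G2 X -> Omega z -> P1Finf a -> P1Finf b ->
  abs (udiff id z (mob X a) (mob X b)) =
  abs (cross a b) * abs (\det (invmx X)) / (abs (ell (invmx X) a z) * abs (ell (invmx X) b z)).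
Proof.
move=> gX oz fa fb; have uX := G2_unit gX; have d0 := det_neq0 gX.
rewrite udiffE //; try exact: P1Finf_mob.
have pa := pole_form_neq0 oz (P1Finf_mob gX fa); have pb := pole_form_neq0 oz (P1Finf_mob gX fb).
rewrite -!absM -abs_div; congr (abs _); move: pa pb.
have E s : exists2 e, e != 0 & [/\ X 0 0 * hx s + X 0 1 * hy s = e * hx (mob X s),
    X 1 0 * hx s + X 1 1 * hy s = e * hy (mob X s) &
    ell (invmx X) s z = e * pole_form (mob X s) z / \det X].
  have [e e0 [e1 e2]] := mob_hom s uX; exists e => //; split => //.
  apply: (mulIf d0); rewrite divfK //.
  transitivity ((e * hy (mob X s)) * z - e * hx (mob X s)); last by rewrite /pole_form; ring.
  rewrite -e1 -e2 invmx2 // /ell !mxE /=.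
  have -> : ((hy s * ((\det X)^-1 * X 1 1) - hx s * ((\det X)^-1 * - X 1 0)) * z +
   (hy s * ((\det X)^-1 * - X 0 1) - hx s * ((\det X)^-1 * X 0 0))) * \det X =
    (hy s * X 1 1 + hx s * X 1 0) * z - (hy s * X 0 1 + hx s * X 0 0).
    by move: (\det X) d0 => d d0; field.
  by ring.
have [e e0 [e1 e2 ->]] := E a; have [e' e0' [e1' e2' ->]] := E b.
rewrite det_inv => pa pb.
have -> : cross (mob X a) (mob X b) = \det X * cross a b / (e * e').
  apply: (mulIf (mulf_neq0 e0 e0')); rewrite divfK ?mulf_neq0 // /cross.
  transitivity ((e' * hx (mob X b)) * (e * hy (mob X a)) - (e * hx (mob X a)) * (e' * hy (mob X b))); first by ring.
  by rewrite -e1 -e2 -e1' -e2' det2; ring.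
by move: (\det X) d0 => d d0; field; rewrite pa pb d0 e0 e0'.
Qed.

Let X g := mxFK K (mxAF g *m delta).
Let Y g := invmx (X g).
Let pt (s : P1 (ratfun Fq)) := omap emb s.

Lemma X_unit g : Gamma n g -> mxAF g *m delta \in unitmx.
Proof. by move=> gg; rewrite unitmx_mul delta_unit mxAF_unit //; exact: Gamma_unit gg. Qed.

Lemma X_G2 g : Gamma n g -> G2 (X g).
Proof. by move=> /X_unit; exact: G2_mxFK. Qed.

Let eta := abs (\det (mxFK K delta)).

Lemma eta_gt0 : 0 < eta. Proof. by rewrite abs_gt0 det_neq0 //; exact: G2_mxFK. Qed.

Lemma abs_det_Y g : Gamma n g -> abs (\det (Y g)) = eta^-1.
Proof.
move=> gg; rewrite det_inv absV /X mxFKM det_mulmx absM -/(mxAK K g).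
by rewrite abs_det_mxAK ?mul1r //; exact: Gamma_unit gg.
Qed.

Let term z g := kprod emb z (kmap (mob (mxAF g *m delta)) D).
Let Lf z g s := abs (ell (Y g) (pt s) z).

Lemma P1pt s : P1Finf (pt s). Proof. exact: P1Finf_omap. Qed.

Lemma Lf_cross g m z s s' : Gamma n g -> Omega_aff (K := K) m z ->
  abs (cross (pt s) (pt s')) / eta / q ^+ m <= Lf z g s * Lf z g s'.
Proof.
move=> gg za; apply: le_trans (ell_cross _ _ _ _); try exact: P1pt; last first.
  by move=> i j; exact: G2_Finf (G2V (X_G2 gg)).
by rewrite abs_det_Y // ler_wpM2l ?mulr_ge0 ?invr_ge0 ?(ltW eta_gt0) //; case: za.
Qed.

Lemma pt_inj : injective pt.
Proof. by move=> [x|] [y|] //= [] /fmorph_inj ->. Qed.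

Lemma cross_pt_gt0 s s' : s <> s' -> 0 < abs (cross (pt s) (pt s')).
Proof. by move=> ss; rewrite abs_gt0 cross_neq0 // => /pt_inj. Qed.

Lemma Lf_gt0 g z s : Gamma n g -> Omega z -> 0 < Lf z g s.
Proof.
move=> gg oz; have [i [si _]] := no_common_end s.
have [m za] := (Omega_affP z).1 oz.
have : 0 < Lf z g s * Lf z g (ka i).
  apply: lt_le_trans (Lf_cross _ _ gg za).
  by rewrite !divr_gt0 ?cross_pt_gt0 ?exprn_gt0 ?eta_gt0.
by rewrite [0 < Lf z g s]lt_def abs_ge0 andbT; apply: contraTneq => ->; rewrite mul0r ltxx.
Qed.

(** On an affinoid every factor of a term is at most q^m, so a term of size at least e has no small
    factor. A factor is a constant divided by the product of its two linear forms, which is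
    therefore bounded. *)
Lemma Lf_product m e : 0 < e -> forall i, exists2 C, 0 < C & forall g z, Gamma n g ->
  Omega_aff (K := K) m z -> e <= abs (term z g) -> Lf z g (ka i) * Lf z g (@kb _ D i) <= C.
Proof.
move=> e0 i; have [_ kge1 _ kab _] := D_wf.
pose A g z j := abs (udiff id z (mob (X g) (pt (ka j))) (mob (X g) (pt (@kb _ D j)))).
have termE z g : abs (term z g) = \prod_j A g z j ^+ @kexp _ D j.
  by rewrite /term /kprod abs_prod; apply: eq_bigr => j _; rewrite absX udiff_omap !mob_omap.
pose c j := abs (cross (pt (ka j)) (pt (@kb _ D j))).
have c0 j : 0 < c j by exact: cross_pt_gt0.
have AE g z j : Gamma n g -> Omega z -> A g z j = c j / eta / (Lf z g (ka j) * Lf z g (@kb _ D j)).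
  move=> gg oz; rewrite /A abs_udiff_ell //; try exact: P1pt; last exact: X_G2.
  by rewrite abs_det_Y.
have Ale g z j : Gamma n g -> Omega_aff (K := K) m z -> A g z j <= q ^+ m.
  move=> gg za; have oz := Omega_aff_Omega za; rewrite AE //.
  have := Lf_cross (ka j) (@kb _ D j) gg za; rewrite -/(c j).
  rewrite ler_pdivrMr ?exprn_gt0 // => H.
  by rewrite ler_pdivrMr ?mulr_gt0 ?Lf_gt0 // [leRHS]mulrC.
pose M := \prod_(j | j != i) (q ^+ m) ^+ @kexp _ D j.
have M0 : 0 < M by apply: prodr_gt0 => j _; rewrite !exprn_gt0.
(* M bounds the other factors. The minimum with 1 removes the exponent: if A <= 1, its power with
   positive exponent is at most A. *)
pose e2 := Num.min 1 (e / M).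
have e20 : 0 < e2 by rewrite lt_min ltr01 divr_gt0.
exists (c i / eta / e2) => [|g z gg za]; first by rewrite !divr_gt0 ?eta_gt0.
rewrite termE (bigD1 i) //= => H; have oz := Omega_aff_Omega za.
have Ai : e2 <= A g z i.
  have [A1|A1] := leP 1 (A g z i); first by rewrite ge_min A1.
  rewrite ge_min; apply/orP; right; rewrite ler_pdivrMr //; apply: le_trans H _.
  apply: ler_pM; rewrite ?exprn_ge0 //; first by apply: prodr_ge0 => j _; rewrite exprn_ge0.
    by have := kge1 i; case: (kexp i) => // p _; rewrite exprS ler_piMr // exprn_ile1 // ltW.
  apply: ler_prod => j _; rewrite exprn_ge0 //=.
  by rewrite lerXn2r ?nnegrE ?exprn_ge0 ?Ale // ltW.
move: Ai; rewrite AE // ler_pdivlMr ?mulr_gt0 ?Lf_gt0 // => Ai.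
by rewrite ler_pdivlMr // mulrC.
Qed.

(** A bound for the product of the forms at s and s' bounds neither of them. A pair that avoids s'
    supplies a lower bound for the form at s', by [Lf_cross] with both of its ends and [Lf_product];
    hence an upper bound at s. *)
Lemma Lf_bounded m e s s' : 0 < e -> (exists i, s = ka i /\ s' = @kb _ D i) \/ (exists i, s' = ka i /\ s = @kb _ D i) ->
  exists C, forall g z, Gamma n g -> Omega_aff (K := K) m z -> e <= abs (term z g) -> Lf z g s <= C.
Proof.
move=> e0 Hs; have [C C0 HC] : exists2 C, 0 < C & forall g z, Gamma n g ->
    Omega_aff (K := K) m z -> e <= abs (term z g) -> Lf z g s * Lf z g s' <= C.
  case: Hs => -[i [-> ->]]; first exact: Lf_product.
  by have [C C0 H] := Lf_product m e0 i; exists C => // g z gg za et; rewrite mulrC H.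
have [i [si1 si2]] := no_common_end s'; have [C1 C10 HC1] := Lf_product m e0 i.
pose kap u := abs (cross (pt s') (pt u)) / eta / q ^+ m.
have k1 : 0 < kap (ka i) by rewrite !divr_gt0 ?cross_pt_gt0 ?exprn_gt0 ?eta_gt0.
have k2 : 0 < kap (@kb _ D i) by rewrite !divr_gt0 ?cross_pt_gt0 ?exprn_gt0 ?eta_gt0.
exists (1 + C ^+ 2 * C1 / (kap (ka i) * kap (@kb _ D i))) => g z gg za et.
have h := HC g z gg za et; have h1 := HC1 g z gg za et.
have h2 := Lf_cross s' (ka i) gg za; have h3 := Lf_cross s' (@kb _ D i) gg za.
rewrite -/(kap _) in h2; rewrite -/(kap _) in h3.
have oz := Omega_aff_Omega za.
have := Lf_gt0 s gg oz; have := Lf_gt0 s' gg oz; have := Lf_gt0 (ka i) gg oz; have := Lf_gt0 (@kb _ D i) gg oz.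
move: h h1 h2 h3 k1 k2; set u := Lf z g s; set v := Lf z g s'; set x := Lf z g (ka i); set y := Lf z g (kb i).
set c1 := kap _; set c2 := kap _ => h h1 h2 h3 k1 k2 y0 x0 v0 u0.
have H1 : c1 * c2 <= v ^+ 2 * C1.
  apply: le_trans (_ : (v * x) * (v * y) <= _); first by apply: ler_pM => //; exact: ltW.
  have -> : v * x * (v * y) = v ^+ 2 * (x * y) by ring.
  by rewrite ler_wpM2l // sqr_ge0.
have H2 : u ^+ 2 * (c1 * c2) <= C ^+ 2 * C1.
  apply: le_trans (_ : u ^+ 2 * (v ^+ 2 * C1) <= _); first by rewrite ler_wpM2l // sqr_ge0.
  have uv0 : 0 <= u * v by rewrite mulr_ge0 // ltW.
  by rewrite mulrA -exprMn ler_wpM2r ?(ltW C10) // lerXn2r ?nnegrE // ltW.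
have H3 : u ^+ 2 <= C ^+ 2 * C1 / (c1 * c2) by rewrite ler_pdivlMr // mulr_gt0.
have [u1|u1] := leP u 1; first by apply: le_trans u1 _; rewrite lerDl; apply: le_trans H3; rewrite sqr_ge0.
by apply: le_trans (_ : u ^+ 2 <= _); [nra | apply: le_trans H3 _; rewrite lerDr].
Qed.

(** If a term is at least e, the two forms of one pair are bounded. Their coefficients determine the
    matrix Y inverse to g delta, because [cross] is nonzero. So the polynomial entries of the
    inverse of g, which is delta Y, are bounded, and only finitely many g remain. *)
Lemma terms_uniformly_small m e : 0 < e -> exists B0, [/\ uniq B0, [set` B0] `<=` Gamma n &
  forall g z, Gamma n g -> g \notin B0 -> Omega_aff (K := K) m z -> abs (term z g) < e].
Proof.
move=> e0; have [kr2 _ _ kab _] := D_wf; pose i0 : 'I_(kr D) := Ordinal (ltnW kr2).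
have [C HC] : exists C, forall g z, Gamma n g -> Omega_aff (K := K) m z -> e <= abs (term z g) -> Lf z g (ka i0) <= C.
  by apply: (@Lf_bounded m e (ka i0) (kb i0)) => //; left; exists i0.
have [C' HC'] : exists C, forall g z, Gamma n g -> Omega_aff (K := K) m z -> e <= abs (term z g) -> Lf z g (kb i0) <= C.
  by apply: (@Lf_bounded m e (kb i0) (ka i0)) => //; right; exists i0.
pose C1 := Num.max 1 (Num.max C C'); have C11 : 1 <= C1 by rewrite /C1 le_max lexx.
have CC1 : C <= C1 by rewrite /C1 !le_max lexx orbT.
have CC1' : C' <= C1 by rewrite /C1 !le_max lexx !orbT.
pose C2 := C1 * q ^+ m * q ^+ m.
have qm1 : 1 <= q ^+ m by rewrite exprn_ege1 // ltW.
have coef g z s : Gamma n g -> Omega_aff (K := K) m z -> Lf z g s <= C1 ->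
    abs (hy (pt s) * Y g 0 0 - hx (pt s) * Y g 1 0) <= C2 /\
    abs (hy (pt s) * Y g 0 1 - hx (pt s) * Y g 1 1) <= C2.
  move=> gg za; have [f1 f2] := P1FinfP (P1pt s); have fY i j := G2_Finf i j (G2V (X_G2 gg)).
  rewrite /Lf /ell; set a := _ - _; set b := _ - _ => H.
  have fa : Finf a by apply: FinfB; apply: FinfM.
  have fb : Finf b by apply: FinfB; apply: FinfM.
  have [z1 z2] := za.
  have ha : abs a <= C1 * q ^+ m.
    rewrite -ler_pdivrMr ?exprn_gt0 //; apply: le_trans H.
    by apply: le_trans (abs_lin_ge _ fa fb); rewrite ler_wpM2l.
  have C10 : 0 <= C1 by exact: le_trans ler01 C11.
  have qm0 : 0 <= q ^+ m by exact: le_trans ler01 qm1.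
  split; first by apply: le_trans ha _; rewrite ler_peMr // mulr_ge0.
  have -> : b = (a * z + b) - a * z by ring.
  apply: absB_le.
    apply: le_trans H _; rewrite /C2 -mulrA ler_peMr //.
    by rewrite mulr_ege1.
  by rewrite absM ler_pM.
pose s0 := pt (ka i0); pose s1 := pt (@kb _ D i0); pose c := cross s0 s1.
have c0 : c != 0 by rewrite -abs_gt0 cross_pt_gt0.
pose H0 := \sum_(x <- [:: hx s0; hx s1; hy s0; hy s1]) abs x.
have HH x : x \in [:: hx s0; hx s1; hy s0; hy s1] -> abs x <= H0.
  move=> xi; rewrite /H0 (perm_big _ (perm_to_rem xi)) big_cons lerDl.
  by apply: sumr_ge0 => ? _.
pose C3 := H0 * C2 / abs c.
have Ybound g z i j : Gamma n g -> Omega_aff (K := K) m z -> e <= abs (term z g) -> abs (Y g i j) <= C3.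
  move=> gg za et.
  have [a0 b0] := coef g z (ka i0) gg za (le_trans (HC g z gg za et) CC1).
  have [a1 b1] := coef g z (kb i0) gg za (le_trans (HC' g z gg za et) CC1').
  rewrite /C3 ler_pdivlMr ?abs_gt0 // -absM.
  have bd u v p r : abs p <= C2 -> abs r <= C2 -> abs u <= H0 -> abs v <= H0 -> abs (u * p - v * r) <= H0 * C2.
    by move=> h1 h2 h3 h4; apply: absB_le; rewrite absM ler_pM.
  have m0 : hx s0 \in [:: hx s0; hx s1; hy s0; hy s1] by rewrite !inE eqxx.
  have m1 : hx s1 \in [:: hx s0; hx s1; hy s0; hy s1] by rewrite !inE eqxx orbT.
  have m2 : hy s0 \in [:: hx s0; hx s1; hy s0; hy s1] by rewrite !inE eqxx !orbT.
  have m3 : hy s1 \in [:: hx s0; hx s1; hy s0; hy s1] by rewrite !inE eqxx !orbT.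
  move: i j; apply: ord2P; apply: ord2P.
  - have -> : Y g 0 0 * c = hx s1 * (hy s0 * Y g 0 0 - hx s0 * Y g 1 0) - hx s0 * (hy s1 * Y g 0 0 - hx s1 * Y g 1 0) by rewrite /c /cross; ring.
    by apply: bd => //; apply: HH.
  - have -> : Y g 0 1 * c = hx s1 * (hy s0 * Y g 0 1 - hx s0 * Y g 1 1) - hx s0 * (hy s1 * Y g 0 1 - hx s1 * Y g 1 1) by rewrite /c /cross; ring.
    by apply: bd => //; apply: HH.
  - have -> : Y g 1 0 * c = hy s1 * (hy s0 * Y g 0 0 - hx s0 * Y g 1 0) - hy s0 * (hy s1 * Y g 0 0 - hx s1 * Y g 1 0) by rewrite /c /cross; ring.
    by apply: bd => //; apply: HH.
  - have -> : Y g 1 1 * c = hy s1 * (hy s0 * Y g 0 1 - hx s0 * Y g 1 1) - hy s0 * (hy s1 * Y g 0 1 - hx s1 * Y g 1 1) by rewrite /c /cross; ring.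
    by apply: bd => //; apply: HH.
pose d := mxFK K delta; pose H1 := \sum_i \sum_j abs (d i j).
have dH i j : abs (d i j) <= H1.
  by move: i j; apply: ord2P; apply: ord2P; rewrite /H1 !sum2; 
    have := abs_ge0 (d 0 0); have := abs_ge0 (d 0 1); have := abs_ge0 (d 1 0); have := abs_ge0 (d 1 1); lra.
have [B HB] := @bounded_matrices Fq R K (H1 * C3).
exists (undup [seq g <- [seq invmx g | g <- B] | `[< Gamma n g >]]); split; first exact: undup_uniq.
  by move=> g /=; rewrite mem_undup mem_filter => /andP[/asboolP].
move=> g z gg gB za; rewrite ltNge; apply: contraNN gB => et.
rewrite mem_undup mem_filter; apply/andP; split; first exact/asboolP.
apply/mapP; exists (invmx g); last by rewrite invmxK.
apply: HB => i j; have ug := Gamma_unit gg.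
have -> : a2k K (invmx g i j) = (d *m Y g) i j.
  rewrite -mxAKE mxAKV //; congr (_ _ i j).
  have uX := G2_unit (X_G2 gg); have ud : d \in unitmx by apply: G2_unit; exact: G2_mxFK.
  have uK := G2_unit (G2_mxAK K ug).
  by rewrite /Y /X mxFKM invmx_prod // mulKVmx.
by rewrite mulmx2; apply: absD_le; rewrite absM ler_pM // (Ybound g z).
Qed.

Lemma terms_summable z : Omega z -> summable (K := K) (Gamma n) (term z).
Proof.
move=> /Omega_affP[m za] e e0; have [B0 [uB sB H]] := terms_uniformly_small m e0.
by exists B0; split=> // g gg gB; exact: H.
Qed.

Lemma rational_kprod (D' : kdata (ratfun Fq)) m :
  rational_on (Omega_aff (K := K) m) (fun z => kprod emb z D').
Proof.
apply: rational_prod => i; apply: rationalX.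
have P (s : P1 (ratfun Fq)) : rational_on (Omega_aff (K := K) m) (fun z => if s is Some x then (z - emb x)^-1 else 0).
  case: s => [x|]; last by apply: rational_eq (rational_poly _ 0) => z _; rewrite horner0.
  apply: rationalV => [z /Omega_aff_Omega oz|]; first by apply: Omega_neq => //; exact: Finf_iota.
  by apply: rational_eq (rational_poly _ ('X - (emb x)%:P)) => z _; rewrite !hornerE.
apply: rational_eq (rationalD (P (kb i)) (rationalM (rational_poly _ (-1)%:P) (P (ka i)))) => z _.
by rewrite hornerC mulN1r.
Qed.

Lemma poincare_holomorphic : holomorphic (poincare K n delta D).
Proof.
move=> m e e0; have [B0 [uB sB H]] := terms_uniformly_small m e0.
have [p [r pr]] := @rational_sum K (Omega_aff (K := K) m) _ B0 (fun g z => term z g) (fun g => rational_kprod _ m).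
exists p, r => z za; have [r0 <-] := pr z za; split=> //.
apply: usum_near => //; first exact: terms_summable (Omega_aff_Omega za).
by move=> g gg gB; exact: H.
Qed.

(** Replacing h by g h permutes the group; each term acquires the power 2k of the factor of
    automorphy because det g = 1. *)
Lemma poincare_modular g z : Gamma n g -> Omega z ->
  poincare K n delta D (mobz (mxAK K g) z) = jfac (mxAK K g) z ^+ (2 * k) * poincare K n delta D z.
Proof.
move=> gg oz; have ug := Gamma_unit gg; have gK := G2_mxAK K ug.
have [_ _ ek _ _] := D_wf.
rewrite /poincare -usum_scale //; last exact: terms_summable.
rewrite -(@usum_reindex _ _ K K_Cinf _ _ _ (fun h => g *m h) (fun h => invmx g *m h)); first last.
- by apply: terms_summable; exact: Omega_mobz.
- move=> h; split=> [gh|gh]; first exact: GammaM.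
  by rewrite -(mulKmx ug h); apply: GammaM => //; exact: GammaV.
- by move=> h; rewrite mulKVmx.
- by move=> h; rewrite mulKmx.
apply: usum_eq => // [|h gh].
  have sg := terms_summable (Omega_mobz gK oz).
  move=> e e0; have [B0 [uB sB H]] := sg e e0.
  exists [seq invmx g *m h | h <- B0]; split.
  - by rewrite map_inj_uniq //; apply: can_inj (mulKVmx ug).
  - by move=> _ /= /mapP[h /sB gh ->]; apply: GammaM => //; exact: GammaV.
  move=> h gh hB; apply: H; first exact: GammaM.
  by apply: contraNN hB => hB; rewrite -(mulKmx ug h) map_f.
have uh : mxAF h *m delta \in unitmx by exact: X_unit.
have ug' : mxAF g \in unitmx by exact: mxAF_unit.
transitivity (kprod emb (mobz (mxFK K (mxAF g)) z) (kmap (mob (mxAF g)) (kmap (mob (mxAF h *m delta)) D))).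
  have -> // : mob (mxAF (g *m h) *m delta) = (fun s => mob (mxAF g) (mob (mxAF h *m delta) s)).
  by apply/funext => s; rewrite mxAFM -mulmxA (mobM s ug' uh).
rewrite kprod_mob //= ek mulrC; congr (_ * _).
by rewrite -[mxFK K _]/(mxAK K g) det_mxAK (Gamma_det n_size gg) rmorph1 divr1 -exprM.
Qed.

End PoincareSeries.

Lemma image_swap (A B B' C : Type) (f : A -> B) (g : B -> C) (f' : A -> B') (g' : B' -> C)
  (S : set A) : (forall x, g (f x) = g' (f' x)) -> g @` (f @` S) = g' @` (f' @` S).
Proof. by move=> e; rewrite !image_comp; apply: eq_imagel => x _; exact: e. Qed.

Lemma image_image (A B C : Type) (f : A -> B) (g : B -> C) (h : A -> C) (S : set A) :
  (forall x, g (f x) = h x) -> g @` (f @` S) = h @` S.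
Proof. by move=> e; rewrite image_comp; apply: eq_imagel => x _; exact: e. Qed.

Lemma scaleE (F : fieldType) c (A : 'M[F]_2) i j : (c *: A) i j = c * A i j.
Proof. by rewrite mxE. Qed.

(** * Vertices of the tree, stabilizers and neighbours *)

Section Tree.

Variables (Fq : finFieldType) (R : realType) (K : valued_ext Fq R).
Local Notation abs := (vabs K).
Local Notation q := (#|Fq|%:R : R).
Local Notation T := (Defs.iota K (AtoF 'X)).
Local Notation emb := (Defs.iota K).
Local Notation im := (@vabs_i Fq R K).
Local Notation Omega := (@Omega Fq R K).
Local Notation Finf := (@Finf Fq R K).
Local Notation G2 := (@GL2Finf Fq R K).
Local Notation v0 := (vtx K 0).
Local Notation act := (@act_vertex Fq R K).
Implicit Types (z : K) (g h m : 'M[K]_2).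

Lemma act_lattice_of g h : act_lattice g (lattice_of h) = lattice_of (h *m invmx g).
Proof. by apply: image_image => x; rewrite mulmxA. Qed.

Lemma act_lattice_scale g c (L : set 'rV[K]_2) :
  act_lattice g (scale_lattice c L) = scale_lattice c (act_lattice g L).
Proof. by apply: image_swap => x; rewrite scalemxAl. Qed.

Lemma act_homothety g (L : set 'rV[K]_2) :
  act g (homothety_class L) = homothety_class (act_lattice g L).
Proof. by apply: image_image => c; rewrite act_lattice_scale. Qed.

Lemma act_vertexM g h v : g \in unitmx -> h \in unitmx -> act g (act h v) = act (g *m h) v.
Proof.
move=> ug uh; apply: image_image => L; apply: image_image => x.
by rewrite invmx_prod // mulmxA.
Qed.

Lemma act_vertex1 v : act 1%:M v = v.
Proof.
have e (L : set 'rV[K]_2) : act_lattice (K := K) 1%:M L = L.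
  rewrite /act_lattice (_ : invmx _ = 1%:M) ?invmx1 //; first by apply/seteqP; split=> [_ [x ? <-]|x]; rewrite ?mulmx1 //; exists x; rewrite ?mulmx1.
rewrite /act_vertex (_ : act_lattice (K := K) 1%:M = id) ?image_id //; exact/funext.
Qed.

Lemma act_vertexK g v : g \in unitmx -> act (invmx g) (act g v) = v.
Proof. by move=> ug; rewrite act_vertexM ?unitmx_inv // mulVmx // act_vertex1. Qed.

Lemma act_vertexVK g v : g \in unitmx -> act g (act (invmx g) v) = v.
Proof. by move=> ug; rewrite act_vertexM ?unitmx_inv // mulmxV // act_vertex1. Qed.

Lemma act_vertex_inj g v w : g \in unitmx -> act g v = act g w -> v = w.
Proof. by move=> ug e; rewrite -(act_vertexK v ug) e act_vertexK. Qed.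

Definition integral g := forall i j, abs (g i j) <= 1.

Lemma integralM g h : integral g -> integral h -> integral (g *m h).
Proof. by move=> ig ih i j; rewrite mulmx2; apply: absD_le; rewrite absM mulr_ile1. Qed.

Lemma integral_det g : integral g -> abs (\det g) <= 1.
Proof. by move=> ig; rewrite det2; apply: absB_le; rewrite absM mulr_ile1. Qed.

Lemma integralV g : integral g -> abs (\det g) = 1 -> integral (invmx g).
Proof.
move=> ig dg; have ug : g \in unitmx by rewrite unitmxE unitfE -abs_gt0 dg.
have e : abs (\det g)^-1 = 1 by rewrite absV dg invr1.
by rewrite invmx2 //; apply: ord2P; apply: ord2P; rewrite mxE absM e mul1r mk2E ?absN.
Qed.

Lemma mem_lattice g (x : 'rV[K]_2) : G2 g ->
  lattice_of g x <-> (forall j, Finf (x 0 j)) /\ forall j, abs ((x *m invmx g) 0 j) <= 1.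
Proof.
move=> gg; have ug := G2_unit gg; have gV := G2V gg; split.
  move=> [y /= oy <-]; have fy j : Finf (y 0 j) by have /OinfP[] := oy j.
  split=> j; first by rewrite mulmx2; apply: FinfD; apply: FinfM => //; exact: G2_Finf.
  by rewrite mulmxK //; have /OinfP[] := oy j.
move=> [fx H]; exists (x *m invmx g); last by rewrite mulmxKV.
move=> j /=; apply/OinfP; split; last exact: H.
by rewrite mulmx2; apply: FinfD; apply: FinfM => //; exact: G2_Finf.
Qed.

Lemma homothety_eq (L L' : set 'rV[K]_2) : homothety_class L = homothety_class L' <->
  exists c, [/\ Finf c, c != 0 & L' = scale_lattice c L].
Proof.
have sM a b (M : set 'rV[K]_2) : scale_lattice a (scale_lattice b M) = scale_lattice (a * b) M.
  by apply: image_image => x; rewrite scalerA.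
have s1 (M : set 'rV[K]_2) : scale_lattice 1 M = M.
  by apply/seteqP; split=> [_ [x ? <-]|x]; rewrite ?scale1r //; exists x; rewrite ?scale1r.
split=> [e|[c [fc c0 ->]]].
  have : homothety_class L L by rewrite e; rewrite -e; exists 1; rewrite ?s1 //; split; [exact: Finf1|rewrite oner_neq0].
  have : homothety_class L' L' by exists 1; rewrite ?s1 //; split; [exact: Finf1|rewrite oner_neq0].
  by rewrite -e => -[c [fc c0] <-] _; exists c.
apply/seteqP; split=> _ [a [fa a0] <-].
  exists (a / c); last by rewrite sM divfK.
  by split; [apply: FinfM => //; exact: FinfV | rewrite mulf_neq0 ?invr_eq0].
by exists (a * c); [split; [exact: FinfM | rewrite mulf_neq0] | rewrite sM].
Qed.

Lemma vtx0E : v0 = homothety_class (lattice_of 1%:M).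
Proof.
rewrite /vtx; congr (homothety_class (lattice_of _)).
by apply: mx2P; rewrite !mxE.
Qed.

Lemma act_vtx0 g : act g v0 = homothety_class (lattice_of (invmx g)).
Proof. by rewrite vtx0E act_homothety act_lattice_of mul1mx. Qed.

(** The product of the scalars with GL_2(O_infinity): the stabilizer of v_0 in GL_2(F_infinity), by
    [K0_fix] and [fix_K0]. *)
Definition K0 g := exists c, [/\ Finf c, c != 0, integral (c *: g) & abs (\det (c *: g)) = 1].

Lemma K0_fix g : G2 g -> K0 g -> act g v0 = v0.
Proof.
move=> gg [c [fc c0 ic dc]]; rewrite act_vtx0 vtx0E; apply/homothety_eq.
have gc := G2Z fc c0 gg; have ug := G2_unit gg.
exists c^-1; split; [exact: FinfV | by rewrite invr_eq0 |].
have e1 : invmx (1%:M : 'M[K]_2) = 1%:M by apply: invmx_mul; rewrite mulmx1.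
have ei : invmx (c *: g) = c^-1 *: invmx g.
  by apply: invmx_mul; rewrite -scalemxAl -scalemxAr scalerA mulfV // mulmxV ?scale1r.
apply/seteqP; split=> x.
  move=> /(mem_lattice _ (G2_1 K)); rewrite e1 mulmx1 => -[fx x1].
  exists (c *: x); last by rewrite scalerA mulVf // scale1r.
  apply/(mem_lattice _ (G2V gg)); split=> j; first by rewrite mxE; exact: FinfM.
  rewrite invmxK -scalemxAl scalemxAr mulmx2.
  by apply: absD_le; rewrite absM mulr_ile1.
move=> [y /(mem_lattice _ (G2V gg))[fy y1] <-].
apply/(mem_lattice _ (G2_1 K)); split=> j; first by rewrite mxE; apply: FinfM => //; exact: FinfV.
rewrite e1 mulmx1; have -> : c^-1 *: y = y *m invmx (invmx g) *m invmx (c *: g).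
  by rewrite invmxK ei -scalemxAr mulmxK.
by rewrite mulmx2; apply: absD_le; rewrite absM mulr_ile1 // ?y1 // integralV.
Qed.

Lemma fix_K0 g : G2 g -> act g v0 = v0 -> K0 g.
Proof.
move=> gg; rewrite act_vtx0 vtx0E => /homothety_eq[c [fc c0 e]].
have e1 : invmx (1%:M : 'M[K]_2) = 1%:M by apply: invmx_mul; rewrite mulmx1.
have ug := G2_unit gg.
have dl i j : Finf (delta_mx (0 : 'I_1) i 0 j : K).
  by rewrite mxE; case: andP => _; [exact: Finf1|exact: Finf0].
have ei : c^-1 *: g *m (c *: invmx g) = 1%:M.
  by rewrite -scalemxAl -scalemxAr scalerA mulVf // mulmxV ?scale1r.
have i1 : integral (c^-1 *: g).
  move=> i j; have : lattice_of (K := K) 1%:M (delta_mx 0 i).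
    apply/(mem_lattice _ (G2_1 K)); split=> // l; rewrite e1 mulmx1 mxE.
    by case: andP => _; rewrite ?abs1 ?abs0.
  rewrite e => -[y /(mem_lattice _ (G2V gg))[_ y1] ey].
  have := y1 j; rewrite invmxK; have -> : y = c^-1 *: delta_mx 0 i by rewrite -ey scalerA mulVf // scale1r.
  by rewrite -scalemxAl scalemxAr -rowE !mxE.
have i2 : integral (c *: invmx g).
  move=> i j; have : lattice_of (K := K) 1%:M (c *: (delta_mx (0 : 'I_1) i *m invmx g)).
    rewrite e; exists (delta_mx (0 : 'I_1) i *m invmx g) => //.
    apply/(mem_lattice _ (G2V gg)); split=> l.
      by rewrite -rowE mxE; exact: G2_Finf (G2V gg).
    by rewrite mulmxK ?unitmx_inv // mxE; case: andP => _; rewrite ?abs1 ?abs0.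
  by move=> /(mem_lattice _ (G2_1 K))[_ /(_ j)]; rewrite e1 mulmx1 -rowE !mxE.
exists c^-1; split => //; [exact: FinfV | by rewrite invr_eq0 |].
have := congr1 (fun m => abs (\det m)) ei; rewrite det_mulmx det1 absM abs1 => ed.
apply: le_anti; rewrite integral_det //=; rewrite -ed.
by rewrite ler_piMr // integral_det.
Qed.

Lemma act_vtx0_eq g h : G2 g -> G2 h -> act g v0 = act h v0 <-> K0 (invmx g *m h).
Proof.
move=> gg gh; have ug := G2_unit gg; have uh := G2_unit gh; have gi := G2M (G2V gg) gh.
split=> [e|k]; first by apply: fix_K0 => //; rewrite -act_vertexM ?unitmx_inv // -e act_vertexK.
by rewrite -{1}(K0_fix gi k) -act_vertexM ?unitmx_inv // act_vertexVK.
Qed.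

Lemma act_vtx0_K0 g k : G2 g -> G2 k -> K0 k -> act (g *m k) v0 = act g v0.
Proof. by move=> gg gk kk; rewrite -act_vertexM ?G2_unit // K0_fix. Qed.

(** These translations extend v_n to all integers; [vz] runs through the line from 0 to infinity. *)
Definition shift (i : int) : 'M[K]_2 := mk2 (T ^ i) 0 0 1.
Definition vz (i : int) := act (shift i) v0.
Definition flip : 'M[K]_2 := mk2 0 1 1 0.

Lemma Texp_neq0 (i : int) : T ^ i != 0.
Proof. by rewrite expfz_neq0 // T_neq0. Qed.

Lemma TexpD (i j : int) : T ^ (i + j) = T ^ i * T ^ j.
Proof. by rewrite expfzDr // T_neq0. Qed.

Lemma G2_shift i : G2 (shift i).
Proof.
apply: G2_mk2; rewrite ?mulr1 ?mul0r ?subr0 ?Texp_neq0 //; try exact: Finf0; try exact: Finf1.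
exact: Finf_Texp.
Qed.

Lemma G2_flip : G2 flip.
Proof.
apply: G2_mk2; try exact: Finf0; try exact: Finf1.
by rewrite mul0r mulr1 sub0r oppr_eq0 oner_neq0.
Qed.

Lemma shiftD i j : shift i *m shift j = shift (i + j).
Proof. by apply: mx2P; rewrite mulmx2 !mk2E ?TexpD; ring. Qed.

Lemma shift0 : shift 0 = 1%:M.
Proof. by apply: mx2P; rewrite !mxE. Qed.

Lemma shiftV i : invmx (shift i) = shift (- i).
Proof. by apply: invmx_mul; rewrite shiftD subrr shift0. Qed.

Lemma vz0 : vz 0 = v0. Proof. by rewrite /vz shift0 act_vertex1. Qed.

Lemma act_shift i j : act (shift i) (vz j) = vz (i + j).
Proof. by rewrite /vz act_vertexM ?shiftD //; apply: G2_unit; exact: G2_shift. Qed.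

Lemma vtxE (i : nat) : vtx K i = vz i.
Proof.
rewrite /vz act_vtx0 shiftV /vtx; congr (homothety_class (lattice_of _)).
by apply: mx2P; rewrite mxE ?mk2E ?mxE //= pi_inf_def exprVn exprnN.
Qed.

Lemma flip_vz i : act flip (vz i) = vz (- i).
Proof.
have gs := G2_shift; have gf := G2_flip.
rewrite /vz act_vertexM ?G2_unit //; apply/esym/act_vtx0_eq => //; first exact: G2M.
rewrite shiftV opprK; exists (T ^ (- i)); split; [exact: Finf_Texp | exact: Texp_neq0 | |].
  by apply: ord2P; apply: ord2P; rewrite scaleE !mulmx2 !mk2E ?(mul0r, mulr0, add0r, addr0, mulr1, mul1r, abs0, ler01) //
    -?TexpD ?addNr ?expr0z ?abs1.
rewrite detZ !det_mulmx !det_mk2 !(mul0r, mulr0, mulr1, subr0, sub0r, mulNr, mulrN, mul1r).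
rewrite absN expr2 -!TexpD (_ : _ + _ = 0) ?expr0z ?abs1 //; lia.
Qed.

(* Vertices of the tree correspond to balls x + T^i O of F_infinity. *)
Definition ball_mx x (i : int) : 'M[K]_2 := mk2 (T ^ i) x 0 1.
Definition ball x i := act (ball_mx x i) v0.

Lemma vz_ball i : vz i = ball 0 i. Proof. by []. Qed.

Lemma G2_ball x i : Finf x -> G2 (ball_mx x i).
Proof.
move=> fx; apply: G2_mk2; rewrite ?mulr1 ?mulr0 ?subr0 ?Texp_neq0 //; try exact: Finf0; try exact: Finf1.
exact: Finf_Texp.
Qed.

Lemma ballV x i : invmx (ball_mx x i) = mk2 (T ^ (- i)) (- (T ^ (- i) * x)) 0 1.
Proof.
have e : T ^ i * T ^ (- i) = 1 by rewrite -TexpD subrr expr0z.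
apply: invmx_mul; apply: mx2P; rewrite mulmx2 !mk2E !mxE /= ?mulr0 ?mul0r ?mulr1 ?addr0 ?add0r //.
by rewrite mulrN mulrA e mul1r addrC subrr.
Qed.

Lemma ball_eq x y i j : Finf x -> Finf y ->
  ball x i = ball y j <-> i = j /\ abs (x - y) <= q ^ i.
Proof.
move=> fx fy; have gx := G2_ball i fx; have gy := G2_ball j fy.
rewrite /ball act_vtx0_eq // ballV.
set k := _ *m _; have k00 : k 0 0 = T ^ (j - i) by rewrite mulmx2 !mk2E mulr0 addr0 -TexpD addrC.
have k01 : k 0 1 = T ^ (- i) * (y - x) by rewrite mulmx2 !mk2E; ring.
have k10 : k 1 0 = 0 by rewrite mulmx2 !mk2E; ring.
have k11 : k 1 1 = 1 by rewrite mulmx2 !mk2E; ring.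
have ayx : (abs (T ^ (- i) * (y - x)) <= 1) = (abs (x - y) <= q ^ i).
  by rewrite absM abs_Texp absB -ler_pdivlMl ?exprz_gt0 // mulr1 invr_expz opprK.
split=> [[c [fc c0 ic dc]]|[ij xy]].
  have := ic 0 0; have := ic 0 1; have := ic 1 1; rewrite !scaleE k00 k01 k11 mulr1 => h1 h2 h3.
  move: dc; rewrite det2 !scaleE k00 k01 k10 k11 !mulr0 subr0 mulr1 absM => dc.
  have ac : abs c = 1 by apply: le_anti; rewrite h1 /= -dc ler_piMl.
  move: dc; rewrite ac mulr1 absM ac mul1r abs_Texp -(expr0z q) => /q_exprz_inj e.
  have ij : i = j by lia.
  by split=> //; rewrite -ayx; move: h2; rewrite absM ac mul1r.
exists 1; split; [exact: Finf1 | exact: oner_neq0 | | ].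
  rewrite scale1r; apply: ord2P; apply: ord2P; rewrite ?k00 ?k01 ?k10 ?k11 ?abs0 ?abs1 //.
    by rewrite ij subrr expr0z abs1.
  by rewrite ayx.
by rewrite scale1r det2 k00 k01 k10 k11 ij subrr expr0z mulr0 subr0 mulr1 abs1.
Qed.

(** Iwasawa decomposition. The larger entry e of the bottom row fixes the scaling, and x is the
    quotient of the two entries in its column. *)
Lemma iwasawa m : G2 m -> exists x i, Finf x /\ act m v0 = ball x i.
Proof.
move=> gm; have [um fm] := gm; have d0 := det_neq0 gm; have fd := Finf_det gm.
have key (x e : K) : Finf x -> Finf e -> e != 0 -> abs (m 1 0) <= abs e -> abs (m 1 1) <= abs e ->
    abs (m 0 0 - x * m 1 0) <= abs (\det m / e) -> abs (m 0 1 - x * m 1 1) <= abs (\det m / e) ->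
    exists x i, Finf x /\ act m v0 = ball x i.
  move=> fx fe e0 h0 h1 h2 h3; have ae : 0 < abs e by rewrite abs_gt0.
  have [||i ei] := @Finf_val _ _ _ (\det m / e ^+ 2).
  - by apply: FinfM => //; apply: FinfV; exact: FinfX.
  - by rewrite mulf_neq0 ?invr_eq0 ?expf_neq0.
  exists x, i; split=> //; apply/esym; rewrite act_vtx0_eq //; last exact: G2_ball.
  rewrite ballV; set k := _ *m _.
  have k0 j : k 0 j = T ^ (- i) * (m 0 j - x * m 1 j) by rewrite mulmx2 !mk2E; ring.
  have k1 j : k 1 j = m 1 j by rewrite mulmx2 !mk2E; ring.
  have aT : abs (T ^ (- i)) = abs e ^+ 2 / abs (\det m).
    by rewrite abs_Texp -invr_expz -ei abs_div absX invf_div.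
  have ad : 0 < abs (\det m) by rewrite abs_gt0.
  have top j : abs (m 0 j - x * m 1 j) <= abs (\det m / e) -> abs (e^-1 * k 0 j) <= 1.
    rewrite abs_div k0 !absM aT absV => H.
    rewrite ler_pdivlMr // in H.
    have -> : (abs e)^-1 * (abs e ^+ 2 / abs (\det m) * abs (m 0 j - x * m 1 j)) =
      (abs (m 0 j - x * m 1 j) * abs e) / abs (\det m) by field; rewrite !gt_eqF.
    by rewrite ler_pdivrMr // mul1r.
  have bot j : abs (m 1 j) <= abs e -> abs (e^-1 * k 1 j) <= 1.
    by move=> H; rewrite k1 absM absV ler_pdivrMl // mulr1.
  exists e^-1; split; [exact: FinfV | by rewrite invr_eq0 | |].
    by apply: ord2P; apply: ord2P; rewrite scaleE ?top ?bot.
  rewrite detZ det_mulmx det_mk2 mulr0 subr0 mulr1 !absM aT !absV.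
  by field; rewrite !gt_eqF.
have [c1|c1] := leP (abs (m 1 0)) (abs (m 1 1)).
  have e0 : m 1 1 != 0.
    apply: contraNneq d0 => e0; move: c1; rewrite e0 abs0 => c1.
    have : abs (m 1 0) == 0 by rewrite eq_le c1 abs_ge0.
    by rewrite abs_eq0 => /eqP e1; rewrite det2 e0 e1 !mulr0 subr0.
  apply: (key (m 0 1 / m 1 1) (m 1 1)) => //; first by apply: FinfM => //; exact: FinfV.
    by rewrite (_ : _ - _ = \det m / m 1 1) // det2; field.
  by rewrite divfK // subrr abs0.
have e0 : m 1 0 != 0 by rewrite -abs_gt0 (le_lt_trans _ c1).
apply: (key (m 0 0 / m 1 0) (m 1 0)) => //; try exact: ltW.
- by apply: FinfM => //; exact: FinfV.
- by rewrite divfK // subrr abs0.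
by rewrite (_ : _ - _ = - (\det m / m 1 0)) ?absN // det2; field.
Qed.


(** GL_2(F_infinity) is transitive on oriented edges. The base changes X and Y = pi X^-1 are
    integral with determinants that are not units, so both determinants have absolute value 1/q and
    Y has a unit entry. A matrix of GL_2(O_infinity) with the column of this entry as first column
    brings both lattices into standard position. *)
Lemma adjacentP v w : adjacent v w -> exists m, [/\ G2 m, v = act m v0 & w = act m (vz 1)].
Proof.
move=> [L [L' [[g gg ->] [g' gg' ->] -> -> [[sub1 nsub1] [sub2 nsub2]]]]].
have ug := G2_unit gg; have ug' := G2_unit gg'.
have dl (i : 'I_2) j : Finf (delta_mx (0 : 'I_1) i 0 j : K).
  by rewrite mxE; case: andP => _; [exact: Finf1|exact: Finf0].
have dl1 (i : 'I_2) j : abs (delta_mx (0 : 'I_1) i 0 j : K) <= 1.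
  by rewrite mxE; case: andP => _; rewrite ?abs1 ?abs0.
have rowP h i : G2 h -> lattice_of h (delta_mx (0 : 'I_1) i *m h).
  move=> gh; apply/(mem_lattice _ gh); split=> j; first by rewrite -rowE mxE; exact: G2_Finf.
  by rewrite mulmxK ?G2_unit.
pose X := g' *m invmx g; have gX : G2 X by apply: G2M => //; exact: G2V.
have iX : integral X.
  move=> i j; have /(mem_lattice _ gg)[_ /(_ j)] := sub2 _ (rowP g' i gg').
  by rewrite -mulmxA -rowE mxE.
have pi0 : pi_inf K != 0 by rewrite pi_inf_def invr_eq0 T_neq0.
have api : abs (pi_inf K) = q^-1 by rewrite pi_inf_def absV abs_T.
have fpi : Finf (pi_inf K) by rewrite pi_inf_def; apply/FinfV/Finf_T.
pose Y := pi_inf K *: (g *m invmx g').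
have iY : integral Y.
  move=> i j; have : scale_lattice (pi_inf K) (lattice_of g) (pi_inf K *: (delta_mx (0 : 'I_1) i *m g)).
    by exists (delta_mx (0 : 'I_1) i *m g) => //; exact: rowP.
  move=> /sub1 /(mem_lattice _ gg')[_ /(_ j)].
  by rewrite -scalemxAl -mulmxA -rowE !mxE.
have gY : G2 Y by apply: G2Z => //; apply: G2M => //; exact: G2V.
have XY : X *m Y = pi_inf K *: 1%:M.
  by rewrite /X /Y -scalemxAr mulmxA mulmxKV // mulmxV.
have dXY : abs (\det X) * abs (\det Y) = q ^ (-2).
  by rewrite -absM -det_mulmx XY detZ det1 mulr1 absX api expr2 -exprnN expr2 invfM.
have dX1 : abs (\det X) < 1.
  rewrite lt_neqAle integral_det // andbT; apply/eqP => d1; apply: nsub2.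
  move=> x /(mem_lattice _ gg)[fx x1]; apply/(mem_lattice _ gg'); split=> // j.
  have -> : x *m invmx g' = x *m invmx g *m invmx X.
    by rewrite /X invmx_prod ?unitmx_inv // invmxK mulmxA mulmxKV.
  by rewrite mulmx2; apply: absD_le; rewrite absM mulr_ile1 // integralV.
have dY1 : abs (\det Y) < 1.
  rewrite lt_neqAle integral_det // andbT; apply/eqP => d1; apply: nsub1.
  move=> x /(mem_lattice _ gg')[fx x1]; exists ((pi_inf K)^-1 *: x); last by rewrite scalerA mulfV // scale1r.
  apply/(mem_lattice _ gg); split=> j; first by rewrite mxE; apply: FinfM => //; exact: FinfV.
  have -> : (pi_inf K)^-1 *: x *m invmx g = x *m invmx g' *m invmx Y.
    have -> : invmx Y = (pi_inf K)^-1 *: (g' *m invmx g).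
      apply: invmx_mul; rewrite -scalemxAl -scalemxAr scalerA mulfV // scale1r.
      by rewrite mulmxA mulmxKV // mulmxV.
    by rewrite -scalemxAr mulmxA mulmxKV // scalemxAl.
  by rewrite mulmx2; apply: absD_le; rewrite absM mulr_ile1 // integralV.
have [i ei] := Finf_val (Finf_det gX) (det_neq0 gX).
have [j ej] := Finf_val (Finf_det gY) (det_neq0 gY).
have dY : abs (\det Y) = q ^ (-1).
  move: dXY dX1 dY1; rewrite ei ej -expfzDr ?gt_eqF // -(expr0z q) !q_exprz_lt => /q_exprz_inj *.
  by congr (_ ^ _); lia.
have Yval a b : Y a b != 0 -> abs (Y a b) < 1 -> abs (Y a b) <= q ^ (-1).
  move=> n0; have [l ->] := Finf_val (G2_Finf a b gY) n0.
  by rewrite -(expr0z q) q_exprz_lt q_exprz_le; lia.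
have [a [b Yab]] : exists a b, abs (Y a b) = 1.
  apply: contrapT => H.
  have le1 a b : abs (Y a b) <= q ^ (-1).
    have [->|n0] := eqVneq (Y a b) 0; first by rewrite abs0 ltW // exprz_gt0.
    apply: Yval => //; rewrite lt_neqAle iY andbT; apply/eqP => e; apply: H; by exists a, b.
  have : abs (\det Y) <= q ^ (-1) * q ^ (-1).
    by rewrite det2; apply: absB_le; rewrite absM ler_pM.
  by rewrite dY -expfzDr ?gt_eqF // q_exprz_le.
have [fY0 fY1] : Finf (Y 0 b) /\ Finf (Y 1 b) by split; exact: G2_Finf.
(* Column b of Y is primitive: complete it to a matrix kap of GL_2(O). *)
have [kap [ik fk dk ckap]] : exists kap : 'M[K]_2, [/\ integral kap, forall i j, Finf (kap i j),
    abs (\det kap) = 1 & forall i, kap i 0 = Y i b].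
  have i01 : abs (0 : K) <= 1 by rewrite abs0 ler01.
  have i11 : abs (1 : K) <= 1 by rewrite abs1.
  move: Yab; move: a; apply: ord2P => Yab.
    exists (mk2 (Y 0 b) 0 (Y 1 b) 1); split.
    - by apply: ord2P; apply: ord2P; rewrite mk2E ?iY.
    - by apply: ord2P; apply: ord2P; rewrite mk2E //; [exact: Finf0|exact: Finf1].
    - by rewrite det_mk2 mul0r subr0 mulr1.
    - by apply: ord2P; rewrite mk2E.
  exists (mk2 (Y 0 b) 1 (Y 1 b) 0); split.
  - by apply: ord2P; apply: ord2P; rewrite mk2E ?iY.
  - by apply: ord2P; apply: ord2P; rewrite mk2E //; [exact: Finf1|exact: Finf0].
  - by rewrite det_mk2 mulr0 sub0r mul1r absN.
  - by apply: ord2P; rewrite mk2E.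
have uk : kap \in unitmx by rewrite unitmxE unitfE -abs_gt0 dk.
have gk : G2 kap by split.
have Kk : K0 kap by exists 1; rewrite scale1r oner_neq0; split => //; exact: Finf1.
exists (invmx g *m kap); split; first by apply: G2M => //; exact: G2V.
  by rewrite act_vtx0_K0 ?act_vtx0 ?invmxK //; exact: G2V.
have -> : homothety_class (lattice_of g') = act (invmx g') v0 by rewrite act_vtx0 invmxK.
rewrite /vz act_vertexM ?unitmx_mul ?unitmx_inv ?ug ?uk //; last exact: G2_unit (G2_shift _).
apply/esym/act_vtx0_eq.
- apply: G2M; last exact: G2_shift.
  by apply: G2M => //; exact: G2V.
- exact: G2V.
pose Z := invmx kap *m Y.
have iZ : integral Z by apply: integralM => //; apply: integralV.
have Zb : forall i, Z i b = (i == 0)%:R.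
  have : invmx kap *m kap = 1%:M by rewrite mulVmx.
  move=> /matrixP H i'; have := H i' 0; rewrite !mulmx2 !ckap mxE => ->.
  by rewrite mxE.
have dZ : abs (\det Z) = q ^ (-1) by rewrite det_mulmx absM det_inv absV dk invr1 mul1r.
have -> : invmx (invmx g *m kap *m shift 1) *m invmx g' = T *: (shift (-1) *m Z).
  rewrite invmx_prod ?unitmx_mul ?unitmx_inv ?ug ?uk //; last exact: G2_unit (G2_shift _).
  rewrite invmx_prod ?unitmx_inv // invmxK shiftV /Z /Y pi_inf_def -!scalemxAr scalerA.
  by rewrite mulfV ?T_neq0 // scale1r !mulmxA.
have W0 j' : (T *: (shift (-1) *m Z)) 0 j' = Z 0 j'.
  rewrite scaleE mulmx2 !mk2E mul0r addr0 mulrA.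
  by rewrite (_ : T * T ^ (-1) = 1) ?mul1r // exprN1 mulfV ?T_neq0.
have W1 j' : (T *: (shift (-1) *m Z)) 1 j' = T * Z 1 j'.
  by rewrite scaleE mulmx2 !mk2E mul0r add0r mul1r.
exists 1; rewrite scale1r oner_neq0; split => //; first exact: Finf1; last first.
  rewrite detZ det_mulmx det_mk2 mul0r subr0 mulr1 !absM dZ abs_T abs_Texp exprN1.
  by field; rewrite gt_eqF.
have aZ1 j' : abs (T * Z 1 j') <= 1.
  have [->|jb] := eqVneq j' b; first by rewrite Zb mulr0 abs0.
  suff e : abs (Z 1 j') = q ^ (-1) by rewrite absM e abs_T exprN1 mulfV ?gt_eqF.
  rewrite -dZ det2; move: jb Zb; move: b {Yab fY0 fY1 ckap} j'.
  apply: ord2P; apply: ord2P => // _ Zb.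
    by rewrite !Zb /= mul1r mulr0 subr0.
  by rewrite !Zb /= mulr0 sub0r mul1r absN.
by apply: ord2P => j'; rewrite ?W0 ?W1 ?iZ.
Qed.

Lemma adjacent_shift : adjacent v0 (vz 1).
Proof.
exists (lattice_of 1%:M), (lattice_of (shift (-1))); split.
- by exists 1%:M => //; exact: G2_1.
- by exists (shift (-1)) => //; exact: G2_shift.
- exact: vtx0E.
- by rewrite /vz act_vtx0 shiftV.
have gs := G2_shift (-1); have g1 := G2_1 K.
have e1 : invmx (1%:M : 'M[K]_2) = 1%:M by apply: invmx_mul; rewrite mulmx1.
have s0 (x : 'rV[K]_2) : (x *m shift 1) 0 0 = T * x 0 0 by rewrite mulmx2 !mk2E expr1z; ring.
have s1 (x : 'rV[K]_2) : (x *m shift 1) 0 1 = x 0 1 by rewrite mulmx2 !mk2E; ring.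
have api : abs (pi_inf K) < 1 by rewrite pi_inf_def absV abs_T invf_lt1.
have piT : T * pi_inf K = 1 by rewrite pi_inf_def mulfV // T_neq0.
have P1 (x : 'rV[K]_2) : lattice_of 1%:M x <-> (forall j, Finf (x 0 j)) /\ forall j, abs (x 0 j) <= 1.
  by rewrite (mem_lattice _ g1) e1 mulmx1.
have P2 (x : 'rV[K]_2) : lattice_of (shift (-1)) x <-> (forall j, Finf (x 0 j)) /\ (abs (T * x 0 0) <= 1 /\ abs (x 0 1) <= 1).
  rewrite (mem_lattice _ gs) shiftV opprK; split=> -[fx H]; split=> //.
    by split; [rewrite -s0 | rewrite -s1].
  by case: H => h0 h1; apply: ord2P; rewrite ?s0 ?s1.
have d0 j : Finf (delta_mx (0 : 'I_1) (0 : 'I_2) 0 j : K) by rewrite mxE; case: andP => _; [exact: Finf1|exact: Finf0].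
have d1 j : Finf (delta_mx (0 : 'I_1) (1 : 'I_2) 0 j : K) by rewrite mxE; case: andP => _; [exact: Finf1|exact: Finf0].
split; split.
- move=> _ [x /P1[fx x1] <-]; apply/P2; split=> [j|].
    by rewrite mxE; apply: FinfM => //; rewrite pi_inf_def; apply/FinfV/Finf_T.
  rewrite !mxE mulrA piT mul1r x1; split=> //.
  by rewrite absM mulr_ile1 // ltW.
- move=> H; have : lattice_of (shift (-1)) (delta_mx (0 : 'I_1) (1 : 'I_2)).
    by apply/P2; split=> //; rewrite !mxE /= mulr0 abs0 abs1.
  move=> /H[x /P1[_ x1] /matrixP/(_ 0 1)]; rewrite !mxE /= => /(congr1 abs).
  rewrite absM abs1 => e; have := x1 1; have := abs_ge0 (x 0 1); have := abs_ge0 (pi_inf K); nra.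
- move=> x /P2[fx [x0 x1]]; apply/P1; split=> //; apply: ord2P => //.
  apply: le_trans x0; rewrite absM abs_T ler_peMl // ltW //.
- move=> H; have : lattice_of (K := K) 1%:M (delta_mx (0 : 'I_1) (0 : 'I_2)).
    apply/P1; split=> // j; rewrite mxE; case: andP => _; rewrite ?abs1 ?abs0 //.
  by move=> /H/P2[_ []]; rewrite !mxE /= mulr1 abs_T leNgt q_gt1.
Qed.

Lemma adjacent_act g v w : G2 g -> adjacent v w -> adjacent (act g v) (act g w).
Proof.
move=> gg [L [L' [[h gh ->] [h' gh' ->] -> -> H]]].
have ug := G2_unit gg.
exists (act_lattice g (lattice_of h)), (act_lattice g (lattice_of h')); split.
- by rewrite act_lattice_of; exists (h *m invmx g) => //; apply: G2M => //; exact: G2V.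
- by rewrite act_lattice_of; exists (h' *m invmx g) => //; apply: G2M => //; exact: G2V.
- exact: act_homothety.
- exact: act_homothety.
have inj (A B : set 'rV[K]_2) : act_lattice g A `<=` act_lattice g B -> A `<=` B.
  move=> s x Ax; have [|y By] := s (x *m invmx g); first by exists x.
  by move=> /(can_inj (mulmxKV ug)) <-.
rewrite -act_lattice_scale; case: H => -[s1 n1] [s2 n2]; split; split.
- by move=> _ [x /s1 sx <-]; exists x.
- by move=> /inj.
- by move=> _ [x /s2 sx <-]; exists x.
- by move=> /inj.
Qed.

Lemma adjacent_vz m i : G2 m -> adjacent (act m (vz i)) (act m (vz (i + 1))).
Proof.
move=> gm; have := adjacent_act (G2M gm (G2_shift i)) adjacent_shift.
have us := G2_unit (G2_shift i).
have e j : act (m *m shift i) (vz j) = act m (vz (i + j)).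
  by rewrite -act_vertexM ?act_shift // G2_unit.
by rewrite -vz0 !e addr0.
Qed.

(** Neighbours are the next larger ball or a maximal smaller ball. After writing the edge as
    [ball_mx x i *m k] with k in K0, the cases depend on whether the lower left entry of the
    normalized k is a unit. *)
Lemma ball_neighbor x i w : Finf x -> adjacent (ball x i) w ->
  w = ball x (i + 1) \/ exists y, [/\ Finf y, w = ball y (i - 1) & ball y i = ball x i].
Proof.
move=> fx /adjacentP[m [gm em ->]]; have gB := G2_ball i fx; have uB := G2_unit gB.
have um := G2_unit gm.
have [k [gk -> +]] : exists k, [/\ G2 k, m = ball_mx x i *m k & K0 k].
  exists (invmx (ball_mx x i) *m m); split; last exact/act_vtx0_eq.
    by apply: G2M => //; exact: G2V.
  by rewrite mulKVmx.
have uk := G2_unit gk; have us := G2_unit (G2_shift 1).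
rewrite /vz act_vertexM ?unitmx_mul ?uB //.
move=> [c [fc c0 ic dc]].
have Tinv : T * T ^ (-1) = 1 by rewrite exprN1 mulfV // T_neq0.
have [c1|c1] := eqVneq (abs (c * k 1 0)) 1; [right|left]; last first.
  have lt1 : abs (c * k 1 0) < 1 by rewrite lt_neqAle c1 -scaleE ic.
  have le1 : abs (T * (c * k 1 0)) <= 1.
    by apply: Fclosure_shift => //; apply/FinfP/FinfM => //; exact: G2_Finf.
  have eB : ball_mx x (i + 1) = ball_mx x i *m shift 1.
    by apply: mx2P; rewrite mulmx2 !mk2E ?TexpD; ring.
  apply/esym; rewrite /ball eB; apply/act_vtx0_eq; try by apply: G2M => //; try exact: G2M; exact: G2_shift.
  have -> : invmx (ball_mx x i *m shift 1) *m (ball_mx x i *m k *m shift 1) = shift (-1) *m k *m shift 1.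
    by rewrite invmx_prod // shiftV -!mulmxA mulKmx.
  exists c; split => //; last first.
    rewrite -dc !detZ !det_mulmx !det_mk2 mul0r !subr0 !mulr1; congr (abs (_ * _)).
    by rewrite mulrAC -TexpD addNr expr0z mul1r.
  have h := ic; move: (h 0 0) (h 0 1) (h 1 1); rewrite !scaleE => h00 h01 h11.
  apply: ord2P; apply: ord2P; rewrite scaleE !mulmx2 !mk2E !(mul0r, mulr0, add0r, addr0, mulr1, mul1r) //.
  - rewrite expr1z (_ : c * _ = (T * T ^ (-1)) * (c * k 0 0)); last by ring.
    by rewrite Tinv mul1r.
  - rewrite mulrCA absM abs_Texp exprN1; apply: mulr_ile1 => //.
      by rewrite invr_ge0 ltW.
    by rewrite invf_le1 // ltW.
  - by rewrite mulrA mulrC expr1z.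
have k10 : k 1 0 != 0 by apply: contra_eq_neq c1 => ->; rewrite mulr0 abs0 eq_sym oner_neq0.
pose y := x + T ^ i * (k 0 0 / k 1 0).
have fy : Finf y.
  apply: FinfD => //; apply: FinfM; first exact: Finf_Texp.
  by apply: FinfM; [exact: G2_Finf | apply: FinfV; exact: G2_Finf].
have gB' := G2_ball (i - 1) fy.
have ack : abs (k 0 0 / k 1 0) <= 1.
  have -> : k 0 0 / k 1 0 = (c * k 0 0) / (c * k 1 0) by field; rewrite c0 k10.
  by rewrite abs_div c1 divr1 -scaleE ic.
exists y; split => //; last first.
  apply/ball_eq => //; split=> //; have -> : y - x = T ^ i * (k 0 0 / k 1 0) by rewrite /y; ring.
  by rewrite absM abs_Texp ler_piMr ?exprz_ge0 // ltW.
apply/esym; rewrite /ball; apply/act_vtx0_eq => //.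
  by apply: G2M; [exact: G2M | exact: G2_shift].
rewrite ballV; set B' := mk2 _ _ _ _.
have eT : T ^ (- (i - 1)) * T ^ i = T by rewrite -TexpD (_ : _ + _ = 1) ?expr1z //; lia.
have e : B' *m (ball_mx x i *m k *m shift 1) =
    mk2 0 (- (T * \det k / k 1 0)) (k 1 0 * T) (k 1 1).
  have eB : B' *m ball_mx x i = mk2 T (- (T * (k 0 0 / k 1 0))) 0 1.
    apply: mx2P; rewrite mulmx2 !mk2E; try ring; first by rewrite mulr0 addr0 eT.
    rewrite /y; transitivity (- ((T ^ (- (i - 1)) * T ^ i) * (k 0 0 / k 1 0))); last by rewrite eT.
    by ring.
  rewrite !mulmxA eB; apply: mx2P; rewrite !mulmx2 !mk2E ?expr1z ?det2; first [by field; exact: k10 | by field | by ring].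
rewrite e; exists (c * T ^ (-1)); split.
- by apply: FinfM => //; exact: Finf_Texp.
- by rewrite mulf_neq0 // Texp_neq0.
- have ad : abs (c * (\det k / k 1 0)) = 1.
    have -> : c * (\det k / k 1 0) = (c ^+ 2 * \det k) / (c * k 1 0) by field; rewrite c0 k10.
    by rewrite abs_div c1 divr1 -dc detZ.
  have h11 := ic 1 1; rewrite scaleE in h11.
  apply: ord2P; apply: ord2P; rewrite scaleE mk2E.
  + by rewrite mulr0 abs0.
  + have -> : c * T ^ (-1) * - (T * \det k / k 1 0) = - ((T * T ^ (-1)) * (c * (\det k / k 1 0))) by ring.
    by rewrite Tinv mul1r absN ad.
  + have -> : c * T ^ (-1) * (k 1 0 * T) = (T * T ^ (-1)) * (c * k 1 0) by ring.
    by rewrite Tinv mul1r c1.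
  + rewrite mulrAC absM mulr_ile1 // abs_Texp exprN1 invf_le1 // ltW //.
rewrite detZ det_mk2 mul0r sub0r.
have gen (S t d : K) : (c * S) ^+ 2 * - (- (t * d / k 1 0) * (k 1 0 * t)) = (t * S) ^+ 2 * (c ^+ 2 * d) by field.
by rewrite gen Tinv expr1n mul1r -dc detZ.
Qed.

End Tree.

(** * Geodesics, the points over vertices and edges, and the equality case of the weight *)

Section Geodesics.

Variables (Fq : finFieldType) (R : realType) (K : valued_ext Fq R).
Local Notation abs := (vabs K).
Local Notation q := (#|Fq|%:R : R).
Local Notation T := (Defs.iota K (AtoF 'X)).
Local Notation emb := (Defs.iota K).
Local Notation im := (@vabs_i Fq R K).
Local Notation Omega := (@Omega Fq R K).
Local Notation Finf := (@Finf Fq R K).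
Local Notation G2 := (@GL2Finf Fq R K).
Local Notation v0 := (vtx K 0).
Local Notation act := (@act_vertex Fq R K).
Local Notation vz := (@vz Fq R K).
Local Notation shift := (@shift Fq R K).
Local Notation flip := (@flip Fq R K).
Local Notation ball := (@ball Fq R K).
Implicit Types (z : K) (g h m : 'M[K]_2).

Lemma upper_vz g : G2 g -> g 1 0 = 0 -> exists x s, Finf x /\ forall j, act g (vz j) = ball x (j + s).
Proof.
move=> gg g10; have ug := G2_unit gg; have d0 := det_neq0 gg.
have e : \det g = g 0 0 * g 1 1 by rewrite det2 g10 mulr0 subr0.
have n0 : g 0 0 != 0 by apply: contraNneq d0; rewrite e => ->; rewrite mul0r.
have n1 : g 1 1 != 0 by apply: contraNneq d0; rewrite e => ->; rewrite mulr0.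
have f00 := G2_Finf 0 0 gg; have f11 := G2_Finf 1 1 gg.
have [||s es] := @Finf_val _ _ _ (g 0 0 / g 1 1).
- by apply: FinfM => //; exact: FinfV.
- by rewrite mulf_neq0 ?invr_eq0.
have fx : Finf (g 0 1 / g 1 1) by apply: FinfM; [exact: G2_Finf | exact: FinfV].
exists (g 0 1 / g 1 1), s; split=> // j; have gs := G2_shift K j; have us := G2_unit gs.
have gB := G2_ball (j + s) fx.
apply/esym; rewrite /vz act_vertexM //; apply/act_vtx0_eq => //; first exact: G2M.
rewrite ballV; set k := _ *m _.
have k00 : k 0 0 = T ^ (- s) * g 0 0.
  have -> : k 0 0 = T ^ (- (j + s)) * T ^ j * g 0 0 by rewrite mulmx2 !mulmx2 !mk2E g10; ring.
  by rewrite -TexpD (_ : - (j + s) + j = - s) //; lia.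
have k01 : k 0 1 = 0 by rewrite mulmx2 !mulmx2 !mk2E g10; field.
have k10 : k 1 0 = 0 by rewrite mulmx2 !mulmx2 !mk2E g10; ring.
have k11 : k 1 1 = g 1 1 by rewrite mulmx2 !mulmx2 !mk2E g10; ring.
have e0 : abs ((g 1 1)^-1 * k 0 0) = 1.
  rewrite k00 mulrCA [_^-1 * _]mulrC absM es abs_Texp -expfzDr ?gt_eqF //.
  by rewrite addNr expr0z.
have e1 : (g 1 1)^-1 * k 1 1 = 1 by rewrite k11 mulVf.
exists (g 1 1)^-1; split; [exact: FinfV | by rewrite invr_eq0 | |].
  by apply: ord2P; apply: ord2P; rewrite scaleE ?e0 ?e1 ?k01 ?k10 ?mulr0 ?abs0 ?abs1.
by rewrite det2 !scaleE e1 k01 mulr0 mul0r subr0 mulr1 e0.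
Qed.

(* A half-line that goes down once goes down for ever, and the tail of the
   line goes up. *)
Lemma line_unique (y : int -> vertex K) : injective y ->
  (forall n, adjacent (y n) (y (n + 1))) ->
  has_end (fun n => y (- n%:Z)) (Some 0) -> has_end (fun n => y n%:Z) None ->
  exists s, forall n, y n = vz (n + s).
Proof.
move=> y_inj adj end0 endoo.
pose up n := exists x l, [/\ Finf x, y n = ball x l & y (n + 1) = ball x (l + 1)].
pose down n := exists x l, [/\ Finf x, y n = ball x l & y (n + 1) = ball x (l - 1)].
have updown n : up n \/ down n.
  have [m [gm em _]] := adjacentP (adj n); have [x [l [fx ex]]] := iwasawa gm.
  have eyn : y n = ball x l by rewrite em ex.
  have := adj n; rewrite eyn => /(ball_neighbor fx)[e|[x' [fx' e e']]].
    by left; exists x, l.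
  by right; exists x', l; rewrite e' eyn.
have down1 n : down n -> down (n + 1).
  move=> [x [l [fx e1 e2]]]; case: (updown (n + 1)) => // -[x' [l' [fx' e1' e2']]].
  have := e1'; rewrite e2 => /(ball_eq _ _ fx fx')[el xx].
  have : y n = y (n + 1 + 1).
    rewrite e1 e2'; apply/(ball_eq _ _ fx fx'); split; first by lia.
    by apply: le_trans xx _; rewrite q_exprz_le; lia.
  by move=> /y_inj; lia.
have downS n (k : nat) : down n -> down (n + k%:Z).
  move=> dn; elim: k => [|k IH]; first by rewrite addr0.
  by rewrite -addn1 PoszD addrA; exact: down1.
have allup n : up n.
  case: (updown n) => // dn; have [g [gg eg [m [p H]]]] := endoo.
  have g10 : g 1 0 = 0.
    by move: eg; rewrite /= /hpoint; case: eqP.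
  have [x [s [fx Hx]]] := upper_vz gg g10.
  pose i := `|n|%N; have : down (m + i)%N%:Z.
    have -> : (m + i)%N%:Z = n + (absz ((m + i)%N%:Z - n))%:Z by lia.
    exact: downS.
  move=> [x' [l [fx' e1 e2]]].
  have h1 := H i; have h2 := H i.+1; rewrite !vtxE !Hx in h1 h2.
  have e : (m + i.+1)%N%:Z = (m + i)%N%:Z + 1 by lia.
  rewrite e e2 in h2; rewrite e1 in h1.
  have [k1 _] := (ball_eq _ _ fx' fx).1 h1; have [k2 _] := (ball_eq _ _ fx' fx).1 h2.
  lia.
have step n l : y n = vz l -> y (n + 1) = vz (l + 1).
  rewrite !vz_ball => e; have [x [l' [fx e1 e2]]] := allup n.
  move: e; rewrite e1 => /(ball_eq _ _ fx (Finf0 K))[el xx].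
  rewrite e2; apply/(ball_eq _ _ fx (Finf0 K)); split; first by lia.
  by apply: le_trans xx _; rewrite q_exprz_le; lia.
have [g [gg eg [m [p H]]]] := end0.
have g00 : g 0 0 = 0.
  move: eg; rewrite /= /hpoint; case: eqP => // /eqP g10 [] /eqP.
  by rewrite mulf_eq0 invr_eq0 (negbTE g10) orbF => /eqP.
have gf := G2_flip K; have uf := G2_unit gf; have gfg := G2M gf gg.
have [|x [s [fx Hx]]] := upper_vz gfg; first by rewrite mulmx2 !mk2E g00; ring.
have ff : flip *m flip = 1%:M by apply: mx2P; rewrite mulmx2 !mk2E mxE /=; ring.
have [i0 xi0] := @q_exprz_unbounded Fq R (abs x).
exists (m%:Z - s - p%:Z) => n; pose i := (absz n + absz i0 + absz s)%N.
(* Seen through [flip], the line near its end 0 is a chain of growing balls around x. Once they are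
   large enough to contain 0, they are the standard balls. *)
have base : y (- (m + i)%N%:Z) = vz (- s - p%:Z - i%:Z).
  rewrite H vtxE; have := Hx (p + i)%N%:Z; have -> : ball x ((p + i)%N%:Z + s) = vz ((p + i)%N%:Z + s).
    rewrite vz_ball; apply/(ball_eq _ _ fx (Finf0 K)); split=> //.
    by rewrite subr0; apply: le_trans (ltW xi0) _; rewrite q_exprz_le /i; lia.
  move=> /(congr1 (act flip)); rewrite flip_vz act_vertexM ?G2_unit // mulmxA ff mul1mx => ->.
  by congr (vz _); lia.
have walk (t : nat) : y (- (m + i)%N%:Z + t%:Z) = vz (- s - p%:Z - i%:Z + t%:Z).
  elim: t => [|t IH]; first by rewrite !addr0.
  have -> : t.+1%:Z = t%:Z + 1 by lia.
  by rewrite !addrA; exact: step.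
have := walk (absz (n + (m + i)%N%:Z)).
have -> : - (m + i)%N%:Z + (absz (n + (m + i)%N%:Z))%:Z = n by rewrite /i; lia.
by move=> ->; congr (vz _); rewrite /i; lia.
Qed.

(** Cells of translates of the standard line. This form is explicit enough for matrix computations;
    [geodesicP] links it to lines with given ends. *)
Definition geo (a b : P1 K) (c : set (vertex K)) := exists M n, [/\ G2 M, mob M (Some 0) = a,
  mob M None = b & c = [set act M (vz n)] \/ c = [set act M (vz n); act M (vz (n + 1))]].

Lemma has_end_act h x s : G2 h -> has_end x s -> has_end (fun i => act h (x i)) (mob h s).
Proof.
move=> gh [g [gg eg [m [p H]]]]; exists (h *m g); split; first exact: G2M.
  by rewrite mobM ?G2_unit // eg.
by exists m, p => i; rewrite H act_vertexM ?G2_unit.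
Qed.

Lemma vz_inj : injective vz.
Proof. by move=> i j; rewrite !vz_ball => /(ball_eq _ _ (Finf0 K) (Finf0 K))[]. Qed.

Lemma geodesicP a b c : P1Finf a -> P1Finf b -> a <> b -> geodesic a b c <-> geo a b c.
Proof.
move=> fa fb ab; split; last first.
  move=> [M [n [gM M0 Moo Hc]]]; have uM := G2_unit gM.
  exists (fun i => act M (vz i)); last by exists n.
  split.
  - by move=> i j /(act_vertex_inj uM)/vz_inj.
  - by move=> i; exact: adjacent_vz.
  - exists (M *m flip); split; [apply: G2M => //; exact: G2_flip | | ].
      rewrite mobM ?G2_unit //; last exact: G2_flip.
      by rewrite -M0 /= !mk2E /hpoint oner_eq0 divr1.
    exists 0%N, 0%N => i; rewrite -act_vertexM ?G2_unit //; last exact: G2_flip.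
    by rewrite vtxE flip_vz !add0n.
  - exists M; split => //; exists 0%N, 0%N => i; by rewrite !add0n vtxE.
move=> [x [x_inj adj enda endb] [n Hc]].
have [f1 f2] := P1FinfP fa; have [f3 f4] := P1FinfP fb.
pose M := frame a b; have uM : M \in unitmx by exact: frame_unit.
have gM : G2 M by split => //; apply: ord2P; apply: ord2P; rewrite mk2E.
have gV := G2V gM; have uV := G2_unit gV.
have [||||s Hs] := @line_unique (fun i => act (invmx M) (x i)).
- by move=> i j /(act_vertex_inj uV)/x_inj.
- by move=> i; exact: adjacent_act.
- by have := has_end_act gV enda; rewrite -{1}(frame0 a b) mobK.
- by have := has_end_act gV endb; rewrite -{1}(frame_inf a b) mobK.
have xE i : x i = act M (vz (i + s)) by rewrite -Hs act_vertexVK.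
exists M, (n + s); split; rewrite ?frame0 ?frame_inf //.
by rewrite addrAC -(xE n) -(xE (n + 1)).
Qed.

Lemma geo_act m a b c : G2 m -> geo a b c -> geo (mob m a) (mob m b) (act m @` c).
Proof.
move=> gm [M [n [gM M0 Moo Hc]]]; exists (m *m M), n; split.
- exact: G2M.
- by rewrite mobM ?G2_unit // M0.
- by rewrite mobM ?G2_unit // Moo.
- have um := G2_unit gm; have uM := G2_unit gM.
  by case: Hc => ->; [left | right]; rewrite ?image_setU !image_set1 !(act_vertexM _ um uM).
Qed.

Lemma set2_eq (X : Type) (a b c d : X) : [set a; b] = [set c; d] -> (a = c /\ b = d) \/ (a = d /\ b = c).
Proof.
move=> e; have ha : [set c; d] a by rewrite -e; left.
have hb : [set c; d] b by rewrite -e; right.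
have hc : [set a; b] c by rewrite e; left.
have hd : [set a; b] d by rewrite e; right.
by move: ha hb hc hd => /= [->|->] [->|->] [|] ? [|] ?; subst; tauto.
Qed.

Lemma set2_neq1 (X : Type) (a b c : X) : a <> b -> [set a; b] <> [set c].
Proof.
move=> ab e; have ha : [set c] a by rewrite -e; left.
have hb : [set c] b by rewrite -e; right.
by apply: ab; rewrite ha hb.
Qed.

Lemma v0_neq_v1 : v0 <> vz 1.
Proof. by rewrite -vz0 => /vz_inj. Qed.

Lemma edge_neq m : G2 m -> act m v0 <> act m (vz 1).
Proof. by move=> gm /(act_vertex_inj (G2_unit gm)); exact: v0_neq_v1. Qed.

Lemma mobz_scale c g z : c != 0 -> mobz (c *: g) z = mobz g z.
Proof.
move=> c0; rewrite /mobz !scaleE -!mulrA -!mulrDr invfM mulrACA divff //.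
by rewrite mul1r.
Qed.

Lemma abs_half z : z ^+ 2 = T -> 1 < abs z < q.
Proof.
move=> e; have q0 : 0 <= q by rewrite ltW.
apply: (abs_root e) => //; rewrite abs_T q_gt1 expr2 ltr_pMr //= q_gt1.
Qed.

Lemma im_annulus z : 1 < abs z < q -> im z = abs z.
Proof.
move=> H; have := @im_noninteger _ _ K z 0 0 (Finf0 K).
by rewrite subr0 expr0z add0r expr1z; apply.
Qed.

Lemma Omega_im z : 0 < abs z -> abs z = im z -> Omega z.
Proof. by move=> z0 e; apply/im_gt0; rewrite -e. Qed.

(** After scaling, g is integral with unit determinant and lower left entry at most 1/q. For 1 < |z|
    < q the terms g_00 z and g_11 then dominate numerator and denominator. *)
Lemma fix_edge g z : G2 g -> act g v0 = v0 -> act g (vz 1) = vz 1 -> 1 < abs z < q ->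
  abs (mobz g z) = abs z /\ im (mobz g z) = abs z.
Proof.
move=> gg g0 g1 za; have [z1 zq] := andP za; have imz := im_annulus za.
have oz : Omega z by apply: Omega_im => //; apply: lt_trans z1.
have [c [fc c0 ic dc]] := fix_K0 gg g0.
have gs := G2_shift K 1; have us := G2_unit gs; have ug := G2_unit gg.
have : K0 (invmx (shift 1) *m (g *m shift 1)).
  by apply/act_vtx0_eq => //; [exact: G2M | rewrite -act_vertexM].
rewrite shiftV => -[c' [fc' c0' ic' dc']].
have ecc : abs c' = abs c.
  have : abs c' ^+ 2 = abs c ^+ 2.
    have d0 : abs (\det g) != 0 by rewrite abs_eq0 det_neq0.
    apply: (mulIf d0); rewrite -!absX -!absM -!detZ dc.
    move: dc'; rewrite !detZ !det_mulmx !det_mk2 mul0r !subr0 !mulr1 => <-.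
    by congr (abs (_ * _)); rewrite mulrCA -TexpD addNr expr0z mulr1.
  by move/eqP; rewrite eqrXn2 // => /eqP.
set k := c *: g in ic dc; have gk : G2 k by exact: G2Z.
have k10 : abs (k 1 0) <= q^-1.
  have := ic' 1 0; rewrite scaleE !mulmx2 !mk2E !(mul0r, mulr0, addr0, add0r, mul1r) expr1z.
  rewrite !absM ecc abs_T mulrA -absM -scaleE -/k => H.
  by rewrite -[leRHS]mul1r ler_pdivlMr.
have q1 : q^-1 < 1 by rewrite invf_lt1.
have [k00 k11] : abs (k 0 0) = 1 /\ abs (k 1 1) = 1.
  have lt1 : abs (k 0 1 * k 1 0) < 1.
    rewrite absM; apply: le_lt_trans q1; apply: le_trans k10.
    by rewrite ler_piMl // ic.
  have : abs (k 0 0 * k 1 1) = 1.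
    have -> : k 0 0 * k 1 1 = \det k + k 0 1 * k 1 0 by rewrite det2; ring.
    by rewrite absDl ?dc.
  rewrite absM => e; have h0 := ic 0 0; have h1 := ic 1 1.
  have a0 := abs_ge0 (k 0 0); have a1 := abs_ge0 (k 1 1).
  by split; nra.
have jk : abs (jfac k z) = 1.
  rewrite /jfac absDr ?k11 // absM; have := abs_ge0 z => ?.
  apply: le_lt_trans (_ : q^-1 * abs z < 1); first by rewrite ler_wpM2r.
  by rewrite mulrC ltr_pdivrMr // mul1r.
rewrite -(mobz_scale g z c0) -/k im_mobz // dc jk expr1n divr1 mul1r; split=> //.
rewrite /mobz abs_div -/(jfac k z) jk divr1 absDl absM k00 mul1r //.
by apply: le_lt_trans z1; exact: ic.
Qed.

(** The only other case is a reversed edge, and z -> T / z reverses it. This is the reason for the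
    choice z^2 = T: the reversal preserves |z|. *)
Lemma edge_annulus0 h z : G2 h -> [set act h v0; act h (vz 1)] = [set v0; vz 1] ->
  z ^+ 2 = T -> abs (mobz h z) = abs z /\ im (mobz h z) = abs z.
Proof.
move=> gh e ez; have za := abs_half ez; have uh := G2_unit gh.
have z0 : 0 < abs z by apply: lt_trans (_ : 1 < _) => //; case/andP: za.
case: (set2_eq e) => -[e0 e1]; first exact: fix_edge.
pose w : 'M[K]_2 := shift 1 *m flip.
have gs := G2_shift K 1; have gf := G2_flip K; have us := G2_unit gs; have uf := G2_unit gf.
have gw : G2 w by exact: G2M.
have uw := G2_unit gw.
have w0 : act w v0 = vz 1 by rewrite -vz0 -act_vertexM // flip_vz oppr0 act_shift.
have w1 : act w (vz 1) = v0 by rewrite -act_vertexM // flip_vz act_shift subrr vz0.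
pose h' := invmx w *m h; have gh' : G2 h' by apply: G2M => //; exact: G2V.
have [||a1 i1] := @fix_edge h' z gh' _ _ za.
- by rewrite -act_vertexM ?unitmx_inv // e0 -w0 act_vertexK.
- by rewrite -act_vertexM ?unitmx_inv // e1 -w1 act_vertexK.
have oz : Omega z by apply: Omega_im; rewrite // im_annulus.
have oh' : Omega (mobz h' z) by exact: Omega_mobz.
have -> : mobz h z = mobz w (mobz h' z) by rewrite -mobzM ?mulKVmx // jfac_neq0.
have j : abs (jfac w (mobz h' z)) = abs z.
  by rewrite /jfac !mulmx2 !mk2E !(mul0r, mulr0, addr0, add0r, mul1r, mulr1) a1.
have qz : q = abs z ^+ 2 by rewrite -absX ez abs_T.
rewrite im_mobz // j i1 det_mulmx !det_mk2 !(mul0r, subr0, mulr1, sub0r, mulrN1) absN expr1z abs_T.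
split; last by rewrite qz; field; rewrite gt_eqF.
rewrite /mobz abs_div -/(jfac w _) j !mulmx2 !mk2E expr1z.
rewrite !(mul0r, mulr0, addr0, add0r, mul1r, mulr1) abs_T qz.
by field; rewrite gt_eqF.
Qed.

Lemma abs_mobz_shift i z : abs (mobz (shift i) z) = q ^ i * abs z.
Proof. by rewrite /mobz !mk2E mul0r add0r divr1 addr0 absM abs_Texp. Qed.

Lemma im_mobz_shift i z : Omega z -> im (mobz (shift i) z) = q ^ i * im z.
Proof.
move=> oz; rewrite im_mobz //; last exact: G2_shift.
by rewrite det_mk2 /jfac !mk2E !(mul0r, add0r, mulr1, subr0, abs1, expr1n, divr1) abs_Texp.
Qed.

Lemma edge_annulus h z i : G2 h -> [set act h v0; act h (vz 1)] = [set vz i; vz (i + 1)] ->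
  z ^+ 2 = T -> abs (mobz h z) = q ^ i * abs z /\ im (mobz h z) = q ^ i * abs z.
Proof.
move=> gh e ez; have uh := G2_unit gh; have gs := G2_shift K; have us j := G2_unit (gs j).
pose h' := shift (- i) *m h; have gh' : G2 h' by exact: G2M.
have [|a1 i1] := @edge_annulus0 h' z gh' _ ez.
  move: e => /(congr1 (image^~ (act (shift (- i))))).
  by rewrite !image_setU !image_set1 !(act_vertexM _ (us _) uh) !act_shift addNr addrA addNr add0r vz0.
have za := abs_half ez.
have oz : Omega z by apply: Omega_im; rewrite ?im_annulus //; apply: lt_trans (_ : 1 < _) => //; case/andP: za.
have oh' : Omega (mobz h' z) by exact: Omega_mobz.
have -> : mobz h z = mobz (shift i) (mobz h' z).
  by rewrite -mobzM ?jfac_neq0 // mulmxA shiftD subrr shift0 mul1mx.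
by rewrite abs_mobz_shift im_mobz_shift // a1 i1.
Qed.

Lemma abs_lin_vertex a b z : abs z = im z -> Finf a -> Finf b ->
  abs (a * z + b) = Num.max (abs a * abs z) (abs b).
Proof.
move=> ez fa fb; have [->|a0] := eqVneq a 0.
  by rewrite abs0 !mul0r add0r max_r.
have -> : a * z + b = a * (z - (- b / a)) by field.
rewrite absM abs_sub_im //; last by apply: FinfM; [exact: FinfN | exact: FinfV].
by rewrite maxr_pMr // abs_div absN mulrCA divff ?mulr1 // abs_eq0.
Qed.

(** After scaling, g lies in GL_2(O_infinity). Each of its rows has an entry of absolute value 1, so
    numerator and denominator at z are units. *)
Lemma fix_vertex g z : G2 g -> act g v0 = v0 -> abs z = 1 -> im z = 1 ->
  [/\ abs (mobz g z) = 1, im (mobz g z) = 1 &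
  forall z', abs z' = 1 -> im z' = 1 -> abs (mobz g z - mobz g z') = abs (z - z')].
Proof.
move=> gg g0 az iz; have [c [fc c0 ic dc]] := fix_K0 gg g0.
set k := c *: g in ic dc; have gk : G2 k by exact: G2Z.
have row i w : abs w = 1 -> im w = 1 -> abs (k i 0 * w + k i 1) = 1.
  move=> aw iw; rewrite abs_lin_vertex ?aw ?iw ?mulr1 //; try exact: G2_Finf.
  apply: le_anti; rewrite ge_max !ic /= leNgt gt_max; apply/negP => /andP[h0 h1].
  have : abs (\det k) < 1.
    have ab (x y : K) : abs x < 1 -> abs y <= 1 -> abs (x * y) < 1.
      by move=> x1 y1; rewrite absM; apply: le_lt_trans x1; rewrite ler_piMr.
    rewrite det2; move: i h0 h1; apply: ord2P => h0 h1; apply: absB_lt.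
    - exact: ab.
    - exact: ab.
    - by rewrite mulrC; exact: ab.
    - by rewrite mulrC; exact: ab.
  by rewrite dc ltxx.
have om w : abs w = 1 -> im w = 1 -> Omega w by move=> aw iw; apply/im_gt0; rewrite iw.
rewrite -!(mobz_scale g _ c0) -/k; split.
- by rewrite /mobz abs_div !row // divr1.
- by rewrite (im_mobz gk (om z az iz)) dc iz /jfac row // expr1n divr1 mulr1.
move=> z' az' iz'; rewrite -!(mobz_scale g _ c0) -/k.
have j0 := jfac_neq0 gk (om z az iz); have j0' := jfac_neq0 gk (om z' az' iz').
have -> : mobz k z - mobz k z' = \det k * (z - z') / (jfac k z * jfac k z').
  by rewrite /mobz -!/(jfac k _) det2; rewrite /jfac in j0 j0' *; field; rewrite j0 j0'.
by rewrite abs_div !absM /jfac !row // dc mul1r mulr1 divr1.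
Qed.

Lemma vertex_affinoid g z i : G2 g -> act g v0 = vz i -> abs z = 1 -> im z = 1 ->
  [/\ abs (mobz g z) = q ^ i, im (mobz g z) = q ^ i &
  forall z', abs z' = 1 -> im z' = 1 -> abs (mobz g z - mobz g z') = q ^ i * abs (z - z')].
Proof.
move=> gg e az iz; have ug := G2_unit gg; have gs := G2_shift K; have us j := G2_unit (gs j).
pose h := shift (- i) *m g; have gh : G2 h by exact: G2M.
have eh : act h v0 = v0 by rewrite -act_vertexM // e act_shift addNr vz0.
have [a1 i1 d1] := fix_vertex gh eh az iz.
have om w : abs w = 1 -> im w = 1 -> Omega w by move=> aw iw; apply/im_gt0; rewrite iw.
have E w : abs w = 1 -> im w = 1 -> mobz g w = mobz (shift i) (mobz h w).
  move=> aw iw; have ow := om w aw iw.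
  by rewrite -mobzM ?jfac_neq0 // mulmxA shiftD subrr shift0 mul1mx.
rewrite E // abs_mobz_shift im_mobz_shift; last by apply: Omega_mobz => //; exact: om.
rewrite a1 i1 mulr1; split => // z' az' iz'; rewrite E // -d1 //.
rewrite -(abs_Texp K) -absM; congr (abs _).
by rewrite /mobz !mk2E !mul0r !add0r !divr1 !addr0 mulrBr.
Qed.

Lemma primitive_coords (s : P1 K) : P1Finf s -> exists x y e, [/\ Finf x, Finf y, e != 0,
  x = e * hx s /\ y = e * hy s & Num.max (abs x) (abs y) = 1].
Proof.
case: s => [x|] /= fs; last first.
  exists 1, 0, 1; rewrite oner_neq0 !mulr1 mulr0 abs1 abs0.
  by split=> //; [exact: Finf1 | exact: Finf0 | rewrite max_l].
have [x1|x1] := leP (abs x) 1.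
  exists x, 1, 1; rewrite oner_neq0 !mul1r abs1 max_r //; split=> //; exact: Finf1.
have x0 : x != 0 by rewrite -abs_gt0 (lt_trans _ x1).
exists 1, x^-1, x^-1; rewrite invr_eq0 x0 mulVf // mulr1 abs1 absV max_l ?invf_le1 ?(ltW x1) //; last first.
  exact: lt_trans x1.
by split => //; [exact: Finf1 | exact: FinfV].
Qed.

Lemma weight_coords z (a b : P1 K) xa ya ea xb yb eb : Omega z -> P1Finf a -> P1Finf b ->
  ea != 0 -> eb != 0 -> xa = ea * hx a /\ ya = ea * hy a -> xb = eb * hx b /\ yb = eb * hy b ->
  weight z a b = abs (xb * ya - xa * yb) * im z / (abs (ya * z - xa) * abs (yb * z - xb)).
Proof.
move=> oz fa fb ea0 eb0 [-> ->] [-> ->]; rewrite weightE // /cross /pole_form.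
have -> : eb * hx b * (ea * hy a) - ea * hx a * (eb * hy b) = ea * eb * (hx b * hy a - hx a * hy b) by ring.
have -> : ea * hy a * z - ea * hx a = ea * (hy a * z - hx a) by ring.
have -> : eb * hy b * z - eb * hx b = eb * (hy b * z - hx b) by ring.
have := pole_form_neq0 oz fa; have := pole_form_neq0 oz fb; rewrite /pole_form -!abs_gt0 => pb pa.
rewrite !absM; rewrite -!abs_gt0 in ea0 eb0.
by field; rewrite !gt_eqF.
Qed.

Lemma coords_frame (a b : P1 K) xa ya ea xb yb eb : Finf xa -> Finf ya -> Finf xb -> Finf yb ->
  ea != 0 -> eb != 0 -> xa = ea * hx a /\ ya = ea * hy a -> xb = eb * hx b /\ yb = eb * hy b ->
  xb * ya - xa * yb != 0 -> [/\ G2 (mk2 xb xa yb ya), mob (mk2 xb xa yb ya) (Some 0) = a &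
    mob (mk2 xb xa yb ya) None = b].
Proof.
move=> f1 f2 f3 f4 ea0 eb0 [e1 e2] [e3 e4] d0; split.
- exact: G2_mk2.
- by rewrite /= !mk2E !mulr0 !add0r e1 e2 hpoint_scale // hpointE.
- by rewrite /= !mk2E e3 e4 hpoint_scale // hpointE.
Qed.

(** In primitive coordinates both pole forms are units at z, so the weight is the absolute value of
    the determinant. If it is 1, the matrix of coordinates lies in GL_2(O_infinity) and fixes
    v_0. *)
Lemma geo_vertex z a b : P1Finf a -> P1Finf b -> abs z = 1 -> im z = 1 -> weight z a b = 1 ->
  geo a b [set v0].
Proof.
move=> fa fb az iz; have oz : Omega z by apply/im_gt0; rewrite iz.
have [xa [ya [ea [f1 f2 ea0 Ea ma]]]] := primitive_coords fa.
have [xb [yb [eb [f3 f4 eb0 Eb mb]]]] := primitive_coords fb.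
have pf x y : Finf x -> Finf y -> Num.max (abs x) (abs y) = 1 -> abs (y * z - x) = 1.
  move=> fx fy m1; rewrite abs_lin_vertex ?az ?iz ?mulr1 ?absN //; first by rewrite maxC.
  exact: FinfN.
rewrite (weight_coords oz fa fb ea0 eb0 Ea Eb) !pf // iz !mulr1 divr1 => d1.
have d0 : xb * ya - xa * yb != 0 by rewrite -abs_gt0 d1.
have [gM M0 Moo] := coords_frame f1 f2 f3 f4 ea0 eb0 Ea Eb d0.
exists (mk2 xb xa yb ya), 0; split => //; left; rewrite vz0 K0_fix //.
have le1 (x y : K) : Num.max (abs x) (abs y) = 1 -> abs x <= 1 /\ abs y <= 1.
  by move=> <-; rewrite !le_max !lexx orbT.
have [l1 l2] := le1 _ _ ma; have [l3 l4] := le1 _ _ mb.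
exists 1; rewrite scale1r oner_neq0; split => //; [exact: Finf1 | | by rewrite det_mk2].
by apply: ord2P; apply: ord2P; rewrite mk2E.
Qed.

(** Four cases, according to the side of the edge on which each end lies. Two ends on the side of
    v_0 give weight at most 1 / |z|, two on the other side at most |z| / q, both below 1. For ends
    on different sides, weight 1 means unit determinant, and the matrix of coordinates fixes both
    vertices, up to exchanging its columns. *)
Lemma geo_edge z a b : P1Finf a -> P1Finf b -> z ^+ 2 = T -> weight z a b = 1 ->
  geo a b [set v0; vz 1].
Proof.
move=> fa fb ez; have za := abs_half ez; have imz := im_annulus za; have [z1 zq] := andP za.
have z0 : 0 < abs z by apply: lt_trans z1.
have oz : Omega z by apply: Omega_im.
have [xa [ya [ea [f1 f2 ea0 Ea ma]]]] := primitive_coords fa.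
have [xb [yb [eb [f3 f4 eb0 Eb mb]]]] := primitive_coords fb.
have le1 (x y : K) : Num.max (abs x) (abs y) = 1 -> abs x <= 1 /\ abs y <= 1.
  by move=> <-; rewrite !le_max !lexx orbT.
have [l1 l2] := le1 _ _ ma; have [l3 l4] := le1 _ _ mb.
have q1 : q^-1 < 1 by rewrite invf_lt1.
have qz : q^-1 * abs z < 1 by rewrite mulrC ltr_pdivrMr // mul1r.
have small x : Finf x -> abs x < 1 -> abs x <= q^-1.
  move=> fx x1; have := Fclosure_shift ((FinfP x).1 fx) x1; rewrite absM abs_T => h.
  by rewrite -[leRHS]mul1r ler_pdivlMr // mulrC.
have pf x y : Finf x -> Finf y -> abs (y * z - x) = Num.max (abs y * abs z) (abs x).
  by move=> fx fy; rewrite abs_lin_vertex ?absN //; exact: FinfN.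
(* |y| = 1 means that the point lies on the side of v0 *)
have pf1 x y : Finf x -> Finf y -> abs x <= 1 -> abs y = 1 -> abs (y * z - x) = abs z.
  by move=> fx fy x1 y1; rewrite pf // y1 mul1r max_l // (le_trans x1) // ltW.
have pf2 x y : Finf x -> Finf y -> Num.max (abs x) (abs y) = 1 -> abs y < 1 -> abs (y * z - x) = 1 /\ abs x = 1.
  move=> fx fy m1 y1; have ax : abs x = 1 by move: m1; case: leP => // _ e; rewrite e ltxx in y1.
  rewrite pf // ax max_r //; apply: ltW; apply: le_lt_trans qz.
  by rewrite ler_wpM2r ?(ltW z0) ?small.
have key x x' y y' : Finf x -> Finf y -> Finf x' -> Finf y' -> abs x' <= 1 -> abs y = 1 -> abs y' <= q^-1 -> abs x = 1 \/ abs x <= 1 ->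
   abs x' = 1 -> G2 (mk2 x' x y' y) -> act (mk2 x' x y' y) v0 = v0 /\ act (mk2 x' x y' y) (vz 1) = vz 1.
  move=> fx fy fx' fy' _ y1 y'1 Hx x'1 gM.
  have xle : abs x <= 1 by case: Hx => [->|].
  have dM : abs (\det (mk2 x' x y' y)) = 1.
    rewrite det_mk2 absBl ?absM ?x'1 ?y1 ?mulr1 //; apply: le_lt_trans q1.
    by apply: le_trans y'1; rewrite ler_piMl.
  have y'2 : abs y' <= 1 by apply: le_trans y'1 (ltW q1).
  split.
    apply: K0_fix => //; exists 1; rewrite scale1r oner_neq0; split => //; first exact: Finf1.
    by apply: ord2P; apply: ord2P; rewrite mk2E ?x'1 ?y1.
  have gs := G2_shift K 1; have us := G2_unit gs; have uM := G2_unit gM.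
  rewrite /vz act_vertexM //; apply/esym/act_vtx0_eq => //; first exact: G2M.
  have -> : invmx (shift 1) *m (mk2 x' x y' y *m shift 1) = mk2 x' (T^-1 * x) (T * y') y.
    rewrite shiftV; apply: mx2P; rewrite !mulmx2 !mk2E ?exprN1 ?expr1z;
      first [by ring | by field; rewrite T_neq0].
  have t1 : abs (T^-1 * x) <= 1 by rewrite absM absV abs_T mulr_ile1 ?invr_ge0 ?(ltW q1) // ltW.
  have t2 : abs (T * y') <= 1 by rewrite absM abs_T mulrC -ler_pdivlMr // mul1r.
  exists 1; rewrite scale1r oner_neq0; split => //; first exact: Finf1.
    by apply: ord2P; apply: ord2P; rewrite mk2E ?x'1 ?y1.
  rewrite det_mk2 -dM det_mk2; congr (abs (_ - _)).
  by field; rewrite T_neq0.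
rewrite (weight_coords oz fa fb ea0 eb0 Ea Eb) imz.
have [ya1|ya1] := eqVneq (abs ya) 1; have [yb1|yb1] := eqVneq (abs yb) 1.
- rewrite !pf1 // => e; have : abs (xb * ya - xa * yb) <= 1 by apply: absB_le; rewrite absM mulr_ile1.
  have : abs (xb * ya - xa * yb) = abs z.
    by move: e; set t := abs (_ - _) => e; rewrite -[RHS]mul1r -e; field; rewrite gt_eqF.
  by move=> ->; rewrite leNgt z1.
- have yb2 : abs yb < 1 by rewrite lt_neqAle yb1.
  have [pb xb1] := pf2 _ _ f3 f4 mb yb2; rewrite pf1 // pb => e.
  have d1 : abs (xb * ya - xa * yb) = 1.
    by move: e; set t := abs (_ - _) => e; rewrite -e; field; rewrite gt_eqF.
  have d0 : xb * ya - xa * yb != 0 by rewrite -abs_gt0 d1.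
  have [gM M0 Moo] := coords_frame f1 f2 f3 f4 ea0 eb0 Ea Eb d0.
  exists (mk2 xb xa yb ya), 0; split => //; right; rewrite add0r vz0.
  by have [|-> ->] := key xa xb ya yb f1 f2 f3 f4 l3 ya1 (small _ f4 yb2) (or_intror l1) xb1.
- have ya2 : abs ya < 1 by rewrite lt_neqAle ya1.
  have [pa xa1] := pf2 _ _ f1 f2 ma ya2; rewrite (pf1 xb) // pa => e.
  have d1 : abs (xb * ya - xa * yb) = 1.
    by move: e; set t := abs (_ - _) => e; rewrite -e; field; rewrite gt_eqF.
  have d0 : xb * ya - xa * yb != 0 by rewrite -abs_gt0 d1.
  have [gM M0 Moo] := coords_frame f1 f2 f3 f4 ea0 eb0 Ea Eb d0.
  exists (mk2 xb xa yb ya), (- 1); split => //; right; rewrite addNr vz0.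
  have gM' : G2 (mk2 xa xb ya yb) by apply: G2_mk2 => //; move: d0; rewrite -oppr_eq0 opprB.
  have -> : mk2 xb xa yb ya = mk2 xa xb ya yb *m flip by apply: mx2P; rewrite mulmx2 !mk2E; ring.
  have uf := G2_unit (G2_flip K); have uM' := G2_unit gM'.
  rewrite -!act_vertexM // flip_vz opprK -vz0 flip_vz oppr0 vz0.
  have [|-> ->] := key xb xa yb ya f3 f4 f1 f2 l1 yb1 (small _ f2 ya2) (or_intror l3) xa1 => //.
  by rewrite setUC.
- have ya2 : abs ya < 1 by rewrite lt_neqAle ya1.
  have yb2 : abs yb < 1 by rewrite lt_neqAle yb1.
  have [pa xa1] := pf2 _ _ f1 f2 ma ya2; have [pb xb1] := pf2 _ _ f3 f4 mb yb2.
  rewrite pa pb mulr1 divr1 => e; have : abs (xb * ya - xa * yb) <= q^-1.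
    by apply: absB_le; rewrite absM ?xb1 ?xa1 mul1r small.
  move=> h; have : abs (xb * ya - xa * yb) * abs z < 1.
    by apply: le_lt_trans qz; rewrite ler_wpM2r // ltW.
  by rewrite e ltxx.
Qed.

Lemma weight_0oo z : Omega z -> weight z (Some 0) None = im z / abs z.
Proof.
move=> oz; rewrite weightE ?P1Finf_omap //=; last exact: Finf0.
by rewrite /cross /pole_form /= !(mul1r, mul0r, subr0, sub0r, absN, abs1, mulr1).
Qed.

Lemma edge_weight m a b z : G2 m -> z ^+ 2 = T -> geo a b [set act m v0; act m (vz 1)] ->
  weight (mobz m z) a b = 1.
Proof.
move=> gm ez [M [i [gM <- <- Hc]]]; have um := G2_unit gm; have uM := G2_unit gM.
case: Hc => e; first by case: (set2_neq1 (edge_neq gm) e).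
have gV := G2V gM; have uV := G2_unit gV.
have gh := G2M gV gm; have [|a1 i1] := @edge_annulus _ z i gh _ ez.
  move: e => /(congr1 (image^~ (act (invmx M)))).
  by rewrite !image_setU !image_set1 !act_vertexK // !(act_vertexM _ uV um).
have za := abs_half ez.
have oz : Omega z by apply: Omega_im; rewrite ?im_annulus //; apply: lt_trans (_ : 1 < _) => //; case/andP: za.
have oh : Omega (mobz (invmx M *m m) z) by exact: Omega_mobz.
have -> : mobz m z = mobz M (mobz (invmx M *m m) z).
  by rewrite -mobzM ?jfac_neq0 // mulKVmx.
rewrite weight_mob //; [|exact: Finf0].
by rewrite weight_0oo // a1 i1 divff // -a1 abs_eq0; apply/eqP => e0; apply: oh; rewrite e0; exact: Finf0.
Qed.

(** Exchanging the vertices of an edge changes the parity of the valuation of the determinant, which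
    neither scalars nor an element of unit determinant can do. *)
Lemma edge_parity g m : G2 g -> abs (\det g) = 1 -> G2 m -> act g (act m v0) <> act m (vz 1).
Proof.
move=> gg dg gm; have ug := G2_unit gg; have um := G2_unit gm.
have gs := G2_shift K 1; have us := G2_unit gs.
rewrite act_vertexM // /vz act_vertexM // => /(act_vtx0_eq (G2M gg gm) (G2M gm gs))[c [fc c0 ic]].
rewrite detZ !det_mulmx det_inv !det_mulmx det_mk2 mulr1 mul0r subr0 expr1z !absM absV absM dg mul1r abs_T.
have dm : abs (\det m) != 0 by rewrite abs_eq0 det_neq0.
rewrite mulKf //; have [i ->] := Finf_val fc c0.
move=> e; have : q ^ (i + i + 1) = q ^ 0 by rewrite !expfzDr ?gt_eqF // expr0z expr1z.
by move=> /q_exprz_inj; lia.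
Qed.

Lemma edge_stabilizer (n : {poly Fq}) (g : 'M[{poly Fq}]_2) m : (1 < size n)%N -> Gamma n g -> G2 m ->
  stable_vertex n (act m v0) -> act_edge (mxAK K g) [set act m v0; act m (vz 1)] = [set act m v0; act m (vz 1)] ->
  g = 1%:M.
Proof.
move=> n_size gg gm [_ st]; have ug := Gamma_unit gg; have gK := G2_mxAK K ug.
rewrite /act_edge image_setU !image_set1 => e; case: (set2_eq e) => -[{}e _]; first exact: st.
by case: (edge_parity gK (abs_det_mxAK K ug) gm e).
Qed.

Lemma is_vertex_act m : G2 m -> is_vertex (act m v0).
Proof.
move=> gm; rewrite act_vtx0; exists (lattice_of (invmx m)) => //.
by exists (invmx m) => //; exact: G2V.
Qed.

Lemma closed_edge_finite (e : set (vertex K)) (f : int -> vertex K) v w i0 : e = [set v; w] -> injective f ->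
  ~ (forall i, i0 <= i -> closed_edge e [set f i]).
Proof.
move=> -> f_inj H.
have H' i : i0 <= i -> f i = v \/ f i = w.
  move=> /H[h|[u hu h]].
    by have : [set v; w] (f i) by rewrite -h.
  by have -> : f i = u by have : [set u] (f i) by rewrite -h.
have [|] := H' i0 (lexx _); have [] := H' (i0 + 1) ltac:(lia); have [] := H' (i0 + 2) ltac:(lia) => h2 h1 h0;
  try (by have /f_inj := etrans h0 (esym h1); lia);
  try (by have /f_inj := etrans h0 (esym h2); lia);
  by have /f_inj := etrans h1 (esym h2); lia.
Qed.

Lemma weight_end_oo z a : abs z = im z -> Omega z -> P1Finf a -> a <> None ->
  (if a is Some x then abs x <= abs z else true) -> weight z a None = 1 /\ weight z None a = 1.
Proof.
move=> ez oz; case: a => [x|] // fx _ xz.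
have z0 : 0 < abs z by rewrite ez; exact/im_gt0.
have e : abs (z - x) = abs z by rewrite abs_sub_im // max_l.
rewrite !weightE // /cross /pole_form /=.
rewrite !(mul1r, mulr1, mul0r, mulr0, subr0, sub0r, add0r, absN, abs1) e -ez divff ?gt_eqF //.
Qed.

Lemma geo_vertex_act m z a b : G2 m -> P1Finf a -> P1Finf b -> abs z = 1 -> im z = 1 ->
  weight (mobz m z) a b = 1 -> geo a b [set act m v0].
Proof.
move=> gm fa fb az iz; have oz : Omega z by apply/im_gt0; rewrite iz.
have gV := G2V gm; have fa' := P1Finf_mob gV fa; have fb' := P1Finf_mob gV fb.
have um := G2_unit gm.
rewrite -{1}(mobVK a um) -{1}(mobVK b um) weight_mob // => w1.
have := geo_act gm (geo_vertex fa' fb' az iz w1).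
by rewrite !mobVK // image_set1.
Qed.

Lemma geo_edge_act m z a b : G2 m -> P1Finf a -> P1Finf b -> z ^+ 2 = T ->
  weight (mobz m z) a b = 1 -> geo a b [set act m v0; act m (vz 1)].
Proof.
move=> gm fa fb ez; have za := abs_half ez.
have oz : Omega z by apply: Omega_im; rewrite ?im_annulus //; apply: lt_trans (_ : 1 < _) => //; case/andP: za.
have gV := G2V gm; have fa' := P1Finf_mob gV fa; have fb' := P1Finf_mob gV fb.
have um := G2_unit gm.
rewrite -{1}(mobVK a um) -{1}(mobVK b um) weight_mob // => w1.
have := geo_act gm (geo_edge fa' fb' ez w1).
by rewrite !mobVK // image_setU !image_set1.
Qed.

(* Geodesics with a common end share a half-line. *)
Lemma meet_common_end (D : kdata (ratfun Fq)) e v w : (forall i, @ka _ D i <> @kb _ D i) ->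
  (0 < kr D)%N -> geodesics_meet K D = closed_edge e -> e = [set v; w] ->
  forall s, exists i, s <> @ka _ D i /\ s <> @kb _ D i.
Proof.
move=> Dab r0 meet ee s; apply: contrapT => H.
have {}H i : s = ka i \/ s = @kb _ D i.
  by apply: contrapT => /not_orP[h1 h2]; apply: H; exists i.
pose i0 : 'I_(kr D) := Ordinal r0.
pose s' := if s == ka i0 then kb i0 else @ka _ D i0.
have ss' : s' <> s.
  rewrite /s'; case: eqP => [->|n1]; first by move=> e1; exact: (Dab i0).
  by move=> e1; apply: n1.
pose M0 := frame s' s; have uM0 : M0 \in unitmx by exact: frame_unit.
pose M := mxFK K M0; have gM : G2 M by exact: G2_mxFK.
have uM := G2_unit gM.
have Moo : mob M None = omap emb s by rewrite -[None]/(omap emb None) -mob_omap frame_inf.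
have [z [az iz _]] := @exists_vertex_pt Fq R K 0 [::]; rewrite expr0z in az iz.
pose rad (x : P1 K) : R := if x is Some y then abs y else 0.
pose other (i : 'I_(kr D)) := mob (invmx M) (omap emb (if s == ka i then kb i else @ka _ D i)).
(* In the coordinate where s is infinity, all other ends have absolute value below q^j0. Above that
   height every pair has weight 1, so all its geodesics contain the half-line. *)
have [j0 Hj0] := @q_exprz_unbounded Fq R (\sum_i rad (other i)).
have rad0 i : 0 <= rad (other i) by rewrite /rad; case: (other i).
apply: (@closed_edge_finite e (fun j => act M (vz j)) v w j0 ee).
  by move=> i j /(act_vertex_inj uM)/vz_inj.
move=> j j0j; rewrite -meet => i _.
apply/geodesicP; try exact: P1Finf_omap.
  by case: (@ka _ D i) (@kb _ D i) (Dab i) => [x|] [y|] //= xy [] /fmorph_inj e1; apply: xy; rewrite e1.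
have -> : act M (vz j) = act (M *m shift j) v0.
  by rewrite -act_vertexM ?G2_unit //; exact: G2_shift.
have gs := G2_shift K j.
apply: (geo_vertex_act (G2M gM gs) _ _ az iz); try exact: P1Finf_omap.
have oz : Omega z by apply/im_gt0; rewrite iz.
rewrite mobzM ?jfac_neq0 //; set z' := mobz (shift j) z.
have oz' : Omega z' by exact: Omega_mobz.
have az' : abs z' = q ^ j by rewrite abs_mobz_shift az mulr1.
have iz' : im z' = q ^ j by rewrite im_mobz_shift // iz mulr1.
have W : weight z' (other i) None = 1 /\ weight z' None (other i) = 1.
  apply: weight_end_oo => //; first by rewrite az' iz'.
  - by apply: P1Finf_mob; [exact: G2V | exact: P1Finf_omap].
  - rewrite /other => /(congr1 (mob M)); rewrite mobVK // Moo => e1.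
    have : (if s == ka i then kb i else @ka _ D i) = s.
      by move: e1; case: (if _ then _ else _) => [x|]; case: (s) => [y|] //= [] /fmorph_inj ->.
    case: eqP => [e2 e3|n2 e3]; last exact: n2.
    by apply: (Dab i); rewrite e3.
  - suff : rad (other i) <= abs z' by rewrite /rad; case: (other i).
    rewrite az'; apply: le_trans (_ : q ^ j0 <= _); last by rewrite q_exprz_le.
    apply: le_trans (ltW Hj0); rewrite (bigD1 i) //= lerDl; exact: sumr_ge0.
have fo : P1Finf (other i) by apply: P1Finf_mob; [exact: G2V | exact: P1Finf_omap].
have oE : mob M (other i) = omap emb (if s == ka i then kb i else @ka _ D i) by rewrite mobVK.
case: (H i) => si.
  rewrite si eqxx in oE; rewrite -oE -si -Moo weight_mob //; exact: W.2.
have ni : (s == ka i) = false by apply/eqP => e1; apply: (Dab i); rewrite -e1.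
by rewrite ni in oE; rewrite -oE -si -Moo weight_mob //; exact: W.1.
Qed.

End Geodesics.

(** * Gauss norms of rational functions on discs *)

Section GaussNorms.

Variables (Fq : finFieldType) (R : realType) (K : valued_ext Fq R).
Local Notation abs := (vabs K).
Local Notation q := (#|Fq|%:R : R).
Local Notation T := (Defs.iota K (AtoF 'X)).
Local Notation im := (@vabs_i Fq R K).
Local Notation Omega := (@Omega Fq R K).
Local Notation Finf := (@Finf Fq R K).
Implicit Types (z a b : K) (l zs ps : seq K) (t r : R).

Definition count_le a t l := count (fun b => abs (b - a) <= t) l.
Definition count_lt a t l := count (fun b => abs (b - a) < t) l.
(** The Gauss norm, on the disc of centre a and radius t, of the monic polynomial with roots l. Its
    logarithmic slope in t counts the roots in the disc. *)
Definition gprod a t l : R := \prod_(b <- l) Num.max t (abs (b - a)).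

Lemma gprod_gt0 a t l : 0 < t -> 0 < gprod a t l.
Proof. by move=> t0; apply: prodr_gt0 => b _; rewrite lt_max t0. Qed.

Lemma gprod_up a t r l : 0 < t -> 1 <= r ->
  gprod a t l * r ^+ count_le a t l <= gprod a (r * t) l.
Proof.
move=> t0 r1; have r0 : 0 < r by apply: lt_le_trans r1.
rewrite /gprod /count_le; elim: l => [|b l IH]; first by rewrite !big_nil expr0 mulr1.
rewrite !big_cons /= exprD mulrACA; apply: ler_pM => //.
- by rewrite mulr_ge0 ?exprn_ge0 ?(ltW r0) // le_max ltW.
- by rewrite mulr_ge0 ?exprn_ge0 ?(ltW r0) // ltW // -/(gprod a t l) gprod_gt0.
have tr : t <= r * t by rewrite ler_peMl // ltW.
have [h|h] := boolP (abs (b - a) <= t); first by rewrite max_l // expr1 mulrC le_max lexx.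
by rewrite max_r ?(ltW (_ : t < _)) ?ltNge // expr0 mulr1 le_max lexx orbT.
Qed.

Lemma gprod_up_eq a t r l : 0 < t -> 1 <= r -> (forall b, b \in l -> ~~ (t < abs (b - a) < r * t)) ->
  gprod a (r * t) l = gprod a t l * r ^+ count_le a t l.
Proof.
move=> t0 r1; have tr : t <= r * t by rewrite ler_peMl // ltW.
rewrite /gprod /count_le; elim: l => [|b l IH] H; first by rewrite !big_nil expr0 mulr1.
rewrite !big_cons /= exprD mulrACA IH => [|b' bl]; last by apply: H; rewrite inE bl orbT.
congr (_ * _); have := H b (mem_head _ _).
have [h _|] := boolP (abs (b - a) <= t); first by rewrite !max_l ?(le_trans h) // expr1 mulrC.
by rewrite -ltNge => h; rewrite h -leNgt expr0 mulr1 => h'; rewrite !max_r // ltW.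
Qed.

Lemma gprod_down a t r l : 0 < t -> 1 <= r ->
  gprod a (r * t) l <= gprod a t l * r ^+ count_lt a (r * t) l.
Proof.
move=> t0 r1; have r0 : 0 < r by apply: lt_le_trans r1.
have tr : t <= r * t by rewrite ler_peMl // ltW.
rewrite /gprod /count_lt; elim: l => [|b l IH]; first by rewrite !big_nil expr0 mulr1.
rewrite !big_cons /= exprD mulrACA; apply: ler_pM => //.
- by rewrite le_max (le_trans _ tr) // ltW.
- by rewrite ltW // -/(gprod a (r * t) l) gprod_gt0 // mulr_gt0.
have [h|] := boolP (abs (b - a) < r * t).
  by rewrite max_l ?(ltW h) // expr1 mulrC ler_wpM2r ?(ltW r0) // le_max lexx.
by rewrite -leNgt => h; rewrite max_r // expr0 mulr1 le_max lexx orbT.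
Qed.

Lemma gprod_down_eq a t r l : 0 < t -> 1 <= r -> (forall b, b \in l -> ~~ (t < abs (b - a) < r * t)) ->
  gprod a (r * t) l = gprod a t l * r ^+ count_lt a (r * t) l.
Proof.
move=> t0 r1; have tr : t <= r * t by rewrite ler_peMl // ltW.
rewrite /gprod /count_lt; elim: l => [|b l IH] H; first by rewrite !big_nil expr0 mulr1.
rewrite !big_cons /= exprD mulrACA IH => [|b' bl]; last by apply: H; rewrite inE bl orbT.
congr (_ * _); have := H b (mem_head _ _).
have [h|] := boolP (abs (b - a) < r * t); last by rewrite -leNgt => h _; rewrite !max_r ?(le_trans tr) // expr0 mulr1.
by rewrite andbT -leNgt => h'; rewrite !max_l ?(ltW h) // expr1 mulrC.
Qed.

Variables (c : K) (zs ps : seq K).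

Definition ratf z : K := c * \prod_(b <- zs) (z - b) / \prod_(b <- ps) (z - b).
Definition gauss a t : R := abs c * gprod a t zs / gprod a t ps.

Lemma gauss_ge0 a t : 0 < t -> 0 <= gauss a t.
Proof. by move=> t0; rewrite !mulr_ge0 ?invr_ge0 // ltW // gprod_gt0. Qed.

(** Zeros met on the way outwards only increase the norm, so the inequality asks only the poles to
    avoid the annulus; an approximant has no poles in annuli of its affinoid. *)
Lemma gauss_up a t r : 0 < t -> 1 <= r -> (forall b, b \in ps -> ~~ (t < abs (b - a) < r * t)) ->
  gauss a t * r ^+ count_le a t zs <= gauss a (r * t) * r ^+ count_le a t ps.
Proof.
move=> t0 r1 H; have r0 : 0 < r by apply: lt_le_trans r1.
rewrite /gauss (gprod_up_eq t0 r1 H) invfM !mulrA divfK ?expf_neq0 ?gt_eqF //.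
rewrite mulrAC ler_wpM2r ?invr_ge0 ?(ltW (gprod_gt0 _ _ _)) //.
by rewrite -mulrA ler_wpM2l // gprod_up.
Qed.

Lemma gauss_down a t r : 0 < t -> 1 <= r -> (forall b, b \in ps -> ~~ (t < abs (b - a) < r * t)) ->
  gauss a (r * t) * r ^+ count_lt a (r * t) ps <= gauss a t * r ^+ count_lt a (r * t) zs.
Proof.
move=> t0 r1 H; have r0 : 0 < r by apply: lt_le_trans r1.
rewrite /gauss (gprod_down_eq t0 r1 H) invfM !mulrA divfK ?expf_neq0 ?gt_eqF //.
rewrite [leRHS]mulrAC ler_wpM2r ?invr_ge0 ?(ltW (gprod_gt0 _ _ _)) //.
by rewrite -mulrA ler_wpM2l // gprod_down.
Qed.

Lemma gauss_down_eq a t r : 0 < t -> 1 <= r -> (forall b, b \in zs ++ ps -> ~~ (t < abs (b - a) < r * t)) ->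
  gauss a (r * t) * r ^+ count_lt a (r * t) ps = gauss a t * r ^+ count_lt a (r * t) zs.
Proof.
move=> t0 r1 H; have r0 : 0 < r by apply: lt_le_trans r1.
have Hz b : b \in zs -> ~~ (t < abs (b - a) < r * t) by move=> bz; apply: H; rewrite mem_cat bz.
have Hp b : b \in ps -> ~~ (t < abs (b - a) < r * t) by move=> bp; apply: H; rewrite mem_cat bp orbT.
rewrite /gauss (gprod_down_eq t0 r1 Hz) (gprod_down_eq t0 r1 Hp) invfM.
have gp := gprod_gt0 a ps t0.
by field; rewrite expf_neq0 ?gt_eqF.
Qed.

Lemma abs_ratf_le z a t : 0 < t -> abs (z - a) <= t ->
  (forall b, b \in ps -> abs (z - b) = Num.max t (abs (b - a))) -> abs (ratf z) <= gauss a t.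
Proof.
move=> t0 za Hp; rewrite /ratf /gauss abs_div absM !abs_prod.
have -> : \prod_(i <- ps) abs (z - i) = gprod a t ps.
  by rewrite /gprod big_seq [RHS]big_seq; apply: eq_bigr.
rewrite ler_wpM2r ?invr_ge0 ?(ltW (gprod_gt0 _ _ _)) // ler_wpM2l //.
apply: ler_prod => b _; rewrite abs_ge0 /=.
have -> : z - b = (z - a) - (b - a) by ring.
by apply: absB_le; rewrite le_max ?lexx ?orbT // za.
Qed.

Lemma abs_ratf_eq z a t : (forall b, b \in zs ++ ps -> abs (z - b) = Num.max t (abs (b - a))) ->
  abs (ratf z) = gauss a t.
Proof.
move=> H; rewrite /ratf /gauss abs_div absM !abs_prod.
congr (_ * _ / _); rewrite /gprod big_seq [RHS]big_seq; apply: eq_bigr => b bl; apply: H; rewrite mem_cat bl ?orbT //.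
Qed.

Lemma gauss_center a b t : abs (a - b) <= t -> gauss a t = gauss b t.
Proof.
move=> ab; have E l : gprod a t l = gprod b t l.
  rewrite /gprod; apply: eq_bigr => x _.
  rewrite (_ : x - b = (x - a) + (a - b)); last by ring.
  have [h|] := boolP (abs (x - a) <= t); last first.
    by rewrite -ltNge => h; congr Num.max; apply/esym/absDl; exact: le_lt_trans ab h.
  have h' : abs (x - a + (a - b)) <= t by apply: absD_le.
  by rewrite !max_l.
by rewrite /gauss !E.
Qed.

End GaussNorms.

(** * Counting points in disjoint residue discs *)

Section DiscCounts.

Variables (Fq : finFieldType) (R : realType) (K : valued_ext Fq R).
Local Notation abs := (vabs K).
Variables (J : finType) (w : J -> K) (s : R).
Hypothesis w_le : forall j, abs (w j) <= s.
Hypothesis w_far : forall i j, i != j -> s <= abs (w i - w j).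

Lemma disc_sum_le l : (\sum_j count_lt (w j) s l <= count_le 0 s l)%N.
Proof.
rewrite /count_lt /count_le; elim: l => [|b l IH] /=; first by rewrite big1.
rewrite big_split /=; apply: leq_add => //.
have [[j bj]|H] := pselect (exists j, abs (b - w j) < s); last first.
  rewrite big1 // => j _; case: ltP => // bj; case: H; by exists j.
rewrite (bigD1 j) //= bj big1 ?addn0 => [|i ij].
  have -> // : abs (b - 0) <= s.
  by rewrite subr0 -(subrK (w j) b) absD_le // ltW.
case: ltP => // bi; have := w_far ij; rewrite leNgt.
have -> : w i - w j = (b - w j) - (b - w i) by ring.
by rewrite absB_lt.
Qed.

Lemma disc_sum_ge l : (forall b, b \in l -> abs b <= s -> exists j, abs (b - w j) < s) ->
  (count_le 0 s l <= \sum_j count_lt (w j) s l)%N.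
Proof.
rewrite /count_lt /count_le; elim: l => [|b l IH] H //=.
rewrite big_split /=; apply: leq_add; last by apply: IH => b' bl; apply: H; rewrite inE bl orbT.
rewrite subr0; have [bs|//] := leP (abs b) s.
have [j bj] := H b (mem_head _ _) bs.
by rewrite (bigD1 j) //= bj.
Qed.

End DiscCounts.

(** * Slopes of an approximant at a vertex where the maximum is attained *)

Section Approximation.

Variables (Fq : finFieldType) (R : realType) (K : valued_ext Fq R).
Local Notation abs := (vabs K).
Local Notation q := (#|Fq|%:R : R).
Local Notation T := (Defs.iota K (AtoF 'X)).
Local Notation im := (@vabs_i Fq R K).
Local Notation Omega := (@Omega Fq R K).
Local Notation Finf := (@Finf Fq R K).
Local Notation aff m := (Omega_aff (K := K) m).
Implicit Types (z a b : K).

Lemma split_poly (p : {poly K}) : exists c l, forall z, p.[z] = c * \prod_(b <- l) (z - b).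
Proof.
have [l el] := closed_field_poly_normal p; exists (lead_coef p), l => z.
rewrite {1}el hornerZ horner_prod; congr (_ * _).
by apply: eq_bigr => b _; rewrite !hornerE.
Qed.

Lemma holomorphic_approx (f : K -> K) m e : holomorphic f -> 0 < e -> exists c zs ps,
  (forall z, aff m z -> abs (f z - ratf c zs ps z) < e) /\ forall b, b \in ps -> ~ aff m b.
Proof.
move=> hf e0; have [p [r H]] := hf m e e0.
have [c [zs Ep]] := split_poly p; have [c' [ps Er]] := split_poly r.
exists (c / c'), zs, ps; split=> [z za|b bp ba].
  have [r0 near] := H z za; rewrite /ratf; move: near; rewrite Ep Er => near.
  rewrite (_ : c / c' * _ / _ = c * \prod_(b <- zs) (z - b) / (c' * \prod_(b <- ps) (z - b))) //.
  by rewrite invfM mulrACA !mulrA.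
have [] := H b ba; rewrite Er (big_rem b bp) /= subrr mul0r mulr0 eqxx.
by [].
Qed.

Lemma im_sub z a : Finf a -> im (z - a) = im z.
Proof.
move=> fa; apply: le_anti; apply/andP; split; apply: im_ge => x fx.
  have -> : z - x = (z - a) - (x - a) by ring.
  by apply: im_le; exact: FinfB.
have -> : z - a - x = z - (a + x) by ring.
by apply: im_le; exact: FinfD.
Qed.

Lemma annulus_value (i : int) : exists sg : K, q ^ i < abs sg < q ^ (i + 1).
Proof.
have [w /andP[w1 wq]] := near_one K (q_gt1 Fq R); exists (T ^ i * w).
rewrite absM abs_Texp ltr_pMr ?exprz_gt0 // w1 /= expfzDr ?gt_eqF // expr1z.
by rewrite ltr_pM2l ?exprz_gt0.
Qed.

Lemma annulus_im z a (i : int) : Finf a -> q ^ i < abs (z - a) < q ^ (i + 1) -> im z = abs (z - a).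
Proof. by move=> fa; exact: im_noninteger. Qed.

Variables (f : K -> K) (k : nat) (B : R) (m : nat) (c : K) (zs ps : seq K) (e : R).
Hypothesis B_gt0 : 0 < B.
Hypothesis f_le : forall z, Omega z -> abs (f z) * im z ^+ k <= B.
Let h := ratf c zs ps.
Hypothesis near : forall z, aff m z -> abs (f z - h z) < e.
Hypothesis ps_out : forall b, b \in ps -> ~ aff m b.
Hypothesis e_gt0 : 0 < e.
Hypothesis e_small : e * q ^+ m ^+ k <= B.
Let gn := gauss c zs ps.

Lemma im_aff z : aff m z -> 0 < im z <= q ^+ m.
Proof.
move=> [h1 h2]; rewrite (lt_le_trans _ h2) ?invr_gt0 ?exprn_gt0 //=.
by apply: le_trans h1; exact: im_le_abs.
Qed.

Lemma e_im z : aff m z -> e * im z ^+ k <= B.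
Proof.
move=> /im_aff/andP[i0 im1]; apply: le_trans e_small; rewrite ler_pM2l //.
by rewrite lerXn2r ?nnegrE // ?exprn_ge0 // ltW.
Qed.

Lemma h_le z : aff m z -> abs (h z) * im z ^+ k <= B.
Proof.
move=> za; have oz := Omega_aff_Omega za; have i0 : 0 <= im z ^+ k by rewrite exprn_ge0 ?im_ge0.
have -> : h z = f z - (f z - h z) by ring.
apply: le_trans (_ : Num.max (abs (f z)) e * im z ^+ k <= _).
  rewrite ler_wpM2r // absB_le // le_max ?lexx //.
  by rewrite (ltW (near za)) orbT.
have [h1|h1] := leP (abs (f z)) e; first exact: e_im.
exact: f_le.
Qed.

(** Because e |z|_i^k <= B on the affinoid, the error is too small to matter wherever either
    function reaches the bound. *)
Lemma h_max z : aff m z -> abs (h z) * im z ^+ k = B <-> abs (f z) * im z ^+ k = B.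
Proof.
move=> za; have /andP[i0 _] := im_aff za; have i0' : 0 < im z ^+ k by rewrite exprn_gt0.
have nz := near za.
have ge (u : R) : u * im z ^+ k = B -> e <= u.
  by move=> eu; rewrite -(ler_pM2r i0') eu e_im.
split=> H; have eu := ge _ H; rewrite -H; congr (_ * _).
  by apply: abs_near_le nz eu.
by apply/esym; apply: (@abs_near_le _ _ _ _ _ e) => //; rewrite absB in nz; have := abs_near_le nz eu => ->.
Qed.

Lemma annulus_aff z a (i : int) : Finf a -> abs a <= q ^+ m -> - m%:Z <= i -> i + 1 <= m%:Z ->
  q ^ i < abs (z - a) < q ^ (i + 1) -> aff m z.
Proof.
move=> fa am mi im1 za; have /andP[z1 z2] := za; split.
  rewrite -(subrK a z); apply: absD_le => //; apply: le_trans (ltW z2) _.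
  by rewrite exprnP q_exprz_le.
rewrite (annulus_im fa za); apply: le_trans (ltW z1).
by rewrite exprnP invr_expz q_exprz_le.
Qed.

Lemma annulus_poles a (i : int) : Finf a -> abs a <= q ^+ m -> - m%:Z <= i -> i + 1 <= m%:Z ->
  forall b, b \in ps -> ~~ (q ^ i < abs (b - a) < q ^ (i + 1)).
Proof. by move=> fa am mi im1 b /ps_out bn; apply/negP => /annulus_aff H; exact/bn/H. Qed.

Lemma gauss_annulus_le a (i : int) (sg : K) : Finf a -> abs a <= q ^+ m -> - m%:Z <= i -> i + 1 <= m%:Z ->
  q ^ i < abs sg < q ^ (i + 1) -> gn a (abs sg) * abs sg ^+ k <= B.
Proof.
move=> fa am mi im1 sa; have sg0 : sg != 0.
  by rewrite -abs_gt0; apply: lt_trans (_ : q ^ i < _); rewrite ?exprz_gt0 //; case/andP: sa.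
have [z [za Hz]] := generic_pt a (zs ++ ps) sg0.
have zz : aff m z by apply: (annulus_aff fa am mi im1); rewrite za.
have := h_le zz; rewrite /h (abs_ratf_eq c Hz) (annulus_im (i := i) fa) ?za //.
Qed.

(** A pole cannot lie in the affinoid, so a pole in a disc of radius q^i is closer than q^i to
    F_infinity. Hence all poles there belong to the residue discs of the q rational centres. *)
Lemma pole_near z0 a (i : int) b : Finf a -> abs a <= q ^+ m -> - m%:Z <= i -> i <= m%:Z ->
  b \in ps -> abs (b - a) <= q ^ i -> exists2 x, Finf x & abs (b - x) < q ^ i.
Proof.
move=> fa am mi im1 bp ba; apply: contrapT => H; apply: (ps_out bp); split.
  rewrite -(subrK a b); apply: absD_le => //; apply: le_trans ba _.
  by rewrite exprnP q_exprz_le.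
apply: le_trans (_ : q ^ i <= _); first by rewrite exprnP invr_expz q_exprz_le.
by apply: im_ge => x fx; rewrite leNgt; apply/negP => bx; apply: H; exists x.
Qed.

Lemma vertex_aff z (i : int) : - m%:Z <= i -> i <= m%:Z -> abs z = q ^ i -> im z = q ^ i -> aff m z.
Proof.
move=> mi im1 za zi; split; first by rewrite za exprnP q_exprz_le.
by rewrite zi exprnP invr_expz q_exprz_le.
Qed.

Lemma gauss_vertex_le (i : int) : - m%:Z <= i -> i <= m%:Z -> gn 0 (q ^ i) * (q ^ i) ^+ k <= B.
Proof.
move=> mi im1; have [z [za zi Hz]] := @exists_vertex_pt _ _ K i (zs ++ ps).
have := h_le (vertex_aff mi im1 za zi); rewrite zi /h (@abs_ratf_eq Fq R K c zs ps z 0 (q ^ i)) //.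
by move=> b /Hz; rewrite subr0.
Qed.

(** No pole shares a residue disc with a point over the vertex, so every such point is generic with
    respect to the poles. *)
Lemma pole_dist z0 (i : int) b : - m%:Z <= i -> i <= m%:Z -> abs z0 = q ^ i -> im z0 = q ^ i ->
  b \in ps -> abs (z0 - b) = Num.max (q ^ i) (abs (b - 0)).
Proof.
move=> mi im1 za zi bp; rewrite subr0.
have [bi|bi] := leP (abs b) (q ^ i); last by rewrite [LHS]absBr // za.
have [||x fx bx] := @pole_near z0 0 i b (Finf0 K) _ mi im1 bp.
- by rewrite abs0 exprn_ge0.
- by rewrite subr0.
apply: le_anti; rewrite absB_le ?za //=.
have zx : q ^ i <= abs (z0 - x) by rewrite -zi im_le.
have -> : z0 - b = (z0 - x) - (b - x) by ring.
by rewrite absBl // (lt_le_trans bx).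
Qed.

Lemma gauss_vertex z0 (i : int) : - m%:Z <= i -> i <= m%:Z -> abs z0 = q ^ i -> im z0 = q ^ i ->
  abs (f z0) * im z0 ^+ k = B -> gn 0 (q ^ i) * (q ^ i) ^+ k = B.
Proof.
move=> mi im1 za zi fz; apply: le_anti; rewrite gauss_vertex_le //=.
have zz := vertex_aff mi im1 za zi.
rewrite -((h_max zz).2 fz) zi ler_wpM2r ?exprn_ge0 ?exprz_ge0 ?(ltW (q_gt0 _ _)) //.
apply: abs_ratf_le; rewrite ?exprz_gt0 ?subr0 ?za // => b bp.
exact: pole_dist.
Qed.

Lemma exp_le_exp (x : R) (i j : nat) : 1 < x -> (x ^+ i <= x ^+ j) = (i <= j)%N.
Proof. by move=> x1; rewrite ler_eXn2l. Qed.

Section Vertex.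

Variables (i : int).
Hypothesis i_ge : - m%:Z < i.
Hypothesis i_lt : i < m%:Z.
Hypothesis at_max : gn 0 (q ^ i) * (q ^ i) ^+ k = B.
Let s := q ^ i.

Fact im1 : - m%:Z <= i - 1. Proof. by move: i_ge; clear; lia. Qed.
Fact im2 : i - 1 + 1 <= m%:Z. Proof. by move: i_lt; clear; lia. Qed.
Fact im3 : - m%:Z <= i. Proof. exact: ltW. Qed.
Fact im4 : i + 1 <= m%:Z. Proof. by move: i_lt; clear; lia. Qed.

Lemma s_gt0 : 0 < s. Proof. exact: exprz_gt0. Qed.

Let center c' := c2k K c' * T ^ i.

Lemma Finf_center c' : Finf (center c').
Proof. by apply: FinfM; [exact: Finf_c2k | exact: Finf_Texp]. Qed.

Lemma abs_center_le c' : abs (center c') <= s.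
Proof. by rewrite absM abs_Texp ler_piMl ?exprz_ge0 ?abs_c2k_le1 // ltW. Qed.

Lemma abs_center_m c' : abs (center c') <= q ^+ m.
Proof.
by apply: le_trans (abs_center_le c') _; rewrite exprnP q_exprz_le; apply: ltW.
Qed.

Lemma gauss_centerE c' : gn (center c') s = gn 0 s.
Proof. by apply: gauss_center; rewrite subr0 abs_center_le. Qed.

(** If the poles exceeded the zeros by more than k in this disc, the Gauss norm times t^k would grow
    on entering the disc and pass the bound B. *)
Lemma child_le c' : (count_lt (center c') s ps <= k + count_lt (center c') s zs)%N.
Proof.
have [sg /andP[sg1 sg2]] := annulus_value (i - 1); rewrite subrK -/s in sg2.
have sg0 : 0 < abs sg by apply: lt_trans sg1; exact: exprz_gt0.
pose r := s / abs sg; have r1 : 1 < r by rewrite ltr_pdivlMr // mul1r.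
have rs : r * abs sg = s by rewrite divfK // gt_eqF.
have := @gauss_down _ _ _ c zs ps (center c') (abs sg) r sg0 (ltW r1); rewrite rs => /(_ _) H.
have {}H : gn (center c') s * r ^+ count_lt (center c') s ps <= gn (center c') (abs sg) * r ^+ count_lt (center c') s zs.
  apply: H => b bp; apply: contra (annulus_poles (Finf_center c') (abs_center_m c') _ _ bp (i := i - 1)).
  - by move=> /andP[h1 h2]; rewrite subrK (lt_trans sg1).
  - exact: im1.
  - exact: im2.
have H2 := gauss_annulus_le (Finf_center c') (abs_center_m c') (i := i - 1) (sg := sg).
have {}H2 : gn (center c') (abs sg) * abs sg ^+ k <= B by apply: H2; rewrite ?im1 ?im2 // subrK sg1.
rewrite -(exp_le_exp _ _ r1) exprD.
have Bs : gn (center c') s = B / s ^+ k by rewrite gauss_centerE -at_max mulfK // expf_neq0 // gt_eqF // s_gt0.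
have gs0 : 0 < gn (center c') s by rewrite Bs divr_gt0 ?exprn_gt0 ?s_gt0.
rewrite -(ler_pM2l gs0); apply: le_trans H _.
have r0 : 0 < r by apply: lt_trans r1.
rewrite mulrA ler_wpM2r ?exprn_ge0 ?(ltW r0) //.
rewrite Bs /r expr_div_n mulrA divfK ?expf_neq0 ?gt_eqF ?s_gt0 //.
by rewrite ler_pdivlMr // exprn_gt0.
Qed.

(* When the slope vanishes at the vertex, convexity and the bound by B force
   the norm to be constant along the annulus, which then contains no zeros. *)
Lemma child_eq c' z : (count_lt (center c') s ps = k + count_lt (center c') s zs)%N ->
  q ^ (i - 1) < abs (z - center c') < s -> abs (f z) * im z ^+ k = B.
Proof.
move=> ePZ zann; have /andP[z1 z2] := zann.
have zann' : q ^ (i - 1) < abs (z - center c') < q ^ (i - 1 + 1) by rewrite subrK.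
have zz := annulus_aff (Finf_center c') (abs_center_m c') im1 im2 zann'.
have poles := annulus_poles (Finf_center c') (abs_center_m c') im1 im2; rewrite subrK -/s in poles.
have ez := annulus_im (Finf_center c') zann'.
set a := center c' in ePZ zann zann' z1 z2 zz poles ez *.
pose t := abs (z - a); rewrite -/t in z1 z2 ez.
have t0 : 0 < t by apply: lt_trans z1; exact: exprz_gt0.
have Bs : gn a s = B / s ^+ k by rewrite gauss_centerE -at_max mulfK // expf_neq0 // gt_eqF // s_gt0.
have down u v : q ^ (i - 1) < u -> u < v -> v <= s ->
   gn a v * (v / u) ^+ count_lt a v ps <= gn a u * (v / u) ^+ count_lt a v zs.
  move=> u1 uv vs; have u0 : 0 < u by apply: lt_trans u1; exact: exprz_gt0.
  have := @gauss_down _ _ _ c zs ps a u (v / u) u0; rewrite divfK ?gt_eqF //; apply.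
    by rewrite ler_pdivlMr // mul1r ltW.
  move=> b bp; apply: contra (poles b bp) => /andP[h1 h2].
  by rewrite (lt_trans u1) //= (lt_le_trans h2).
have le_B (u : K) : q ^ (i - 1) < abs u -> abs u < s -> gn a (abs u) * abs u ^+ k <= B.
  move=> u1 u2; apply: (gauss_annulus_le (i := i - 1) (Finf_center c') (abs_center_m c') im1 im2).
  by rewrite subrK u1.
have Nt : gn a t * t ^+ k = B.
  apply: le_anti; rewrite le_B //=.
  have := down t s z1 z2 (lexx _); rewrite ePZ exprD mulrA.
  have st0 : 0 < s / t by rewrite divr_gt0 // s_gt0.
  rewrite ler_pM2r ?exprn_gt0 // Bs expr_div_n mulrA divfK ?expf_neq0 ?gt_eqF ?s_gt0 //.
  by rewrite ler_pdivrMr ?exprn_gt0.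
(* A zero on the circle of radius t is lost when shrinking below t. The pole excess would then be
   larger than k, and at the slightly smaller radius |sg| the norm would pass B. *)
have nozero b : b \in zs -> abs (b - a) != t.
  move=> bz; apply/eqP => bt.
  pose w0 := t / q ^ (i - 1); have w01 : 1 < w0 by rewrite ltr_pdivlMr ?exprz_gt0 // mul1r.
  have [w /andP[w1 w2]] := near_one K w01.
  have w0' : 0 < abs w by apply: lt_trans w1.
  pose sg := (z - a) / w; have asg : abs sg = t / abs w by rewrite abs_div.
  have sg1 : q ^ (i - 1) < abs sg.
    by rewrite asg ltr_pdivlMr // mulrC -ltr_pdivlMr ?exprz_gt0.
  have sg2 : abs sg < t by rewrite asg ltr_pdivrMr // ltr_pMr.
  have H := down _ _ sg1 sg2 (ltW z2).
  have r1 : 1 < t / abs sg by rewrite ltr_pdivlMr ?mul1r // (lt_trans _ sg1) ?exprz_gt0.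
  have P : (count_lt a s ps <= count_lt a t ps)%N.
    rewrite /count_lt -!size_filter; rewrite (_ : [seq b <- ps | abs (b - a) < s] = [seq b <- ps | abs (b - a) < t]) //.
    apply: eq_in_filter => x xp; apply/idP/idP => [xs|xt]; last exact: lt_trans z2.
    rewrite ltNge; apply/negP => tx; have := poles x xp; rewrite xs andbT.
    by rewrite (lt_le_trans z1 tx).
  have Z : (count_lt a t zs < count_lt a s zs)%N.
    rewrite /count_lt (permP (perm_to_rem bz)) [X in (_ < X)%N](permP (perm_to_rem bz)) /= bt ltxx z2 add0n add1n ltnS.
    by apply: sub_count => x xt; exact: lt_trans z2.
  have : (count_lt a t ps <= k + count_lt a t zs)%N.
    rewrite -(exp_le_exp _ _ r1) exprD.
    have g0 : 0 < gn a t by rewrite -(pmulr_lgt0 _ (exprn_gt0 k t0)) Nt.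
    rewrite -(ler_pM2l g0); apply: le_trans H _; rewrite mulrA ler_wpM2r ?exprn_ge0 //.
      by apply: ltW; apply: lt_trans r1.
    have sg0 : 0 < abs sg by apply: lt_trans sg1; exact: exprz_gt0.
    rewrite expr_div_n mulrA Nt ler_pdivlMr ?exprn_gt0 // le_B // (lt_trans sg2) //.
  move: ePZ P Z; clear => ePZ P Z H; lia.
apply/(h_max zz); rewrite ez -Nt; congr (_ * _).
apply: abs_ratf_eq => b bl.
have bt : abs (b - a) != t.
  move: bl; rewrite mem_cat => /orP[/nozero//|bp]; apply/eqP => bt.
  by have := poles b bp; rewrite bt z1 z2.
have -> : z - b = (z - a) - (b - a) by ring.
have [h1|h1|h1] := ltgtP (abs (b - a)) t; last by rewrite h1 eqxx in bt.
  by rewrite absBl.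
by rewrite absBr.
Qed.

(** The counterpart of [child_le] for growing radius: with a pole excess below k in the closed disc,
    the norm times t^k would increase outwards. *)
Lemma parent_ge : (count_le 0 s zs + k <= count_le 0 s ps)%N.
Proof.
have [sg /andP[sg1 sg2]] := annulus_value i; rewrite -/s in sg1.
have s0 := s_gt0; pose r := abs sg / s; have r1 : 1 < r by rewrite ltr_pdivlMr // mul1r.
have rs : r * s = abs sg by rewrite divfK // gt_eqF.
have a0 : abs (0 : K) <= q ^+ m by rewrite abs0 exprn_ge0.
have H : gn 0 s * r ^+ count_le 0 s zs <= gn 0 (abs sg) * r ^+ count_le 0 s ps.
  rewrite -rs; apply: gauss_up => //; first exact: ltW.
  move=> b bp; rewrite rs; apply: contra (annulus_poles (Finf0 K) a0 _ _ bp (i := i)).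
  - by move=> /andP[-> h2]; rewrite (lt_trans h2).
  - exact: im3.
  - exact: im4.
have H2 : gn 0 (abs sg) * abs sg ^+ k <= B.
  by apply: (gauss_annulus_le (i := i) (Finf0 K) a0); rewrite ?sg1 ?im3 ?im4.
rewrite -(exp_le_exp _ _ r1) exprD.
have Bs : gn 0 s = B / s ^+ k by rewrite -at_max mulfK // expf_neq0 // gt_eqF.
have gs0 : 0 < gn 0 s by rewrite Bs divr_gt0 ?exprn_gt0.
have r0 : 0 < r by apply: lt_trans r1.
rewrite -(ler_pM2l gs0) mulrA; apply: le_trans (ler_wpM2r _ H) _; first by rewrite exprn_ge0 // ltW.
rewrite mulrAC ler_wpM2r ?exprn_ge0 ?(ltW r0) //.
by rewrite Bs /r expr_div_n mulrA ler_wpM2r // invr_ge0 exprn_ge0 // ltW.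
Qed.

Lemma parent_eq z : (count_le 0 s zs + k = count_le 0 s ps)%N ->
  s < abs z < q ^ (i + 1) -> abs (f z) * im z ^+ k = B.
Proof.
move=> ePZ; rewrite -{1}(subr0 z) => zann; have /andP[z1 z2] := zann.
have s0 := s_gt0.
have a0 : abs (0 : K) <= q ^+ m by rewrite abs0 exprn_ge0.
have im1 := im3; have im2 := im4.
have zann' : q ^ i < abs (z - 0) < q ^ (i + 1) by rewrite z1 subr0.
have zz := annulus_aff (Finf0 K) a0 im1 im2 zann'.
have poles := annulus_poles (Finf0 K) a0 im1 im2; rewrite -/s in poles.
have ez := annulus_im (Finf0 K) zann'.
pose t := abs (z - 0); rewrite -/t in z1 ez; have z2' : t < q ^ (i + 1) by rewrite /t subr0.
have t0 : 0 < t by apply: lt_trans z1.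
have Bs : gn 0 s = B / s ^+ k by rewrite -at_max mulfK // expf_neq0 // gt_eqF.
have up u v : s <= u -> u < v -> v < q ^ (i + 1) ->
   gn 0 u * (v / u) ^+ count_le 0 u zs <= gn 0 v * (v / u) ^+ count_le 0 u ps.
  move=> u1 uv vs; have u0 : 0 < u by apply: lt_le_trans u1.
  have := @gauss_up _ _ _ c zs ps 0 u (v / u) u0; rewrite divfK ?gt_eqF //; apply.
    by rewrite ler_pdivlMr // mul1r ltW.
  move=> b bp; apply: contra (poles b bp) => /andP[h1 h2].
  by rewrite (le_lt_trans u1) //= (lt_trans h2).
have le_B (u : K) : s < abs u -> abs u < q ^ (i + 1) -> gn 0 (abs u) * abs u ^+ k <= B.
  move=> u1 u2; apply: (gauss_annulus_le (i := i) (Finf0 K) a0 im3 im4).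
  by rewrite u1.
have Nt : gn 0 t * t ^+ k = B.
  apply: le_anti; rewrite le_B //=.
  have := up s t (lexx _) z1 z2'; rewrite -ePZ exprD.
  have st0 : 0 < t / s by rewrite divr_gt0.
  rewrite [X in _ <= _ * X]mulrC mulrA ler_pM2r ?exprn_gt0 // Bs => H1.
  move: (ler_wpM2r (exprn_ge0 k (ltW s0)) H1).
  by rewrite divfK ?expf_neq0 ?gt_eqF // expr_div_n -mulrA divfK ?expf_neq0 ?gt_eqF.
have nozero b : b \in zs -> abs (b - 0) != t.
  move=> bz; apply/eqP => bt.
  pose w0 := q ^ (i + 1) / t; have w01 : 1 < w0 by rewrite ltr_pdivlMr // mul1r.
  have [w /andP[w1 w2]] := near_one K w01.
  have w0' : 0 < abs w by apply: lt_trans w1.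
  pose sg := (z - 0) * w; have asg : abs sg = t * abs w by rewrite absM.
  have sg1 : abs sg < q ^ (i + 1).
    by rewrite asg mulrC -ltr_pdivlMr.
  have sg2 : t < abs sg by rewrite asg ltr_pMr.
  have H := up _ _ (ltW z1) sg2 sg1.
  have r1 : 1 < abs sg / t by rewrite ltr_pdivlMr ?mul1r.
  have P : (count_le 0 t ps <= count_le 0 s ps)%N.
    rewrite /count_le -!size_filter; rewrite (_ : [seq b <- ps | abs (b - 0) <= s] = [seq b <- ps | abs (b - 0) <= t]) //.
    apply: eq_in_filter => x xp; apply/idP/idP => [xs|xt]; first exact: le_trans xs (ltW z1).
    rewrite leNgt; apply/negP => tx; have := poles x xp; rewrite tx /=.
    by rewrite (le_lt_trans xt).
  have Z : (count_le 0 s zs < count_le 0 t zs)%N.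
    rewrite /count_le (permP (perm_to_rem bz)) [X in (_ < X)%N](permP (perm_to_rem bz)) /= bt lexx leNgt z1 add0n add1n ltnS.
    by apply: sub_count => x xt; exact: le_trans xt (ltW z1).
  have : (count_le 0 t zs + k <= count_le 0 t ps)%N.
    rewrite -(exp_le_exp _ _ r1) exprD.
    have g0 : 0 < gn 0 t by rewrite -(pmulr_lgt0 _ (exprn_gt0 k t0)) Nt.
    have sg0 : 0 < abs sg by apply: lt_trans sg2.
    have r0 : 0 <= abs sg / t by rewrite divr_ge0 // ltW.
    rewrite -(ler_pM2l g0) mulrA; apply: le_trans (ler_wpM2r _ H) _; first by rewrite exprn_ge0.
    rewrite mulrAC ler_wpM2r ?exprn_ge0 //.
    rewrite expr_div_n mulrA ler_pdivrMr ?exprn_gt0 // Nt le_B // (lt_trans z1) //.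
  move: ePZ P Z; clear => ePZ P Z H; lia.
apply/(h_max zz); rewrite ez -Nt; congr (_ * _).
apply: abs_ratf_eq => b bl.
have bt : abs (b - 0) != t.
  move: bl; rewrite mem_cat => /orP[/nozero//|bp]; apply/eqP => bt.
  by have := poles b bp; rewrite bt z1 z2'.
have -> : z - b = (z - 0) - (b - 0) by ring.
have [h1|h1|h1] := ltgtP (abs (b - 0)) t; last by rewrite h1 eqxx in bt.
  by rewrite absBl.
by rewrite absBr.
Qed.

(** If the approximant had no zero in the residue disc of w, it would reach the bound at w, and by
    [h_max] so would f, which vanishes there. *)
Lemma zero_near w : abs w = s -> im w = s -> f w = 0 -> (0 < count_lt w s zs)%N.
Proof.
move=> wa wi fw; have mi := im3; have im1 := ltW i_lt.
have ww := vertex_aff mi im1 wa wi.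
rewrite lt0n; apply/eqP => c0.
have far b : b \in zs -> s <= abs (b - w).
  move=> bz; rewrite leNgt; apply/negP => bw.
  by move/eqP: c0; rewrite -leqn0 leqNgt -has_count; apply/negP/negPn/hasP; exists b.
have : abs (h w) * im w ^+ k = B.
  rewrite wi -at_max; congr (_ * _); apply: abs_ratf_eq => b.
  rewrite mem_cat => /orP[bz|bp]; last exact: pole_dist.
  rewrite subr0; have := far b bz; rewrite absB.
  have [h1|h1] := leP (abs b) s; last by rewrite [LHS]absBr // wa.
  by move=> h2; apply: le_anti; rewrite h2 andbT absB_le // wa.
move=> /(h_max ww); rewrite fw abs0 mul0r => B0; move: B_gt0; rewrite -B0 ltxx; by [].
Qed.

(** The poles in the closed disc all lie in the q rational discs, each with pole excess at most k -
    1. The discs around the points w are disjoint from these and contribute at least N zeros, while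
    the total pole excess is at least k + 1. Together this exceeds q(k - 1) by one. *)
Lemma vertex_contradiction (k_ge2 : (2 <= k)%N) (w : 'I_(kdim Fq k) -> K)
  (child_lt : forall c', exists2 z, q ^ (i - 1) < abs (z - center c') < s & abs (f z) * im z ^+ k < B)
  (parent_lt : exists2 z, s < abs z < q ^ (i + 1) & abs (f z) * im z ^+ k < B)
  (w_vertex : forall j, abs (w j) = s /\ im (w j) = s)
  (w_far : forall j j', j != j' -> s <= abs (w j - w j'))
  (w_zero : forall j, f (w j) = 0) : False.
Proof.
have hc c' : (count_lt (center c') s ps < k + count_lt (center c') s zs)%N.
  rewrite ltn_neqAle child_le andbT; apply/eqP => e1.
  by have [z za] := child_lt c'; rewrite (child_eq e1 za) ltxx.
have hp : (count_le 0 s zs + k < count_le 0 s ps)%N.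
  rewrite ltn_neqAle parent_ge andbT; apply/eqP => e1.
  by have [z za] := parent_lt; rewrite (parent_eq e1 za) ltxx.
have cfar c1 c2 : c1 != c2 -> s <= abs (center c1 - center c2).
  move=> c12; rewrite /center -mulrBl -rmorphB absM abs_c2k ?subr_eq0 //.
  by rewrite mul1r abs_Texp.
have Hp : (count_le 0 s ps <= \sum_c' count_lt (center c') s ps)%N.
  apply: disc_sum_ge => b bp bs.
  have [||x fx bx] := @pole_near 0 0 i b (Finf0 K) _ (ltW i_ge) (ltW i_lt) bp.
  - by rewrite abs0 exprn_ge0.
  - by rewrite subr0.
  have [|c' xc] := Finf_digit fx (_ : abs x <= q ^ i).
    by rewrite -(subrK b x) absD_le // absB ltW.
  exists c'; rewrite /center.
  have -> : b - c2k K c' * T ^ i = (b - x) + (x - c2k K c' * T ^ i) by ring.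
  exact: absD_lt.
pose w' (x : Fq + 'I_(kdim Fq k)) := match x with inl c' => center c' | inr j => w j end.
have Hz := @disc_sum_le _ _ K _ w' s _ _ zs.
have {}Hz : (\sum_x count_lt (w' x) s zs <= count_le 0 s zs)%N.
  apply: Hz => [[c'|j]|[c1|j1] [c2|j2]] /=; rewrite ?abs_center_le ?(w_vertex j).1 //.
  - exact: cfar.
  - by move=> _; rewrite absB -(w_vertex j2).2 im_le //; exact: Finf_center.
  - by move=> _; rewrite -(w_vertex j1).2 im_le //; exact: Finf_center.
  - by move=> j12; apply: w_far; apply: contraNneq j12 => ->.
rewrite big_sumType /= in Hz.
have Hw : (kdim Fq k <= \sum_j count_lt (w j) s zs)%N.
  rewrite -{1}(card_ord (kdim Fq k)) -sum1_card; apply: leq_sum => j _.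
  by apply: zero_near; rewrite ?w_zero //; case: (w_vertex j).
have Hs : (\sum_c' count_lt (center c') s ps <= \sum_c' count_lt (center c') s zs + #|Fq| * k.-1)%N.
  rewrite -(sum_nat_const Fq) -big_split /=; apply: leq_sum => c' _; have := hc c'; lia.
have q2 : (2 <= #|Fq|)%N by exact: finNzRing_gt1.
have e1 : (#|Fq| * k.-1 = #|Fq| * k - #|Fq|)%N by rewrite -subn1 mulnBr muln1.
have e2 : (k * (#|Fq| - 1) = #|Fq| * k - k)%N by rewrite mulnBr muln1 mulnC.
(* Excludes truncation in the subtraction that defines [kdim]. *)
have : (k + #|Fq| <= #|Fq| * k)%N by nia.
have : kdim Fq k = (k * (#|Fq| - 1) - #|Fq|)%N by [].
move: hp Hp Hz Hs Hw e1 e2; clear.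
move: (\sum_j count_lt (w j) s zs)%N (\sum_c' count_lt (center c') s ps)%N (\sum_c' count_lt (center c') s zs)%N.
lia.
Qed.

End Vertex.

End Approximation.

(** * Maxima over vertices and along edges *)

Section LocalMaxima.

Variables (Fq : finFieldType) (R : realType) (K : valued_ext Fq R).
Local Notation abs := (vabs K).
Local Notation q := (#|Fq|%:R : R).
Local Notation T := (Defs.iota K (AtoF 'X)).
Local Notation im := (@vabs_i Fq R K).
Local Notation Omega := (@Omega Fq R K).
Local Notation Finf := (@Finf Fq R K).
Local Notation aff m := (Omega_aff (K := K) m).
Implicit Types (z a b : K).

Section OneApproximation.

Variables (f : K -> K) (m : nat) (c : K) (zs ps : seq K) (e : R).
Let h := ratf c zs ps.
Hypothesis near : forall z, aff m z -> abs (f z - h z) < e.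
Hypothesis ps_out : forall b, b \in ps -> ~ aff m b.
Let gn := gauss c zs ps.

Lemma abs_h z : aff m z -> e <= abs (f z) -> abs (h z) = abs (f z).
Proof. by move=> /near; rewrite absB => H1; exact: abs_near_le. Qed.

Lemma abs_f z : aff m z -> e <= abs (h z) -> abs (f z) = abs (h z).
Proof. by move=> /near H1; exact: abs_near_le. Qed.

Lemma h_vertex_le z (i : int) : - m%:Z <= i -> i <= m%:Z -> abs z = q ^ i -> im z = q ^ i ->
  abs (h z) <= gn 0 (q ^ i).
Proof.
move=> mi im1 za zi; apply: abs_ratf_le; rewrite ?exprz_gt0 ?subr0 ?za // => b bp.
exact: (pole_dist ps_out mi im1).
Qed.

Lemma vertex_attain (i : int) : - m%:Z <= i -> i <= m%:Z -> e <= gn 0 (q ^ i) ->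
  exists z, [/\ abs z = q ^ i, im z = q ^ i & abs (f z) = gn 0 (q ^ i)].
Proof.
move=> mi im1 eN; have [z [za zi Hz]] := @exists_vertex_pt _ _ K i (zs ++ ps).
have hz : abs (h z) = gn 0 (q ^ i) by apply: abs_ratf_eq => b /Hz; rewrite subr0.
by exists z; split=> //; rewrite abs_f ?hz //; exact: vertex_aff za zi.
Qed.

Lemma annulus_pole_dist a z (i : int) : Finf a -> abs a <= q ^+ m -> - m%:Z <= i -> i + 1 <= m%:Z ->
  q ^ i < abs (z - a) < q ^ (i + 1) -> forall b, b \in ps ->
  abs (b - a) != abs (z - a) /\ abs (z - b) = Num.max (abs (z - a)) (abs (b - a)).
Proof.
move=> fa am mi im1 za b bp; have H := annulus_poles ps_out fa am mi im1 bp.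
have bz : abs (b - a) != abs (z - a) by apply: contraNneq H => ->.
split=> //; have -> : z - b = (z - a) - (b - a) by ring.
have [h1|h1|h1] := ltgtP (abs (b - a)) (abs (z - a)); last by rewrite h1 eqxx in bz.
  by rewrite absBl.
by rewrite absBr.
Qed.

End OneApproximation.

(** An error equal to one nonzero value is small enough: the Gauss norm of the approximant is at
    least this value, is attained by f at a generic point, and bounds f over the vertex. *)
Lemma vertex_max f (i : nat) : holomorphic f -> exists z0, [/\ abs z0 = q ^ i%:Z, im z0 = q ^ i%:Z &
  forall z, abs z = q ^ i%:Z -> im z = q ^ i%:Z -> abs (f z) <= abs (f z0)].
Proof.
move=> hf; have [[z1 [a1 i1 f1]]|H] := pselect (exists z1, [/\ abs z1 = q ^ i%:Z, im z1 = q ^ i%:Z & f z1 != 0]); last first.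
  have [z0 [za zi _]] := @exists_vertex_pt _ _ K i [::]; exists z0; split=> // z az iz.
  have [->|fz] := eqVneq (f z) 0; first by rewrite abs0.
  by case: H; exists z.
have e0 : 0 < abs (f z1) by rewrite abs_gt0.
have [c [zs [ps [near out]]]] := holomorphic_approx i hf e0.
have mi : - i%:Z <= i%:Z by lia.
have N1 : abs (f z1) <= gauss c zs ps 0 (q ^ i).
  rewrite -(abs_h near (vertex_aff mi (lexx _) a1 i1) (lexx _)).
  exact: (h_vertex_le c zs out mi (lexx _) a1 i1).
have [z0 [a0 i0 f0]] := vertex_attain near mi (lexx _) N1.
exists z0; split=> // z az iz; rewrite f0.
have [fz|fz] := leP (abs (f z1)) (abs (f z)); last by rewrite (le_trans (ltW fz)).
by rewrite -(abs_h near (vertex_aff mi (lexx _) az iz) fz); exact: (h_vertex_le c zs out mi (lexx _) az iz).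
Qed.

(** The sign of zeros + k - poles in the disc through z decides where the norm times t^k grows:
    weakly outwards or strictly inwards. Strictness on the inner side matters on the edges that
    leave the stable part. *)
Lemma annulus_max f k (i : nat) z : holomorphic f -> f z != 0 -> q ^ i%:Z < abs z < q ^ (i%:Z + 1) ->
  (exists z0, [/\ abs z0 = q ^ (i%:Z + 1), im z0 = q ^ (i%:Z + 1) &
     abs (f z) * im z ^+ k <= abs (f z0) * im z0 ^+ k]) \/
  (exists z0, [/\ abs z0 = q ^ i%:Z, im z0 = q ^ i%:Z &
     abs (f z) * im z ^+ k < abs (f z0) * im z0 ^+ k]).
Proof.
have mi : - (i.+1)%:Z <= i%:Z by lia.
have im1 : i%:Z + 1 <= (i.+1)%:Z by lia.
have mi1 : - (i.+1)%:Z <= i%:Z + 1 by lia.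
have im0 : i%:Z <= (i.+1)%:Z by lia.
move=> hf fz; rewrite -{1 2}(subr0 z) => za.
set s := q ^ i%:Z in za *; set S := q ^ (i%:Z + 1) in za *; pose t := abs (z - 0).
have /andP[st tS] := za; rewrite -/t in st tS.
have s0 : 0 < s by exact: exprz_gt0.
have t0 : 0 < t by apply: lt_trans st.
have S0 : 0 < S by apply: lt_trans tS.
(* The factor (t / S)^k keeps the error below the Gauss norm at the outer vertex too, where only
   norm times radius^k is bounded below. *)
pose e := abs (f z) * (t / S) ^+ k.
have fz0 : 0 < abs (f z) by rewrite abs_gt0.
have e0 : 0 < e by rewrite mulr_gt0 // exprn_gt0 // divr_gt0.
have [c [zs [ps [near out]]]] := holomorphic_approx i.+1 hf e0.
have a0 : abs (0 : K) <= q ^+ i.+1 by rewrite abs0 exprn_ge0.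
have zz := annulus_aff (Finf0 K) a0 mi im1 za.
have ez : im z = t := annulus_im (Finf0 K) za.
have efz : e <= abs (f z).
  rewrite /e ler_piMr ?exprn_ile1 ?divr_ge0 ?(ltW t0) ?(ltW S0) //.
  by rewrite ler_pdivrMr // mul1r ltW.
have PD := annulus_pole_dist out (Finf0 K) a0 mi im1 za.
have Nt : abs (f z) <= gauss c zs ps 0 t.
  rewrite -(abs_h near zz efz); apply: abs_ratf_le => // b bp; exact: (PD b bp).2.
have poles := annulus_poles out (Finf0 K) a0 mi im1.
have PP : count_le 0 t ps = count_lt 0 t ps.
  by rewrite /count_le /count_lt; apply: eq_in_count => b bp; rewrite le_eqVlt (negPf (PD b bp).1).
pose Z := count_le 0 t zs; pose P := count_le 0 t ps.
have [hZ|hZ] := leqP P (Z + k).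
  left; have r1 : 1 <= S / t by rewrite ler_pdivlMr // mul1r ltW.
  have := @gauss_up _ _ _ c zs ps 0 t (S / t) t0 r1; rewrite divfK ?gt_eqF // => /(_ _) H.
  have {}H : gauss c zs ps 0 t * (S / t) ^+ Z <= gauss c zs ps 0 S * (S / t) ^+ P.
    by apply: H => b bp; apply: contra (poles b bp) => /andP[h1 ->]; rewrite (lt_trans st).
  have {}H : gauss c zs ps 0 t <= gauss c zs ps 0 S * (S / t) ^+ k.
    have := le_trans H (ler_wpM2l (gauss_ge0 _ _ _ _ S0) (ler_weXn2l r1 hZ)).
    by rewrite addnC exprD mulrA ler_pM2r // exprn_gt0 // divr_gt0.
  have HS : abs (f z) * t ^+ k <= gauss c zs ps 0 S * S ^+ k.
    apply: le_trans (ler_wpM2r (exprn_ge0 k (ltW t0)) (le_trans Nt H)) _.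
    by rewrite expr_div_n mulrA divfK // gt_eqF // exprn_gt0.
  have eN : e <= gauss c zs ps 0 S by rewrite /e expr_div_n mulrA ler_pdivrMr ?exprn_gt0.
  have [z0 [az0 iz0 f0]] := vertex_attain near mi1 im1 eN.
  by exists z0; split=> //; rewrite f0 iz0 ez.
right; have r1 : 1 < t / s by rewrite ltr_pdivlMr // mul1r.
have := @gauss_down _ _ _ c zs ps 0 s (t / s) s0 (ltW r1); rewrite divfK ?gt_eqF // => /(_ _) H.
have {}H : gauss c zs ps 0 t * (t / s) ^+ P <= gauss c zs ps 0 s * (t / s) ^+ Z.
  rewrite {1}/P PP; apply: le_trans (H _) _.
    by move=> b bp; apply: contra (poles b bp) => /andP[-> h1]; rewrite (lt_trans h1).
  rewrite ler_wpM2l ?gauss_ge0 // ler_weXn2l ?(ltW r1) //.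
  by apply: sub_count => x /=; exact: ltW.
have {}H : gauss c zs ps 0 t * (t / s) ^+ k.+1 <= gauss c zs ps 0 s.
  have := le_trans (ler_wpM2l (gauss_ge0 _ _ _ _ t0) (ler_weXn2l (ltW r1) hZ)) H.
  by rewrite -addnS addnC exprD mulrA ler_pM2r // exprn_gt0 // divr_gt0.
have gt0 : 0 < gauss c zs ps 0 t by apply: lt_le_trans Nt.
have HS : abs (f z) * t ^+ k < gauss c zs ps 0 s * s ^+ k.
  apply: lt_le_trans (ler_wpM2r (exprn_ge0 k (ltW s0)) H).
  have -> : (t / s) ^+ k.+1 = (t / s) * (t ^+ k / s ^+ k) by rewrite exprS expr_div_n.
  rewrite !mulrA divfK ?gt_eqF ?exprn_gt0 // ltr_pM2r ?exprn_gt0 // -mulrA.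
  by apply: le_lt_trans Nt _; rewrite ltr_pMr.
have eN : e <= gauss c zs ps 0 s.
  apply: le_trans efz _; apply: le_trans Nt _; apply: le_trans H.
  by rewrite ler_peMr ?(ltW gt0) // exprn_ege1 // ltW.
have [z0 [az0 iz0 f0]] := vertex_attain near mi im0 eN.
by exists z0; split=> //; rewrite f0 iz0 ez.
Qed.

End LocalMaxima.

(** * Vertices of type at least d: periodicity against decay *)

Section CuspLemma.

Variables (Fq : finFieldType) (R : realType) (K : valued_ext Fq R).
Local Notation abs := (vabs K).
Local Notation q := (#|Fq|%:R : R).
Local Notation T := (Defs.iota K (AtoF 'X)).
Local Notation im := (@vabs_i Fq R K).
Local Notation Omega := (@Omega Fq R K).
Local Notation Finf := (@Finf Fq R K).
Local Notation aff m := (Omega_aff (K := K) m).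
Implicit Types (z a b : K).

Variables (n : {poly Fq}) (d : nat).
Hypothesis n_monic : n \is monic.
Hypothesis n_deg : size n = d.+1.

(* An entry [p] stands for the period [n * p], of absolute value at most
   [q ^+ L]. *)
Definition multiples L : seq {poly Fq} := [seq p <- small_polys Fq (L.+1 - d) | p != 0].

Lemma multiplesP L p : (p \in multiples L) = (p != 0) && (size p <= L.+1 - d)%N.
Proof. by rewrite mem_filter mem_small_polys. Qed.

Lemma multiples_uniq L : uniq (multiples L).
Proof. by rewrite filter_uniq // small_polys_uniq. Qed.

Lemma n_neq0 : n != 0. Proof. by rewrite monic_neq0. Qed.

Lemma abs_multiple p : p != 0 -> abs (a2k K (n * p)) = q ^+ (d + (size p).-1).
Proof.
move=> p0; rewrite abs_a2k ?mulf_neq0 ?n_neq0 // size_mul ?n_neq0 // n_deg.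
by rewrite addSn /= -subn1 -addnBA ?subn1 // size_poly_gt0.
Qed.

Lemma abs_multiple_le L p : p \in multiples L -> abs (a2k K (n * p)) <= q ^+ L.
Proof.
rewrite multiplesP => /andP[p0 sp]; rewrite abs_multiple // ler_weXn2l ?(ltW (q_gt1 _ _)) //.
by have := size_poly_gt0 p; rewrite p0; lia.
Qed.

Lemma size_multiples L : (size (multiples L)).+1 = (#|Fq| ^ (L.+1 - d))%N.
Proof.
rewrite -size_small_polys size_filter -(count_predC (fun p : {poly Fq} => p != 0)) -addn1; congr addn.
rewrite (eq_count (a2 := pred1 0)); last by move=> p /=; rewrite negbK.
by rewrite count_uniq_mem ?small_polys_uniq // mem_small_polys size_poly0.
Qed.

Lemma prod_subset (s t : seq {poly Fq}) (g : {poly Fq} -> R) : uniq s -> uniq t -> {subset s <= t} ->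
  (forall p, p \in t -> 1 <= g p) -> \prod_(p <- s) g p <= \prod_(p <- t) g p.
Proof.
move=> us ut st g1; rewrite [X in _ <= X](bigID (mem s)) /= -[X in _ <= X * _]big_filter.
have pe : perm_eq [seq p <- t | p \in s] s.
  apply: uniq_perm; rewrite ?filter_uniq // => p; rewrite mem_filter.
  by apply: andb_idr; apply: st.
rewrite (perm_big _ pe) /= ler_peMr //.
  by rewrite big_seq prodr_ge0 // => p /st /g1; apply: le_trans.
rewrite big_seq_cond; elim/big_rec: _ => // p x /andP[pt _] x1; rewrite -[1]mulr1; apply: ler_pM => //.
exact: g1.
Qed.

(** The absolute value at |z| = |z|_i = q^L of the exponential function of the lattice nA: periods
    larger than q^L contribute factors of absolute value 1. *)
Definition theta L : R := q ^+ L * \prod_(p <- multiples L) (q ^+ L / abs (a2k K (n * p))).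

Lemma theta_ge L : q ^+ L <= theta L.
Proof.
rewrite /theta ler_peMr ?exprn_ge0 //.
have := @prod_subset [::] (multiples L) (fun p => q ^+ L / abs (a2k K (n * p))) isT (multiples_uniq L).
rewrite big_nil; apply => // p pL; rewrite ler_pdivlMr ?mul1r ?abs_multiple_le //.
by move: pL; rewrite multiplesP => /andP[p0 _]; rewrite abs_multiple // exprn_gt0.
Qed.

Lemma theta_gt0 L : 0 < theta L.
Proof. by apply: lt_le_trans (theta_ge L); rewrite exprn_gt0. Qed.

(** The exponent is the number of periods of absolute value at most q^L, zero included; each of them
    contributes a factor q. *)
Lemma theta_step L : theta L * q ^+ (#|Fq| ^ (L.+1 - d)) <= theta L.+1.
Proof.
have pos p L' : p \in multiples L' -> 0 < abs (a2k K (n * p)).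
  by rewrite multiplesP => /andP[p0 _]; rewrite abs_multiple // exprn_gt0.
apply: le_trans (_ : q ^+ L.+1 * \prod_(p <- multiples L) (q ^+ L.+1 / abs (a2k K (n * p))) <= _).
  under [X in _ <= _ * X]eq_bigr do rewrite exprS -mulrA.
  rewrite big_split /= big_const_seq count_predT iter_mulr mulr1 exprS.
  by rewrite mulrACA -exprS size_multiples mulrC.
rewrite ler_pM2l ?exprn_gt0 //; apply: prod_subset; rewrite ?multiples_uniq //.
  by move=> p; rewrite !multiplesP => /andP[-> /=]; lia.
by move=> p pL; rewrite ler_pdivlMr ?mul1r ?abs_multiple_le // (pos _ _ pL).
Qed.

Lemma theta_le L M : (L <= M)%N -> theta L <= theta M.
Proof.
move=> LM; rewrite -(subnK LM); elim: (M - L)%N => [|i IH]; first by rewrite add0n.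
apply: le_trans IH _; rewrite addSn; apply: le_trans (theta_step _).
by rewrite ler_peMr ?(ltW (theta_gt0 _)) // exprn_ege1 // ltW // q_gt1.
Qed.

(* A multiple of [n] in each of the discs of radius [q ^+ L.+1] around the
   points [c T ^+ L.+1]. *)
Definition shift_of L (c : Fq) : {poly Fq} := n * (c *: 'X^(L.+1 - d)).

Lemma shift_near L c : (d <= L.+1)%N -> abs (a2k K (shift_of L c) - c2k K c * T ^+ L.+1) < q ^+ L.+1.
Proof.
move=> dL; have -> : T ^+ L.+1 = a2k K 'X^(L.+1) by rewrite rmorphXn.
rewrite c2kE -rmorphM -rmorphB /shift_of.
set p := _ - _; have [->|p0] := eqVneq p 0; first by rewrite rmorph0 abs0 exprn_gt0.
rewrite abs_a2k // ltr_eXn2l ?q_gt1 // prednK ?size_poly_gt0 //.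
apply/leq_sizeP => j; rewrite leq_eqVlt => /orP[/eqP <-|jL].
  rewrite /p coefB -scalerAr coefZ mul_polyC coefZ coefXn eqxx coefMXn.
  rewrite ltnNge leq_subr /= subKn // -[d]/(d.+1.-1) -n_deg.
  by rewrite -/(lead_coef n) (monicP n_monic) subrr.
rewrite /p coefB -scalerAr coefZ mul_polyC coefZ coefXn gtn_eqF // coefMXn.
rewrite ltnNge (leq_trans (leq_subr _ _) (ltnW jL)) /= nth_default ?mulr0 ?subrr //.
by rewrite n_deg; lia.
Qed.

Variables (f : K -> K) (k : nat) (B : R).
Hypothesis B_gt0 : 0 < B.
Hypothesis f_holo : holomorphic f.
Hypothesis f_le : forall z, Omega z -> abs (f z) * im z ^+ k <= B.
Hypothesis f_periodic : forall p z, Omega z -> f (z + a2k K (n * p)) = f z.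

Section Counting.

Variables (m : nat) (c : K) (zs ps : seq K) (e : R).
Let h := ratf c zs ps.
Hypothesis near : forall z, aff m z -> abs (f z - h z) < e.
Hypothesis ps_out : forall b, b \in ps -> ~ aff m b.
Hypothesis e_gt0 : 0 < e.
Hypothesis e_small : e * q ^+ m ^+ k <= B.
Let N a t := gauss c zs ps a t.
Let Q L := q ^+ L.

(** The pole excess in the disc is at most k times the number of periods in it. Equivalently for the
    slopes, the Gauss norm falls no faster than theta^-k grows, whence [N_step]. *)
Definition balanced L := (count_le 0 (Q L) ps <= count_le 0 (Q L) zs + k * #|Fq| ^ (L.+1 - d))%N.

Lemma Q_gt0 L : 0 < Q L. Proof. by rewrite exprn_gt0. Qed.

Lemma Q_ltm L : (L < m)%N -> [/\ - m%:Z <= L%:Z, L%:Z + 1 <= m%:Z & Q L.+1 = q ^ (L%:Z + 1)].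
Proof. by move=> Lm; split; [move: Lm; clear; lia | move: Lm; clear; lia | rewrite addrC -intS]. Qed.

Lemma annulus_ps a L : Finf a -> abs a <= q ^+ m -> (L < m)%N -> forall b, b \in ps ->
  ~~ (Q L < abs (b - a) < Q L.+1).
Proof.
move=> fa am /Q_ltm[mi im1 ->]; exact: (annulus_poles ps_out fa am mi im1).
Qed.

Lemma disc_cover L (w : Fq -> K) : (L <= m)%N -> (forall x, abs (w x - c2k K x * T ^+ L) < Q L) ->
  (count_le 0 (Q L) ps <= \sum_x count_lt (w x) (Q L) ps)%N /\
  (\sum_x count_lt (w x) (Q L) zs <= count_le 0 (Q L) zs)%N.
Proof.
move=> Lm wn; have cl x : abs (c2k K x * T ^+ L) <= Q L.
  by rewrite absM absX abs_T ler_piMl ?exprn_ge0 // abs_c2k_le1.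
split.
  apply: disc_sum_ge => b bp bs.
  have mi : - m%:Z <= L%:Z by lia.
  have im1 : L%:Z <= m%:Z by lia.
  have [||x fx bx] := @pole_near _ _ K m ps ps_out 0 0 L b (Finf0 K) _ mi im1 bp.
  - by rewrite abs0 exprn_ge0.
  - by rewrite subr0.
  have [|x' xc] := Finf_digit fx (_ : abs x <= q ^ L%:Z).
    by rewrite -(subrK b x) absD_le // absB ltW.
  exists x'; have -> : b - w x' = (b - x) + ((x - c2k K x' * T ^ L) - (w x' - c2k K x' * T ^ L)) by ring.
  by apply: absD_lt => //; apply: absB_lt => //; exact: wn.
apply: disc_sum_le => [x|x y xy].
  by rewrite -(subrK (c2k K x * T ^+ L) (w x)) absD_le // ltW.
have -> : w x - w y = ((w x - c2k K x * T ^+ L) - (w y - c2k K y * T ^+ L)) + (c2k K x - c2k K y) * T ^+ L by ring.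
have E : abs ((c2k K x - c2k K y) * T ^+ L) = Q L.
  by rewrite -rmorphB absM abs_c2k ?subr_eq0 // mul1r absX abs_T.
by rewrite [leRHS]absDr E // absB_lt.
Qed.

(** By [child_le] the q residue discs have total pole excess at most q k, and d <= j makes the
    number of periods at least q. *)
Lemma balanced_base j : (d <= j)%N -> (j < m)%N -> N 0 (Q j) * Q j ^+ k = B -> balanced j.
Proof.
move=> dj jm H; have wn (x : Fq) : abs (c2k K x * T ^+ j - c2k K x * T ^+ j) < Q j by rewrite subrr abs0 Q_gt0.
have [H1 H2] := disc_cover (ltnW jm) wn.
have jm1 : - m%:Z < j%:Z by lia.
have jm2 : j%:Z < m%:Z by lia.
have ch := child_le B_gt0 f_le near ps_out e_gt0 e_small jm1 jm2 H.
rewrite /balanced; apply: leq_trans H1 _.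
apply: (@leq_trans (\sum_x (k + count_lt (c2k K x * T ^+ j) (Q j) zs))).
  by apply: leq_sum => x _; exact: ch.
rewrite big_split /= sum_nat_const addnC leq_add // mulnC leq_mul2l orbC.
rewrite -{1}(expn1 #|Fq|) leq_pexp2l //; first by rewrite (ltn_trans _ (finNzRing_gt1 Fq)).
by lia.
Qed.

Lemma N_up L t : (L < m)%N -> Q L <= t -> t <= Q L.+1 -> balanced L ->
  N 0 (Q L) <= N 0 t * (t / Q L) ^+ (k * #|Fq| ^ (L.+1 - d)).
Proof.
move=> Lm t1 t2 bal; have r1 : 1 <= t / Q L by rewrite ler_pdivlMr ?mul1r // Q_gt0.
have := gauss_up c zs (Q_gt0 L) r1 (a := 0) (ps := ps); rewrite divfK ?gt_eqF ?Q_gt0 // => /(_ _) H.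
have t0 : 0 < t by apply: lt_le_trans (Q_gt0 L) t1.
have {}H := le_trans (H _) (ler_wpM2l (gauss_ge0 c zs ps 0 t0) (ler_weXn2l r1 bal)).
rewrite -(ler_pM2r (_ : 0 < (t / Q L) ^+ count_le 0 (Q L) zs)); last first.
  by rewrite exprn_gt0 // divr_gt0 ?Q_gt0.
rewrite -[leRHS]mulrA -exprD addnC; apply: H => b bp; apply: contra (annulus_ps (Finf0 K) _ Lm bp).
  by move=> /andP[-> h1]; rewrite (lt_le_trans h1).
by rewrite abs0 exprn_ge0.
Qed.

Lemma N_step L : (L < m)%N -> balanced L ->
  N 0 (Q L) * theta L ^+ k <= N 0 (Q L.+1) * theta L.+1 ^+ k.
Proof.
move=> Lm bal; have QQ : Q L <= Q L.+1 by rewrite ler_weXn2l ?(ltW (q_gt1 _ _)).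
have := N_up Lm QQ (lexx _) bal; rewrite {2 3}/Q exprS mulfK ?expf_neq0 ?gt_eqF // -exprS => H.
apply: le_trans (ler_wpM2r (exprn_ge0 k (ltW (theta_gt0 L))) H) _.
rewrite -mulrA ler_wpM2l ?gauss_ge0 ?Q_gt0 // mulnC exprM -exprMn mulrC.
have th1 := ltW (theta_gt0 L.+1); have th0 := ltW (theta_gt0 L).
by rewrite lerXn2r ?nnegrE ?theta_step // mulr_ge0 ?exprn_ge0.
Qed.

(* Periodicity makes the Gauss norms around [0] and around a period agree,
   hence also their slopes, which count zeros and poles. *)
Lemma child_counts L p : (L < m)%N -> abs (a2k K (n * p)) <= Q L.+1 -> balanced L ->
  e * q ^+ (k * #|Fq| ^ (L.+1 - d)) <= N 0 (Q L) ->
  (count_lt (a2k K (n * p)) (Q L.+1) ps + count_lt 0 (Q L.+1) zs =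
   count_lt 0 (Q L.+1) ps + count_lt (a2k K (n * p)) (Q L.+1) zs)%N.
Proof.
move=> Lm; set b := a2k K (n * p) => bQ bal eN.
have [mi im1 QE] := Q_ltm Lm.
have fb : Finf b by exact: Finf_a2k.
have bm : abs b <= q ^+ m by apply: le_trans bQ _; rewrite ler_weXn2l ?(ltW (q_gt1 _ _)).
have a0 : abs (0 : K) <= q ^+ m by rewrite abs0 exprn_ge0.
have QQ : Q L < Q L.+1 by rewrite ltr_eXn2l // q_gt1.
(* Between u0 and the outer radius there are no zeros around 0 or b, and no poles either, so both
   Gauss norms are exact powers of the radius there. Comparing them at two radii u < v compares the
   exponents. *)
have [u0 [u01 u02 Hu0]] : exists u0, [/\ Q L <= u0, u0 < Q L.+1 & forall a x, a \in [:: 0; b] ->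
    x \in zs -> abs (x - a) < Q L.+1 -> abs (x - a) <= u0].
  pose l := [seq t <- [seq abs (x - 0) | x <- zs] ++ [seq abs (x - b) | x <- zs] | t < Q L.+1].
  exists (\big[Num.max/Q L]_(t <- l) t); split.
  - by elim: l => [|t l IH]; rewrite ?big_nil ?big_cons // le_max IH orbT.
  - have : forall t, t \in l -> t < Q L.+1 by move=> t; rewrite mem_filter => /andP[].
    elim: l => [|t l IH] H; rewrite ?big_nil ?big_cons // gt_max H ?mem_head //=.
    by apply: IH => t' tl; apply: H; rewrite inE tl orbT.
  move=> a x ab xz xa; have : abs (x - a) \in l.
    rewrite mem_filter xa mem_cat; move: ab; rewrite !inE => /orP[]/eqP ->; first by rewrite (map_f (fun x => abs (x - 0))).
    by rewrite (map_f (fun x => abs (x - b))) ?orbT.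
  by elim: l => // t l IH; rewrite inE big_cons le_max => /orP[/eqP->|/IH ->]; rewrite ?lexx ?orbT.
have pick t : 0 < t -> t < Q L.+1 -> exists sg : K, t < abs sg < Q L.+1.
  move=> t0 tQ; have w01 : 1 < Q L.+1 / t by rewrite ltr_pdivlMr // mul1r.
  have [w /andP[w1 w2]] := near_one K w01; have w0 : 0 < abs w by apply: lt_trans w1.
  exists (T ^+ L.+1 / w); rewrite abs_div absX abs_T -/(Q L.+1).
  by rewrite ltr_pdivlMr // mulrC -ltr_pdivlMr // w2 ltr_pdivrMr // ltr_pMr ?Q_gt0.
have u00 : 0 < u0 by apply: lt_le_trans (Q_gt0 L) u01.
have [su /andP[su1 su2]] := pick _ u00 u02; set u := abs su in su1 su2.
have uu0 : 0 < u by apply: lt_trans su1.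
have [sv /andP[sv1 sv2]] := pick _ uu0 su2; set v := abs sv in sv1 sv2.
have vv0 : 0 < v by apply: lt_trans sv1.
have same (sg : K) : Q L < abs sg -> abs sg < Q L.+1 -> 0 < N 0 (abs sg) /\ N b (abs sg) = N 0 (abs sg).
  move=> s1 s2; have s0 : 0 < abs sg by apply: lt_trans s1; exact: Q_gt0.
  have eN' : e <= N 0 (abs sg).
    have h1 := N_up Lm (ltW s1) (ltW s2) bal.
    have h2 : (abs sg / Q L) ^+ (k * #|Fq| ^ (L.+1 - d)) <= q ^+ (k * #|Fq| ^ (L.+1 - d)).
      rewrite lerXn2r ?nnegrE ?divr_ge0 ?(ltW (Q_gt0 _)) // ler_pdivrMr ?Q_gt0 //.
      by rewrite /Q -exprS ltW.
    rewrite -(ler_pM2r (_ : 0 < q ^+ (k * #|Fq| ^ (L.+1 - d)))) ?exprn_gt0 //.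
    apply: le_trans eN _; apply: le_trans h1 _; rewrite ler_wpM2l // gauss_ge0 //.
  have sg0 : sg != 0 by rewrite -abs_gt0.
  (* The zeros and poles are also listed after translation by -b, so that z is generic around 0 and
     z + b is generic around b. *)
  have [z [za Hz]] := generic_pt 0 (zs ++ ps ++ [seq x - b | x <- zs ++ ps]) sg0.
  have zan : q ^ L%:Z < abs (z - 0) < q ^ (L%:Z + 1) by rewrite za -QE s1.
  have zbn : q ^ L%:Z < abs (z + b - b) < q ^ (L%:Z + 1) by rewrite addrK -(subr0 z).
  have zz := annulus_aff (Finf0 K) a0 mi im1 zan.
  have zb := annulus_aff fb bm mi im1 zbn.
  have h0 : abs (h z) = N 0 (abs sg).
    by apply: abs_ratf_eq => x xl; apply: Hz; rewrite catA mem_cat xl.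
  have hb : abs (h (z + b)) = N b (abs sg).
    apply: abs_ratf_eq => x xl; have -> : z + b - x = z - (x - b) by ring.
    rewrite Hz ?subr0 // catA mem_cat; apply/orP; right; exact: map_f.
  split; first exact: lt_le_trans eN'.
  rewrite -h0 -hb; apply: (@abs_near_le _ _ _ _ _ e); last by rewrite h0.
  have -> : h (z + b) - h z = (f z - h z) - (f (z + b) - h (z + b)).
    by rewrite f_periodic; [ring | exact: Omega_aff_Omega zz].
  by apply: absB_lt; exact: near.
have [Nu0 Nu] := same su (le_lt_trans u01 su1) su2; rewrite -/u in Nu0 Nu.
have [Nv0 Nv] := same sv (lt_trans (le_lt_trans u01 su1) sv1) sv2; rewrite -/v in Nv0 Nv.
have r1 : 1 < v / u by rewrite ltr_pdivlMr // mul1r.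
have cz a : a \in [:: 0; b] -> count_lt a v zs = count_lt a (Q L.+1) zs.
  move=> ab; apply: eq_in_count => x xz; apply/idP/idP => [h1|h1]; first exact: lt_trans sv2.
  by apply: le_lt_trans (Hu0 a x ab xz h1) _; exact: lt_trans sv1.
have cp a : Finf a -> abs a <= q ^+ m -> count_lt a v ps = count_lt a (Q L.+1) ps.
  move=> fa am; apply: eq_in_count => x xp; apply/idP/idP => [h1|h1]; first exact: lt_trans sv2.
  have := annulus_ps fa am Lm xp; rewrite h1 andbT -leNgt => h2.
  by apply: le_lt_trans h2 _; exact: lt_trans (le_lt_trans u01 su1) sv1.
have eqn a : a \in [:: 0; b] -> Finf a -> abs a <= q ^+ m ->
    N a v * (v / u) ^+ count_lt a (Q L.+1) ps = N a u * (v / u) ^+ count_lt a (Q L.+1) zs.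
  move=> ab fa am; rewrite -cz // -cp //.
  have := gauss_down_eq c (zs := zs) (ps := ps) (a := a) uu0 (ltW r1); rewrite divfK ?gt_eqF //; apply.
  move=> x; rewrite mem_cat => /orP[xz|xp].
    apply/negP => /andP[h1 h2]; have := Hu0 a x ab xz (lt_trans h2 sv2).
    by rewrite leNgt (lt_trans su1).
  apply: contra (annulus_ps fa am Lm xp) => /andP[h1 h2].
  by rewrite (lt_trans (le_lt_trans u01 su1)) //= (lt_trans h2).
have E0 := eqn 0 (mem_head _ _) (Finf0 K) a0.
have Eb := eqn b (mem_last 0 [:: b]) fb bm; rewrite Nv Nu in Eb.
have r0 : 0 < v / u by apply: lt_trans r1.
apply: (ieexprIn r0); first by rewrite gt_eqF.
rewrite !exprD; apply: (mulfI (_ : N 0 v * N 0 u != 0)); first by rewrite mulf_neq0 // gt_eqF.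
by rewrite [LHS]mulrACA Eb [RHS]mulrACA E0 mulrC.
Qed.

(** The discs around the q periods of [shift_of] have the same pole excess as the one around 0, by
    [child_counts], and for that one [balanced L] gives the bound. Summation multiplies it by q, as
    does passing to the next number of periods. *)
Lemma balanced_step L : (d <= L.+1)%N -> (L < m)%N -> balanced L ->
  e * q ^+ (k * #|Fq| ^ (L.+1 - d)) <= N 0 (Q L) -> balanced L.+1.
Proof.
move=> dL Lm bal eN; have wn x := shift_near x dL.
have [H1 H2] := disc_cover Lm wn.
rewrite /balanced; apply: leq_trans H1 _.
have P0 : count_lt 0 (Q L.+1) ps = count_le 0 (Q L) ps.
  apply: eq_in_count => x xp; apply/idP/idP => h1.
    have := annulus_ps (Finf0 K) (_ : abs 0 <= q ^+ m) Lm xp; rewrite h1 andbT -leNgt; apply.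
    by rewrite abs0 exprn_ge0.
  by apply: le_lt_trans h1 _; rewrite ltr_eXn2l // q_gt1.
have Z0 : (count_le 0 (Q L) zs <= count_lt 0 (Q L.+1) zs)%N.
  by apply: sub_count => x h1; apply: le_lt_trans h1 _; rewrite ltr_eXn2l // q_gt1.
have ch x : (count_lt (a2k K (shift_of L x)) (Q L.+1) ps <=
    count_lt (a2k K (shift_of L x)) (Q L.+1) zs + k * #|Fq| ^ (L.+1 - d))%N.
  have bQ : abs (a2k K (shift_of L x)) <= Q L.+1.
    rewrite -(subrK (c2k K x * T ^+ L.+1) (a2k K _)) absD_le ?(ltW (wn x)) //.
    by rewrite absM absX abs_T ler_piMl ?exprn_ge0 // abs_c2k_le1.
  have := child_counts Lm bQ bal eN; rewrite -/(shift_of L x) P0.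
  by move: bal Z0; rewrite /balanced; clear; lia.
apply: (@leq_trans (\sum_x (count_lt (a2k K (shift_of L x)) (Q L.+1) zs + k * #|Fq| ^ (L.+1 - d)))).
  by apply: leq_sum => x _; exact: ch.
rewrite big_split /= sum_nat_const leq_add // mulnCA leq_mul2l -expnS.
by rewrite leq_pexp2l ?orbT // ?(ltn_trans _ (finNzRing_gt1 Fq)) //; lia.
Qed.

End Counting.

(** From a maximum at height j on, the Gauss norm times theta^k does not decrease. The decay
    hypothesis bounds the norm times theta^(k+1), and theta is unbounded. *)
Lemma cusp_vertex (C r : R) (j : nat) z0 : (d <= j)%N ->
  (forall L z, r < q ^+ L -> abs z = q ^+ L -> im z = q ^+ L -> abs (f z) * theta L ^+ k.+1 <= C) ->
  abs z0 = q ^+ j -> im z0 = q ^+ j -> abs (f z0) * im z0 ^+ k = B -> False.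
Proof.
move=> dj decay za zi fz.
pose c0 := B / q ^+ j ^+ k * theta j ^+ k.
have qj : 0 < q ^+ j ^+ k by rewrite !exprn_gt0.
have c00 : 0 < c0 by rewrite mulr_gt0 ?divr_gt0 // exprn_gt0 // theta_gt0.
have q1 := ltW (q_gt1 Fq R).
have [M [jM rM CM]] : exists M, [/\ (j <= M)%N, r < q ^+ M & C / c0 < theta M].
  have [M1 HM1] := q_unbounded Fq r; have [M2 HM2] := q_unbounded Fq (C / c0).
  exists (maxn j (maxn M1 M2)); split; first exact: leq_maxl.
    by apply: lt_le_trans HM1 _; rewrite ler_weXn2l // !leq_max leqnn orbT.
  apply: lt_le_trans (theta_ge _); apply: lt_le_trans HM2 _.
  by rewrite ler_weXn2l // !leq_max leqnn !orbT.
pose m := M.+1.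
(* The first bound makes the error harmless against B on the whole affinoid. The second keeps it
   below the Gauss norms, which stay above c0 / theta^k, at all heights up to M. *)
pose e := Num.min (B / q ^+ m ^+ k) (c0 / theta M ^+ k).
have tM0 : 0 < theta M ^+ k by rewrite exprn_gt0 // theta_gt0.
have e0 : 0 < e by rewrite lt_min; apply/andP; split; apply: divr_gt0 => //; rewrite !exprn_gt0.
have [c [zs [ps [near out]]]] := holomorphic_approx m f_holo e0.
have em : e * q ^+ m ^+ k <= B by rewrite -ler_pdivlMr ?exprn_gt0 // ge_min lexx.
have eM : e * theta M ^+ k <= c0 by rewrite -ler_pdivlMr // ge_min lexx orbT.
have jm : (j < m)%N by rewrite ltnS.
have [jm1 jm2] : - m%:Z <= j%:Z /\ j%:Z <= m%:Z by move: jm; clear; lia.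
have at_max := gauss_vertex f_le near out e0 em jm1 jm2 za zi fz.
have main i : (j + i <= M)%N -> balanced zs ps (j + i) /\ c0 <= gauss c zs ps 0 (q ^+ (j + i)) * theta (j + i) ^+ k.
  elim: i => [|i IH] iM.
    rewrite addn0; split; first exact: (balanced_base near out e0 em).
    by rewrite /c0 -at_max mulfK // gt_eqF.
  rewrite addnS in iM *; have [bal low] := IH (ltnW iM).
  have Lm : (j + i < m)%N by rewrite ltnW.
  split; last by apply: le_trans low _; exact: (N_step c out Lm bal).
  apply: (balanced_step near out e0 em _ Lm bal); first by rewrite -addnS (leq_trans dj) // leq_addr.
  have tL : 0 < theta (j + i) ^+ k by rewrite exprn_gt0 // theta_gt0.
  rewrite -(ler_pM2r tL); apply: le_trans low; apply: le_trans eM.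
  rewrite mulnC exprM -mulrA -exprMn mulrC [leRHS]mulrC ler_wpM2r ?(ltW e0) //.
  have tL0 := ltW (theta_gt0 (j + i)).
  set x := _ * theta (j + i).
  have x0 : 0 <= x by rewrite mulr_ge0 ?exprn_ge0.
  have xM : x <= theta M by rewrite /x mulrC; exact: le_trans (theta_step _) (theta_le _).
  by rewrite lerXn2r ?nnegrE // ltW ?theta_gt0.
have [|_ low] := main (M - j)%N; first by rewrite subnKC.
rewrite subnKC // in low.
have eN : e <= gauss c zs ps 0 (q ^ M%:Z).
  by rewrite -(ler_pM2r tM0) (le_trans eM).
have [Mm1 Mm2] : - m%:Z <= M%:Z /\ M%:Z <= m%:Z by rewrite /m; clear; lia.
have [z [az iz fzM]] := vertex_attain near Mm1 Mm2 eN.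
have := decay M z rM az iz; rewrite fzM exprS mulrCA mulrC => H.
move: CM; rewrite ltNge => /negP; apply.
by rewrite ler_pdivlMr // (le_trans _ H) // [leLHS]mulrC ler_pM2r ?theta_gt0.
Qed.

End CuspLemma.

(** * The slash operator and reduction theory for GL_2(A) *)

Section Slash.

Variables (Fq : finFieldType) (R : realType) (K : valued_ext Fq R).
Local Notation abs := (vabs K).
Local Notation q := (#|Fq|%:R : R).
Local Notation T := (Defs.iota K (AtoF 'X)).
Local Notation im := (@vabs_i Fq R K).
Local Notation Omega := (@Omega Fq R K).
Local Notation Finf := (@Finf Fq R K).
Local Notation G2 := (@GL2Finf Fq R K).
Local Notation aff m := (Omega_aff (K := K) m).
Local Notation AA := {poly Fq}.
Implicit Types (z a b : K) (g : 'M[AA]_2) (G : 'M[K]_2).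

Definition slash (k : nat) G (f : K -> K) z : K := jfac G z ^- (2 * k) * f (mobz G z).

Lemma slashM k G H f z : G2 G -> G2 H -> Omega z ->
  slash k (G *m H) f z = slash k H (slash k G f) z.
Proof.
move=> GG HH oz; have j0 := jfac_neq0 HH oz.
by rewrite /slash mobzM // jfacM // exprMn invfM -[LHS]mulrA [LHS]mulrCA.
Qed.

Lemma jfac_bounds G m : G2 G -> exists j0 J, [/\ 0 < j0, 0 < J &
  forall z, aff m z -> j0 <= abs (jfac G z) <= J].
Proof.
move=> GG; have qm : 0 < q ^+ m by rewrite exprn_gt0.
pose j0 := if G 1 0 == 0 then abs (G 1 1) else abs (G 1 0) / q ^+ m.
pose J := Num.max 1 (Num.max (abs (G 1 0) * q ^+ m) (abs (G 1 1))).
exists j0, J; split=> [||z [z1 z2]].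
- rewrite /j0; case: eqVneq => [c0|c0]; last by rewrite divr_gt0 // abs_gt0.
  rewrite abs_gt0; have := det_neq0 GG; rewrite det2 c0 mulr0 subr0.
  by apply: contraNneq => ->; rewrite mulr0.
- by rewrite lt_max ltr01.
apply/andP; split.
  rewrite /j0 /jfac; case: eqVneq => [->|c0]; first by rewrite mul0r add0r.
  apply: le_trans (abs_lin_ge z (G2_Finf 1 0 GG) (G2_Finf 1 1 GG)).
  by rewrite ler_wpM2l.
by rewrite /jfac /J absD_le // !le_max ?lexx ?orbT // absM ler_wpM2l // orbT.
Qed.

Lemma mobz_aff G m : G2 G -> exists m', forall z, aff m z -> aff m' (mobz G z).
Proof.
move=> GG; have [j0 [J [j00 J0 H]]] := jfac_bounds m GG.
have qm : 0 < q ^+ m by rewrite exprn_gt0.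
pose N := Num.max (abs (G 0 0) * q ^+ m) (abs (G 0 1)).
have D0 : 0 < abs (\det G) by rewrite abs_gt0 det_neq0.
have [m1 H1] := q_unbounded Fq (N / j0); have [m2 H2] := q_unbounded Fq (J ^+ 2 * q ^+ m / abs (\det G)).
have q1 := ltW (q_gt1 Fq R).
exists (maxn m1 m2) => z za; have /andP[b1 b2] := H z za; have oz := Omega_aff_Omega za.
have jz : 0 < abs (jfac G z) by apply: lt_le_trans b1.
have [z1 z2] := za; split.
  rewrite /mobz abs_div; apply: le_trans (_ : N / j0 <= _).
    apply: ler_pM; rewrite ?invr_ge0 //; last by rewrite lef_pV2.
    by rewrite absD_le // !le_max ?lexx ?orbT // absM ler_wpM2l.
  by apply: ltW; apply: lt_le_trans H1 _; rewrite ler_weXn2l // leq_maxl.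
rewrite im_mobz //; apply: le_trans (_ : abs (\det G) / (J ^+ 2 * q ^+ m) <= _).
  rewrite -[leRHS]invrK lef_pV2 ?posrE ?invr_gt0 ?exprn_gt0 ?divr_gt0 ?mulr_gt0 ?exprn_gt0 //.
  rewrite invf_div; apply: le_trans (ltW H2) _; by rewrite ler_weXn2l // leq_maxr.
rewrite -[leRHS]mulrA ler_wpM2l // invfM mulrC; apply: ler_pM => //.
- by rewrite invr_ge0 ltW.
- by rewrite invr_ge0 exprn_ge0 // ltW.
by rewrite lef_pV2 ?posrE ?exprn_gt0 // lerXn2r ?nnegrE // ltW.
Qed.

Lemma slash_holomorphic k G f : G2 G -> holomorphic f -> holomorphic (slash k G f).
Proof.
move=> GG hf m e e0; have [j0 [J [j00 J0 Hj]]] := jfac_bounds m GG.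
have [m' Hm] := mobz_aff m GG.
have e1 : 0 < e * j0 ^+ (2 * k) by rewrite mulr_gt0 ?exprn_gt0.
have [p [r Hpr]] := hf m' _ e1.
have jp : rational_on (aff m) (jfac G).
  apply: (rational_eq (f := fun z => (G 1 0 *: 'X + (G 1 1)%:P).[z])); last exact: rational_poly.
  by move=> z _; rewrite !hornerE.
have np : rational_on (aff m) (fun z => G 0 0 * z + G 0 1).
  apply: (rational_eq (f := fun z => (G 0 0 *: 'X + (G 0 1)%:P).[z])); last exact: rational_poly.
  by move=> z _; rewrite !hornerE.
have jn z : aff m z -> jfac G z != 0.
  by move=> /Hj/andP[h1 _]; rewrite -abs_gt0 (lt_le_trans j00).
have mp : rational_on (aff m) (mobz G).
  by apply: (rationalM np); exact: rationalV.
have pp (s : {poly K}) : rational_on (aff m) (fun z => s.[mobz G z]).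
  apply: (rational_eq (f := fun z => \sum_(i <- enum 'I_(size s)) s`_i * mobz G z ^+ i)).
    by move=> z _; rewrite horner_coef big_enum.
  apply: rational_sum => i; apply: rationalM; last exact: rationalX.
  apply: (rational_eq (f := fun z => (s`_i)%:P.[z])); last exact: rational_poly.
  by move=> z _; rewrite hornerE.
have [P [Q HPQ]] : rational_on (aff m) (fun z => jfac G z ^- (2 * k) * (p.[mobz G z] * (r.[mobz G z])^-1)).
  apply: rationalM; first by apply: rationalV (rationalX _ jp) => z /jn j; rewrite expf_neq0.
  apply: rationalM => //; apply: rationalV => // z za.
  by have [] := Hpr _ (Hm _ za).
exists P, Q => z za; have [Q0 E] := HPQ z za; split=> //; rewrite -E /slash -mulrBr absM absV absX.
have [_ near] := Hpr _ (Hm _ za); have /andP[b1 _] := Hj z za.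
have jz : 0 < abs (jfac G z) by apply: lt_le_trans b1.
rewrite mulrC ltr_pdivrMr ?exprn_gt0 //; apply: lt_le_trans near _.
by rewrite ler_wpM2l ?(ltW e0) // lerXn2r ?nnegrE // ltW.
Qed.

Lemma slash_size k g f z : g \in unitmx -> Omega z ->
  abs (slash k (mxAK K g) f z) * im z ^+ k = abs (f (mobz (mxAK K g) z)) * im (mobz (mxAK K g) z) ^+ k.
Proof.
move=> gu oz; have GG := G2_mxAK K gu.
rewrite im_mobz // abs_det_mxAK // mul1r /slash absM absV absX expr_div_n -exprM.
by rewrite -[LHS]mulrA [LHS]mulrCA; congr (_ * _); rewrite mulrC.
Qed.

Definition upperA (p : AA) : 'M[AA]_2 :=
  \matrix_(i < 2, j < 2) if i == j then 1 else if i == 0 then p else 0.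
(** The map z -> p + 1/z, one step of a continued fraction. *)
Definition flipA (p : AA) : 'M[AA]_2 :=
  \matrix_(i < 2, j < 2) if i == 0 then if j == 0 then p else 1 else if j == 0 then 1 else 0.

Lemma upperA_unit p : upperA p \in unitmx.
Proof.
apply: (proj1 (mulmx1_unit (_ : upperA p *m upperA (- p) = 1%:M))).
by apply/matrixP => i j; rewrite !mxE sum2 !mxE; elim/ord2P: i; elim/ord2P: j => /=; ring.
Qed.

Lemma flipA_unit p : flipA p \in unitmx.
Proof.
pose B : 'M[AA]_2 := \matrix_(i < 2, j < 2) if i == 0 then if j == 0 then 0 else 1 else if j == 0 then 1 else - p.
apply: (proj1 (mulmx1_unit (_ : flipA p *m B = 1%:M))).
by apply/matrixP => i j; rewrite !mxE sum2 !mxE; elim/ord2P: i; elim/ord2P: j => /=; ring.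
Qed.

Lemma mobz_upperA p z : mobz (mxAK K (upperA p)) z = z + a2k K p.
Proof. by rewrite /mobz !mxAKE !mxE /= rmorph1 rmorph0 mul1r mul0r add0r divr1. Qed.

Lemma jfac_upperA p z : jfac (mxAK K (upperA p)) z = 1.
Proof. by rewrite /jfac !mxAKE !mxE /= rmorph1 rmorph0 mul0r add0r. Qed.

Lemma mobz_flipA p z : z != 0 -> mobz (mxAK K (flipA p)) z = a2k K p + z^-1.
Proof.
by move=> z0; rewrite /mobz !mxAKE !mxE /= rmorph1 rmorph0 mul1r addr0 mulrDl mulfK // mul1r.
Qed.

(* Reduction to the points with [abs z = im z >= 1], by the continued
   fraction expansion. *)
Lemma poly_reduce i z : Omega z -> abs z < q ^+ i ->
  exists p, abs (z - a2k K p) < 1 \/ (abs (z - a2k K p) = im z /\ 1 <= im z).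
Proof.
elim: i z => [|i IH] z oz zi.
  by exists 0; left; rewrite rmorph0 subr0 -(expr0 q).
have [z1|z1] := ltP (abs z) 1; first by exists 0; left; rewrite rmorph0 subr0.
have [zi'|zn] := eqVneq (abs z) (im z); first by exists 0; right; rewrite rmorph0 subr0 -zi'.
have [x fx xz] : exists2 x, Finf x & abs (z - x) < abs z.
  apply: contrapT => H; case/eqP: zn; apply: le_anti; rewrite im_le_abs andbT.
  by apply: im_ge => x fx; rewrite leNgt; apply/negP => h; apply: H; exists x.
have ax : abs x = abs z.
  by apply/esym/(@abs_near_le _ _ _ _ _ (abs z)) => //; rewrite leNgt; apply/negP => h; have := absBl h; move: xz => /[swap] ->; rewrite ltxx.
have x0 : x != 0 by rewrite -abs_gt0 ax (lt_le_trans ltr01).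
have [j aj] := Finf_val fx x0.
have j0 : 0 <= j by rewrite -(q_exprz_le Fq R) expr0z -aj ax.
have [j' ej] : exists j' : nat, j = j' by exists `|j|%N; rewrite gez0_abs.
subst j; have ji : (j' <= i)%N.
  have : q ^+ j' < q ^+ i.+1 by rewrite (exprnP _ j') -aj ax.
  by rewrite ltr_eXn2l // q_gt1.
have xj : abs x <= q ^ j'%:Z by rewrite aj.
have [c xc] := Finf_digit fx xj.
pose p : AA := c *: 'X^j'.
have ep : a2k K p = c2k K c * T ^ j'%:Z.
  by rewrite c2kE /p -mul_polyC rmorphM rmorphXn.
have fp : Finf (a2k K p) by exact: Finf_a2k.
have oz' : Omega (z - a2k K p) by apply/im_gt0; rewrite im_sub //; apply/im_gt0.
have [|p' H] := IH _ oz'.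
  rewrite ep; have -> : z - c2k K c * T ^ j'%:Z = (z - x) + (x - c2k K c * T ^ j'%:Z) by ring.
  apply: lt_le_trans (_ : q ^ j'%:Z <= _); last by rewrite ler_weXn2l // ltW // q_gt1.
  by apply: absD_lt => //; rewrite -aj ax.
exists (p + p'); rewrite rmorphD opprD addrA; move: H; rewrite im_sub //.
Qed.

(** The factor |c z + d| is bounded below: by |d| >= 1 if c = 0, and by |c| |z|_i >= |z|_i
    otherwise, as nonzero polynomials have absolute value at least 1. *)
Lemma im_bounded z : Omega z -> exists C, forall g, g \in unitmx -> im (mobz (mxAK K g) z) <= C.
Proof.
move=> oz; have iz : 0 < im z by apply/im_gt0.
pose mu := Num.min 1 (im z); have mu0 : 0 < mu by rewrite lt_min ltr01.
exists (im z / mu ^+ 2) => g gu; have GG := G2_mxAK K gu.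
rewrite im_mobz // abs_det_mxAK // mul1r ler_wpM2l ?(ltW iz) //.
have jm : mu <= abs (jfac (mxAK K g) z).
  rewrite /jfac; have [c0|c0] := eqVneq (mxAK K g 1 0) 0.
    rewrite c0 mul0r add0r; apply: le_trans (_ : 1 <= _); first by rewrite ge_min lexx.
    rewrite mxAKE a2k_ge1 //; have := det_neq0 GG; rewrite det2 c0 mulr0 subr0 mulf_eq0.
    by rewrite negb_or => /andP[_]; rewrite mxAKE; apply: contraNneq => ->; rewrite rmorph0.
  apply: le_trans (abs_lin_ge z (G2_Finf 1 0 GG) (G2_Finf 1 1 GG)).
  apply: le_trans (_ : im z <= _); first by rewrite ge_min lexx orbT.
  rewrite ler_peMl ?(ltW iz) // mxAKE a2k_ge1 //.
  by move: c0; rewrite mxAKE; apply: contraNneq => ->; rewrite rmorph0.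
rewrite lef_pV2 ?posrE ?exprn_gt0 ?(lt_le_trans mu0) //.
by rewrite lerXn2r ?nnegrE // ltW.
Qed.

(** If |y| < 1 and |y| differs from |y|_i, then |y| is a value of F_infinity and hence at most 1/q.
    Inversion then multiplies the imaginary part by at least q, and by [im_bounded] this can happen
    only a bounded number N of times. *)
Lemma reduction z : Omega z -> exists g z', [/\ g \in unitmx, Omega z',
  abs z' = im z', 1 <= abs z' & z = mobz (mxAK K g) z'].
Proof.
move=> oz; have [C HC] := im_bounded oz; have iz : 0 < im z by apply/im_gt0.
have [N HN] : exists N : nat, forall g, g \in unitmx -> im (mobz (mxAK K g) z) < im z * q ^+ N.
  have [N HN] := q_unbounded Fq (C / im z); exists N => g gu.
  by apply: le_lt_trans (HC g gu) _; rewrite mulrC -ltr_pdivrMr.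
elim: N z oz iz {C HC} HN => [|N IH] z oz iz HN.
  by have := HN 1%:M (unitmx1 _ _); rewrite mxAK1 mobz1 expr0 mulr1 ltxx.
have [i zi] := q_unbounded Fq (abs z).
have [p [zp|[zp z1]]] := poly_reduce oz zi; last first.
  have fp : Finf (a2k K p) by exact: Finf_a2k.
  exists (upperA p), (z - a2k K p); split; rewrite ?upperA_unit ?im_sub ?zp ?mobz_upperA ?subrK //.
  by apply/im_gt0; rewrite im_sub.
have fp : Finf (a2k K p) by exact: Finf_a2k.
pose y := z - a2k K p; have y0 : y != 0 by exact: Omega_neq.
have oy : Omega y by apply/im_gt0; rewrite im_sub.
have iy : im y = im z by rewrite im_sub.
have zE : z = mobz (mxAK K (flipA p)) y^-1 by rewrite mobz_flipA ?invr_eq0 // invrK addrC subrK.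
have G0 := G2_mxAK K (flipA_unit 0).
have yE : y^-1 = mobz (mxAK K (flipA 0)) y by rewrite mobz_flipA // rmorph0 add0r.
have oy' : Omega y^-1 by rewrite yE; exact: Omega_mobz.
have iy' : im y^-1 = im z / abs y ^+ 2.
  rewrite yE im_mobz // abs_det_mxAK ?flipA_unit // mul1r iy /jfac !mxAKE !mxE /=.
  by rewrite rmorph1 rmorph0 mul1r addr0.
have ay0 : 0 < abs y by rewrite abs_gt0.
have [ey|ny] := eqVneq (abs y) (im y).
  exists (flipA p), y^-1; split=> //; first exact: flipA_unit.
    by rewrite iy' absV -iy -ey expr2 invfM mulrA divff ?mul1r // gt_eqF.
  by rewrite absV invf_ge1 // ltW.
have yq : abs y <= q^-1.
  have [x fx xz] : exists2 x, Finf x & abs (y - x) < abs y.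
    apply: contrapT => H; case/eqP: ny; apply: le_anti; rewrite im_le_abs andbT.
    by apply: im_ge => x fx; rewrite leNgt; apply/negP => h; apply: H; exists x.
  have ax : abs x = abs y.
    by apply/esym/(@abs_near_le _ _ _ _ _ (abs y)) => //; rewrite leNgt; apply/negP => h; have := absBl h; move: xz => /[swap] ->; rewrite ltxx.
  have x0 : x != 0 by rewrite -abs_gt0 ax.
  have [j aj] := Finf_val fx x0; rewrite -ax aj -[q^-1]/(q ^ (-1)) q_exprz_le.
  have : q ^ j < q ^ 0 by rewrite -aj ax expr0z.
  by rewrite q_exprz_lt; clear; lia.
have Fp := G2_mxAK K (flipA_unit p).
have [g [z' [gu oz' z1 z2 E]]] : exists g z', [/\ g \in unitmx, Omega z', abs z' = im z', 1 <= abs z' & y^-1 = mobz (mxAK K g) z'].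
  apply: IH => //; first by apply/im_gt0.
  move=> g gu; have := HN (g *m invmx (flipA p)).
  rewrite unitmx_mul gu unitmx_inv flipA_unit => /(_ isT).
  rewrite mxAKM mobzM ?mxAKV ?flipA_unit //; last by apply: jfac_neq0 => //; exact: G2V.
  rewrite {1}zE mobzK // => H; apply: lt_le_trans H _.
  rewrite iy' exprS -mulrA ler_wpM2l ?(ltW iz) // ler_wpM2r ?exprn_ge0 //.
  rewrite -[leLHS]invrK lef_pV2 ?posrE ?invr_gt0 ?exprn_gt0 //.
  rewrite expr2; apply: le_trans (_ : abs y * 1 <= _).
    by rewrite ler_wpM2l // ltW.
  by rewrite mulr1.
exists (flipA p *m g), z'; split=> //; first by rewrite unitmx_mul flipA_unit.
by rewrite zE E mxAKM mobzM // jfac_neq0 //; exact: G2_mxAK.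
Qed.

End Slash.

(** * A form of M_{2k}^{k+1} that vanishes at the chosen points is zero *)

Section VanishingForms.

Variables (Fq : finFieldType) (R : realType) (K : valued_ext Fq R).
Local Notation abs := (vabs K).
Local Notation q := (#|Fq|%:R : R).
Local Notation T := (Defs.iota K (AtoF 'X)).
Local Notation im := (@vabs_i Fq R K).
Local Notation Omega := (@Omega Fq R K).
Local Notation Finf := (@Finf Fq R K).
Local Notation G2 := (@GL2Finf Fq R K).
Local Notation AA := {poly Fq}.
Implicit Types (z a b : K) (g h : 'M[AA]_2).

Hypothesis K_Cinf : is_Cinf K.
Variables (n : AA) (k d : nat).
Hypothesis n_monic : n \is monic.
Hypothesis n_deg : size n = d.+1.
Hypothesis d_ge1 : (1 <= d)%N.
Hypothesis k_ge2 : (2 <= k)%N.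

Let n_size : (1 < size n)%N. Proof. by rewrite n_deg. Qed.

Lemma seq_uniform (S : eqType) (s : seq S) (P : S -> nat -> Prop) :
  (forall x L L', (L <= L')%N -> P x L -> P x L') -> (forall x, x \in s -> exists L, P x L) ->
  exists L, forall x, x \in s -> P x L.
Proof.
move=> mono; elim: s => [|x s IH] H; first by exists 0%N.
have [L1 H1] := H x (mem_head _ _).
have [|L2 H2] := IH; first by move=> y ys; apply: H; rewrite inE ys orbT.
exists (maxn L1 L2) => y; rewrite inE => /orP[/eqP->|/H2].
  by apply: mono H1; exact: leq_maxl.
by apply: mono; exact: leq_maxr.
Qed.

Lemma seq_argmax (S : eqType) (s : seq S) (F : S -> R) : s != [::] ->
  exists2 x, x \in s & forall y, y \in s -> F y <= F x.
Proof.
elim: s => // x [|x' s] IH _; first by exists x => [|y]; rewrite inE // => /eqP ->.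
have [//|x0 xs H] := IH.
have [h|h] := leP (F x0) (F x).
  by exists x => [|y]; rewrite ?mem_head // inE => /orP[/eqP->|/H/le_trans->].
by exists x0 => [|y]; rewrite inE ?xs ?orbT // => /orP[/eqP->|/H//]; exact: ltW.
Qed.

(** Matrices congruent modulo n are in the same coset, and reduced residues have bounded entries. A
    residue matrix without invertible lift receives the identity as its harmless default. *)
Lemma Gamma_classes : exists s : seq 'M[AA]_2, (forall h, h \in s -> h \in unitmx) /\
  forall g, g \in unitmx -> exists2 h, h \in s & Gamma n (g *m invmx h).
Proof.
have [B HB] := bounded_matrices K (q ^+ d).
pose rep (M : 'M[AA]_2) := xget (1%:M : 'M[AA]_2) [set g | g \in unitmx /\ forall i j, g i j %% n = M i j].
exists [seq rep M | M <- B]; split=> [h /mapP[M _ ->]|g gu].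
  by rewrite /rep; case: xgetP => [x -> [] //|_]; rewrite unitmx1.
pose M : 'M[AA]_2 := \matrix_(i, j) (g i j %% n).
have MB : M \in B.
  apply: HB => i j; rewrite mxE; have [->|r0] := eqVneq (g i j %% n) 0.
    by rewrite rmorph0 abs0 exprn_ge0.
  rewrite abs_a2k // ler_weXn2l ?(ltW (q_gt1 _ _)) //.
  have := ltn_modp (g i j) n; rewrite monic_neq0 // n_deg => h.
  by move: h; rewrite ltnS; exact: leq_trans (leq_pred _).
exists (rep M); first exact: map_f.
have [ru rM] : rep M \in unitmx /\ forall i j, rep M i j %% n = M i j.
  rewrite /rep; case: xgetP => [x -> []//|/(_ g)[]]; split=> // i j; by rewrite mxE.
by apply: Gamma_cong => // i j; rewrite rM mxE.
Qed.

Variable f : K -> K.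
Hypothesis f_holo : holomorphic f.
Hypothesis f_modular : forall g z, Gamma n g -> Omega z ->
  f (mobz (mxAK K g) z) = jfac (mxAK K g) z ^+ (2 * k) * f z.
Hypothesis f_cusp : forall s, vanishes_ge n (2 * k) k.+1 f (cusp n s).

Local Notation sl g := (slash k (mxAK K g) f).
Local Notation Phi z := (abs (f z) * im z ^+ k).

Lemma slash_Gamma g h z : Gamma n g -> h \in unitmx -> Omega z -> sl (g *m h) z = sl h z.
Proof.
move=> gG hu oz; have gu := Gamma_unit gG; have GG := G2_mxAK K gu; have HH := G2_mxAK K hu.
rewrite mxAKM slashM // {1}/slash [in RHS]/slash; congr (_ * _).
rewrite /slash f_modular //; last exact: Omega_mobz.
by rewrite mulrA mulVf ?mul1r // expf_neq0 // jfac_neq0 //; exact: Omega_mobz.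
Qed.

Lemma slash_periodic g p z : g \in unitmx -> Omega z -> sl g (z + a2k K (n * p)) = sl g z.
Proof.
move=> gu oz; pose u : 'M[AA]_2 := upperA (n * p).
have uu : u \in unitmx by exact: upperA_unit.
have cG : Gamma n (g *m u *m invmx g) by apply: Gamma_conjV => //; exact: Gamma_translation.
have := slash_Gamma cG gu oz; rewrite mulmxKV // mxAKM slashM //; [|exact: G2_mxAK|exact: G2_mxAK].
by rewrite {1}/slash jfac_upperA mobz_upperA expr1n invr1 mul1r.
Qed.

Lemma Phi_slash_Gamma g h z : Gamma n g -> h \in unitmx -> Omega z ->
  Phi (mobz (mxAK K (g *m h)) z) = Phi (mobz (mxAK K h) z).
Proof.
move=> gG hu oz; have gu := Gamma_unit gG.
rewrite -!(slash_size k f) ?unitmx_mul ?gu ?hu // slash_Gamma //.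
Qed.

Lemma slash_decay g : g \in unitmx -> exists C r, [/\ 0 <= C, 1 <= r & forall z, abs z = im z -> r < abs z ->
  abs (sl g z) <= C * abs (t_param n (mxAF g) z) ^+ k.+1].
Proof.
move=> gu; have nu := mxAF_unit gu.
have cg : cusp n (mob (mxAF g) None) (mob (mxAF g) None).
  by exists 1%:M; [exact: Gamma1 | rewrite mxAF1 mob1].
have [c Hc] := f_cusp nu cg.
have [C [r [C0 r0 H]]] := t_expansion_bound K_Cinf Hc.
exists (C + abs (c k.+1)), (Num.max 1 r); split; first by rewrite addr_ge0.
  by rewrite le_max lexx.
move=> z az; rewrite gt_max => /andP[z1 zr].
have z0 : 0 < abs z by apply: lt_trans z1.
have [t0 t1] := t_param_le K_Cinf n (mxAF g) az z0.
set t := t_param n (mxAF g) z in t0 t1 *.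
have tle : abs t <= 1.
  rewrite -(ler_pM2r z0) mul1r; apply: le_trans t1 (ltW z1).
have := H z az zr; rewrite -/t -/(slash k (mxAK K g) f z) => near.
rewrite -(subrK (c k.+1 * t ^+ k.+1) (sl g z)); apply: absD_le.
  apply: le_trans near _; rewrite exprSr mulrA; apply: le_trans (_ : C * abs t ^+ k.+1 <= _).
    by rewrite ler_piMr // mulr_ge0 // exprn_ge0.
  by rewrite ler_wpM2r ?exprn_ge0 // lerDl.
by rewrite absM absX ler_wpM2r ?exprn_ge0 // lerDr.
Qed.

Lemma translation_mem g p : g \in unitmx -> p != 0 ->
  (translations n (mxAF g) `\ 0) (AtoF (n * p)).
Proof.
move=> gu p0; split; last first.
  by move/eqP; rewrite AtoF_eq0 mulf_eq0 (negPf p0) (negPf (monic_neq0 n_monic)).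
exists (g *m upperA (n * p) *m invmx g); first by apply: Gamma_conjV => //; exact: Gamma_translation.
rewrite -[invmx (mxAF g)]mxAFV // -!mxAFM !mulmxA mulVmx // mul1mx mulmxKV //.
apply/matrixP => i j; rewrite !mxE; case: ifP => _; first exact: rmorph1.
by case: ifP => // _; exact: rmorph0.
Qed.

(** The periods nA occur at every cusp of the form g infinity with g in GL_2(A), so |t| <= 1 / theta
    there. *)
Lemma slash_theta g : g \in unitmx -> exists C r, forall L z, r < q ^+ L -> abs z = q ^+ L -> im z = q ^+ L ->
  abs (sl g z) * theta K n d L ^+ k.+1 <= C.
Proof.
move=> gu; have [C [r [C0 r1 H]]] := slash_decay gu; exists C, r => L z rL az iz.
have z0 : 0 < abs z by rewrite az exprn_gt0.
have azi : abs z = im z by rewrite az iz.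
pose D := [seq AtoF (n * p) | p <- multiples Fq d L].
have uD : uniq D.
  rewrite map_inj_uniq ?multiples_uniq // => p p' /eqP; rewrite -subr_eq0 /AtoF -rmorphB /=.
  rewrite -/(AtoF _) AtoF_eq0 -mulrBr mulf_eq0 (negPf (monic_neq0 n_monic)) subr_eq0.
  by move=> /eqP.
have sD : [set` D] `<=` translations n (mxAF g) `\ 0.
  move=> x /mapP[p]; rewrite multiplesP => /andP[p0 _] ->; exact: translation_mem.
have [t0 tb] := t_param_bound K_Cinf azi z0 uD sD.
have th0 : 0 < theta K n d L by exact: theta_gt0.
have tt : abs (t_param n (mxAF g) z) * theta K n d L <= 1.
  apply: le_trans tb; rewrite ler_wpM2l // /theta az ler_wpM2l ?exprn_ge0 // big_map.
  apply: ler_prod => p _; rewrite le_max lexx orbT andbT.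
  by rewrite divr_ge0 // exprn_ge0.
have rz : r < abs z by rewrite az.
apply: le_trans (ler_wpM2r (exprn_ge0 _ (ltW th0)) (H z azi rz)) _.
rewrite -mulrA -exprMn ler_piMr // exprn_ile1 // mulr_ge0 // ltW //.
Qed.

(** The normalized value is at most C |t|^(k+1) |z|^k, and |t| |z| <= 1 leaves C / |z|. *)
Lemma slash_small g (beta : R) : g \in unitmx -> 0 < beta ->
  exists L : nat, forall z, abs z = im z -> q ^+ L <= abs z -> Phi (mobz (mxAK K g) z) < beta.
Proof.
move=> gu b0; have [C [r [C0 r1 H]]] := slash_decay gu.
have [L1 H1] := q_unbounded Fq r; have [L2 H2] := q_unbounded Fq (C / beta).
have q1 := ltW (q_gt1 Fq R).
exists (maxn L1 L2) => z az zL.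
have zr : r < abs z by apply: lt_le_trans H1 _; apply: le_trans zL; rewrite ler_weXn2l // leq_maxl.
have zC : C / beta < abs z by apply: lt_le_trans H2 _; apply: le_trans zL; rewrite ler_weXn2l // leq_maxr.
have z0 : 0 < abs z by apply: lt_trans (lt_le_trans ltr01 r1) zr.
have oz : Omega z by apply/im_gt0; rewrite -az.
rewrite -slash_size //; apply: le_lt_trans (ler_wpM2r _ (H z az zr)) _; first by rewrite exprn_ge0 // im_ge0.
have [t0 t1] := t_param_le K_Cinf n (mxAF g) az z0.
rewrite -az exprS -!mulrA -exprMn; apply: (@le_lt_trans _ _ (C / abs z)); last first.
  by rewrite ltr_pdivrMr // mulrC -ltr_pdivrMr.
rewrite ler_wpM2l //; apply: le_trans (_ : abs (t_param n (mxAF g) z) * 1 <= _).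
  by rewrite ler_wpM2l // exprn_ile1 // mulr_ge0.
by rewrite mulr1 -[leRHS]mul1r ler_pdivlMr.
Qed.

Lemma abs_floor z : 1 <= abs z -> exists i : nat, abs z = q ^ i%:Z \/ q ^ i%:Z < abs z < q ^ (i%:Z + 1).
Proof.
move=> z1; have [N zN] := q_unbounded Fq (abs z).
elim: N zN => [|N IH] zN; first by move: zN; rewrite expr0 ltNge z1.
have [h|h|h] := ltgtP (abs z) (q ^+ N); [exact: IH | | by exists N; left].
by exists N; right; rewrite -exprnP h /= -[N%:Z + 1]/((N + 1)%N%:Z) addn1.
Qed.

(** Reduction and invariance leave finitely many classes. High up, the values stay below the one at
    zs; lower down, [annulus_max] moves a point of an edge to a vertex without loss. The maximum is
    then over a finite list of classes and heights. *)
Lemma max_attained zs : Omega zs -> f zs != 0 -> exists g (i : nat) z0,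
  [/\ g \in unitmx, abs z0 = q ^ i%:Z, im z0 = q ^ i%:Z, 0 < Phi (mobz (mxAK K g) z0) &
   forall z, Omega z -> Phi z <= Phi (mobz (mxAK K g) z0)].
Proof.
move=> os fs; have b0 : 0 < Phi zs by rewrite mulr_gt0 ?abs_gt0 // exprn_gt0 //; apply/im_gt0.
have [s [su sG]] := Gamma_classes.
have [L HL] : exists L, forall g, g \in s -> forall z, abs z = im z -> q ^+ L <= abs z -> Phi (mobz (mxAK K g) z) < Phi zs.
  apply: seq_uniform => [g L L' LL H z az zL|g gs]; last exact: slash_small (su _ gs) b0.
  by apply: H => //; apply: le_trans zL; rewrite ler_weXn2l // ltW // q_gt1.
have q1 := ltW (q_gt1 Fq R).
pose V := [seq (g, i) | g <- s, i <- seq.iota 0 L.+1].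
have VP g i : g \in s -> (i <= L)%N -> (g, i) \in V.
  by move=> gs iL; apply/allpairsP; exists (g, i); rewrite mem_iota.
pose best (x : 'M[AA]_2 * nat) := [set y | [/\ abs y = q ^ x.2%:Z,
    im y = q ^ x.2%:Z & forall z, abs z = q ^ x.2%:Z -> im z = q ^ x.2%:Z ->
    Phi (mobz (mxAK K x.1) z) <= Phi (mobz (mxAK K x.1) y)]].
pose zm x := xget 0 (best x).
have Hzm x : x.1 \in unitmx -> best x (zm x).
  case: x => g i /= gu; apply: xgetPex.
  have [z0 [az iz Hz]] := vertex_max i (slash_holomorphic k (G2_mxAK K gu) f_holo).
  exists z0; split=> // z az' iz'.
  have ip : 0 < q ^ i by exact: exprz_gt0.
  have oz : Omega z by apply/im_gt0; rewrite iz'.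
  have oz0 : Omega z0 by apply/im_gt0; rewrite iz.
  by rewrite -!slash_size // iz iz' ler_wpM2r ?exprn_ge0 ?(ltW ip) // Hz.
have V0 : V != [::].
  have [h hs _] := sG 1%:M (unitmx1 _ _).
  by apply/eqP => V0; have := VP h 0%N hs isT; rewrite V0.
have [[g i] gV gmax] := seq_argmax (fun x => Phi (mobz (mxAK K x.1) (zm x))) V0.
have {gV}[gs iL] : g \in s /\ (i <= L)%N.
  by move/allpairsP: gV => [[g' i'] [h1 h2 [-> ->]]]; split; first exact: h1; move: h2; rewrite mem_iota add0n ltnS.
have gu := su _ gs; have [az iz _] := Hzm (g, i) gu.
pose B := Phi (mobz (mxAK K g) (zm (g, i))).
have low z : Omega z -> Phi z < Phi zs \/ Phi z <= B.
  move=> oz; have [h [z' [hu oz' az' z1 ->]]] := reduction oz.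
  have [h0 h0s hG] := sG h hu; have h0u := su _ h0s.
  have -> : h = h *m invmx h0 *m h0 by rewrite mulmxKV.
  rewrite Phi_slash_Gamma //.
  have [zL|zL] := leP (q ^+ L) (abs z'); first by left; exact: HL.
  right; have [j Hj] := abs_floor z1.
  have vert (j' : nat) y : (j' <= L)%N -> abs y = q ^ j'%:Z -> im y = q ^ j'%:Z -> Phi (mobz (mxAK K h0) y) <= B.
    move=> jL ay iy; have [_ _ H] := Hzm (h0, j') h0u.
    apply: le_trans (H y ay iy) _; exact: (gmax (h0, j') (VP _ _ h0s jL)).
  have jL : (j < L)%N.
    rewrite -(ltr_eXn2l (q_gt1 Fq R)) exprnP; apply: le_lt_trans zL.
    by case: Hj => [->//|/andP[/ltW]].
  have [f0|f0] := eqVneq (f (mobz (mxAK K h0) z')) 0.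
    by rewrite f0 abs0 mul0r mulr_ge0 // exprn_ge0 // im_ge0.
  have [ej|zj] := Hj; first by apply: (vert j) => //; [exact: ltnW | rewrite -az'].
  have s0 : sl h0 z' != 0.
    by rewrite mulf_neq0 // invr_eq0 expf_neq0 // jfac_neq0 //; exact: G2_mxAK.
  have [[y [ay iy]]|[y [ay iy /ltW]]] := annulus_max k (slash_holomorphic k (G2_mxAK K h0u) f_holo) s0 zj.
    have oy : Omega y by apply/im_gt0; rewrite iy exprz_gt0.
    by rewrite !slash_size // => H; apply: le_trans H _; apply: (vert j.+1); rewrite // intS addrC.
  have oy : Omega y by apply/im_gt0; rewrite iy exprz_gt0.
  by rewrite !slash_size // => H; apply: le_trans H _; apply: (vert j) => //; exact: ltnW.
have sB : Phi zs <= B by case: (low _ os); rewrite ?ltxx.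
exists g, i, (zm (g, i)); split=> //; first exact: lt_le_trans sB.
by move=> z /low[/ltW/le_trans|//]; exact.
Qed.

Hypothesis vertex_zeros : forall g (i : nat), g \in unitmx -> (i < d)%N ->
  exists w : 'I_(kdim Fq k) -> K, [/\ forall j, abs (w j) = q ^ i%:Z /\ im (w j) = q ^ i%:Z,
    forall j j', j != j' -> q ^ i%:Z <= abs (w j - w j') & forall j, f (mobz (mxAK K g) (w j)) = 0].
Hypothesis edge_zeros : forall g (i : nat), g \in unitmx -> (i.+1 < d)%N ->
  exists2 z, q ^ i%:Z < abs z < q ^ (i%:Z + 1) & f (mobz (mxAK K g) z) = 0.

(** By [high], B is not attained over a vertex of type at least d. By [ann], every edge carries a
    point with a smaller value: a zero of f if both vertices are stable, and otherwise any point,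
    since a value B would be reached over the outer vertex or strictly exceeded over the inner
    one. *)
Lemma form_zero z : Omega z -> f z = 0.
Proof.
move=> oz; have [//|fz] := eqVneq (f z) 0; exfalso.
have [g [i [z0 [gu az0 iz0 B0 Bmax]]]] := max_attained oz fz.
set B := Phi (mobz (mxAK K g) z0) in B0 Bmax.
have sB h : h \in unitmx -> forall y, Omega y -> abs (sl h y) * im y ^+ k <= B.
  by move=> hu y oy; rewrite slash_size //; apply: Bmax; apply: Omega_mobz => //; exact: G2_mxAK.
have sH h : h \in unitmx -> holomorphic (sl h).
  by move=> hu; apply: slash_holomorphic => //; exact: G2_mxAK.
have high h (j : nat) y : h \in unitmx -> (d <= j)%N -> abs y = q ^ j%:Z -> im y = q ^ j%:Z ->
    abs (sl h y) * im y ^+ k = B -> False.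
  move=> hu dj ay iy H; have [C [r decay]] := slash_theta hu.
  by apply: (cusp_vertex n_monic n_deg B0 (sH h hu) (sB h hu) _ dj decay ay iy H) => p y' oy'; exact: slash_periodic.
have ann h (j : nat) : h \in unitmx -> exists2 y, q ^ j%:Z < abs y < q ^ (j%:Z + 1) & Phi (mobz (mxAK K h) y) < B.
  move=> hu; have [jd|jd] := ltnP j.+1 d.
    have [y ya fy] := edge_zeros hu jd; exists y => //.
    by rewrite fy abs0 mul0r.
  have [y ya] := annulus_value K j%:Z; exists y => //.
  have ya' : q ^ j%:Z < abs (y - 0) < q ^ (j%:Z + 1) by rewrite subr0.
  have iy := annulus_im (Finf0 K) ya'.
  have oy : Omega y.
    by apply/im_gt0; rewrite iy; apply: lt_trans (_ : q ^ j%:Z < _); rewrite ?exprz_gt0 //; case/andP: ya'.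
  rewrite lt_neqAle Bmax ?andbT; last by apply: Omega_mobz => //; exact: G2_mxAK.
  apply/eqP => H; rewrite -slash_size // in H.
  have s0 : sl h y != 0 by apply: contraTneq B0 => s0; rewrite -H s0 abs0 mul0r ltxx.
  have [[x [ax ix]]|[x [ax ix]]] := annulus_max k (sH h hu) s0 ya.
    have ox : Omega x by apply/im_gt0; rewrite ix exprz_gt0.
    rewrite H => Bx; have ej : j.+1%:Z = j%:Z + 1 by rewrite intS addrC.
    apply: (high h j.+1 x); rewrite ?ej //.
    by apply: le_anti; rewrite sB.
  have ox : Omega x by apply/im_gt0; rewrite ix exprz_gt0.
  by rewrite H ltNge sB.
have oz0 : Omega z0 by apply/im_gt0; rewrite iz0 exprz_gt0.
have fz0 : abs (sl g z0) * im z0 ^+ k = B by rewrite slash_size.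
have [id|di] := ltnP i d; last exact: (high g i z0).
have [w [w_v w_far w0]] := vertex_zeros gu id.
pose m := i.+1; have qm : 0 < q ^+ m ^+ k by rewrite !exprn_gt0.
pose e := B / q ^+ m ^+ k; have e0 : 0 < e by rewrite divr_gt0.
have em : e * q ^+ m ^+ k <= B by rewrite divfK // gt_eqF.
have [c [zl [pl [near out]]]] := holomorphic_approx m (sH g gu) e0.
have [mi1 [mi2 [mi3 mi4]]] : - m%:Z < i%:Z /\ i%:Z < m%:Z /\ - m%:Z <= i%:Z /\ i%:Z <= m%:Z by rewrite /m; clear; lia.
have at_max := gauss_vertex (sB g gu) near out e0 em mi3 mi4 az0 iz0 fz0.
apply: (vertex_contradiction B0 (sB g gu) near out e0 em mi1 mi2 at_max k_ge2 (w := w)) => //.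
(* For i > 0 the edge towards the centre c' T^i is a translate of the standard edge just below v_i.
   Below v_0 it is the image of the edge from v_0 to v_1 under z -> c' + 1/z. *)
- move=> c'; case: i {az0 iz0 id w_v w_far m qm e e0 em near mi1 mi2 mi3 mi4 at_max out w0 w} => [|i].
    pose h := g *m flipA c'%:P; have hu : h \in unitmx by rewrite unitmx_mul gu flipA_unit.
    have [y /andP[y1 y2] Hy] := ann h 0%N hu.
    have y1' : 1 < abs y by move: y1; rewrite expr0z.
    have y0 : 0 < abs y by apply: lt_trans y1'.
    have iy : im y = abs (y - 0) by apply: (annulus_im (i := 0) (Finf0 K)); rewrite subr0 y1 y2.
    have oy : Omega y by apply/im_gt0; rewrite iy subr0.
    have yn : y != 0 by rewrite -abs_gt0.
    exists (c2k K c' + y^-1).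
      have -> : c2k K c' + y^-1 - c2k K c' * T ^ 0%N%:Z = y^-1 by rewrite expr0z mulr1 addrAC subrr add0r.
      rewrite expr0z absV invf_lt1 // y1' andbT.
      rewrite sub0r -invr_expz expr1z ltf_pV2 ?posrE //.
    have -> : c2k K c' + y^-1 = mobz (mxAK K (flipA c'%:P)) y by rewrite mobz_flipA // c2kE.
    rewrite slash_size //; last by apply: Omega_mobz => //; apply: G2_mxAK; exact: flipA_unit.
    by rewrite -mobzM -?mxAKM // jfac_neq0 //; apply: G2_mxAK; exact: flipA_unit.
  pose p : AA := c' *: 'X^(i.+1).
  have ep : a2k K p = c2k K c' * T ^ i.+1%:Z by rewrite c2kE /p -mul_polyC rmorphM rmorphXn.
  pose h := g *m upperA p; have hu : h \in unitmx by rewrite unitmx_mul gu upperA_unit.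
  have [y ya Hy] := ann h i hu.
  have iy : im y = abs (y - 0) by apply: (annulus_im (i := i) (Finf0 K)); rewrite subr0.
  have oy : Omega y.
    by apply/im_gt0; rewrite iy subr0; apply: lt_trans (_ : q ^ i%:Z < _); rewrite ?exprz_gt0 //; case/andP: ya.
  have Ei : (i.+1%:Z - 1 = i%:Z) /\ (i%:Z + 1 = i.+1%:Z) by clear; lia.
  exists (y + c2k K c' * T ^ i.+1%:Z).
    by rewrite addrK Ei.1 -Ei.2.
  rewrite -ep -mobz_upperA slash_size //; last by apply: Omega_mobz => //; apply: G2_mxAK; exact: upperA_unit.
  by rewrite -mobzM -?mxAKM // jfac_upperA oner_eq0.
- have [y ya Hy] := ann g i gu; exists y => //.
  have iy : im y = abs (y - 0) by apply: (annulus_im (i := i) (Finf0 K)); rewrite subr0.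
  have oy : Omega y.
    by apply/im_gt0; rewrite iy subr0; apply: lt_trans (_ : q ^ i%:Z < _); rewrite ?exprz_gt0 //; case/andP: ya.
  by rewrite slash_size.
by move=> j; rewrite /slash w0 mulr0.
Qed.

End VanishingForms.

(** * Kurihara differentials over a common denominator *)

Section KuriharaNumerators.

Variables (Fq : finFieldType).
Implicit Types (a b s : P1 Fq) (D : kdata Fq).

(** The finite part of the denominator at a. With the constant [kappa] it gives u(z; a, b) the
    uniform shape of [udiff_lin]. *)
Definition lin a : {poly Fq} := if a is Some c then 'X - c%:P else 1.

Definition kappa a b : Fq :=
  match a, b with
  | Some x, Some y => y - x
  | None, Some _ => 1
  | Some _, None => -1
  | None, None => 0
  end.

(** The pole order at s of the differential: s(z; a, b) has simple poles at a and b, also at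
    infinity, and no zeros. *)
Definition mult D s : nat := (\sum_i @kexp _ D i * ((ka i == s) + (@kb _ D i == s)))%N.

Definition numer k D : {poly Fq} :=
  (\prod_i kappa (ka i) (@kb _ D i) ^+ kexp i)%:P * \prod_c ('X - c%:P) ^+ (k.-1 - mult D (Some c)).

(** Some pair avoids s, and its exponent, which is positive, is missing from the pole order. *)
Lemma mult_le k D s : kurihara k D -> (mult D s <= k.-1)%N.
Proof.
move=> [[_ e1 ek ab _] E].
have [i si] : exists i : 'I_(kr D), ~ kpair i s.
  apply: contrapT => H; have : (\bigcap_(i in [set: 'I_(kr D)]) kpair i) s.
    by move=> i _; apply: contrapT => h; apply: H; exists i.
  by rewrite E.
have zi : ((ka i == s) + (@kb _ D i == s) = 0)%N.
  case: eqP => [h|_]; first by case: si; left.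
  by case: eqP => [h|_] //; case: si; right.
rewrite /mult (bigD1 i) //= zi muln0 add0n.
apply: (@leq_trans (\sum_(j | j != i) @kexp _ D j)).
  apply: leq_sum => j _; rewrite -[leqRHS]muln1 leq_mul2l; apply/orP; right.
  by case: eqP => [<-|_]; case: eqP => //= h; case: (ab j).
have : (kexp i + \sum_(j | j != i) @kexp _ D j = k)%N by rewrite -ek [RHS](bigD1 i).
move: (e1 i); clear; lia.
Qed.

Lemma mult_sum k D : kurihara k D -> (\sum_s mult D s = 2 * k)%N.
Proof.
move=> [[_ _ ek _ _] _]; rewrite /mult exchange_big /= -ek big_distrr /=.
apply: eq_bigr => i _; rewrite -big_distrr /= mulnC; congr muln.
have one x : (\sum_s (x == s :> P1 Fq) = 1)%N.
  by rewrite (bigD1 x) //= eqxx big1 // => s; rewrite eq_sym => /negPf ->.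
by rewrite big_split /= !one.
Qed.

(** The degree is q(k - 1) - (2k - mult at infinity), since the pole orders add up to 2k. The last
    multiplicity is at most k - 1, which leaves at most N - 1. *)
Lemma numer_size k D : (2 <= k)%N -> kurihara k D -> (size (numer k D) <= kdim Fq k)%N.
Proof.
move=> k2 kD; rewrite /numer mul_polyC; apply: leq_trans (size_scale_leq _ _) _.
apply: leq_trans (size_poly_prod_leq _ _) _.
under eq_bigr do rewrite size_exp_XsubC.
have H1 : (\sum_(c : Fq) mult D (Some c) + mult D None = 2 * k)%N.
  rewrite -(mult_sum kD) [RHS](bigD1 None) //= addnC; congr addn.
  rewrite [RHS](reindex_onto Some (odflt 0)) /=; last by case.
  by apply: eq_bigl => c; rewrite eqxx.
have H2 : (\sum_(c : Fq) (k.-1 - mult D (Some c)) + \sum_(c : Fq) mult D (Some c) = #|Fq| * k.-1)%N.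
  rewrite -big_split /= -[RHS]sum_nat_const; apply: eq_bigr => c _.
  by rewrite subnK // mult_le.
under eq_bigr do rewrite -addn1.
rewrite big_split /= sum1_card /kdim (_ : #|xpredT| = #|Fq|); last by apply: eq_card.
have := mult_le None kD; have := finNzRing_gt1 Fq; move: H1 H2.
move: (\sum_(c : Fq) (k.-1 - _))%N (\sum_c mult D _)%N (mult D None) => S1 S2 M.
have e1 : (#|Fq| * k.-1 = #|Fq| * k - #|Fq|)%N by rewrite -subn1 mulnBr muln1.
have e2 : (k * (#|Fq| - 1) = #|Fq| * k - k)%N by rewrite mulnBr muln1 mulnC.
rewrite e1 e2; have : (#|Fq| <= #|Fq| * k)%N by rewrite leq_pmulr // ltnW.
by move: (#|Fq| * k)%N k2; clear; lia.
Qed.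

Variables (L : fieldType) (h : {rmorphism Fq -> L}).

Lemma lin_eval s z : (map_poly h (lin s)).[z] = \prod_c (z - h c) ^+ (s == Some c).
Proof.
case: s => [x|] /=.
  rewrite rmorphB /= map_polyX map_polyC /= !hornerE (bigD1 x) //= eqxx expr1 big1 ?mulr1 // => c.
  by move=> /negPf cx; rewrite (_ : (Some x == Some c) = (x == c)) // eq_sym cx expr0.
by rewrite rmorph1 hornerE big1 // => c _; rewrite expr0.
Qed.

Lemma udiff_lin z a b : (forall c, z != h c) -> a <> b ->
  udiff h z a b = h (kappa a b) / ((map_poly h (lin a)).[z] * (map_poly h (lin b)).[z]).
Proof.
move=> zh ab; case: a b ab => [x|] [y|] //= _; rewrite /udiff ?rmorphB ?rmorph1 ?rmorphN ?rmorph1 /= ?map_polyX ?map_polyC !hornerE ?subr0 ?sub0r ?mul1r ?mulr1 ?mulN1r //.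
by field; rewrite !subr_eq0 !zh.
Qed.

Lemma kprod_numer k D z : kurihara k D -> (forall c, z != h c) ->
  kprod h z D * (\prod_c (z - h c)) ^+ k.-1 = (map_poly h (numer k D)).[z].
Proof.
move=> kD zh; have [[_ _ _ ab _] _] := kD.
have zc c : z - h c != 0 by rewrite subr_eq0.
have mC (c : Fq) : (map_poly h c%:P).[z] = h c by rewrite map_polyC hornerC.
rewrite /numer rmorphM /= hornerM mC !rmorph_prod horner_prod.
have -> : kprod h z D = \prod_i h (kappa (ka i) (@kb _ D i) ^+ @kexp _ D i) / \prod_c (z - h c) ^+ mult D (Some c).
  rewrite /kprod /mult; under [X in _ / X]eq_bigr do rewrite -prodrXr.
  rewrite exchange_big /= -prodf_div; apply: eq_bigr => i _.
  rewrite udiff_lin // expr_div_n rmorphXn; congr (_ / _).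
  rewrite !lin_eval -big_split /= -prodrXl; apply: eq_bigr => c _.
  by rewrite -exprD -exprM mulnC.
rewrite -prodrXl mulrAC -mulrA; congr (_ * _).
rewrite -prodf_div; apply: eq_bigr => c _.
rewrite rmorphXn rmorphB /= map_polyX map_polyC /= horner_exp !hornerE.
by rewrite -{1}(subnK (mult_le (Some c) kD)) exprD mulfK // expf_neq0.
Qed.

End KuriharaNumerators.

(** * Linear systems over the integers of K and reduction of the Kurihara basis *)

Section IntegralSystems.

Variables (Fq : finFieldType) (R : realType) (K : valued_ext Fq R).
Local Notation abs := (vabs K).
Local Notation q := (#|Fq|%:R : R).
Local Notation T := (Defs.iota K (AtoF 'X)).
Local Notation im := (@vabs_i Fq R K).

Lemma abs_prod_le1 (I : Type) (r : seq I) (P : pred I) (x : I -> K) :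
  (forall i, abs (x i) <= 1) -> abs (\prod_(i <- r | P i) x i) <= 1.
Proof. by move=> H; rewrite abs_prod prodr_ile1 // => i _; rewrite abs_ge0 H. Qed.

Lemma abs_sign (b : bool) : abs ((-1) ^+ b) = 1.
Proof. by rewrite absX absN abs1 expr1n. Qed.

Lemma abs_det_le1 N (A : 'M[K]_N) : (forall i j, abs (A i j) <= 1) -> abs (\det A) <= 1.
Proof.
move=> H; apply: abs_sum_le => // s _; rewrite absM abs_sign mul1r.
exact: abs_prod_le1.
Qed.

(** The adjugate of an integral matrix is integral, and the determinant is a unit. *)
Lemma small_solution N (A : 'M[K]_N) (x : 'rV[K]_N) e : 0 < e -> (forall i j, abs (A i j) <= 1) ->
  abs (\det A) = 1 -> (forall j, abs ((x *m A) 0 j) < e) -> forall i, abs (x 0 i) < e.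
Proof.
move=> e0 A1 dA H i; rewrite -[abs (x 0 i)]mul1r -dA -absM.
have <- : ((x *m A) *m \adj A) 0 i = \det A * x 0 i.
  by rewrite -mulmxA mul_mx_adj mul_mx_scalar mxE.
rewrite mxE; apply: abs_sum_lt => // j _; rewrite absM.
apply: le_lt_trans (H j); rewrite ler_piMr // mxE /cofactor absM absX absN abs1 expr1n mul1r.
by apply: abs_det_le1 => i' j'; rewrite !mxE.
Qed.

Lemma prod_near (I : Type) (r : seq I) (x y : I -> K) :
  (forall i, [/\ abs (x i - y i) < 1, abs (x i) <= 1 & abs (y i) <= 1]) ->
  abs (\prod_(i <- r) x i - \prod_(i <- r) y i) < 1.
Proof.
move=> H; elim: r => [|i r IH]; first by rewrite !big_nil subrr abs0.
rewrite !big_cons.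
have -> : x i * \prod_(j <- r) x j - y i * \prod_(j <- r) y j =
  x i * (\prod_(j <- r) x j - \prod_(j <- r) y j) + (x i - y i) * \prod_(j <- r) y j by ring.
have [h1 h2 h3] := H i; apply: absD_lt; rewrite absM.
  by apply: le_lt_trans IH; rewrite ler_piMl.
apply: le_lt_trans h1; rewrite ler_piMr // abs_prod_le1 // => j; by case: (H j).
Qed.

Lemma pow_near (x y : K) m : abs (x - y) < 1 -> abs x <= 1 -> abs y <= 1 -> abs (x ^+ m - y ^+ m) < 1.
Proof.
move=> h1 h2 h3; have := @prod_near _ (nseq m tt) (fun _ => x) (fun _ => y).
by rewrite !big_const_seq !count_predT size_nseq !iter_mulr_1; apply.
Qed.

Lemma far_points N : exists w : 'I_N -> K, (forall i, abs (w i) = 1 /\ im (w i) = 1) /\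
  forall i j, i != j -> abs (w i - w j) = 1.
Proof.
have [s [sN s1 sd]] : exists s : seq K, [/\ size s = N, forall x, x \in s -> abs x = 1 /\ im x = 1 &
    pairwise (fun x y => abs (x - y) == 1) s].
  elim: N => [|N [s [sN s1 sd]]]; first by exists [::].
  have [z [za zi Hz]] := @exists_vertex_pt _ _ K 0 s; rewrite expr0z in za zi Hz.
  exists (z :: s); split; first by rewrite /= sN.
    by move=> x; rewrite inE => /orP[/eqP->|/s1].
  rewrite /= sd andbT; apply/allP => b bs; rewrite Hz // (s1 b bs).1 maxxx //.
exists (fun i => s`_i); split=> [i|]; first by apply: s1; rewrite mem_nth // sN.
move=> i j ij; wlog lij : i j ij / (i < j)%N.
  move=> H; have [h|h|h] := ltngtP i j; first exact: H.
    by rewrite absB; apply: H; rewrite // eq_sym.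
  by case/eqP: ij; apply: val_inj.
have /(pairwiseP 0) := sd => /(_ i j); rewrite !inE sN => H.
by apply/eqP/H.
Qed.

(** Equality in P^1(F) is the relation x y' = x' y, which survives reduction; a constant of absolute
    value below 1 is zero. *)
Lemma reduces_to_unique (a : P1 (ratfun Fq)) (al al' : P1 Fq) :
  reduces_to K a al -> reduces_to K a al' -> al = al'.
Proof.
move=> [x [y [xi [eta [hx1 hy1 n1 -> ->]]]]] [x' [y' [xi' [eta' [hx1' hy1' n1' ea ->]]]]].
have le1 (u : ratfun Fq) c : abs (Defs.iota K (u - FqtoF c)) < 1 -> abs (Defs.iota K u) <= 1.
  move=> h; rewrite -(subrK (FqtoF c) u) rmorphD absD_le ?(ltW h) //.
  exact: abs_c2k_le1.
have ne0 (u : ratfun Fq) c : abs (Defs.iota K (u - FqtoF c)) < 1 -> c != 0 -> u != 0.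
  move=> h c0; apply: contraTneq h => ->; rewrite sub0r rmorphN absN -leNgt.
  by rewrite -/(c2k K c) abs_c2k.
have cr : x * y' = x' * y.
  move: ea; rewrite /hpoint; have [y0|y0] := eqVneq y 0; have [y0'|y0'] := eqVneq y' 0 => //.
    by rewrite y0 y0' !mulr0.
  by move=> [] /eqP; rewrite eqr_div // => /eqP.
have E : xi * eta' = xi' * eta.
  apply/eqP; rewrite -subr_eq0; apply: contraT => ne.
  have : abs (c2k K (xi * eta' - xi' * eta)) < 1.
    rewrite rmorphB !rmorphM.
    have -> : c2k K xi * c2k K eta' - c2k K xi' * c2k K eta =
      (Defs.iota K x' * (Defs.iota K y - c2k K eta) + (Defs.iota K x' - c2k K xi') * c2k K eta)
      - (Defs.iota K x * (Defs.iota K y' - c2k K eta') + (Defs.iota K x - c2k K xi) * c2k K eta').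
      have := congr1 (Defs.iota K) cr; rewrite !rmorphM => e.
      apply/eqP; rewrite -subr_eq0; apply/eqP.
      transitivity (Defs.iota K x * Defs.iota K y' - Defs.iota K x' * Defs.iota K y); first by ring.
      by rewrite e subrr.
    have lt u v : abs u <= 1 -> abs v < 1 -> abs (u * v) < 1.
      by move=> u1 v1; rewrite absM; apply: le_lt_trans v1; rewrite ler_piMl.
    by apply: absB_lt; apply: absD_lt; rewrite ?(mulrC (_ - _)); apply: lt; rewrite -?rmorphB ?(le1 _ _ hx1) ?(le1 _ _ hx1') ?abs_c2k_le1.
  by rewrite abs_c2k // ltxx.
rewrite /hpoint; have [e0|e0] := eqVneq eta 0; have [e0'|e0'] := eqVneq eta' 0 => //.
- move: E; rewrite e0 mulr0 => /eqP; rewrite mulf_eq0 (negPf e0') orbF => /eqP x0.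
  by move: n1; rewrite x0 e0 eqxx.
- move: E; rewrite e0' mulr0 => /esym/eqP; rewrite mulf_eq0 (negPf e0) orbF => /eqP x0.
  by move: n1'; rewrite x0 e0' eqxx.
by congr Some; apply/eqP; rewrite eqr_div // E.
Qed.

Local Notation pole emb z s := (if s is Some x then (z - emb x)^-1 else 0).

Lemma abs_sub_c2k z c : abs z = 1 -> im z = 1 -> abs (z - c2k K c) = 1.
Proof.
move=> za zi; rewrite abs_sub_im ?za ?zi //; last exact: Finf_c2k.
by rewrite max_l // abs_c2k_le1.
Qed.

(** If a reduces to infinity, then a is infinity or |a| > 1, and 1 / (z - a) reduces to 0, the value
    at infinity. Otherwise |z - a| = 1, and the difference of the inverses has the size of the
    difference of the poles. *)
Lemma pole_reduction z a al : abs z = 1 -> im z = 1 -> reduces_to K a al ->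
  [/\ abs (pole (Defs.iota K) z a - pole (c2k K) z al) < 1,
      abs (pole (Defs.iota K) z a) <= 1 & abs (pole (c2k K) z al) <= 1].
Proof.
move=> za zi [x [y [xi [eta [hx1 hy1 n1 -> ->]]]]].
have zF (u : ratfun Fq) : abs (z - Defs.iota K u) = Num.max 1 (abs (Defs.iota K u)).
  by rewrite abs_sub_im ?za ?zi //; exact: Finf_iota.
have p2 : abs (pole (c2k K) z (hpoint xi eta)) <= 1.
  by rewrite /hpoint; case: eqP => _; rewrite ?abs0 // absV abs_sub_c2k // invr1.
have p1 : abs (pole (Defs.iota K) z (hpoint x y)) <= 1.
  by rewrite /hpoint; case: eqP => _; rewrite ?abs0 // absV zF invf_le1 ?lt_max ?ltr01 // le_max lexx.
split=> //; rewrite /hpoint.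
have [e0|e0] := eqVneq eta 0.
  have x0 : xi != 0 by move: n1; rewrite e0 eqxx orbF.
  have ax : abs (Defs.iota K x) = 1.
    rewrite -(abs_c2k K x0); apply: abs_near; rewrite abs_c2k // /c2k -rmorphB; exact: hx1.
  have ay : abs (Defs.iota K y) < 1 by move: hy1; rewrite e0 /FqtoF /AtoF !rmorph0 subr0.
  rewrite subr0; case: eqVneq => [_|y0]; first by rewrite abs0.
  have iy0 : 0 < abs (Defs.iota K y) by rewrite abs_gt0 fmorph_eq0.
  have a1 : 1 < abs (Defs.iota K (x / y)) by rewrite fmorph_div abs_div ax mul1r invf_gt1.
  by rewrite absV zF invf_lt1 ?lt_max ?a1 ?orbT // ltr01.
have ay : abs (Defs.iota K y) = 1.
  rewrite -(abs_c2k K e0); apply: abs_near; rewrite abs_c2k // /c2k -rmorphB; exact: hy1.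
have y0 : y != 0 by rewrite -(fmorph_eq0 (Defs.iota K)) -abs_gt0 ay ltr01.
rewrite (negPf y0).
have ax : abs (Defs.iota K x) <= 1.
  rewrite -(subrK (FqtoF xi) x) rmorphD absD_le ?(ltW hx1) //; exact: abs_c2k_le1.
have near : abs (Defs.iota K (x / y) - c2k K (xi / eta)) < 1.
  have ce : abs (c2k K eta) = 1 by rewrite abs_c2k.
  have ce0 : c2k K eta != 0 by rewrite -abs_gt0 ce ltr01.
  have iy0 : Defs.iota K y != 0 by rewrite fmorph_eq0.
  have -> : Defs.iota K (x / y) - c2k K (xi / eta) =
     ((Defs.iota K x - c2k K xi) * c2k K eta - c2k K xi * (Defs.iota K y - c2k K eta)) / (Defs.iota K y * c2k K eta).
    have -> : c2k K (xi / eta) = c2k K xi / c2k K eta by rewrite fmorph_div.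
    by rewrite fmorph_div; field; rewrite iy0 ce0.
  rewrite abs_div absM ay ce mulr1 divr1; apply: absB_lt; rewrite absM.
    by rewrite ce mulr1 /c2k -rmorphB.
  apply: le_lt_trans hy1; rewrite /c2k -rmorphB ler_piMl //; exact: abs_c2k_le1.
have d1 : abs (z - Defs.iota K (x / y)) = 1.
  by rewrite zF max_l // fmorph_div abs_div ay divr1.
have d2 := abs_sub_c2k (xi / eta) za zi.
have n1' : z - Defs.iota K (x / y) != 0 by rewrite -abs_gt0 d1 ltr01.
have n2' : z - c2k K (xi / eta) != 0 by rewrite -abs_gt0 d2 ltr01.
have -> : (z - Defs.iota K (x / y))^-1 - (z - c2k K (xi / eta))^-1 =
  (Defs.iota K (x / y) - c2k K (xi / eta)) / ((z - Defs.iota K (x / y)) * (z - c2k K (xi / eta))).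
  by move: (Defs.iota K (x / y)) (c2k K (xi / eta)) n1' n2' => u v n1' n2'; field; rewrite n1' n2'.
by rewrite abs_div absM d1 d2 mulr1 divr1.
Qed.

Lemma kprod_reduction z (D : kdata Fq) (a b : 'I_(kr D) -> P1 (ratfun Fq)) : abs z = 1 -> im z = 1 ->
  (forall i, reduces_to K (a i) (ka i)) -> (forall i, reduces_to K (b i) (kb i)) ->
  abs (kprod (Defs.iota K) z (krelift a b) - kprod (c2k K) z D) < 1.
Proof.
move=> za zi ha hb; rewrite /kprod /=; apply: prod_near => i.
have [a1 a2 a3] := pole_reduction za zi (ha i); have [b1 b2 b3] := pole_reduction za zi (hb i).
have u1 : abs (udiff (Defs.iota K) z (a i) (b i)) <= 1 by exact: absB_le.
have u2 : abs (udiff (c2k K) z (ka i) (kb i)) <= 1 by exact: absB_le.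
split; rewrite ?absX ?exprn_ile1 //; apply: pow_near => //.
rewrite /udiff; set A := pole _ _ (a i) in a1 *; set B := pole _ _ (b i) in b1 *.
set A' := pole _ _ (ka i) in a1 *; set B' := pole _ _ (kb i) in b1 *.
by have -> : B - A - (B' - A') = (B - B') - (A - A') by [ring]; exact: absB_lt.
Qed.

Variable k : nat.
Hypothesis k_ge2 : (2 <= k)%N.
Variable D : 'I_(kdim Fq k) -> kdata Fq.
Hypothesis D_kurihara : forall j, kurihara k (D j).
Hypothesis D_basis : form_basis k (fun j => kform_of (D j)).

Definition numer_mx : 'M[Fq]_(kdim Fq k) := \matrix_(j, l) (numer k (D j))`_l.

Definition Fq_to_kform : {rmorphism Fq -> kform Fq} :=
  (@FracField.tofrac {poly Fqbar Fq} \o polyC) \o to_Fqbar Fq.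

(** A relation between the rows becomes, after division by the common denominator, a relation
    between the basis forms. Its coefficients and 0 both express the zero form, so they agree by
    uniqueness of coordinates. *)
Lemma numer_mx_unit : numer_mx \in unitmx.
Proof.
rewrite -row_free_unit; apply: inj_row_free => v Hv.
have P0 : \sum_j (v 0 j) *: numer k (D j) = 0.
  apply/polyP => l; rewrite coef_sum coef0; have [lN|lN] := ltnP l (kdim Fq k).
    have := congr1 (fun M : 'rV_(kdim Fq k) => M 0 (Ordinal lN)) Hv; rewrite !mxE => E.
    rewrite -[RHS]E.
    by apply: eq_bigr => j _; rewrite coefZ mxE.
  apply: big1 => j _; rewrite coefZ nth_default ?mulr0 //.
  exact: leq_trans (numer_size k_ge2 (D_kurihara j)) lN.
have zc c : form_z Fq != Fq_to_kform c.
  rewrite -subr_eq0 /form_z /= -rmorphB /= tofrac_eq0.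
  by rewrite polyXsubC_eq0.
have S0 : \sum_j form_const (to_Fqbar Fq (v 0 j)) * kform_of (D j) = 0.
  have d0 : (\prod_c (form_z Fq - Fq_to_kform c)) ^+ k.-1 != 0.
    by rewrite expf_neq0 //; apply/prodf_neq0 => c _; rewrite subr_eq0.
  apply: (mulIf d0); rewrite mul0r big_distrl /=.
  have := congr1 (fun p => (map_poly Fq_to_kform p).[form_z Fq]) P0; rewrite rmorph0 horner0 => E.
  rewrite -[RHS]E rmorph_sum /= horner_sum; apply: eq_bigr => j _.
  rewrite linearZ /= hornerZ -kprod_numer // mulrA.
  by congr (_ * _ * _).
have [_ /(_ 0)] := D_basis => /(_ (or_introl (erefl _))) [c0 [_ Hc]].
have c1 := Hc [ffun j => to_Fqbar Fq (v 0 j)]; have c2 := Hc [ffun j => 0].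
apply/rowP => j; rewrite mxE; apply/eqP; rewrite -(fmorph_eq0 (to_Fqbar Fq)); apply/eqP.
have : [ffun j => to_Fqbar Fq (v 0 j)] = [ffun j : 'I_(kdim Fq k) => (0 : Fqbar Fq)].
  rewrite -c1 ?c2 //.
    rewrite big1 // => j' _; rewrite ffunE /form_const polyC0.
    by rewrite (_ : FracField.tofrac _ = 0) ?mul0r //; exact: rmorph0.
  by rewrite -[LHS]S0; apply: eq_bigr => j' _; rewrite ffunE.
by move/ffunP => /(_ j); rewrite !ffunE.
Qed.

(** The evaluation matrix at the points w is the matrix of numerator coefficients times a
    Vandermonde matrix, up to unit factors. The first determinant is a nonzero constant, the second
    a product of differences w_i - w_j; both are units. *)
Lemma kurihara_small (w c : 'I_(kdim Fq k) -> K) : (forall i, abs (w i) = 1 /\ im (w i) = 1) ->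
  (forall i j, i != j -> abs (w i - w j) = 1) ->
  (forall i, abs (\sum_j c j * kprod (c2k K) (w i) (D j)) < 1) -> forall j, abs (c j) < 1.
Proof.
move=> w1 wfar H.
pose V := Vandermonde (kdim Fq k) (\row_i w i).
pose M := map_mx (c2k K) numer_mx; pose x : 'rV[K]_(kdim Fq k) := \row_j c j.
have dM : abs (\det M) = 1.
  by rewrite det_map_mx abs_c2k //; have := numer_mx_unit; rewrite unitmxE unitfE.
have dV : abs (\det V) = 1.
  rewrite det_Vandermonde abs_prod big1 // => i _; rewrite abs_prod big1 // => j ij.
  by rewrite !mxE wfar // eq_sym neq_ltn ij.
have M1 i j : abs (M i j) <= 1 by rewrite mxE abs_c2k_le1.
have V1 i j : abs (V i j) <= 1 by rewrite !mxE absX (w1 j).1 expr1n.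
suff /(small_solution ltr01 M1 dM) Hx : forall l, abs ((x *m M) 0 l) < 1.
  by move=> j; have := Hx j; rewrite mxE.
apply: (small_solution ltr01 V1 dV) => i.
have wc c' : w i != c2k K c'.
  by rewrite -subr_eq0 -abs_gt0 abs_sub_c2k ?ltr01 //; case: (w1 i).
have -> : (x *m M *m V) 0 i = (\sum_j c j * kprod (c2k K) (w i) (D j)) * (\prod_c' (w i - c2k K c')) ^+ k.-1.
  rewrite -mulmxA mxE big_distrl /=; apply: eq_bigr => j _; rewrite mxE -mulrA; congr (_ * _).
  rewrite (kprod_numer (h := c2k K) (D_kurihara j)) //.
  rewrite (horner_coef_wide (n := kdim Fq k)); last by rewrite size_map_poly numer_size.
  by rewrite mxE; apply: eq_bigr => l _; rewrite !mxE coef_map.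
have dw : abs (\prod_c' (w i - c2k K c')) = 1.
  by rewrite abs_prod big1 // => c' _; rewrite abs_sub_c2k //; case: (w1 i).
by rewrite absM absX dw expr1n mulr1.
Qed.

End IntegralSystems.

(** * Linear structure of the spaces of modular forms *)

Section ModularSpace.

Variables (Fq : finFieldType) (R : realType) (K : valued_ext Fq R).
Local Notation abs := (vabs K).
Local Notation im := (@vabs_i Fq R K).
Local Notation Omega := (@Omega Fq R K).

Lemma holomorphic_lin (f g : K -> K) (c : K) : holomorphic f -> holomorphic g ->
  holomorphic (fun z => f z + c * g z).
Proof.
move=> hf hg m e e0; have c0 : 0 < abs c + 1 by rewrite ltr_wpDl.
have [p [r H]] := hf m e e0; have [p' [r' H']] := hg m (e / (abs c + 1)) (divr_gt0 e0 c0).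
exists (p * r' + c *: p' * r), (r * r') => z za.
have [r0 h] := H z za; have [r0' h'] := H' z za.
rewrite !hornerE; split; first exact: mulf_neq0.
have -> : f z + c * g z - (p.[z] * r'.[z] + c * p'.[z] * r.[z]) / (r.[z] * r'.[z]) =
  (f z - p.[z] / r.[z]) + c * (g z - p'.[z] / r'.[z]) by field; rewrite r0 r0'.
apply: absD_lt => //; rewrite absM.
move: h'; rewrite ltr_pdivlMr // => h'; apply: le_lt_trans h'.
by rewrite mulrC ler_wpM2l // lerDl.
Qed.

Lemma converges_lin (u v : nat -> K) l l' c : converges u l -> converges v l' ->
  converges (fun i => u i + c * v i) (l + c * l').
Proof.
move=> hu hv e e0; have c0 : 0 < abs c + 1 by rewrite ltr_wpDl.
have [N1 H1] := hu e e0; have [N2 H2] := hv _ (divr_gt0 e0 c0).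
exists (maxn N1 N2) => i; rewrite geq_max => /andP[/H1 h1 /H2 h2].
have -> : u i + c * v i - (l + c * l') = (u i - l) + c * (v i - l') by ring.
apply: absD_lt => //; rewrite absM; move: h2; rewrite ltr_pdivlMr // => h2; apply: le_lt_trans h2.
by rewrite mulrC ler_wpM2l // lerDl.
Qed.

Variables (n : {poly Fq}) (w : nat).

Lemma t_expansion_lin m f g nu a b c : has_t_expansion n w m f nu a -> has_t_expansion n w m g nu b ->
  has_t_expansion (K := K) n w m (fun z => f z + c * g z) nu (fun i => a i + c * b i).
Proof.
move=> [r H] [r' H']; exists (Num.max r r') => z oz; rewrite gt_max => /andP[zr zr'].
have := converges_lin c (H z oz zr) (H' z oz zr').
rewrite mulrDr [_ * (c * _)]mulrCA => L e e0; have [N HN] := L e e0; exists N => i iN.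
have := HN i iN; congr (abs (_ - _) < e).
rewrite big_distrr -big_split /=; apply: eq_bigr => j _; by ring.
Qed.

(** The coefficient of index m is not read by the expansion from m + 1 on and may be arbitrary, so
    it is reset to 0. *)
Lemma t_expansion_shift m f nu a : has_t_expansion n w m.+1 f nu a ->
  has_t_expansion (K := K) n w m f nu (fun i => if i == m then 0 else a i).
Proof.
move=> [r H]; exists r => z oz zr e e0; have [N HN] := H z oz zr e e0.
exists (maxn N m.+1) => i; rewrite geq_max => /andP[iN im].
have := HN i iN; congr (abs (_ - _) < e).
rewrite [RHS]big_ltn // eqxx mul0r add0r !big_nat; apply: eq_bigr => j /andP[mj _].
by rewrite gtn_eqF.
Qed.

Lemma modular_lin m f g c : modular_forms K w m n f -> modular_forms K w m n g ->
  modular_forms K w m n (fun z => f z + c * g z).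
Proof.
move=> [hf mf cf] [hg mg cg]; split; first exact: holomorphic_lin.
- by move=> h z hG oz; rewrite mf // mg // mulrDr [_ * (c * _)]mulrCA.
- move=> s nu nu_u nu_s; have [a Ha] := cf s nu nu_u nu_s; have [b Hb] := cg s nu nu_u nu_s.
  by exists (fun i => a i + c * b i); exact: t_expansion_lin.
Qed.

Lemma modular0 m : modular_forms K w m n (fun _ => 0).
Proof.
split.
- move=> m' e e0; exists 0, 1 => z _; rewrite horner0 hornerC oner_neq0 mul0r subrr abs0; by split.
- by move=> *; rewrite mulr0.
- move=> s nu _ _; exists (fun _ => 0); exists 0 => z _ _ e e0; exists 0%N => i _.
  by rewrite big1 ?mulr0 ?subrr ?abs0 // => j _; rewrite mul0r.
Qed.

Lemma modular_sum m (I : finType) (c : I -> K) (b : I -> K -> K) :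
  (forall i, modular_forms K w m n (b i)) -> modular_forms K w m n (fun z => \sum_i c i * b i z).
Proof.
move=> H; rewrite /index_enum; elim: (Finite.enum I) => [|i r IH].
  rewrite (_ : (fun z => _) = fun _ => 0); first exact: modular0.
  by apply: funext => z; rewrite big_nil.
rewrite (_ : (fun z => _) = fun z => \sum_(j <- r) c j * b j z + c i * b i z); first exact: modular_lin.
by apply: funext => z; rewrite big_cons addrC.
Qed.

Lemma modular_weaken m f : modular_forms K w m.+1 n f -> modular_forms K w m n f.
Proof.
move=> [hf mf cf]; split=> // s nu nu_u nu_s; have [a Ha] := cf s nu nu_u nu_s.
by eexists; exact: t_expansion_shift Ha.
Qed.

End ModularSpace.

(** An injective endomorphism of a finite-dimensional space is surjective. One index type serves
    both sides because series and evaluation points correspond. *)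
Lemma square_system (F : fieldType) (I : finType) (X : I -> I -> F) :
  (forall c : I -> F, (forall y, \sum_x c x * X x y = 0) -> forall x, c x = 0) ->
  forall t : I -> F, exists c : I -> F, forall y, \sum_x c x * X x y = t y.
Proof.
move=> H t; pose M : 'M[F]_#|I| := \matrix_(i, j) X (enum_val i) (enum_val j).
have sumE (c : 'rV[F]_#|I|) j : (c *m M) 0 j = \sum_x c 0 (enum_rank x) * X x (enum_val j).
  rewrite mxE (reindex (@enum_val I I)) /=; last exact: onW_bij (@enum_val_bij I).
  by apply: eq_bigr => i _; rewrite enum_valK mxE.
have Mu : M \in unitmx.
  rewrite -row_free_unit; apply: inj_row_free => v Hv; apply/rowP => j; rewrite mxE.
  have := H (fun x => v 0 (enum_rank x)) _ (enum_val j); rewrite enum_valK; apply => y.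
  by have := sumE v (enum_rank y); rewrite Hv mxE enum_rankK => <-.
pose c := (\row_j t (enum_val j)) *m invmx M.
exists (fun x => c 0 (enum_rank x)) => y.
by have := sumE c (enum_rank y); rewrite mulmxKV // mxE enum_rankK => <-.
Qed.

(** * Sizes of the terms of a Poincare series *)

Section TermWeights.

Variables (Fq : finFieldType) (R : realType) (K : valued_ext Fq R).
Local Notation abs := (vabs K).
Local Notation q := (#|Fq|%:R : R).
Local Notation T := (Defs.iota K (AtoF 'X)).
Local Notation im := (@vabs_i Fq R K).
Local Notation Omega := (@Omega Fq R K).
Local Notation Finf := (@Finf Fq R K).
Local Notation G2 := (@GL2Finf Fq R K).
Local Notation act := (@act_vertex Fq R K).
Local Notation emb := (Defs.iota K).
Local Notation v0 := (vtx K 0).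
Implicit Types (z : K) (X : 'M[ratfun Fq]_2) (D : kdata (ratfun Fq)).

Hypothesis K_Cinf : is_Cinf K.
Variables (n : {poly Fq}) (k : nat).
Hypothesis n_size : (1 < size n)%N.

(** The equality case of [kprod_le1], by [kprod_lt1] and [kprod_eq1]. *)
Definition tight z X D := forall i, weight z (omap emb (mob X (ka i))) (omap emb (mob X (@kb _ D i))) = 1.

Lemma kprod_le1 z X D : kdata_wf k D -> Omega z -> abs (kprod emb z (kmap (mob X) D)) * im z ^+ k <= 1.
Proof.
move=> [_ _ ek _ _] oz; have := abs_kprod z (kmap (mob X) D); rewrite /= ek => ->.
apply: prodr_ile1 => i _; rewrite exprn_ge0 ?weight_ge0 //= exprn_ile1 ?weight_ge0 ?weight_le1 //; exact: P1Finf_omap.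
Qed.

Lemma kprod_lt1 z X D : kdata_wf k D -> Omega z -> ~ tight z X D ->
  abs (kprod emb z (kmap (mob X) D)) * im z ^+ k < 1.
Proof.
move=> [_ e1 ek _ _] oz nt; have := abs_kprod z (kmap (mob X) D); rewrite /= ek => ->.
have [i wi] : exists i, weight z (omap emb (mob X (ka i))) (omap emb (mob X (@kb _ D i))) <> 1.
  by apply: contrapT => H; apply: nt => i; apply: contrapT => h; apply: H; exists i.
rewrite (bigD1 i) //=; set x := weight _ _ _ in wi *.
have x0 : 0 <= x by exact: weight_ge0.
have x1 : x < 1.
  by rewrite lt_neqAle weight_le1 ?andbT //; [exact/eqP|exact: P1Finf_omap|exact: P1Finf_omap].
apply: (@le_lt_trans _ _ (x ^+ @kexp _ D i * 1)); last by rewrite mulr1 exprn_ilt1 // -lt0n.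
rewrite ler_wpM2l ?exprn_ge0 //; apply: prodr_ile1 => j _.
by rewrite exprn_ge0 ?weight_ge0 //= exprn_ile1 ?weight_ge0 ?weight_le1 //; exact: P1Finf_omap.
Qed.

Lemma kprod_eq1 z X D : kdata_wf k D -> tight z X D ->
  abs (kprod emb z (kmap (mob X) D)) * im z ^+ k = 1.
Proof.
move=> [_ e1 ek _ _] ti; have := abs_kprod z (kmap (mob X) D); rewrite /= ek => ->.
by apply: big1 => i _; rewrite ti expr1n.
Qed.

Lemma tight_vertex m z X D : kdata_wf k D -> G2 m -> X \in unitmx -> abs z = 1 -> im z = 1 -> tight (mobz m z) X D ->
  geodesics_meet K D [set act (invmx (mxFK K X)) (act m v0)].
Proof.
move=> [_ _ _ ab _] mG Xu za zi ti i _.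
have XG := G2_mxFK K Xu.
apply/geodesicP; [exact: P1Finf_omap|exact: P1Finf_omap| |].
  by move=> h; apply: (ab i); move: h; case: (ka i) => [x|]; case: (kb i) => [y|] //= [] /fmorph_inj ->.
have := geo_vertex_act mG (P1Finf_omap K _) (P1Finf_omap K _) za zi (ti i).
move=> /(geo_act (G2V XG)); rewrite !mob_omap !mobK ?G2_unit // image_set1.
by [].
Qed.

Lemma tight_edge m z X D : kdata_wf k D -> G2 m -> X \in unitmx -> z ^+ 2 = T -> tight (mobz m z) X D ->
  geodesics_meet K D [set act (invmx (mxFK K X)) (act m v0); act (invmx (mxFK K X)) (act m (vz 1))].
Proof.
move=> [_ _ _ ab _] mG Xu zT ti i _.
have XG := G2_mxFK K Xu.
apply/geodesicP; [exact: P1Finf_omap|exact: P1Finf_omap| |].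
  by move=> h; apply: (ab i); move: h; case: (ka i) => [x|]; case: (kb i) => [y|] //= [] /fmorph_inj ->.
have := geo_edge_act mG (P1Finf_omap K _) (P1Finf_omap K _) zT (ti i).
by move=> /(geo_act (G2V XG)); rewrite !mob_omap !mobK ?G2_unit // image_setU !image_set1.
Qed.

Lemma edge_tight m z D : kdata_wf k D -> G2 m -> z ^+ 2 = T ->
  geodesics_meet K D [set act m v0; act m (vz 1)] -> tight (mobz m z) 1%:M D.
Proof.
move=> [_ _ _ ab _] mG zT H i; rewrite !mob1.
apply: edge_weight => //; have := H i I => /geodesicP; apply; [exact: P1Finf_omap|exact: P1Finf_omap|].
by move=> h; apply: (ab i); move: h; case: (ka i) => [x|]; case: (kb i) => [y|] //= [] /fmorph_inj ->.
Qed.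

Variables (delta : 'M[ratfun Fq]_2) (D : kdata (ratfun Fq)).
Hypothesis delta_unit : delta \in unitmx.
Hypothesis D_wf : kdata_wf k D.
Hypothesis no_common_end : forall s, exists i, s <> @ka _ D i /\ s <> @kb _ D i.

Let term z g := kprod emb z (kmap (mob (mxAF g *m delta)) D).

(** After normalization by |z|_i^k every term that is not tight is smaller than 1, so modulo
    elements smaller than 1 the series is the sum of its tight terms. *)
Lemma poincare_near z B0 : Omega z -> uniq B0 -> [set` B0] `<=` Gamma n ->
  (forall g, Gamma n g -> g \notin B0 -> ~ tight z (mxAF g *m delta) D) ->
  abs (poincare K n delta D z - \sum_(g <- B0) term z g) * im z ^+ k < 1.
Proof.
move=> oz uB sB H; have i0 : 0 < im z ^+ k by rewrite exprn_gt0 //; apply/im_gt0.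
rewrite -ltr_pdivlMr // div1r; apply: usum_near => //.
- exact: (terms_summable n delta_unit D_wf no_common_end).
- by rewrite invr_gt0.
- move=> g gG gB; rewrite -div1r ltr_pdivlMr //; apply: kprod_lt1 => //; exact: H.
Qed.

Lemma poincare_lt1 z : Omega z -> (forall g, Gamma n g -> ~ tight z (mxAF g *m delta) D) ->
  abs (poincare K n delta D z) * im z ^+ k < 1.
Proof.
move=> oz H; have := @poincare_near z [::] oz isT; rewrite big_nil subr0; apply=> // g gG _; exact: H.
Qed.

Lemma poincare_le1 z : Omega z -> abs (poincare K n delta D z) * im z ^+ k <= 1.
Proof.
move=> oz; have i0 : 0 < im z ^+ k by rewrite exprn_gt0 //; apply/im_gt0.
have S := terms_summable n delta_unit D_wf no_common_end oz.
have e0 : 0 < (im z ^+ k)^-1 by rewrite invr_gt0.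
have [B0 [uB sB HB]] := S _ e0.
have near := usum_near K_Cinf S e0 uB sB HB.
rewrite -ler_pdivlMr // div1r; rewrite -/(poincare K n delta D z) in near.
rewrite -(subrK (\sum_(g <- B0) term z g) (poincare K n delta D z)) absD_le ?(ltW near) //.
rewrite big_seq; apply: abs_sum_le; first exact: ltW.
by move=> g gB; rewrite -div1r ler_pdivlMr //; exact: kprod_le1.
Qed.

End TermWeights.

(** * Evaluation at the chosen points and the basis of M_{2k}^{k+1} *)

Section EvaluationBasis.

Variables (Fq : finFieldType) (R : realType) (K : valued_ext Fq R).
Local Notation abs := (vabs K).
Local Notation q := (#|Fq|%:R : R).
Local Notation T := (Defs.iota K (AtoF 'X)).
Local Notation im := (@vabs_i Fq R K).
Local Notation Omega := (@Omega Fq R K).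
Local Notation Finf := (@Finf Fq R K).
Local Notation G2 := (@GL2Finf Fq R K).
Local Notation act := (@act_vertex Fq R K).
Local Notation emb := (Defs.iota K).
Local Notation v0 := (vtx K 0).
Local Notation v1 := (@vz Fq R K 1).
Implicit Types (z : K).

Hypothesis K_Cinf : is_Cinf K.
Variables (k d : nat).
Hypothesis k_ge2 : (2 <= k)%N.
Hypothesis d_ge1 : (1 <= d)%N.
Variable n : {poly Fq}.
Hypothesis n_monic : n \is monic.
Hypothesis n_deg : size n = d.+1.

Let n_size : (1 < size n)%N. Proof. by rewrite n_deg. Qed.

(** A common end of all lifted pairs would reduce to a common point of all pairs of the Kurihara
    differential. *)
Lemma vertex_no_common_end (D : kdata Fq) (a b : 'I_(kr D) -> P1 (ratfun Fq)) : kurihara k D ->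
  (forall i, reduces_to K (a i) (ka i)) -> (forall i, reduces_to K (b i) (kb i)) ->
  forall s, exists i, s <> a i /\ s <> b i.
Proof.
move=> [[r2 _ _ _ _] E] ha hb s; apply: contrapT => H.
have eqs i : s = a i \/ s = b i.
  by apply: contrapT => h; apply: H; exists i; split=> e; apply: h; [left|right].
have i0 : 'I_(kr D) by exists 0%N; exact: ltn_trans r2.
have [sg hs] : exists sg, reduces_to K s sg.
  by case: (eqs i0) => ->; [exists (ka i0)|exists (kb i0)].
have : (\bigcap_(i in [set: 'I_(kr D)]) kpair i) sg.
  move=> i _; case: (eqs i) => e; rewrite e in hs; [left|right].
    exact: reduces_to_unique hs (ha i).
  exact: reduces_to_unique hs (hb i).
by rewrite E.
Qed.

Lemma krelift_wf (D : kdata Fq) (a b : 'I_(kr D) -> P1 (ratfun Fq)) : kurihara k D ->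
  (forall i, reduces_to K (a i) (ka i)) -> (forall i, reduces_to K (b i) (kb i)) ->
  kdata_wf k (krelift a b).
Proof.
move=> [[r2 e1 ek ab inj] _] ha hb; split=> // [i /= eab|i j].
  by apply: (ab i); apply: reduces_to_unique (ha i) _; rewrite eab; exact: hb.
rewrite /kpair /= => e; apply: inj; rewrite /kpair.
have u x al al' : reduces_to K x al -> reduces_to K x al' -> al = al' := @reduces_to_unique _ _ K x al al'.
case: (set2_eq e) => -[e1' e2'].
  rewrite (u _ _ _ (ha i) (_ : reduces_to K (a i) (@ka _ D j))); last by rewrite e1'; exact: ha.
  by rewrite (u _ _ _ (hb i) (_ : reduces_to K (b i) (@kb _ D j))) // e2'; exact: hb.
rewrite (u _ _ _ (ha i) (_ : reduces_to K (a i) (@kb _ D j))); last by rewrite e1'; exact: hb.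
rewrite (u _ _ _ (hb i) (_ : reduces_to K (b i) (@ka _ D j))); last by rewrite e2'; exact: ha.
exact: setUC.
Qed.

Variables (IV : finType) (delta : IV -> 'M[ratfun Fq]_2).
Hypothesis delta_unit : forall v, delta v \in unitmx.
Hypothesis vertex_lifts : orbit_representatives n (fun g => act (mxAK K g))
  (stable_vertex (K := K) n) (fun v => act (mxFK K (delta v)) v0).
Variable DV : IV -> 'I_(kdim Fq k) -> kdata Fq.
Hypothesis DV_kurihara : forall v j, kurihara k (DV v j).
Hypothesis DV_basis : forall v, form_basis k (fun j => kform_of (DV v j)).
Variables aV bV : forall v j, 'I_(kr (DV v j)) -> P1 (ratfun Fq).
Arguments aV : clear implicits.
Arguments bV : clear implicits.
Hypothesis aV_red : forall v j i, reduces_to K (aV v j i) (ka (k := DV v j) i).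
Hypothesis bV_red : forall v j i, reduces_to K (bV v j i) (kb (k := DV v j) i).
Hypothesis V_meet : forall v j, geodesics_meet K (krelift (aV v j) (bV v j)) = [set [set v0]].
Variables (IE : finType) (eE : IE -> set (vertex K)).
Hypothesis edge_lifts : orbit_representatives n (fun g => act_edge (mxAK K g))
  (noncuspidal_edge (K := K) n) eE.
Variable DE : IE -> kdata (ratfun Fq).
Hypothesis DE_wf : forall e, kdata_wf k (DE e).
Hypothesis E_meet : forall e, geodesics_meet K (DE e) = closed_edge (eE e).

Local Notation lV v j := (krelift (aV v j) (bV v j)).
Let X := (IV * 'I_(kdim Fq k) + IE)%type.
Let fVE (x : X) := match x with
  | inl vj => poincare K n (delta vj.1) (lV vj.1 vj.2)
  | inr e => poincare K n 1%:M (DE e) end.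

Variables (w : 'I_(kdim Fq k) -> K) (zeta : K) (mE : IE -> 'M[K]_2).
Hypothesis w1 : forall i, abs (w i) = 1 /\ im (w i) = 1.
Hypothesis wfar : forall i j, i != j -> abs (w i - w j) = 1.
Hypothesis zetaT : zeta ^+ 2 = T.
Hypothesis mE_G2 : forall e, G2 (mE e).
Hypothesis mE_edge : forall e, eE e = [set act (mE e) v0; act (mE e) v1].

Let mV v := mxFK K (delta v).
Let pt (x : X) := match x with inl vj => mobz (mV vj.1) (w vj.2) | inr e => mobz (mE e) zeta end.

Lemma mV_G2 v : G2 (mV v). Proof. exact: G2_mxFK. Qed.

Lemma Omega_w i : Omega (w i).
Proof. by apply/im_gt0; rewrite (w1 i).2. Qed.

Lemma Omega_zeta : Omega zeta.
Proof.
have /andP[h1 h2] := abs_half zetaT; apply: Omega_im; first exact: lt_trans h1.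
by rewrite im_annulus // h1.
Qed.

Lemma Omega_pt x : Omega (pt x).
Proof.
case: x => [[v i]|e] /=; apply: Omega_mobz; rewrite ?mV_G2 //; first exact: mV_G2.
  exact: Omega_w.
exact: Omega_zeta.
Qed.

Lemma V_wf v j : kdata_wf k (lV v j).
Proof. exact: krelift_wf. Qed.

Lemma V_end v j s : exists i, s <> @ka _ (lV v j) i /\ s <> @kb _ (lV v j) i.
Proof. exact: (vertex_no_common_end (DV_kurihara v j) (@aV_red v j) (@bV_red v j) s). Qed.

Lemma E_end e s : exists i, s <> @ka _ (DE e) i /\ s <> @kb _ (DE e) i.
Proof.
have [r2 _ _ ab _] := DE_wf e.
exact: (meet_common_end ab (ltnW r2) (E_meet e) (mE_edge e)).
Qed.

Lemma edge_neq_e e : act (mE e) v0 <> act (mE e) v1.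
Proof. exact: edge_neq. Qed.

Lemma fVE_le1 x z : Omega z -> abs (fVE x z) * im z ^+ k <= 1.
Proof.
case: x => [[v j]|e] oz /=.
  exact: (poincare_le1 K_Cinf n (delta_unit v) (V_wf v j) (@V_end v j)).
by apply: (poincare_le1 K_Cinf n _ (DE_wf e) (@E_end e)) => //; exact: unitmx1.
Qed.

Lemma XE_unit g : Gamma n g -> mxAF g *m (1%:M : 'M[ratfun Fq]_2) \in unitmx.
Proof. by move=> gG; rewrite mulmx1 mxAF_unit // (Gamma_unit gG). Qed.

Lemma XV_unit v g : Gamma n g -> mxAF g *m delta v \in unitmx.
Proof. by move=> gG; rewrite unitmx_mul mxAF_unit ?delta_unit // (Gamma_unit gG). Qed.

Lemma mE_stable e : stable_vertex n (act (mE e) v0).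
Proof.
have [v [v' [ev _ sv sv']]] := (proj1 edge_lifts) e.
by case: (set2_eq (etrans (esym ev) (mE_edge e))) => -[e1 e2]; rewrite -?e1 -?e2.
Qed.

(* A term of an edge series attains the bound at the chosen point of an edge
   only if it is the identity term at its own edge. *)
Lemma tight_edge_edge g e e' : Gamma n g -> tight (pt (inr e')) (mxAF g *m 1%:M) (DE e) ->
  e = e' /\ g = 1%:M.
Proof.
move=> gG ti; have gu := Gamma_unit gG; have GG := G2_mxAK K gu.
have := tight_edge (DE_wf e) (mE_G2 e') (XE_unit gG) zetaT ti.
rewrite mulmx1 E_meet => -[h|[u _ h]]; last first.
  by have := @set2_neq1 _ _ _ u _ h; case=> /(act_vertex_inj (G2_unit (G2V GG))); exact: edge_neq_e.
have ee : act_edge (mxAK K g) (eE e) = eE e'.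
  rewrite -h /act_edge image_setU !image_set1 !act_vertexVK ?G2_unit //.
have [i [_ Hi]] := (proj2 edge_lifts) (eE e') ((proj1 edge_lifts) e').
have e1 : i = e by apply: Hi; exists g.
have e2 : i = e'.
  apply: Hi; exists 1%:M; first exact: Gamma1.
  by rewrite mE_edge /act_edge image_setU !image_set1 mxAK1 !act_vertex1.
split; first by rewrite -e1.
apply: (edge_stabilizer n_size gG (mE_G2 e') (mE_stable e')).
by rewrite -mE_edge -{1}e2 e1.
Qed.

Lemma edge_at_edge e e' : e <> e' -> abs (fVE (inr e) (pt (inr e'))) * im (pt (inr e')) ^+ k < 1.
Proof.
move=> ne; apply: (poincare_lt1 K_Cinf _ (DE_wf e) (@E_end e)); first exact: unitmx1.
  exact: Omega_pt.
by move=> g gG /(tight_edge_edge gG)[].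
Qed.

Lemma edge_at_itself e : abs (fVE (inr e) (pt (inr e))) * im (pt (inr e)) ^+ k = 1.
Proof.
have oz := @Omega_pt (inr e).
have i0 : 0 < im (pt (inr e)) ^+ k by rewrite exprn_gt0 //; apply/im_gt0.
have ti : tight (pt (inr e)) 1%:M (DE e).
  apply: edge_tight => //; rewrite E_meet mE_edge; by left.
have := @poincare_near _ _ K K_Cinf n k 1%:M (DE e) (unitmx1 _ _) (DE_wf e) (@E_end e) (pt (inr e)) [:: 1%:M] oz isT.
rewrite big_seq1 mxAF1 mulmx1 => H.
have {}H : abs (fVE (inr e) (pt (inr e)) - kprod emb (pt (inr e)) (kmap (mob 1%:M) (DE e))) * im (pt (inr e)) ^+ k < 1.
  apply: H => [g|g gG]; first by rewrite /= inE => /eqP->; exact: Gamma1.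
  by rewrite inE => /eqP g1 /(tight_edge_edge gG)[_].
have H1 := kprod_eq1 (DE_wf e) ti.
rewrite -H1; congr (_ * _); apply: abs_near; rewrite -(ltr_pM2r i0) H1; exact: H.
Qed.

(** The geodesics of a vertex series meet in a vertex only, so no term is tight at a point over an
    edge. *)
Lemma vertex_at_edge v j e : abs (fVE (inl (v, j)) (pt (inr e))) * im (pt (inr e)) ^+ k < 1.
Proof.
apply: (poincare_lt1 K_Cinf (delta_unit v) (V_wf v j) (@V_end v j)); first exact: Omega_pt.
move=> g gG ti; have Xu := XV_unit v gG.
have := tight_edge (V_wf v j) (mE_G2 e) Xu zetaT ti; rewrite V_meet /=.
have XG := G2_mxFK K Xu.
by apply: set2_neq1 => /(act_vertex_inj (G2_unit (G2V XG))); exact: edge_neq_e.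
Qed.

Lemma mV_stable v : stable_vertex n (act (mV v) v0).
Proof. exact: (proj1 vertex_lifts). Qed.

Lemma tight_vertex_vertex g v j v' i : Gamma n g -> tight (pt (inl (v', i))) (mxAF g *m delta v) (lV v j) ->
  v = v' /\ g = 1%:M.
Proof.
move=> gG ti; have gu := Gamma_unit gG; have GG := G2_mxAK K gu; have Xu := XV_unit v gG.
have XG := G2_mxFK K Xu.
have := tight_vertex (V_wf v j) (mV_G2 v') Xu (w1 i).1 (w1 i).2 ti; rewrite V_meet /= => h.
have {}h : act (invmx (mxFK K (mxAF g *m delta v))) (act (mV v') v0) = v0.
  by have : [set v0] (act (invmx (mxFK K (mxAF g *m delta v))) (act (mV v') v0)) by rewrite -h.
have ee : act (mxAK K g) (act (mV v) v0) = act (mV v') v0.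
  rewrite -[X in act (mV v) X]h mxFKM -/(mxAK K g) -/(mV v) (act_vertexM _ (G2_unit GG) (G2_unit (mV_G2 v))).
  rewrite act_vertexVK // unitmx_mul G2_unit ?G2_unit //; exact: mV_G2.
have [v'' [_ Hv]] := (proj2 vertex_lifts) _ (mV_stable v').
have e1 : v'' = v by apply: Hv; exists g.
have e2 : v'' = v' by apply: Hv; exists 1%:M; [exact: Gamma1 | rewrite mxAK1 act_vertex1].
have vv : v = v' by rewrite -e1.
split=> //; apply: (mV_stable v).2 => //; by rewrite ee vv.
Qed.

Lemma vertex_at_vertex v j v' i : v <> v' ->
  abs (fVE (inl (v, j)) (pt (inl (v', i)))) * im (pt (inl (v', i))) ^+ k < 1.
Proof.
move=> ne; apply: (poincare_lt1 K_Cinf (delta_unit v) (V_wf v j) (@V_end v j)); first exact: Omega_pt.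
by move=> g gG /(tight_vertex_vertex gG)[].
Qed.

(** The factor that brings the identity term from the point over the lifted vertex back to the point
    w over v_0. *)
Let jd v i := jfac (mV v) (w i) ^+ 2 / \det (mV v).

Lemma jd_im v i : abs (jd v i) * im (pt (inl (v, i))) = 1.
Proof.
rewrite /= im_mobz ?(w1 i).2; [|exact: mV_G2|exact: Omega_w].
have d0 : 0 < abs (\det (mV v)) by rewrite abs_gt0 det_neq0 //; exact: mV_G2.
have j0 : 0 < abs (jfac (mV v) (w i)) by rewrite abs_gt0 jfac_neq0 //; [exact: mV_G2|exact: Omega_w].
by rewrite /jd abs_div absX mulr1; field; rewrite !gt_eqF.
Qed.

Lemma vertex_at_itself v j i :
  abs (fVE (inl (v, j)) (pt (inl (v, i))) - kprod emb (w i) (lV v j) * jd v i ^+ k) * im (pt (inl (v, i))) ^+ k < 1.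
Proof.
have oz := @Omega_pt (inl (v, i)).
have := @poincare_near _ _ K K_Cinf n k (delta v) (lV v j) (delta_unit v) (V_wf v j) (@V_end v j) (pt (inl (v, i))) [:: 1%:M] oz isT.
rewrite big_seq1 mxAF1 mul1mx /= kprod_mob //; last exact: Omega_w.
have [_ _ ek _ _] := V_wf v j; rewrite ek -/(jd v i); apply=> [g|g gG].
  by rewrite /= inE => /eqP->; exact: Gamma1.
by rewrite inE => /eqP g1 /(tight_vertex_vertex gG)[_].
Qed.

(** The matrix is block triangular modulo small elements. At edge points only the diagonal edge
    entries matter, so edge coefficients are small. At vertex points the edge series are merely
    bounded by 1, but their coefficients are now small, and each vertex is left with its own
    Kurihara system. *)
Lemma eval_small (c : X -> K) : (forall x, abs (c x) <= 1) ->
  (forall y, \sum_x c x * fVE x (pt y) = 0) -> forall x, abs (c x) < 1.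
Proof.
move=> c1 H.
have pos y : 0 < im (pt y) ^+ k by rewrite exprn_gt0 //; apply/im_gt0; exact: Omega_pt.
have cE e : abs (c (inr e)) < 1.
  have := H (inr e); rewrite (bigD1 (inr e)) //= => /eqP; rewrite addr_eq0 => /eqP E.
  apply: (@le_lt_trans _ _ (abs (c (inr e)) * (abs (fVE (inr e) (pt (inr e))) * im (pt (inr e)) ^+ k))).
    by rewrite edge_at_itself mulr1.
  rewrite mulrA -absM E absN -ltr_pdivlMr // div1r; apply: abs_sum_lt; first by rewrite invr_gt0.
  move=> x xe; rewrite absM; apply: (@le_lt_trans _ _ (1 * abs (fVE x (pt (inr e))))).
    by rewrite ler_wpM2r.
  rewrite mul1r -div1r ltr_pdivlMr //; case: x xe => [[v j] _|e' ee]; first exact: vertex_at_edge.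
  by apply: edge_at_edge => h; rewrite h eqxx in ee.
case=> [[v j]|//].
apply: (kurihara_small k_ge2 (DV_kurihara v) (DV_basis v) w1 wfar (c := fun j => c (inl (v, j)))) => i.
set z := pt (inl (v, i)); have zp := pos (inl (v, i)); rewrite -/z in zp.
pose A (x : X) := match x with inl vj => if vj.1 == v then kprod emb (w i) (lV vj.1 vj.2) * jd v i ^+ k else 0 | inr _ => 0 end.
have near x : abs (c x * (fVE x z - A x)) < (im z ^+ k)^-1.
  rewrite absM -div1r ltr_pdivlMr //; case: x => [[v' j']|e]; rewrite -?mulrA.
    apply: (@le_lt_trans _ _ (1 * (abs (fVE (inl (v', j')) z - A (inl (v', j'))) * im z ^+ k))).
      by rewrite ler_wpM2r // mulr_ge0 // ltW.
    rewrite mul1r /A /=; case: (eqVneq v' v) => [->|/eqP ne]; first exact: vertex_at_itself.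
    by rewrite subr0; exact: vertex_at_vertex.
  apply: (@le_lt_trans _ _ (abs (c (inr e)) * 1)); last by rewrite mulr1.
  by rewrite ler_wpM2l // /A subr0 fVE_le1 //; exact: Omega_pt.
have S1 : abs (\sum_x c x * A x) < (im z ^+ k)^-1.
  rewrite -absN -[- _]add0r -{1}(H (inl (v, i))) -/z -sumrB.
  apply: abs_sum_lt; first by rewrite invr_gt0.
  by move=> x _; rewrite -mulrBr.
have S2 : \sum_x c x * A x = (\sum_j0 c (inl (v, j0)) * kprod emb (w i) (lV v j0)) * jd v i ^+ k.
  rewrite big_sumType /= [X in _ + X]big1 ?addr0 => [|e _]; last by rewrite mulr0.
  transitivity (\sum_v' \sum_j' c (inl (v', j')) * A (inl (v', j'))).
    by rewrite pair_bigA /=; apply: eq_bigr => -[v' j'].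
  rewrite (bigD1 v) //= [X in _ + X]big1 ?addr0 => [|v' ne]; last first.
    by apply: big1 => j' _; rewrite (negPf ne) mulr0.
  by rewrite big_distrl; apply: eq_bigr => j' _; rewrite eqxx mulrA.
have S3 : abs (\sum_j0 c (inl (v, j0)) * kprod emb (w i) (lV v j0)) < 1.
  move: S1; rewrite S2 absM absX -div1r ltr_pdivlMr // -mulrA -exprMn jd_im expr1n mulr1.
  by [].
have -> : \sum_j0 c (inl (v, j0)) * kprod (c2k K) (w i) (DV v j0) =
  \sum_j0 c (inl (v, j0)) * kprod emb (w i) (lV v j0) -
  \sum_j0 c (inl (v, j0)) * (kprod emb (w i) (lV v j0) - kprod (c2k K) (w i) (DV v j0)).
  by rewrite -sumrB; apply: eq_bigr => j0 _; ring.
apply: absB_lt => //; apply: abs_sum_lt => // j0 _; rewrite absM.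
have := kprod_reduction (w1 i).1 (w1 i).2 (@aV_red v j0) (@bV_red v j0).
by apply: le_lt_trans; rewrite ler_piMl.
Qed.

(** Division by a coefficient of largest absolute value gives a relation to which [eval_small]
    applies, with one coefficient equal to 1. *)
Lemma eval_injective (c : X -> K) : (forall y, \sum_x c x * fVE x (pt y) = 0) -> forall x, c x = 0.
Proof.
move=> H x; have [//|cx] := eqVneq (c x) 0; exfalso.
have [|x0 _ xmax] := @seq_argmax R X (index_enum X) (fun y => abs (c y)).
  by apply/eqP => e; have := mem_index_enum x; rewrite e.
have {}xmax y : abs (c y) <= abs (c x0) by apply: xmax; exact: mem_index_enum.
have c0 : 0 < abs (c x0) by apply: lt_le_trans (xmax x); rewrite abs_gt0.
have c0' : c x0 != 0 by rewrite -abs_gt0.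
have := @eval_small (fun y => c y / c x0) _ _ x0; rewrite divff // abs1 ltxx => F.
suff: false by []; apply: F => [y|y].
  by rewrite abs_div ler_pdivrMr // mul1r.
rewrite (eq_bigr (fun y' => (c x0)^-1 * (c y' * fVE y' (pt y)))); last by move=> y' _; rewrite mulrA [_ * c y']mulrC.
by rewrite -big_distrr /= H mulr0.
Qed.

(** Conjugation reduces to a congruence element fixing v_i. Determinant 1 makes the scalar in K0 a
    unit, so its off-diagonal entries are at most q^i and its diagonal entries at most 1. All are
    smaller than |n| = q^d, so the multiples of n in them vanish. *)
Lemma stable_low g (i : nat) : g \in unitmx -> (i < d)%N -> stable_vertex n (act (mxAK K g) (vz i)).
Proof.
move=> gu id; have GG := G2_mxAK K gu; have SG := G2_shift K i.
have e0 : act (mxAK K g) (vz i) = act (mxAK K g *m shift K i) v0.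
  by rewrite -(act_vertexM _ (G2_unit GG) (G2_unit SG)).
split; first by rewrite e0; apply: is_vertex_act; exact: G2M.
move=> h hG; have hu := Gamma_unit hG; have HG := G2_mxAK K hu.
pose h' := invmx g *m h *m g; have hG' : Gamma n h' by exact: Gamma_conj.
have hu' := Gamma_unit hG'; have HG' := G2_mxAK K hu'.
move=> fix_h.
have fix' : act (mxAK K h') (vz i) = vz i.
  apply: (act_vertex_inj (G2_unit GG)).
  rewrite -[RHS]fix_h !(act_vertexM _ (G2_unit GG) (G2_unit HG')) (act_vertexM _ (G2_unit HG) (G2_unit GG)).
  by rewrite -!mxAKM /h' !mulmxA mulmxV // mul1mx.
have {}fix' : act (mxAK K h' *m shift K i) v0 = act (shift K i) v0.
  by rewrite -(act_vertexM _ (G2_unit HG') (G2_unit SG)).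
have /(act_vtx0_eq SG (G2M HG' SG)) : act (shift K i) v0 = act (mxAK K h' *m shift K i) v0 by [].
move=> [c [fc c0 int_c det_c]].
set M := invmx _ *m _ in int_c det_c.
have Sd : \det (shift K i) != 0 by exact: det_neq0.
have dM : \det M = 1.
  rewrite /M !det_mulmx det_inv det_mxAK (Gamma_det n_size hG') rmorph1 mul1r mulVr //.
  by rewrite unitfE.
have ac : abs c = 1.
  move: det_c; rewrite detZ dM mulr1 absX => h2; apply/eqP.
  by rewrite -(@eqrXn2 _ 2) ?expr1n ?h2.
have int_M a b : abs (M a b) <= 1.
  by have := int_c a b; rewrite scaleE absM ac mul1r.
have ME : [/\ M 0 0 = a2k K (h' 0 0), M 0 1 = T ^ (- i%:Z) * a2k K (h' 0 1),
    M 1 0 = T ^ i%:Z * a2k K (h' 1 0) & M 1 1 = a2k K (h' 1 1)].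
  have T0 := Texp_neq0 K i.
  rewrite /M shiftV; split; rewrite !mulmx2 !mxAKE /shift !mk2E ?mul0r ?mulr0 ?addr0 ?add0r ?mul1r ?mulr1 //.
    by rewrite mulrCA -TexpD addNr expr0z mulr1.
  by rewrite mulrC.
have [M00 M01 M10 M11] := ME.
have [_ [u hE]] := proj1 (GammaP n h') hG'.
have hE' a b : h' a b = (1%:M : 'M_2) a b + n * u a b by rewrite hE mxE; congr (_ + _); rewrite mxE.
have small (p : {poly Fq}) : abs (a2k K (n * p)) < q ^+ d -> p = 0.
  have [//|p0] := eqVneq p 0; rewrite (abs_multiple K n_monic n_deg p0) ltr_eXn2l ?q_gt1 //.
  by rewrite ltnNge leq_addr.
have qd : 1 < q ^+ d by rewrite exprn_egt1 ?q_gt1 // -lt0n.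
have diag a : abs (a2k K (h' a a)) <= 1 -> u a a = 0.
  move=> h1; apply: small; apply: le_lt_trans qd.
  have -> : n * u a a = h' a a - 1 by rewrite hE' mxE eqxx mulr1n [1 + _]addrC addrK.
  by rewrite rmorphB rmorph1 absB_le // abs1.
have u00 : u 0 0 = 0 by apply: diag; rewrite -M00.
have u11 : u 1 1 = 0 by apply: diag; rewrite -M11.
have qi : q ^ i%:Z < q ^+ d by rewrite -exprnP ltr_eXn2l // q_gt1.
have u01 : u 0 1 = 0.
  apply: small; apply: le_lt_trans qi.
  have -> : n * u 0 1 = h' 0 1 by rewrite hE' mxE /= mulr0n add0r.
  have := int_M 0 1; rewrite M01 absM abs_Texp -invr_expz mulrC ler_pdivrMr ?exprz_gt0 // mul1r.
  by [].
have u10 : u 1 0 = 0.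
  apply: small; apply: le_lt_trans qd.
  have -> : n * u 1 0 = h' 1 0 by rewrite hE' mxE /= mulr0n add0r.
  have := int_M 1 0; rewrite M10 absM abs_Texp; apply: le_trans; rewrite ler_peMl // -exprnP exprn_ege1 // ltW // q_gt1.
have h1 : h' = 1%:M.
  rewrite hE (_ : u = 0) ?scaler0 ?addr0 //.
  by apply/matrixP; elim/ord2P; elim/ord2P; rewrite mxE.
have -> : h = g *m h' *m invmx g by rewrite /h' !mulmxA mulmxV // mul1mx mulmxK.
by rewrite h1 mulmx1 mulmxV.
Qed.

Lemma form_zero_pt f : modular_forms K (2 * k) k.+1 n f -> (forall y, f (pt y) = 0) ->
  forall z, Omega z -> f z = 0.
Proof.
move=> [hf mf cf] f0; apply: (form_zero K_Cinf n_monic n_deg k_ge2 hf mf cf) => g i gu id; have GG := G2_mxAK K gu.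
  have [v [[h hG he] _]] := (proj2 vertex_lifts) _ (stable_low gu id).
  have HG := G2_mxAK K (Gamma_unit hG).
  (* M carries the points w over v_0 to points over v_i. They correspond under g to Gamma-translates
     of the chosen evaluation points, where f vanishes by modularity. *)
  pose M := invmx (mxAK K g) *m (mxAK K h *m mV v).
  have MG : G2 M by apply: G2M; [exact: G2V | apply: G2M => //; exact: mV_G2].
  have Mv : act M v0 = vz i.
    have HV : G2 (mxAK K h *m mV v) by apply: G2M => //; exact: mV_G2.
    rewrite -(act_vertexM _ (G2_unit (G2V GG)) (G2_unit HV)) -(act_vertexM _ (G2_unit HG) (G2_unit (mV_G2 v))).
    by rewrite [act (mxAK K h) _]he act_vertexK // G2_unit.
  exists (fun j => mobz M (w j)); split=> [j|j j' jj|j].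
  - by have [] := vertex_affinoid MG Mv (w1 j).1 (w1 j).2.
  - have [_ _ H] := vertex_affinoid MG Mv (w1 j).1 (w1 j).2.
    by rewrite (H _ (w1 j').1 (w1 j').2) wfar // mulr1.
  have ow := @Omega_w j; have ov := Omega_mobz (mV_G2 v) ow.
  have HV : G2 (mxAK K h *m mV v) by apply: G2M => //; exact: mV_G2.
  rewrite /M mobzM; last by apply: jfac_neq0.
  rewrite mobzVK //; last exact: Omega_mobz.
  rewrite mobzM; last by apply: jfac_neq0 => //; exact: mV_G2.
  by rewrite mf // (f0 (inl (v, j))) mulr0.
have s0 := stable_low gu (ltnW id); have s1 := stable_low gu id.
have ei : i.+1%:Z = i%:Z + 1 by rewrite intS addrC.
have nc : noncuspidal_edge n [set act (mxAK K g) (vz i); act (mxAK K g) (vz i.+1)].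
  by exists (act (mxAK K g) (vz i)), (act (mxAK K g) (vz i.+1)); split=> //; rewrite ei; exact: adjacent_vz.
have [e [[h hG he] _]] := (proj2 edge_lifts) _ nc.
have HG := G2_mxAK K (Gamma_unit hG).
have HE : G2 (mxAK K h *m mE e) by exact: G2M.
pose M := invmx (mxAK K g) *m (mxAK K h *m mE e).
have MG : G2 M by apply: G2M => //; exact: G2V.
have Me : [set act M v0; act M v1] = [set vz i; vz (i%:Z + 1)].
  have aM v : act M v = act (invmx (mxAK K g)) (act (mxAK K h) (act (mE e) v)).
    by rewrite (act_vertexM _ (G2_unit HG) (G2_unit (mE_G2 e))) (act_vertexM _ (G2_unit (G2V GG)) (G2_unit HE)).
  rewrite !aM -(image_set1 (act (invmx (mxAK K g)))) -(image_set1 (act (invmx (mxAK K g))) (act (mxAK K h) (act (mE e) v1))) -image_setU.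
  rewrite -(image_set1 (act (mxAK K h))) -(image_set1 (act (mxAK K h)) (act (mE e) v1)) -image_setU -mE_edge.
  rewrite -/(act_edge (mxAK K h) (eE e)) [act_edge _ _]he image_setU !image_set1 !act_vertexK ?G2_unit // ei.
  by [].
have [am im_m] := edge_annulus MG Me zetaT.
have /andP[z1 z2] := abs_half zetaT.
exists (mobz M zeta).
  rewrite am ltr_pMr ?exprz_gt0 // z1 /= expfzDr ?gt_eqF // expr1z.
  by rewrite ltr_pM2l ?exprz_gt0.
have oz := Omega_zeta; have oe := Omega_mobz (mE_G2 e) oz.
rewrite /M mobzM; last exact: jfac_neq0.
rewrite mobzVK //; last exact: Omega_mobz.
rewrite mobzM; last exact: jfac_neq0.
by rewrite mf // (f0 (inr e)) mulr0.
Qed.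

Lemma fVE_modular x : (forall s, vanishes_ge n (2 * k) k.+1 (fVE x) (cusp n s)) ->
  modular_forms K (2 * k) k.+1 n (fVE x).
Proof.
move=> cx; split=> //; case: x {cx} => [[v j]|e] /=.
- exact: (poincare_holomorphic K_Cinf n (delta_unit v) (V_wf v j) (@V_end v j)).
- by apply: (poincare_holomorphic K_Cinf n _ (DE_wf e) (@E_end e)); exact: unitmx1.
- by move=> g z gG oz; apply: (poincare_modular K_Cinf n_size (delta_unit v) (V_wf v j) (@V_end v j)).
- by move=> g z gG oz; apply: (poincare_modular K_Cinf n_size _ (DE_wf e) (@E_end e)) => //; exact: unitmx1.
Qed.

Lemma basis_fVE : (forall x s, vanishes_ge n (2 * k) k.+1 (fVE x) (cusp n s)) ->
  basis_on_Omega (modular_forms K (2 * k) k.+1 n) fVE.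
Proof.
move=> cV; have mV' x := fVE_modular (cV x); split=> // f fM.
have [c Hc] := square_system (X := fun x y => fVE x (pt y)) eval_injective (fun y => f (pt y)).
have eqf z : Omega z -> f z = \sum_x c x * fVE x z.
  move=> oz; apply/eqP; rewrite -subr_eq0; apply/eqP.
  have M : modular_forms K (2 * k) k.+1 n (fun z => f z + -1 * \sum_x c x * fVE x z).
    by apply: modular_lin => //; exact: modular_sum.
  have := form_zero_pt M _ oz; rewrite mulN1r; apply=> y.
  by rewrite Hc mulN1r subrr.
exists [ffun x => c x]; split=> [z oz|c' Hc'].
  by rewrite eqf //; apply: eq_bigr => x _; rewrite ffunE.
apply/ffunP => x; rewrite ffunE; apply/eqP; rewrite -subr_eq0; apply/eqP.
apply: (eval_injective (c := fun x => c x - c' x)) => y.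
rewrite (eq_bigr (fun x => c x * fVE x (pt y) - c' x * fVE x (pt y))); last by move=> x' _; rewrite mulrBl.
by rewrite sumrB -Hc' ?eqf ?subrr //; exact: Omega_pt.
Qed.

End EvaluationBasis.

Lemma upper_factor (F : fieldType) (X nu : 'M[F]_2) : X \in unitmx -> nu \in unitmx ->
  mob nu None = mob X None -> exists beta, [/\ beta \in unitmx, nu = X *m beta & beta 1 0 = 0].
Proof.
move=> Xu nu_u E; pose beta := invmx X *m nu.
have beta_u : beta \in unitmx by rewrite unitmx_mul unitmx_inv Xu nu_u.
have nuE : nu = X *m beta by rewrite mulKVmx.
exists beta; split=> //.
have : mob beta None = None.
  by rewrite -(mobK (mob beta None) Xu) -(mobM None Xu beta_u) -nuE E mobK.
by rewrite /mob /hpoint; case: eqP.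
Qed.

(** * Leading coefficients at the cusps *)

Section LeadingCoefficients.

Variables (Fq : finFieldType) (R : realType) (K : valued_ext Fq R).
Local Notation abs := (vabs K).
Local Notation im := (@vabs_i Fq R K).
Local Notation Omega := (@Omega Fq R K).
Local Notation G2 := (@GL2Finf Fq R K).
Implicit Types (z : K) (nu : 'M[ratfun Fq]_2) (f g : K -> K).

Hypothesis K_Cinf : is_Cinf K.
Variables (n : {poly Fq}) (w : nat).

Local Notation slashF nu f z := (jfac (mxFK K nu) z ^- w * f (mobz (mxFK K nu) z)).
Local Notation t nu z := (t_param n nu z).

(* Vanishing to order greater than m at nu, as an estimate: this avoids
   manipulating the coefficients of the expansion. *)
Definition decays m f nu := exists C r, [/\ 0 <= C, 1 <= r & forall z, abs z = im z -> r < abs z ->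
  abs (slashF nu f z) <= C * abs (t nu z) ^+ m.+1].

Lemma t_bounds nu z : abs z = im z -> 1 < abs z ->
  [/\ Omega z, 0 < abs (t nu z), abs (t nu z) <= (abs z)^-1 & abs (t nu z) <= 1].
Proof.
move=> az z1; have z0 : 0 < abs z by apply: lt_trans z1.
have [t0 t1] := t_param_le K_Cinf n nu az z0.
have tz : abs (t nu z) <= (abs z)^-1 by rewrite -div1r ler_pdivlMr.
split=> //; first by apply/im_gt0; rewrite -az.
by apply: le_trans tz _; rewrite invf_le1 // ltW.
Qed.

Lemma leading_bound m f nu a : has_t_expansion n w m f nu a ->
  exists C r, [/\ 0 <= C, 1 <= r & forall z, abs z = im z -> r < abs z ->
    abs (slashF nu f z - a m * t nu z ^+ m) <= C * abs (t nu z) ^+ m.+1].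
Proof.
move=> /(t_expansion_bound K_Cinf)[C [r [C0 r0 H]]]; exists C, (Num.max 1 r).
by split=> // [|z az]; [rewrite le_max lexx | rewrite gt_max => /andP[_ zr]; exact: H].
Qed.

Lemma expansion_decays m f nu a : has_t_expansion n w m f nu a -> a m = 0 -> decays m f nu.
Proof.
move=> /leading_bound[C [r [C0 r1 H]]] a0; exists C, r; split=> // z az zr.
by have := H z az zr; rewrite a0 mul0r subr0.
Qed.

Lemma expansion_bound m f nu a : has_t_expansion n w m f nu a ->
  exists C r, [/\ 0 <= C, 1 <= r & forall z, abs z = im z -> r < abs z ->
    abs (slashF nu f z) <= C * abs (t nu z) ^+ m].
Proof.
move=> /leading_bound[C [r [C0 r1 H]]]; exists (C + abs (a m)), r; split; rewrite ?addr_ge0 // => z az zr.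
have [oz t0 _ t1] := t_bounds nu az (le_lt_trans r1 zr).
rewrite -(subrK (a m * t nu z ^+ m) (slashF nu f z)); apply: absD_le.
  apply: le_trans (H z az zr) _; rewrite exprSr mulrA; apply: le_trans (_ : C * abs (t nu z) ^+ m <= _).
    by rewrite ler_piMr // mulr_ge0 // exprn_ge0.
  by rewrite ler_wpM2r ?exprn_ge0 // lerDl.
by rewrite absM absX ler_wpM2r ?exprn_ge0 // lerDr.
Qed.

(** Since |t| <= 1 / |z|, the leading term dominates the remainder as soon as |z| exceeds C /
    |a_m|. *)
Lemma expansion_lower m f nu a : has_t_expansion n w m f nu a -> a m != 0 ->
  exists2 r, 1 <= r & forall z, abs z = im z -> r < abs z ->
    abs (slashF nu f z) = abs (a m) * abs (t nu z) ^+ m.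
Proof.
move=> /leading_bound[C [r [C0 r1 H]]] am; have a0 : 0 < abs (a m) by rewrite abs_gt0.
exists (Num.max r (C / abs (a m))); first by rewrite le_max r1.
move=> z az; rewrite gt_max => /andP[zr zC].
have [oz t0 tz _] := t_bounds nu az (le_lt_trans r1 zr).
have z0 : 0 < abs z by apply: lt_trans (le_lt_trans r1 zr).
rewrite -absX -absM; apply: abs_near; apply: le_lt_trans (H z az zr) _.
rewrite absM absX exprSr mulrCA mulrC ltr_pM2r ?exprn_gt0 //.
apply: le_lt_trans (ler_wpM2l C0 tz) _.
by rewrite ltr_pdivrMr // mulrC -ltr_pdivrMr.
Qed.

Lemma vanishing_bound (x D r : R) : (forall z, abs z = im z -> r < abs z -> 1 < abs z -> x <= D / abs z) -> x <= 0.
Proof.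
move=> H; rewrite leNgt; apply/negP => x0.
have [z [az]] := exists_high_pt K (Num.max (Num.max r 1) (D / x)).
rewrite !gt_max => /andP[/andP[zr z1] zD] z0.
have := H z az zr z1; rewrite ler_pdivlMr // mulrC -ler_pdivlMr // leNgt.
by rewrite zD.
Qed.

Lemma decays_coef m f nu a : has_t_expansion n w m f nu a -> decays m f nu -> a m = 0.
Proof.
move=> /leading_bound[C [r [C0 r1 H]]] [C' [r' [C0' r1' H']]].
apply/eqP; rewrite -(abs_eq0 (K := K)) eq_le abs_ge0 andbT.
apply: (@vanishing_bound _ (C + C') (Num.max r r')) => z az; rewrite gt_max => /andP[zr zr'] z1.
have [oz t0 tz _] := t_bounds nu az z1.
rewrite -(ler_pM2r (exprn_gt0 m t0)) -absX -absM.
have -> : a m * t nu z ^+ m = slashF nu f z - (slashF nu f z - a m * t nu z ^+ m) by ring.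
apply: (@le_trans _ _ ((C + C') * abs (t nu z) ^+ m.+1)).
  apply: absB_le; first by apply: le_trans (H' z az zr') _; rewrite ler_wpM2r ?exprn_ge0 // lerDr.
  by apply: le_trans (H z az zr) _; rewrite ler_wpM2r ?exprn_ge0 // lerDl.
by rewrite exprS mulrA absX ler_wpM2r ?exprn_ge0 // ler_wpM2l // addr_ge0.
Qed.

Lemma decays_lin m f g nu c : decays m f nu -> decays m g nu -> decays m (fun z => f z + c * g z) nu.
Proof.
move=> [C [r [C0 r1 H]]] [C' [r' [C0' r1' H']]].
exists (C + abs c * C'), (Num.max r r'); split.
- by rewrite addr_ge0 ?mulr_ge0.
- by rewrite le_max r1.
move=> z az; rewrite gt_max => /andP[zr zr'].
rewrite mulrDr [_ * (c * _)]mulrCA; apply: absD_le.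
  by apply: le_trans (H z az zr) _; rewrite ler_wpM2r ?exprn_ge0 // lerDl mulr_ge0.
rewrite [leLHS]absM; apply: (@le_trans _ _ (abs c * (C' * abs (t nu z) ^+ m.+1))).
  by rewrite ler_wpM2l // H'.
by rewrite mulrA ler_wpM2r ?exprn_ge0 // lerDr.
Qed.

Lemma decays0 m nu : decays m (fun _ => 0) nu.
Proof. by exists 0, 1; split=> // z _ _; rewrite mulr0 abs0 mul0r. Qed.

Lemma decays_eq m f g nu : nu \in unitmx -> (forall z, Omega z -> f z = g z) -> decays m f nu -> decays m g nu.
Proof.
move=> nu_u E [C [r [C0 r1 H]]]; exists C, r; split=> // z az zr.
have oz : Omega z by have [] := t_bounds nu az (le_lt_trans r1 zr).
by rewrite -E ?H //; apply: Omega_mobz => //; exact: G2_mxFK.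
Qed.

Lemma decays_sum m (I : Type) (s : seq I) (P : pred I) (c : I -> K) (b : I -> K -> K) nu : nu \in unitmx ->
  (forall i, P i -> decays m (b i) nu) -> decays m (fun z => \sum_(i <- s | P i) c i * b i z) nu.
Proof.
move=> nu_u H; elim: s => [|i s IH].
  by apply: decays_eq (decays0 m nu) => // z _; rewrite big_nil.
have [Pi|Pi] := boolP (P i); last first.
  by apply: decays_eq IH => // z _; rewrite big_cons (negPf Pi).
by apply: decays_eq (decays_lin (c i) IH (H i Pi)) => // z _; rewrite big_cons Pi addrC.
Qed.

Lemma expansion_raise m f nu a : has_t_expansion n w m f nu a -> a m = 0 ->
  has_t_expansion (K := K) n w m.+1 f nu a.
Proof.
move=> [r H] a0; exists r => z oz zr e e0; have [N HN] := H z oz zr e e0.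
exists (maxn N m.+1) => i; rewrite geq_max => /andP[iN im].
by have := HN i iN; rewrite big_ltn // a0 mul0r add0r.
Qed.

Lemma vanishing_decays m f nu a : has_t_expansion n w m.+1 f nu a -> decays m f nu.
Proof. by move=> /t_expansion_shift H; apply: expansion_decays H _; rewrite eqxx. Qed.

(* Changing the parameter at a cusp: the quotient of two forms does not depend
   on the parameter, so f vanishes to higher order than g at nu if it does at
   nu0. *)
Lemma decays_transfer m f g nu nu0 gam a b b0 : (1 < size n)%N -> nu \in unitmx -> nu0 \in unitmx -> Gamma n gam ->
  mob nu None = mob (mxAF gam) (mob nu0 None) ->
  (forall h z, Gamma n h -> Omega z -> f (mobz (mxAK K h) z) = jfac (mxAK K h) z ^+ w * f z) ->
  (forall h z, Gamma n h -> Omega z -> g (mobz (mxAK K h) z) = jfac (mxAK K h) z ^+ w * g z) ->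
  has_t_expansion n w m f nu a -> has_t_expansion n w m g nu b ->
  has_t_expansion n w m g nu0 b0 -> b0 m != 0 -> decays m f nu0 -> a m = 0.
Proof.
move=> n_size nu_u nu0_u gG E mf mg ea eb eb0 b0m df.
have gu := Gamma_unit gG; have gF := mxAF_unit gu; have X_u : mxAF gam *m nu0 \in unitmx by rewrite unitmx_mul gF nu0_u.
have [beta [beta_u nuE b10]] : exists beta, [/\ beta \in unitmx, nu = mxAF gam *m nu0 *m beta & beta 1 0 = 0].
  have E' := etrans E (esym (mobM None gF nu0_u)).
  exact: (upper_factor X_u nu_u E').
have BG := G2_mxFK K beta_u; have N0G := G2_mxFK K nu0_u; have GG := G2_mxAK K gu; have NG := G2_mxFK K nu_u.
set b00 := mxFK K beta 0 0; set b01 := mxFK K beta 0 1; set b11 := mxFK K beta 1 1.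
have B10 : mxFK K beta 1 0 = 0 by rewrite mxE b10 rmorph0.
have := det_neq0 BG; rewrite det2 B10 mulr0 subr0 mulf_eq0 negb_or => /andP[h00 h11].
have a00 : 0 < abs b00 by rewrite abs_gt0.
have a11 : 0 < abs b11 by rewrite abs_gt0.
(* High enough, the upper triangular change of frame [beta] multiplies both |z| and |z|_i by this
   constant. *)
pose kap := abs b00 / abs b11; have kap0 : 0 < kap by rewrite divr_gt0.
have beta_high z : abs z = im z -> 1 < abs z -> abs b01 / abs b00 < abs z ->
    abs (mobz (mxFK K beta) z) = kap * abs z /\ im (mobz (mxFK K beta) z) = kap * abs z.
  move=> az z1 zb; have [oz _ _ _] := t_bounds nu az z1.
  have jz : jfac (mxFK K beta) z = b11 by rewrite /jfac B10 mul0r add0r.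
  split.
    rewrite /mobz -/(jfac (mxFK K beta) z) jz abs_div absDl ?absM; last first.
      by rewrite mulrC -ltr_pdivrMr.
    by rewrite /kap mulrAC.
  rewrite im_mobz // jz det2 B10 mulr0 subr0 absM -az /kap -/b00 -/b11.
  by field; rewrite gt_eqF.
have [C0 [r0 [C00 r01 H0]]] := df; have [r2 r21 H2] := expansion_lower eb0 b0m.
have [C1 [r1 [C10 r11 H1]]] := expansion_bound eb.
have [C [r [Cge r_1 H]]] := leading_bound ea.
have b0p : 0 < abs (b0 m) by rewrite abs_gt0.
pose C2 := C0 * C1 / abs (b0 m) / kap.
have C20 : 0 <= C2 by rewrite !divr_ge0 ?mulr_ge0 // ltW.
apply/eqP; rewrite -(abs_eq0 (K := K)) eq_le abs_ge0 andbT.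
apply: (@vanishing_bound _ (C + C2) (Num.max (Num.max (Num.max r r1) (abs b01 / abs b00)) (Num.max r0 r2 / kap))) => z az.
rewrite !gt_max => /andP[/andP[/andP[zr zr1] zb] zk] z1.
have [oz t0 tz _] := t_bounds nu az z1.
have [by1 by2] := beta_high z az z1 zb; set y := mobz (mxFK K beta) z in by1 by2.
have ay : abs y = im y by rewrite by1 by2.
have : Num.max r0 r2 < abs y by rewrite by1 mulrC -ltr_pdivrMr.
rewrite gt_max => /andP[yr0 yr2].
have [oy s0 sy _] := t_bounds nu0 ay (le_lt_trans r01 yr0).
have oy' := Omega_mobz N0G oy.
have nuz : mobz (mxFK K nu) z = mobz (mxAK K gam) (mobz (mxFK K nu0) y).
  rewrite nuE !mxFKM mobzM; last exact: jfac_neq0.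
  by rewrite mobzM //; exact: jfac_neq0.
have jN0 := jfac_neq0 N0G oy; have jG := jfac_neq0 GG oy'; have jN := jfac_neq0 NG oz.
(* The factors of automorphy of f and g are the same and cancel in this product relation. So f is
   compared with g in each frame separately, and never the two parameters t with each other. *)
have cr : abs (slashF nu f z) * abs (slashF nu0 g y) = abs (slashF nu0 f y) * abs (slashF nu g z).
  by rewrite -!absM nuz mf // mg //; congr abs; ring.
have F1 : abs (slashF nu f z) <= C2 * (abs z)^-1 * abs (t nu z) ^+ m.
  have tm0 : 0 < abs (b0 m) * abs (t nu0 y) ^+ m by rewrite mulr_gt0 ?exprn_gt0.
  rewrite -(ler_pM2r tm0) -(H2 y ay yr2) cr.
  apply: (@le_trans _ _ ((C0 * abs (t nu0 y) ^+ m.+1) * (C1 * abs (t nu z) ^+ m))).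
    by apply: ler_pM; rewrite ?abs_ge0 ?H0 ?H1.
  rewrite (H2 y ay yr2) exprSr.
  have -> : C0 * (abs (t nu0 y) ^+ m * abs (t nu0 y)) * (C1 * abs (t nu z) ^+ m) =
     abs (t nu0 y) * (C0 * C1 * abs (t nu0 y) ^+ m * abs (t nu z) ^+ m) by ring.
  have -> : C2 / abs z * abs (t nu z) ^+ m * (abs (b0 m) * abs (t nu0 y) ^+ m) =
     (kap * abs z)^-1 * (C0 * C1 * abs (t nu0 y) ^+ m * abs (t nu z) ^+ m).
    by rewrite /C2; field; rewrite !gt_eqF // (lt_trans _ z1).
  by rewrite -by1 ler_wpM2r // !mulr_ge0 ?exprn_ge0.
have z0 : 0 <= (abs z)^-1 by rewrite invr_ge0.
rewrite -(ler_pM2r (exprn_gt0 m t0)) -absX -absM.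
have -> : a m * t nu z ^+ m = slashF nu f z - (slashF nu f z - a m * t nu z ^+ m) by ring.
rewrite absX mulrDl mulrDl; apply: absB_le.
  by apply: le_trans F1 _; rewrite lerDr !mulr_ge0 ?exprn_ge0.
apply: le_trans (H z az zr) _; rewrite exprS mulrA; apply: le_trans (_ : C / abs z * abs (t nu z) ^+ m <= _).
  by rewrite ler_wpM2r ?exprn_ge0 // ler_wpM2l.
by rewrite lerDl mulr_ge0 ?exprn_ge0 // mulr_ge0.
Qed.

End LeadingCoefficients.

(** * The two bases *)

Lemma exists_frame (F : fieldType) (s : P1 F) : exists2 nu : 'M[F]_2, nu \in unitmx & mob nu None = s.
Proof.
pose a : P1 F := if s is Some _ then None else Some 0.
have as_ : a <> s by rewrite /a; case: (s).
by exists (frame a s); [exact: frame_unit | exact: frame_inf].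
Qed.

Lemma cusp_sub (Fq : finFieldType) (n : {poly Fq}) (s s0 p : P1 (ratfun Fq)) :
  cusp n s0 s -> cusp n s p -> cusp n s0 p.
Proof.
move=> [g gG <-] [h hG <-]; exists (h *m g); first exact: GammaM.
by rewrite mxAFM mobM // mxAF_unit ?(Gamma_unit hG) ?(Gamma_unit gG).
Qed.

Theorem proposition5p1p13
  (Fq : finFieldType) (q_odd : odd #|Fq|)
  (R : realType) (K : valued_ext Fq R) (K_Cinf : is_Cinf K)
  (k d : nat) (k_ge2 : (2 <= k)%N) (d_ge1 : (1 <= d)%N)
  (n : {poly Fq}) (n_monic : n \is monic) (n_deg : size n = d.+1)
  (* lifts of the stable vertices *)
  (IV : finType) (delta : IV -> 'M[ratfun Fq]_2)
  (delta_unit : forall v, delta v \in unitmx)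
  (vertex_lifts :
    orbit_representatives n (fun g => act_vertex (mxAK K g))
      (stable_vertex (K := K) n)
      (fun v => act_vertex (mxFK K (delta v)) (vtx K 0)))
  (* bases of Kurihara differentials, and their lifts *)
  (DV : IV -> 'I_(kdim Fq k) -> kdata Fq)
  (DV_kurihara : forall v j, kurihara k (DV v j))
  (DV_basis : forall v, form_basis k (fun j => kform_of (DV v j)))
  (aV bV : forall v j, 'I_(kr (DV v j)) -> P1 (ratfun Fq))
  (aV_red : forall v j i, reduces_to K (aV v j i) (ka (k := DV v j) i))
  (bV_red : forall v j i, reduces_to K (bV v j i) (kb (k := DV v j) i))
  (V_meet : forall v j,
    geodesics_meet K (krelift (aV v j) (bV v j)) = [set [set vtx K 0]])
  (* non-cuspidal edges *)
  (IE : finType) (eE : IE -> set (vertex K))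
  (edge_lifts :
    orbit_representatives n (fun g => act_edge (mxAK K g))
      (noncuspidal_edge (K := K) n) eE)
  (DE : IE -> kdata (ratfun Fq))
  (DE_wf : forall e, kdata_wf k (DE e))
  (E_meet : forall e, geodesics_meet K (DE e) = closed_edge (eE e))
  (* cusps and cuspidal edges *)
  (IC : finType) (cuspC : IC -> P1 (ratfun Fq))
  (cusp_representatives :
    orbit_representatives n (fun g => mob (mxAF g)) setT cuspC)
  (eC : IC -> set (vertex K))
  (eC_cuspidal : forall c, cuspidal_edge d (eC c))
  (eC_cusp : forall c, edge_leads_to d (eC c) (cusp n (cuspC c)))
  (DC : IC -> kdata (ratfun Fq))
  (DC_wf : forall c, kdata_wf k (DC c))
  (C_meet : forall c, geodesics_meet K (DC c) = closed_edge (eC c)) :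
  let fV v j := poincare K n (delta v) (krelift (aV v j) (bV v j)) in
  let fE e := poincare K n 1%:M (DE e) in
  let fC c := poincare K n 1%:M (DC c) in
  (forall v j s, vanishes_ge n (2 * k) k.+1 (fV v j) (cusp n s)) ->
  (forall e s, vanishes_ge n (2 * k) k.+1 (fE e) (cusp n s)) ->
  (forall c,
    vanishes_exactly n (2 * k) k (fC c) (cusp n (cuspC c)) /\
    forall c', c' != c ->
      vanishes_ge n (2 * k) k.+1 (fC c) (cusp n (cuspC c'))) ->
  let fVE (x : IV * 'I_(kdim Fq k) + IE) :=
    match x with inl vj => fV vj.1 vj.2 | inr e => fE e end in
  let fVEC (x : IV * 'I_(kdim Fq k) + IE + IC) :=
    match x with inl y => fVE y | inr c => fC c end in
  basis_on_Omega (modular_forms K (2 * k) k.+1 n) fVE /\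
  basis_on_Omega (modular_forms K (2 * k) k n) fVEC.
Proof.
move=> fV fE fC HV HE HC fVE fVEC.
have n_size : (1 < size n)%N by rewrite n_deg ltnS.
have [w [w1 wfar]] := far_points K (kdim Fq k).
have [zeta zetaT] := exists_root (Defs.iota K (AtoF 'X)) (isT : (0 < 2)%N).
have /boolp.choice[mE HmE] e : exists m : 'M[K]_2, GL2Finf m /\
    eE e = [set act_vertex m (vtx K 0); act_vertex m (vz 1)].
  have [v [v' [-> adj _ _]]] := proj1 edge_lifts e.
  by have [m [mG -> ->]] := adjacentP adj; exists m.
have mE_G2 e := proj1 (HmE e); have mE_edge e := proj2 (HmE e).
have cVE (x : IV * 'I_(kdim Fq k) + IE) s : vanishes_ge n (2 * k) k.+1 (fVE x) (cusp n s).
  by case: x => [[v j]|e]; [exact: HV | exact: HE].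
have B1 : basis_on_Omega (modular_forms K (2 * k) k.+1 n) fVE.
  exact: (basis_fVE K_Cinf k_ge2 d_ge1 n_monic n_deg delta_unit vertex_lifts DV_kurihara DV_basis aV_red bV_red V_meet
    edge_lifts DE_wf E_meet w1 wfar zetaT mE_G2 mE_edge cVE).
split=> //.
have C_end c s : exists i, s <> @ka _ (DC c) i /\ s <> @kb _ (DC c) i.
  have [r2 _ _ ab _] := DC_wf c; have [v [v' [ev _ _ _]]] := eC_cuspidal c.
  exact: (meet_common_end ab (ltnW r2) (C_meet c) ev).
have cuspP s : exists c, cusp n (cuspC c) s.
  have [c [[g gG gs] _]] := proj2 cusp_representatives s I.
  by exists c; exists g.
have vanish_sub w' m f s s0 : cusp n s0 s -> vanishes_ge (K := K) n w' m f (cusp n s0) -> vanishes_ge n w' m f (cusp n s).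
  by move=> ss0 H nu nu_u nu_s; apply: H => //; exact: cusp_sub ss0 nu_s.
have C_modular c g z : Gamma n g -> Omega z ->
    fC c (mobz (mxAK K g) z) = jfac (mxAK K g) z ^+ (2 * k) * fC c z.
  by move=> gG oz; exact: (poincare_modular K_Cinf n_size (unitmx1 _ _) (DC_wf c) (C_end c)).
have MC c : modular_forms K (2 * k) k n (fC c).
  split; first exact: (poincare_holomorphic K_Cinf n (unitmx1 _ _) (DC_wf c) (C_end c)).
    exact: C_modular.
  move=> s; have [c' cs] := cuspP s; apply: vanish_sub cs _.
  have [He Ho] := HC c; have [->|ne] := eqVneq c' c.
    by move=> nu nu_u nu_s; have [a Ha _] := He nu nu_u nu_s; exists a.
  by move=> nu nu_u nu_s; have [a Ha] := Ho c' ne nu nu_u nu_s; eexists; exact: t_expansion_shift Ha.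
have MVE x : modular_forms K (2 * k) k n (fVE x) by apply: modular_weaken; exact: (proj1 B1).
have MVEC x : modular_forms K (2 * k) k n (fVEC x) by case: x => [y|c]; [exact: MVE | exact: MC].
have /boolp.choice[nuC HnuC] c : exists nu : 'M[ratfun Fq]_2, nu \in unitmx /\ mob nu None = cuspC c.
  by have [nu nu_u nu_c] := exists_frame (cuspC c); exists nu.
have nuC_u c := proj1 (HnuC c); have nuC_c c := proj2 (HnuC c).
have cusp_refl s : cusp n s s by exists 1%:M; [exact: Gamma1 | rewrite mxAF1 mob1].
have nuC_mem c : cusp n (cuspC c) (mob (nuC c) None) by rewrite nuC_c.
have /boolp.choice[aC HaC] c : exists a : nat -> K, has_t_expansion n (2 * k) k (fC c) (nuC c) a /\ a k != 0.
  by have [a Ha a0] := (proj1 (HC c)) (nuC c) (nuC_u c) (nuC_mem c); exists a.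
have decC c c' : c' != c -> decays (K := K) n (2 * k) k (fC c') (nuC c).
  move=> ne; rewrite eq_sym in ne; have [a Ha] := (proj2 (HC c')) c ne (nuC c) (nuC_u c) (nuC_mem c).
  exact: (vanishing_decays K_Cinf Ha).
have decVE c x : decays (K := K) n (2 * k) k (fVE x) (nuC c).
  have [a Ha] := cVE x (cuspC c) (nuC c) (nuC_u c) (nuC_mem c).
  exact: (vanishing_decays K_Cinf Ha).
have sumE (c : IV * 'I_(kdim Fq k) + IE + IC -> K) z :
    \sum_x c x * fVEC x z = \sum_y c (inl y) * fVE y z + \sum_j c (inr j) * fC j z.
  by rewrite big_sumType.
have zero_unique (c : IV * 'I_(kdim Fq k) + IE + IC -> K) :
    (forall z, Omega z -> \sum_x c x * fVEC x z = 0) -> forall x, c x = 0.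
  (* In the frame at cusp j, every other series vanishes to higher order than k, so the relation
     leaves only the nonzero leading coefficient of the cuspidal series of j. *)
  move=> H; have cC j : c (inr j) = 0.
    have [ea a0] := HaC j.
    have e0 := t_expansion_lin (c (inr j)) (_ : has_t_expansion n (2 * k) k (fun _ => 0) (nuC j) (fun _ => 0)) ea.
    have : 0 + c (inr j) * aC j k = 0.
      apply: (decays_coef K_Cinf (e0 _)).
        by exists 0 => z _ _ e e_gt0; exists 0%N => i _; rewrite big1 ?mulr0 ?subrr ?abs0 // => j' _; rewrite mul0r.
      pose rest z := \sum_y c (inl y) * fVE y z + 1 * \sum_(j' | j' != j) c (inr j') * fC j' z.
      apply: (@decays_eq _ _ _ K_Cinf n (2 * k) k (fun z => 0 + -1 * rest z) _ (nuC j) (nuC_u j)).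
        move=> z oz; have := H z oz; rewrite sumE (bigD1 j) //= /rest => E.
        by rewrite !add0r mul1r mulN1r; apply/eqP; rewrite eqr_oppLR -addr_eq0 -addrA [X in _ + X]addrC; apply/eqP.
      apply: decays_lin; first exact: decays0.
      apply: decays_lin; apply: (decays_sum K_Cinf) => // i ne; exact: decC.
    by rewrite add0r => /eqP; rewrite mulf_eq0 (negPf a0) orbF => /eqP.
  have zVE z : Omega z -> 0 = \sum_y c (inl y) * fVE y z.
    by move=> oz; rewrite -{1}(H z oz) sumE [X in _ + X]big1 ?addr0 // => j _; rewrite cC mul0r.
  (* What remains is a relation between the elements of the first basis; uniqueness of the
     coordinates of the zero form ends the argument. *)
  have [c0 [_ Hc0]] := (proj2 B1) (fun _ => 0) (modular0 K n (2 * k) k.+1).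
  case=> [y|j]; last exact: cC.
  have e1 : c0 = [ffun y => c (inl y)].
    by apply: Hc0 => z oz; rewrite [LHS](zVE z oz); apply: eq_bigr => y' _; rewrite ffunE.
  have e2 : c0 = [ffun=> 0].
    by apply: Hc0 => z oz; rewrite big1 // => y' _; rewrite ffunE mul0r.
  by have /ffunP/(_ y) := etrans (esym e1) e2; rewrite !ffunE.
split=> // f fM; have [hf mf cf] := fM.
(* The scalar [al c] is the quotient of the leading coefficients of f and of the cuspidal series at
   c, so that subtracting removes the term of order k. *)
have /boolp.choice[al Hal] c : exists x : K, decays (K := K) n (2 * k) k (fun z => f z + - x * fC c z) (nuC c).
  have [b Hb] := cf (cuspC c) (nuC c) (nuC_u c) (nuC_mem c).
  have [ea a0] := HaC c; exists (b k / aC c k).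
  apply: (expansion_decays K_Cinf (t_expansion_lin _ Hb ea)).
  by rewrite mulNr divfK ?subrr.
pose f' z := f z + 1 * \sum_c - al c * fC c z.
have Mf' : modular_forms K (2 * k) k n f' by apply: modular_lin => //; exact: modular_sum.
have [hf' mf' cf'] := Mf'.
have df' c : decays (K := K) n (2 * k) k f' (nuC c).
  pose g z := (f z + - al c * fC c z) + 1 * \sum_(c' | c' != c) - al c' * fC c' z.
  apply: (@decays_eq _ _ _ K_Cinf n (2 * k) k g _ (nuC c) (nuC_u c)).
    by move=> z oz; rewrite /g /f' [in RHS](bigD1 c) //= !mul1r addrA.
  apply: decays_lin; first exact: Hal.
  apply: (decays_sum K_Cinf) => // c' ne; exact: decC.
have Mf'1 : modular_forms K (2 * k) k.+1 n f'.
  (* Decay is known only in the chosen frames [nuC c]. For an arbitrary frame [nu],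
     [decays_transfer] compares f' with the cuspidal series of the same cusp, whose order there is
     exactly k. *)
  split=> // s nu nu_u nu_s; have [a Ha] := cf' s nu nu_u nu_s; exists a; apply: expansion_raise (Ha) _.
  have [c cs] := cuspP s; have nu_c := cusp_sub cs nu_s; have [gam gG E] := nu_c.
  have [b Hb b0] := (proj1 (HC c)) nu nu_u nu_c; have [ea a0] := HaC c.
  rewrite -(nuC_c c) in E.
  exact: (decays_transfer K_Cinf n_size nu_u (nuC_u c) gG (esym E) mf' (C_modular c) Ha Hb ea a0 (df' c)).
have [c [Hc _]] := (proj2 B1) f' Mf'1.
pose cc (x : IV * 'I_(kdim Fq k) + IE + IC) := match x with inl y => c y | inr j => al j end.
have fE' z : Omega z -> f z = \sum_x cc x * fVEC x z.
  move=> oz; rewrite sumE /= -Hc // /f' mul1r -addrA -big_split /= big1 ?addr0 // => j _.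
  by rewrite mulNr addNr.
exists [ffun x => cc x]; split=> [z oz|c' Hc'].
  by rewrite fE' //; apply: eq_bigr => x _; rewrite ffunE.
apply/ffunP => x; rewrite ffunE; apply/eqP; rewrite -subr_eq0; apply/eqP.
apply: (zero_unique (fun x => cc x - c' x)) => z oz.
rewrite (eq_bigr (fun x => cc x * fVEC x z - c' x * fVEC x z)); last by move=> x' _; rewrite mulrBl.
by rewrite sumrB -Hc' // -fE' // subrr.
Qed.
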